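(* In the setting described in the context, under the Regularity Assumption (A.1)-(A.3) and the Approximation Assumption (with parameters $\theta_\varepsilon$), let the regularisation parameters satisfy $\gamma_\varepsilon\|\theta_\varepsilon\|^2_{\mathcal{R}_\varepsilon}=O(\varepsilon)$. Let $\varepsilon_k>0$ be a null sequence such that for each $k\in\mathbb{N}$ there exists a solution $(\mathbf{y}^k,\mathbf{p}^k,\theta_k)\in W_T^{2N}\times\mathcal{R}_{\varepsilon_k}$ of $(\mathcal{P}^N_{\varepsilon_k})$, where $\mathbf{y}^k=(y_1^k,\dots,y_N^k)$, $\mathbf{p}^k=(p_1^k,\dots,p_N^k)$. If there is $M_\infty>0$ with $\max_i\|y_i^k\|_{L^\infty(I;\mathbb{R}^n)}\le M_\infty$ for all $k\in\mathbb{N}$, then $(\mathbf{y}^k,\mathbf{p}^k,\mathcal{F}^{\varepsilon_k}_{\theta_k}(\mathbf{y}^k))$, with $\mathcal{F}^{\varepsilon_k}_{\theta_k}(\mathbf{y}^k)=(\mathcal{F}^{\varepsilon_k}_{\theta_k}(y_i^k))_{i=1}^N$, admits at least one strong accumulation point $(\bar{\mathbf{y}},\bar{\mathbf{p}},\bar{\mathbf{u}})$ in $W_T^{2N}\times L^2(I;\mathbb{R}^m)^N$. Each such point satisfies, for $i=1,\dots,N$: $(\bar y_i,\bar u_i)$ is a minimizer of $(P_{y_0^i})$, and $$\dot{\bar y}_i=\mathbf{f}(\bar y_i)+\mathbf{g}(\bar y_i)\bar u_i,\quad \bar y_i(0)=y_0^i,$$ $$-\dot{\bar p}_i=D\mathbf{f}(\bar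 y_i)^\top\bar p_i+[D\mathbf{g}(\bar y_i)^\top\bar u_i]\bar p_i+\mathbf{Q}_1^\top\mathbf{Q}_1(\bar y_i-y_d),\quad \bar p_i(T)=Q_2^\top Q_2(\bar y_i(T)-y_d^T).$$
   Context: Setting. Let $n,m\in\mathbb{N}$, $T>0$, $I=(0,T)$, $\bar I=[0,T]$; $W_T=\{y\in L^2(I;\mathbb{R}^n):\dot y\in L^2(I;\mathbb{R}^n)\}$ with $\|y\|_{W_T}^2=\|\dot y\|_{L^2}^2+\|y\|_{L^2}^2$, and $\imath:W_T\to\mathcal{C}(\bar I;\mathbb{R}^n)$ is the continuous embedding. Let $f:\bar I\times\mathbb{R}^n\to\mathbb{R}^n$, $g:\bar I\times\mathbb{R}^n\to\mathbb{R}^{n\times m}$, with Nemytskii operators $\mathbf{f}(y)(t)=f(t,y(t))$, $(\mathbf{g}(y)u)(t)=g(t,y(t))u(t)$. Let $Q_1,Q_2\in\mathbb{R}^{n\times n}$ be symmetric positive semi-definite, $\beta>0$, $y_d\in L^2(I;\mathbb{R}^n)$, and $y_d^T\in\mathbb{R}^n$ a desired terminal state; $\mathbf{Q}_1$ denotes pointwise multiplication by $Q_1$. For $t\in\bar I$ put $$J_t(y,u)=\tfrac12\int_t^T\big(|Q_1(y(s)-y_d(s))|^2+\beta|u(s)|^2\big)\,ds+\tfrac12|Q_2(y(T)-y_d^T)|^2,\qquad J=J_0.$$ For $y_0\in\mathbb{R}^n$, problem $(P_{y_0})$ is: minimize $J(y,u)$ over $(y,u)\in W_T\times L^2(I;\mathbb{R}^m)$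 subject to $\dot y=\mathbf{f}(y)+\mathbf{g}(y)u$, $y(0)=y_0$. The value function is $V^*(t_0,y_0)=\inf J_{t_0}(y,u)$ over $y\in H^1(t_0,T;\mathbb{R}^n)$, $u\in L^2(t_0,T;\mathbb{R}^m)$ with $\dot y=f(\cdot,y)+g(\cdot,y)u$, $y(t_0)=y_0$. $\partial_y,\partial_{yy}$ denote gradient and Hessian in $y$. $Y_0\subset\mathbb{R}^n$ is compact. Regularity Assumption. (A.1) $f,g$ are twice continuously differentiable, and their Jacobians and Hessians with respect to $y$ are Lipschitz continuous on compact sets, uniformly in $t$. (A.2) There is $M_{Y_0}>0$ such that, with $\widehat M=M_{Y_0}\|\imath\|$, $V^*$ is twice continuously differentiable on $\bar I\times\bar B_{2\widehat M}(0)$ with gradient and Hessian Lipschitz continuous (w.r.t. $y$, uniformly in $t$). Let $\mathcal{F}^*(y)(t)=-\frac1\beta g(t,y(t))^\top\partial_yV^*(t,y(t))$ for $y\in W_T$ with $\|y\|_{W_T}\le2M_{Y_0}$. (A.3) For every $y_0\in Y_0$ there is a unique $y=\mathbf{y}^*(y_0)\in W_T$ with $\dot y=\mathbf{f}(y)+\mathbf{g}(y)\mathcal{F}^*(y)$, $y(0)=y_0$, $\|y\|_{W_T}\le M_{Y_0}$, and $(\mathbf{y}^*(y_0),\mathcal{F}^*(\mathbf{y}^*(y_0)))$ is a minimizer of $(P_{y_0})$. Approximation Assumption. Let $\varepsilon_0>0$. For each $0<\varepsilon\le\varepsilon_0$, $\mathcal{R}_\varepsilon\simeq\mathbb{R}^{N_\varepsilon}$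 is a finite-dimensional parameter space with Hilbert norm $\|\cdot\|_{\mathcal{R}_\varepsilon}$, and $(\theta,t,y)\mapsto V^\varepsilon_\theta(t,y)$ belongs to $\mathcal{C}^4(\mathcal{R}_\varepsilon\times\mathbb{R}\times\mathbb{R}^n)$ with $V^\varepsilon_\theta(T,y)=\frac12|Q_2(y-y_d^T)|^2$ for all $y,\theta$. There are $\theta_\varepsilon\in\mathcal{R}_\varepsilon$ and $c>0$ independent of $\varepsilon$ such that $|V^\varepsilon_{\theta_\varepsilon}-V^*|+|\partial_y(V^\varepsilon_{\theta_\varepsilon}-V^* )|+\|\partial_{yy}(V^\varepsilon_{\theta_\varepsilon}-V^* )\|\le c\varepsilon$ on $\bar I\times\bar B_{2\widehat M}(0)$. Put $F^\varepsilon_\theta(t,y)=-\frac1\beta g(t,y)^\top\partial_yV^\varepsilon_\theta(t,y)$, $\mathcal{F}^\varepsilon_\theta(y)(t)=F^\varepsilon_\theta(t,y(t))$. Finite learning problem. Fix $y_0^1,\dots,y_0^N\in Y_0$, weights $\omega_i>0$, $\gamma_1,\gamma_2\ge0$, and $\gamma_\varepsilon>0$. Put $$J_\varepsilon(y,p,\theta)=J(y,\mathcal{F}^\varepsilon_\theta(y))+\int_0^T\tfrac{\gamma_1}2|V^\varepsilon_\theta(t,y(t))-J_t(y,\mathcal{F}^\varepsilon_\theta(y))|^2+\tfrac{\gamma_2}2|\partial_yV^\varepsilon_\theta(t,y(t))-p(t)|^2\,dt.$$ $(\mathcal{P}^N_\varepsilon)$: minimize $\sum_{i=1}^N\omega_iJ_\varepsilon(y_i,p_i,\theta)+\frac{\gamma_\varepsilon}2\|\theta\|^2_{\mathcal{R}_\varepsilon}$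 over $y_i,p_i\in W_T$, $\theta\in\mathcal{R}_\varepsilon$ subject to, for $i=1,\dots,N$, $$\dot y_i=\mathbf{f}(y_i)+\mathbf{g}(y_i)\mathcal{F}^\varepsilon_\theta(y_i),\ y_i(0)=y_0^i,\quad -\dot p_i=D\mathbf{f}(y_i)^\top p_i+[D\mathbf{g}(y_i)^\top\mathcal{F}^\varepsilon_\theta(y_i)]p_i+\mathbf{Q}_1^\top\mathbf{Q}_1(y_i-y_d),\ p_i(T)=Q_2^\top Q_2(y_i(T)-y_d^T).$$ Here $D\mathbf{f}(y)^\top$ is pointwise multiplication by $D_yf(t,y(t))^\top$ and $([D\mathbf{g}(y)^\top u]p)_k=\sum_{i,j}\partial_{y_k}g_{ij}(t,y(t))u_j(t)p_i(t)$. *)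

(* Defs.v *)
(* MathComp-Analysis; reals are an arbitrary [R : realType]. *)
From HB Require Import structures.
From mathcomp Require Import all_boot all_order all_algebra.
From mathcomp Require Import all_classical all_reals all_analysis.

Set Implicit Arguments.
Unset Strict Implicit.
Unset Printing Implicit Defensive.

Import Order.TTheory GRing.Theory Num.Theory.
Import numFieldNormedType.Exports.

Local Open Scope classical_set_scope.
Local Open Scope ring_scope.

(* Euclidean norm of a vector, Frobenius norm of a matrix; the library norm
   [`|A|] on matrices is the maximum norm. *)
Definition enorm {R : realType} {m n : nat} (A : 'M[R]_(m, n)) : R :=
  Num.sqrt (\sum_i \sum_j A i j ^+ 2).

Definition psd {R : realType} {n : nat} (Q : 'M[R]_n) : Prop :=
  Q^T = Q /\ forall x : 'cV[R]_n, 0 <= (x^T *m Q *m x) 0 0.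

Definition pd {R : realType} {n : nat} (Q : 'M[R]_n) : Prop :=
  Q^T = Q /\ forall x : 'cV[R]_n, x != 0 -> 0 < (x^T *m Q *m x) 0 0.

(* Fréchet differential of [h] at [x] relative to the set [K]; it is unique
   when [K] is convex with nonempty interior, and is the usual differential at
   interior points. *)
Definition is_diff_in {R : realType} {E F : normedModType R}
    (K : set E) (h : E -> F) (x : E) (L : {linear E -> F}) : Prop :=
  continuous L /\
  forall d : R, 0 < d ->
    \forall z \near within K (nbhs x),
      `|h z - h x - L (z - x)| <= d * `|z - x|.

(* [C^k] on [K], derivatives at boundary points being relative to [K].  The
   differential is tested against fixed directions, which for the
   finite-dimensional [E] used below is the same as operator-norm continuity. *)
Fixpoint Ck_on {R : realType} {E F : normedModType R}
    (K : set E) (k : nat) (h : E -> F) : Prop :=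
  match k with
  | 0%N => {within K, continuous h}
  | k'.+1 => exists dh : E -> {linear E -> F},
      (forall x, K x -> is_diff_in K h x (dh x)) /\
      (forall v, Ck_on K k' (fun x => dh x v))
  end.

Definition grad {R : realType} {n : nat} (h : 'cV[R]_n -> R)
    (y : 'cV[R]_n) : 'cV[R]_n :=
  \col_k 'D_(delta_mx k 0) h y.

Definition hess {R : realType} {n : nat} (h : 'cV[R]_n -> R)
    (y : 'cV[R]_n) : 'M[R]_n :=
  \matrix_(k, l) 'D_(delta_mx l 0) (fun z => grad h z k 0) y.

Definition jac {R : realType} {n p : nat} (h : 'cV[R]_n -> 'cV[R]_p)
    (y : 'cV[R]_n) : 'M[R]_(p, n) :=
  \matrix_(i, k) 'D_(delta_mx k 0) (fun z => h z i 0) y.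

(* Gradient and Hessian relative to a set [B], needed for functions that are
   regular only on a closed ball (default value 0 if there is no derivative). *)
Definition grad_in {R : realType} {n : nat} (B : set 'cV[R]_n)
    (h : 'cV[R]_n -> R) (y : 'cV[R]_n) : 'cV[R]_n :=
  xget 0 [set G : 'cV[R]_n |
    forall d : R, 0 < d ->
      \forall z \near within B (nbhs y),
        `|h z - h y - (G^T *m (z - y)) 0 0| <= d * `|z - y|].

Definition hess_in {R : realType} {n : nat} (B : set 'cV[R]_n)
    (h : 'cV[R]_n -> R) (y : 'cV[R]_n) : 'M[R]_n :=
  \matrix_(k, l) grad_in B (fun z => grad_in B h z k 0) y l 0.

(* Functions on (a, b) are represented by total functions [R -> _] whose values
   outside the interval are irrelevant. *)
Definition inL2 {R : realType} {n : nat} (a b : R) (v : R -> 'cV[R]_n) : Prop :=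
  forall i, measurable_fun `]a, b[ (fun t => v t i 0) /\
    lebesgue_measure.-integrable `]a, b[ (fun t => ((v t i 0) ^+ 2)%:E).

Definition L2norm {R : realType} {n : nat} (a b : R) (v : R -> 'cV[R]_n) : R :=
  Num.sqrt (\int[lebesgue_measure]_(t in `]a, b[) (enorm (v t) ^+ 2)).

Definition Linfnorm {R : realType} {n : nat} (a b : R) (v : R -> 'cV[R]_n) :
    \bar R :=
  ('N[lebesgue_measure]_+oo[(fun t => (enorm (v t))%:E) \_ `]a, b[])%E.

(* Weak derivatives are tested against C^1_c rather than C^infty_c functions;
   by mollification both classes define the same weak derivative. *)
Definition test_fun {R : realType} (a b : R) (phi : R -> R) : Prop :=
  [/\ forall t, derivable phi t 1,
      continuous (derive1 phi) &
      exists c d : R, [/\ a < c, d < b &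
        forall t, t \notin `[c, d] -> phi t = 0]].

(* [v] belongs to L^2 and is the weak (distributional) derivative of [y]. *)
Definition weak_deriv {R : realType} {n : nat} (a b : R)
    (y v : R -> 'cV[R]_n) : Prop :=
  inL2 a b v /\
  forall (phi : R -> R), test_fun a b phi -> forall i,
    \int[lebesgue_measure]_(t in `]a, b[) (y t i 0 * derive1 phi t) =
    - \int[lebesgue_measure]_(t in `]a, b[) (v t i 0 * phi t).

(* Elements of H^1(a, b; R^n) are identified with their continuous
   representative on [a, b], so that point values are meaningful.  For a = b
   only the value at a matters. *)
Definition inH1 {R : realType} {n : nat} (a b : R) (y : R -> 'cV[R]_n) : Prop :=
  [/\ {within `[a, b], continuous y}, inL2 a b y & exists v, weak_deriv a b y v].

Definition wderiv {R : realType} {n : nat} (a b : R) (y : R -> 'cV[R]_n) :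
    R -> 'cV[R]_n :=
  xget (fun=> 0) [set v | weak_deriv a b y v].

(* norm of the space W_T, whose membership predicate is [inH1 0 T] *)
Definition Wnorm {R : realType} {n : nat} (T : R) (y : R -> 'cV[R]_n) : R :=
  Num.sqrt (L2norm 0 T (wderiv 0 T y) ^+ 2 + L2norm 0 T y ^+ 2).

(* operator norm of the embedding of W_T into C([0, T]; R^n), the latter with
   the supremum of the Euclidean norm *)
Definition embedding_norm {R : realType} (n : nat) (T : R) : R :=
  sup [set r | exists (y : R -> 'cV[R]_n) (t : R),
         [/\ inH1 0 T y, Wnorm T y <= 1, t \in `[0, T] & r = enorm (y t)]].

Record ocp (R : realType) (n m : nat) := Ocp {
  hor : R;
  fdyn : R -> 'cV[R]_n -> 'cV[R]_n;
  gdyn : R -> 'cV[R]_n -> 'M[R]_(n, m);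
  Q1 : 'M[R]_n;
  Q2 : 'M[R]_n;
  beta : R;
  yd : R -> 'cV[R]_n;
  ydT : 'cV[R]_n }.

Definition standing {R : realType} {n m : nat} (P : ocp R n m) : Prop :=
  [/\ 0 < hor P, psd (Q1 P), psd (Q2 P), 0 < beta P & inL2 0 (hor P) (yd P)].

Definition cost {R : realType} {n m : nat} (P : ocp R n m) (t : R)
    (y : R -> 'cV[R]_n) (u : R -> 'cV[R]_m) : R :=
  2^-1 * \int[lebesgue_measure]_(s in `]t, hor P[)
           (enorm (Q1 P *m (y s - yd P s)) ^+ 2 + beta P * enorm (u s) ^+ 2)
  + 2^-1 * enorm (Q2 P *m (y (hor P) - ydT P)) ^+ 2.

Definition state_eq {R : realType} {n m : nat} (P : ocp R n m) (t0 : R)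
    (y0 : 'cV[R]_n) (y : R -> 'cV[R]_n) (u : R -> 'cV[R]_m) : Prop :=
  weak_deriv t0 (hor P) y (fun t => fdyn P t (y t) + gdyn P t (y t) *m u t) /\
  y t0 = y0.

Definition admissible {R : realType} {n m : nat} (P : ocp R n m) (t0 : R)
    (y0 : 'cV[R]_n) (y : R -> 'cV[R]_n) (u : R -> 'cV[R]_m) : Prop :=
  [/\ inH1 t0 (hor P) y, inL2 t0 (hor P) u & state_eq P t0 y0 y u].

Definition minimizer {R : realType} {n m : nat} (P : ocp R n m)
    (y0 : 'cV[R]_n) (y : R -> 'cV[R]_n) (u : R -> 'cV[R]_m) : Prop :=
  admissible P 0 y0 y u /\
  forall y' u', admissible P 0 y0 y' u' -> cost P 0 y u <= cost P 0 y' u'.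

(* +oo when there is no admissible pair *)
Definition value {R : realType} {n m : nat} (P : ocp R n m) (t0 : R)
    (y0 : 'cV[R]_n) : \bar R :=
  ereal_inf [set (cost P t0 yu.1 yu.2)%:E | yu in
    [set yu : (R -> 'cV[R]_n) * (R -> 'cV[R]_m) |
      admissible P t0 y0 yu.1 yu.2]].

Definition Vstar {R : realType} {n m : nat} (P : ocp R n m) (t : R)
    (y : 'cV[R]_n) : R :=
  fine (value P t y).

(* closed ball of radius [2 M ||i||], [i] being the embedding *)
Definition bigball {R : realType} {n m : nat} (P : ocp R n m) (M : R) :
    set 'cV[R]_n :=
  [set y | enorm y <= 2 * (M * embedding_norm n (hor P))].

(* the feedback - beta^-1 g(t, y)^T G(t, y) built from a gradient field [G] *)
Definition feedback {R : realType} {n m : nat} (P : ocp R n m)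
    (G : R -> 'cV[R]_n -> 'cV[R]_n) (t : R) (y : 'cV[R]_n) : 'cV[R]_m :=
  - ((beta P)^-1 *: ((gdyn P t y)^T *m G t y)).

Definition Fstar {R : realType} {n m : nat} (P : ocp R n m) (M : R)
    (y : R -> 'cV[R]_n) : R -> 'cV[R]_m :=
  fun t => feedback P (fun s => grad_in (bigball P M) (Vstar P s)) t (y t).

(* the vector [D g(y)^T u] p at time [t] *)
Definition Dgt {R : realType} {n m : nat} (P : ocp R n m) (t : R)
    (y : 'cV[R]_n) (u : 'cV[R]_m) (p : 'cV[R]_n) : 'cV[R]_n :=
  \col_k \sum_i \sum_j grad (fun z => gdyn P t z i j) y k 0 * u j 0 * p i 0.

Definition adjoint_eq {R : realType} {n m : nat} (P : ocp R n m)
    (y : R -> 'cV[R]_n) (u : R -> 'cV[R]_m) (p : R -> 'cV[R]_n) : Prop :=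
  weak_deriv 0 (hor P) p (fun t =>
    - ((jac (fdyn P t) (y t))^T *m p t + Dgt P t (y t) (u t) (p t)
       + (Q1 P)^T *m Q1 P *m (y t - yd P t))) /\
  p (hor P) = (Q2 P)^T *m Q2 P *m (y (hor P) - ydT P).

Definition regA1 {R : realType} {n m : nat} (P : ocp R n m) : Prop :=
  [/\ Ck_on (`[0, hor P] `*` [set: 'cV[R]_n]) 2 (fun z => fdyn P z.1 z.2),
      Ck_on (`[0, hor P] `*` [set: 'cV[R]_n]) 2 (fun z => gdyn P z.1 z.2) &
      forall K : set 'cV[R]_n, compact K -> exists L : R,
        forall t, t \in `[0, hor P] ->
        [/\ L.-lipschitz_K (jac (fdyn P t)),
            forall i, L.-lipschitz_K (hess (fun z => fdyn P t z i 0)),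
            forall i j, L.-lipschitz_K (grad (fun z => gdyn P t z i j)) &
            forall i j, L.-lipschitz_K (hess (fun z => gdyn P t z i j))]].

Definition regA2 {R : realType} {n m : nat} (P : ocp R n m) (M : R) : Prop :=
  [/\ 0 < M,
      forall t y, t \in `[0, hor P] -> bigball P M y ->
        value P t y \is a fin_num,
      Ck_on (`[0, hor P] `*` bigball P M) 2 (fun z => Vstar P z.1 z.2) &
      exists L : R, forall t, t \in `[0, hor P] ->
        L.-lipschitz_(bigball P M) (grad_in (bigball P M) (Vstar P t)) /\
        L.-lipschitz_(bigball P M) (hess_in (bigball P M) (Vstar P t))].

Definition closed_loop {R : realType} {n m : nat} (P : ocp R n m) (M : R)
    (y0 : 'cV[R]_n) (y : R -> 'cV[R]_n) : Prop :=
  [/\ inH1 0 (hor P) y, state_eq P 0 y0 y (Fstar P M y) & Wnorm (hor P) y <= M].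

(* Uniqueness is uniqueness on [0, T], values outside being irrelevant. *)
Definition regA3 {R : realType} {n m : nat} (P : ocp R n m)
    (Y0 : set 'cV[R]_n) (M : R) : Prop :=
  forall y0, Y0 y0 -> exists y,
    [/\ closed_loop P M y0 y,
        forall y', closed_loop P M y0 y' ->
          forall t, t \in `[0, hor P] -> y' t = y t &
        minimizer P y0 y (Fstar P M y)].

(* For each [e], the parameter space is R^(pdim e) with the Hilbert norm given
   by the Gram matrix [pgram e] of its inner product. *)
Record ansatz (R : realType) (n : nat) := Ansatz {
  pdim : R -> nat;
  pgram : forall e : R, 'M[R]_(pdim e);
  Vth : forall e : R, 'cV[R]_(pdim e) -> R -> 'cV[R]_n -> R }.

Definition pnorm {R : realType} {n : nat} (A : ansatz R n) (e : R)
    (th : 'cV[R]_(pdim A e)) : R :=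
  Num.sqrt ((th^T *m pgram A e *m th) 0 0).

Definition approx_assumption {R : realType} {n m : nat} (P : ocp R n m) (M : R)
    (A : ansatz R n) (e0 : R) (thapp : forall e, 'cV[R]_(pdim A e)) : Prop :=
  [/\ 0 < e0,
      forall e, 0 < e <= e0 ->
        [/\ pd (pgram A e),
            Ck_on [set: 'cV[R]_(pdim A e) * R * 'cV[R]_n] 4
              (fun z => Vth z.1.1 z.1.2 z.2) &
            forall (th : 'cV[R]_(pdim A e)) y,
              Vth th (hor P) y = 2^-1 * enorm (Q2 P *m (y - ydT P)) ^+ 2] &
      exists c : R, 0 < c /\
        forall e, 0 < e <= e0 ->
        forall t y, t \in `[0, hor P] -> bigball P M y ->
          let D := fun z => Vth (thapp e) t z - Vstar P t z in
          `|D y| + enorm (grad_in (bigball P M) D y)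
            + enorm (hess_in (bigball P M) D y) <= c * e].

Definition Fth {R : realType} {n m : nat} (P : ocp R n m) (A : ansatz R n)
    (e : R) (th : 'cV[R]_(pdim A e)) (y : R -> 'cV[R]_n) : R -> 'cV[R]_m :=
  fun t => feedback P (fun s => grad (Vth th s)) t (y t).

Definition Jeps {R : realType} {n m : nat} (P : ocp R n m) (A : ansatz R n)
    (g1 g2 e : R) (y p : R -> 'cV[R]_n) (th : 'cV[R]_(pdim A e)) : R :=
  cost P 0 y (Fth P th y) +
  \int[lebesgue_measure]_(t in `]0, hor P[)
    (g1 / 2 * `|Vth th t (y t) - cost P t y (Fth P th y)| ^+ 2
     + g2 / 2 * enorm (grad (Vth th t) (y t) - p t) ^+ 2).

Definition learning_obj {R : realType} {n m N : nat} (P : ocp R n m)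
    (A : ansatz R n) (w : 'I_N -> R) (g1 g2 : R) (ge : R -> R) (e : R)
    (y p : 'I_N -> R -> 'cV[R]_n) (th : 'cV[R]_(pdim A e)) : R :=
  \sum_i w i * Jeps P g1 g2 (y i) (p i) th + ge e / 2 * pnorm th ^+ 2.

Definition learning_feasible {R : realType} {n m N : nat} (P : ocp R n m)
    (A : ansatz R n) (y0 : 'I_N -> 'cV[R]_n) (e : R)
    (y p : 'I_N -> R -> 'cV[R]_n) (th : 'cV[R]_(pdim A e)) : Prop :=
  forall i, [/\ inH1 0 (hor P) (y i), inH1 0 (hor P) (p i),
    state_eq P 0 (y0 i) (y i) (Fth P th (y i)) &
    adjoint_eq P (y i) (Fth P th (y i)) (p i)].

Definition learning_solution {R : realType} {n m N : nat} (P : ocp R n m)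
    (A : ansatz R n) (y0 : 'I_N -> 'cV[R]_n) (w : 'I_N -> R) (g1 g2 : R)
    (ge : R -> R) (e : R)
    (y p : 'I_N -> R -> 'cV[R]_n) (th : 'cV[R]_(pdim A e)) : Prop :=
  learning_feasible P y0 y p th /\
  forall y' p' (th' : 'cV[R]_(pdim A e)), learning_feasible P y0 y' p' th' ->
    learning_obj P w g1 g2 ge y p th <= learning_obj P w g1 g2 ge y' p' th'.

(* (yb, pb, ub) is the limit of a subsequence in the norm of
   W_T^(2N) x L^2(0, T)^N. *)
Definition strong_accumulation {R : realType} {n m N : nat} (T : R)
    (y p : nat -> 'I_N -> R -> 'cV[R]_n) (u : nat -> 'I_N -> R -> 'cV[R]_m)
    (yb pb : 'I_N -> R -> 'cV[R]_n) (ub : 'I_N -> R -> 'cV[R]_m) : Prop :=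
  (forall i, [/\ inH1 0 T (yb i), inH1 0 T (pb i) & inL2 0 T (ub i)]) /\
  exists s : nat -> nat, {homo s : j k / (j < k)%N} /\
    forall i,
    [/\ (fun k => Wnorm T (fun t => y (s k) i t - yb i t)) @ \oo --> 0,
        (fun k => Wnorm T (fun t => p (s k) i t - pb i t)) @ \oo --> 0 &
        (fun k => L2norm 0 T (fun t => u (s k) i t - ub i t)) @ \oo --> 0].

(* Main.v *)
Require Import Defs.
From mathcomp Require Import all_boot all_order all_algebra.
From mathcomp Require Import all_classical all_reals all_analysis.
From mathcomp Require Import measurable_realfun ring lra.

Set Implicit Arguments.
Unset Strict Implicit.
Unset Printing Implicit Defensive.

Import Order.TTheory GRing.Theory Num.Theory.
Import numFieldNormedType.Exports.
Local Open Scope classical_set_scope.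
Local Open Scope ring_scope.

(* Let y* be an optimal trajectory from (A.3) and p* its adjoint state.  By dynamic
   programming V*(t, y*(t)) is the cost of the remaining part of y*, and comparing with
   the trajectories started at y*(t) + h under the same open-loop control bounds
   V*(t, y*(t) + h) - V*(t, y*(t)) by p*(t).h + O(|h|^2).  Since V* is differentiable this
   forces grad V*(t, y*(t)) = p*(t).  Hence the closed loop built from the approximating
   parameter stays O(e)-close to y*, with control and adjoint O(e)-close as well, and is a
   competitor for the learning problem whose objective exceeds the optimal values by O(e).
   Consequently the costs along the learned closed loops converge to the optimal values.

   A bounded minimizing sequence is equicontinuous, so an ultrafilter finer than the
   filter of cofinite sets yields a uniform limit of the trajectories.  Strong convergence
   of the controls does not need weak lower semicontinuity: the half sum of two nearly
   optimal controls is admissible for a trajectory close to the half sum of the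
   trajectories, so by the parallelogram identity nearly optimal controls are close
   in L^2.  The state and adjoint equations and the cost pass to strong limits. *)

(** * Integrals over bounded intervals *)

(** The parameters [th k] live in spaces of varying dimension and carry no uniform bound, so neither
    the feedback laws nor the learned value functions are expected to converge; everything is
    extracted from the open-loop pairs they generate. The identity of value gradient and adjoint is
    what makes the [g2] penalty of the competitor small: it is the reason why the gradient of the
    ansatz approaches the adjoint state. Conversely the penalties are nonnegative, so the learning
    objective dominates the weighted sum of costs, and positive weights separate the summands.
    Controls are only square integrable, hence the right-hand sides are Lipschitz in the state with
    an L^2 coefficient in time. This is why the Gronwall and Picard estimates are stated for squared
    distances, Cauchy-Schwarz absorbing the coefficient. Weak derivatives are replaced throughout by
    the equivalent integral form [is_primitive]. The factor 2 in the radius of the ball on which V*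
    is regular leaves room for a tube around the optimal trajectories, and the competitor is built
    inside it. *)

Definition integrable_on {R : realType} (a b : R) (f : R -> R) : Prop :=
  lebesgue_measure.-integrable `]a, b[ (EFin \o f).

(** Arranged so that [inL2 a b v] unfolds to this predicate entry by entry. *)
Definition square_integrable {R : realType} (a b : R) (f : R -> R) : Prop :=
  measurable_fun `]a, b[ f /\
  lebesgue_measure.-integrable `]a, b[ (fun t => ((f t) ^+ 2)%:E).

Local Notation ioo a b := (`]a, b[%classic : set _).
Local Notation icc a b := (`[a, b]%classic : set _).
Local Notation Int a b f := (Rintegral lebesgue_measure (ioo a b) f).

Section Integrals.
Context {R : realType}.
Local Notation mu := (@lebesgue_measure R).
Implicit Types (a b c k : R) (f g h : R -> R).

Lemma measure_oo_lty a b : (mu `]a, b[ < +oo)%E.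
Proof. by rewrite (@lebesgue_measure_itv R `]a, b[)/=; case: ifP; rewrite ?ltry// -EFinD ltry. Qed.

Lemma Int_cst a b k : a <= b -> Int a b (fun=> k) = k * (b - a).
Proof.
move=> ab; rewrite Rintegral_cst//; congr (_ * _).
suff E : mu `]a, b[ = (b - a)%:E by exact: (congr1 fine E).
rewrite (@lebesgue_measure_itv R `]a, b[)/= lte_fin.
by move: ab; rewrite le_eqVlt => /predU1P[->|->]; rewrite ?ltxx ?subrr// EFinB.
Qed.

Lemma integrable_on_measurable a b f : integrable_on a b f -> measurable_fun `]a, b[ f.
Proof. by move=> /(measurable_int mu)/measurable_EFinP. Qed.

Lemma integrable_on_le a b f g : measurable_fun `]a, b[ f ->
  (forall t, t \in `]a, b[ -> `|f t| <= g t) -> integrable_on a b g -> integrable_on a b f.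
Proof.
move=> mf fg; apply: le_integrable => //; first exact/measurable_EFinP.
move=> x Dx /=; rewrite lee_fin (le_trans (fg _ _))//; exact: ler_norm.
Qed.

Lemma integrable_on_cst a b k : integrable_on a b (fun=> k).
Proof.
apply: measurable_bounded_integrable => //; first exact: measure_oo_lty.
exact: bounded_cst.
Qed.

Lemma integrable_onD a b f g : integrable_on a b f -> integrable_on a b g ->
  integrable_on a b (fun t => f t + g t).
Proof.
move=> iF iG; rewrite /integrable_on.
by rewrite (_ : _ \o _ = (EFin \o f) \+ (EFin \o g))%E//; exact: integrableD.
Qed.

Lemma integrable_onZ a b k f : integrable_on a b f ->
  integrable_on a b (fun t => k * f t).
Proof.
move=> iF; rewrite /integrable_on.
rewrite (_ : _ \o _ = (fun t => k%:E * (EFin \o f) t))%E//.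
exact: integrableZl.
Qed.

Lemma integrable_onN a b f : integrable_on a b f -> integrable_on a b (fun t => - f t).
Proof.
move=> /(@integrable_onZ _ _ (-1)); congr (integrable_on _ _ _).
by apply/funext => t; rewrite mulN1r.
Qed.

Lemma integrable_onB a b f g : integrable_on a b f -> integrable_on a b g ->
  integrable_on a b (fun t => f t - g t).
Proof. by move=> iF iG; apply: integrable_onD => //; exact: integrable_onN. Qed.

Lemma integrable_on_sum a b (I : Type) (s : seq I) (F : I -> R -> R) :
  (forall i, integrable_on a b (F i)) -> integrable_on a b (fun t => \sum_(i <- s) F i t).
Proof.
move=> iF; elim: s => [|i s IH].
  by under eq_fun do rewrite big_nil; exact: integrable_on_cst.
by under eq_fun do rewrite big_cons; exact: integrable_onD.
Qed.

Lemma integrable_on_norm a b f : integrable_on a b f -> integrable_on a b (fun t => `|f t|).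
Proof. by move=> iF; exact: integrable_norm. Qed.

Lemma integrable_on_sub a b c d f : a <= c -> d <= b ->
  integrable_on a b f -> integrable_on c d f.
Proof.
move=> ac db; apply: integrableS => //.
by apply: subset_itv; rewrite bnd_simp.
Qed.

Lemma IntD a b f g : integrable_on a b f -> integrable_on a b g ->
  Int a b (fun t => f t + g t) = Int a b f + Int a b g.
Proof. by move=> iF iG; exact: RintegralD. Qed.

Lemma IntB a b f g : integrable_on a b f -> integrable_on a b g ->
  Int a b (fun t => f t - g t) = Int a b f - Int a b g.
Proof. by move=> iF iG; exact: RintegralB. Qed.

Lemma IntZ a b k f : integrable_on a b f ->
  Int a b (fun t => k * f t) = k * Int a b f.
Proof. by move=> iF; exact: RintegralZl. Qed.

Lemma IntN a b f : integrable_on a b f -> Int a b (fun t => - f t) = - Int a b f.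
Proof.
move=> iF; rewrite -[RHS]mulN1r -IntZ//.
by apply: eq_Rintegral => t _; rewrite mulN1r.
Qed.

Lemma Int_sum a b (I : Type) (s : seq I) (F : I -> R -> R) :
  (forall i, integrable_on a b (F i)) ->
  Int a b (fun t => \sum_(i <- s) F i t) = \sum_(i <- s) Int a b (F i).
Proof.
move=> iF; elim: s => [|i s IH].
  rewrite big_nil; under eq_Rintegral do rewrite big_nil.
  by rewrite Rintegral_cst// mul0r.
rewrite big_cons -IH -IntD//; last exact: integrable_on_sum.
by apply: eq_Rintegral => t _; rewrite big_cons.
Qed.

Lemma Int_le a b f g : integrable_on a b f -> integrable_on a b g ->
  (forall t, t \in `]a, b[ -> f t <= g t) -> Int a b f <= Int a b g.
Proof. by move=> iF iG fg; exact: le_Rintegral. Qed.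

Lemma Int_ge0 a b f : (forall t, t \in `]a, b[ -> 0 <= f t) -> 0 <= Int a b f.
Proof. by move=> f0; exact: Rintegral_ge0. Qed.

Lemma Int_norm a b f : integrable_on a b f -> `|Int a b f| <= Int a b (fun t => `|f t|).
Proof. by move=> iF; exact: le_normr_Rintegral. Qed.

Lemma eq_Int a b f g : (forall t, t \in `]a, b[ -> f t = g t) -> Int a b f = Int a b g.
Proof. by move=> fg; apply: eq_Rintegral => t /[!inE]; exact: fg. Qed.

Lemma eq_integrable_on a b f g : (forall t, t \in `]a, b[ -> f t = g t) ->
  integrable_on a b f -> integrable_on a b g.
Proof.
by move=> fg; apply: eq_integrable => // t /[!inE] tab /=; rewrite fg.
Qed.

Lemma Int_split a b c f : a <= c -> c <= b -> integrable_on a b f ->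
  Int a b f = Int a c f + Int c b f.
Proof.
move=> ac cb iF.
have iac : integrable_on a c f by exact: integrable_on_sub iF.
move: ac; rewrite le_eqVlt => /predU1P[->|ac].
  by rewrite set_itvoo0 Rintegral_set0 add0r.
move: cb; rewrite le_eqVlt => /predU1P[->|cb].
  by rewrite set_itvoo0 Rintegral_set0 addr0.
rewrite -(@Rintegral_itvB _ f (BRight a) (BLeft b) c)//=; last first.
- by rewrite bnd_simp ltW.
- by rewrite -Rintegral_itv_bndo_bndc// addrC subrK.
Qed.

Lemma Int_nil a f : Int a a f = 0.
Proof. by rewrite set_itvoo0 Rintegral_set0. Qed.

Lemma square_integrable_sqr a b f : square_integrable a b f ->
  integrable_on a b (fun t => f t ^+ 2).
Proof. by case. Qed.

Lemma square_integrable_le a b f g : measurable_fun `]a, b[ f ->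
  (forall t, t \in `]a, b[ -> `|f t| <= g t) -> square_integrable a b g ->
  square_integrable a b f.
Proof.
move=> mf fg [mg ig]; split=> //; apply: (integrable_on_le _ _ ig).
  exact: measurable_funX.
move=> t tab; rewrite normrX lerXn2r ?nnegrE//; last exact: fg.
exact: le_trans (fg t tab).
Qed.

Lemma eq_square_integrable a b f g : (forall t, t \in `]a, b[ -> f t = g t) ->
  square_integrable a b f -> square_integrable a b g.
Proof.
move=> fg [mf iF]; split; last first.
  by apply: eq_integrable_on iF => t tab; rewrite fg.
by apply: eq_measurable_fun mf => t /[!inE]; exact: fg.
Qed.

Lemma integrable_onM a b f g : square_integrable a b f -> square_integrable a b g ->
  integrable_on a b (fun t => f t * g t).
Proof.
move=> [mf iF] [mg ig].
apply: (@integrable_on_le _ _ _ (fun t => f t ^+ 2 + g t ^+ 2)).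
- exact: measurable_funM.
- move=> t _; rewrite normrM -[f t ^+ 2]real_normK ?num_real// -[g t ^+ 2]real_normK ?num_real//.
  have := sqr_ge0 (`|f t| - `|g t|); have := normr_ge0 (f t); have := normr_ge0 (g t).
  nra.
- exact: integrable_onD.
Qed.

Lemma square_integrable_cst a b k : square_integrable a b (fun=> k).
Proof. by split; [exact: measurable_cst|exact: integrable_on_cst]. Qed.

Lemma square_integrable_integrable a b f : square_integrable a b f -> integrable_on a b f.
Proof.
move=> sf; apply: eq_integrable_on (integrable_onM sf (square_integrable_cst _ _ 1)).
by move=> t _; rewrite mulr1.
Qed.

Lemma square_integrableZ a b k f : square_integrable a b f ->
  square_integrable a b (fun t => k * f t).
Proof.
move=> [mf iF]; split; first exact: measurable_funM.
by apply: eq_integrable_on (integrable_onZ (k ^+ 2) iF) => t _; rewrite exprMn.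
Qed.

Lemma square_integrableD a b f g : square_integrable a b f -> square_integrable a b g ->
  square_integrable a b (fun t => f t + g t).
Proof.
move=> sf sg; split.
  by apply: measurable_funD; [case: sf|case: sg].
apply: (@eq_integrable_on _ _ (fun t => f t ^+ 2 + 2 * (f t * g t) + g t ^+ 2)).
  by move=> t _; ring.
apply: integrable_onD; last by case: sg.
apply: integrable_onD; first by case: sf.
exact/integrable_onZ/integrable_onM.
Qed.

Lemma square_integrableN a b f : square_integrable a b f ->
  square_integrable a b (fun t => - f t).
Proof.
move=> /(square_integrableZ (-1)); apply: eq_square_integrable => t _.
by rewrite mulN1r.
Qed.

Lemma square_integrableB a b f g : square_integrable a b f -> square_integrable a b g ->
  square_integrable a b (fun t => f t - g t).
Proof. by move=> sf sg; apply: square_integrableD => //; exact: square_integrableN. Qed.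

Lemma square_integrable_sum a b (I : Type) (s : seq I) (F : I -> R -> R) :
  (forall i, square_integrable a b (F i)) ->
  square_integrable a b (fun t => \sum_(i <- s) F i t).
Proof.
move=> sF; elim: s => [|i s IH].
  by under eq_fun do rewrite big_nil; exact: square_integrable_cst.
by under eq_fun do rewrite big_cons; exact: square_integrableD.
Qed.

Lemma square_integrable_norm a b f : square_integrable a b f ->
  square_integrable a b (fun t => `|f t|).
Proof.
move=> [mf iF]; split; first exact: measurableT_comp.
by apply: eq_integrable_on iF => t _; rewrite real_normK ?num_real.
Qed.

Lemma square_integrable_sub a b c d f : a <= c -> d <= b ->
  square_integrable a b f -> square_integrable c d f.
Proof.
move=> ac db [mf iF]; split; last exact: (integrable_on_sub ac db iF).
by apply: measurable_funS mf => //; apply: subset_itv; rewrite bnd_simp.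
Qed.

Lemma square_integrable_bounded_mul a b k h f : measurable_fun `]a, b[ h ->
  (forall t, t \in `]a, b[ -> `|h t| <= k) -> square_integrable a b f ->
  square_integrable a b (fun t => h t * f t).
Proof.
move=> mh hk sf.
apply: (@square_integrable_le _ _ _ (fun t => k * `|f t|)).
- by apply: measurable_funM => //; case: sf.
- by move=> t tab; rewrite normrM ler_wpM2r ?hk.
- exact/square_integrableZ/square_integrable_norm.
Qed.

(** The integral of [(f - k g)^2] is a nonnegative quadratic polynomial in [k]. *)
Lemma cauchy_schwarz a b f g : square_integrable a b f -> square_integrable a b g ->
  Int a b (fun t => f t * g t) ^+ 2 <=
  Int a b (fun t => f t ^+ 2) * Int a b (fun t => g t ^+ 2).
Proof.
move=> sf sg; set A := Int a b (fun t => f t ^+ 2).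
set B := Int a b (fun t => f t * g t); set C := Int a b (fun t => g t ^+ 2).
have quad k : 0 <= A - 2 * k * B + k ^+ 2 * C.
  have -> : A - 2 * k * B + k ^+ 2 * C = Int a b (fun t => (f t - k * g t) ^+ 2).
    rewrite (@eq_Int _ _ _ (fun t => f t ^+ 2 + (- (2 * k)) * (f t * g t) + k ^+ 2 * g t ^+ 2)); last first.
      by move=> t _; ring.
    have iF := square_integrable_sqr sf; have iG := square_integrable_sqr sg.
    have iFG := integrable_onM sf sg.
    rewrite IntD ?IntD ?IntZ//; [by rewrite mulNr|exact: integrable_onZ| |exact: integrable_onZ].
    by apply: integrable_onD => //; exact: integrable_onZ.
  by apply: Int_ge0 => t _; exact: sqr_ge0.
have C0 : 0 <= C by apply: Int_ge0 => t _; exact: sqr_ge0.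
move: C0; rewrite le_eqVlt => /predU1P[C0|C0].
  have [->|B0] := eqVneq B 0; first by rewrite expr0n/= -C0 mulr0.
  (* When [C] vanishes the polynomial is affine; at this [k] its value is [-1]. *)
  have := quad ((A + 1) / (2 * B)); rewrite -C0 mulr0 addr0.
  suff -> : 2 * ((A + 1) / (2 * B)) * B = A + 1 by lra.
  by field.
(* The minimizer of the quadratic polynomial. *)
have := quad (B / C).
have -> : A - 2 * (B / C) * B + (B / C) ^+ 2 * C = (A * C - B ^+ 2) / C.
  by field; rewrite gt_eqF.
by rewrite pmulr_lge0 ?invr_gt0// subr_ge0.
Qed.

Lemma Int_sqr_le a b f : a <= b -> square_integrable a b f ->
  Int a b f ^+ 2 <= (b - a) * Int a b (fun t => f t ^+ 2).
Proof.
move=> ab sf; have := cauchy_schwarz (square_integrable_cst a b 1) sf.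
rewrite expr1n Int_cst// mul1r; apply: le_trans.
by rewrite (@eq_Int _ _ _ (fun t => 1 * f t))// => t _; rewrite mul1r.
Qed.

Lemma continuous_measurable a b f : {within `[a, b], continuous f} ->
  measurable_fun `]a, b[ f.
Proof.
move=> cf; apply: (@measurable_funS _ _ _ _ `[a, b]%classic) => //.
  exact: subset_itv_oo_cc.
exact: subspace_continuous_measurable_fun.
Qed.

Lemma continuous_bounded a b f : {within `[a, b], continuous f} ->
  exists2 k, 0 <= k & forall t, t \in `[a, b] -> `|f t| <= k.
Proof.
move=> cf; have [ab|ba] := leP a b; last first.
  exists 0 => // t; rewrite in_itv/= => /andP[a1 a2].
  by have := le_lt_trans (le_trans a1 a2) ba; rewrite ltxx.
have cnf : {within `[a, b], continuous (fun t => `|f t|)}.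
  by move=> x; apply: cvg_norm; exact: cf.
have [c _ cmax] := EVT_max ab cnf.
by exists `|f c|.
Qed.

Lemma continuous_square_integrable a b f : {within `[a, b], continuous f} ->
  square_integrable a b f.
Proof.
move=> cf; have [k k0 fk] := continuous_bounded cf.
apply: (@square_integrable_le _ _ _ (fun=> k)).
- exact: continuous_measurable.
- by move=> t tab; apply: fk; exact: subset_itv_oo_cc.
- exact: square_integrable_cst.
Qed.

Lemma continuous_integrable_on a b f : {within `[a, b], continuous f} ->
  integrable_on a b f.
Proof. by move=> /continuous_square_integrable; exact: square_integrable_integrable. Qed.

Lemma Int_derive a b f (F : R -> R) : a <= b -> (forall t : R, derivable F t 1) ->
  derive1 F = f -> continuous f -> Int a b f = F b - F a.
Proof.
rewrite le_eqVlt => /predU1P[->|ab] dF fE cf; first by rewrite Int_nil subrr.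
have cF : continuous F by move=> t; apply: differentiable_continuous; exact/derivable1_diffP.
have cf' : {within `[a, b], continuous f} by exact: continuous_subspaceT.
have := @continuous_FTC2 _ f F a b ab cf'; rewrite -EFinB => H.
rewrite /Rintegral integral_itv_obnd_cbnd; last first.
  by apply/measurable_EFinP; exact: continuous_measurable.
rewrite integral_itv_bndo_bndc; last first.
  apply/measurable_EFinP/(@measurable_funS _ _ _ _ setT) => //.
  exact: continuous_measurable_fun.
rewrite H ?fineB//; last by rewrite fE.
split=> //; first by apply: cvg_at_right_filter; exact: cF.
by apply: cvg_at_left_filter; exact: cF.
Qed.

Lemma Int_additive a b f s t : a <= s -> s <= t -> t <= b -> integrable_on a b f ->
  Int a t f - Int a s f = Int s t f.
Proof.
move=> sa st tb iF; rewrite (@Int_split a t s)//; last exact: integrable_on_sub iF.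
by rewrite addrC addKr.
Qed.

(** Cauchy-Schwarz on the interval between the two times. This is the source of continuity of
    primitives and later of equicontinuity of trajectories. *)
Lemma primitive_hoelder a b f s t : square_integrable a b f ->
  s \in `[a, b] -> t \in `[a, b] ->
  (Int a t f - Int a s f) ^+ 2 <= `|t - s| * Int a b (fun x => f x ^+ 2).
Proof.
move=> sf; wlog st : s t / s <= t => [H|].
  have [/H|/ltW ts] := leP s t; first exact.
  by move=> sab tab; rewrite -sqrrN opprB distrC; exact: H.
rewrite !in_itv/= => /andP[sa _] /andP[_ tb].
rewrite (@Int_additive a b)//; last exact: square_integrable_integrable.
rewrite ger0_norm ?subr_ge0//.
apply: (le_trans (Int_sqr_le st _)); first exact: square_integrable_sub sf.
rewrite ler_wpM2l ?subr_ge0//.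
have iF := square_integrable_sqr sf.
rewrite (@Int_split a b s)//; [|exact: le_trans tb].
rewrite (@Int_split s b t)//; last exact: integrable_on_sub iF.
by rewrite addrCA lerDl addr_ge0// Int_ge0// => x _; exact: sqr_ge0.
Qed.

Lemma primitive_continuous a b f : square_integrable a b f ->
  {within `[a, b], continuous (fun t => Int a t f)}.
Proof.
move=> sf; apply/subspace_continuousP => s sab.
apply/cvgrPdist_le => e e0; set C := Int a b (fun x => f x ^+ 2).
have C0 : 0 <= C by apply: Int_ge0 => t _; exact: sqr_ge0.
near=> t.
have tab : t \in `[a, b] by near: t; exact: withinT.
rewrite -ler_sqr ?nnegrE//; last exact: ltW.
rewrite real_normK ?num_real//; apply: (le_trans (primitive_hoelder sf tab sab)).
have : `|s - t| <= e ^+ 2 / (C + 1).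
  near: t; apply: cvg_within; apply: (@cvgr_dist_le _ _ _ (nbhs s) _ id) => //.
  by rewrite divr_gt0// ?exprn_gt0//; lra.
rewrite ler_pdivlMr; last by lra.
have := normr_ge0 (s - t); rewrite -/C; nra.
Unshelve. all: by end_near. Qed.

Lemma integrable_on_patch a b f : integrable_on a b f ->
  mu.-integrable setT (EFin \o (f \_ `]a, b[)).
Proof.
by move=> iF; rewrite -restrict_EFin; apply/integrable_restrict => //=; rewrite setTI.
Qed.

Lemma patch_mul_lt a b t f x : t <= b ->
  (f \_ `]a, b[) x * (if x < t then 1 else 0) = (f \_ `]a, t[) x.
Proof.
move=> tb; rewrite !patchE !mem_setE !in_itv/=.
case: (a < x); rewrite /= ?mul0r//.
by case: (ltP x t) => xt; rewrite ?mulr0// (lt_le_trans xt tb) mulr1.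
Qed.

Lemma patch_mul_gt a b t f x : a <= t ->
  (f \_ `]a, b[) x * (if t < x then 1 else 0) = (f \_ `]t, b[) x.
Proof.
move=> ta; rewrite !patchE !mem_setE !in_itv/=.
case: (x < b); rewrite /= ?andbF ?mul0r// !andbT.
by case: (ltP t x) => xt; rewrite ?mulr0// (le_lt_trans ta xt) mulr1.
Qed.

(** Fubini on the triangle [a < s < t < b]. It yields integration by parts for functions that are
    merely primitives of square integrable ones. *)
Lemma Int_triangle a b f g : square_integrable a b f -> square_integrable a b g ->
  Int a b (fun t => g t * Int a t f) = Int a b (fun s => f s * Int s b g).
Proof.
move=> sf sg; pose I : set R := `]a, b[%classic.
have mI : measurable I by exact: measurable_itv.
pose f0 := f \_ I; pose g0 := g \_ I.
have mf0 : measurable_fun setT f0 by apply/(measurable_restrictT _ mI); case: sf.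
have mg0 : measurable_fun setT g0 by apply/(measurable_restrictT _ mI); case: sg.
have if0 : mu.-integrable setT (EFin \o f0).
  exact/integrable_on_patch/square_integrable_integrable.
have ig0 : mu.-integrable setT (EFin \o g0).
  exact/integrable_on_patch/square_integrable_integrable.
pose G (z : R * R) : R := f0 z.1 * g0 z.2.
(* The product integrand restricted to the triangle; it is dominated by [G], which is integrable as
   a product of integrable functions. *)
pose H (z : R * R) : R := G z * (if z.1 < z.2 then 1 else 0).
have mG : measurable_fun setT G.
  by apply: measurable_funM; exact: measurableT_comp.
have mH : measurable_fun setT H.
  apply: measurable_funM => //.
  apply: measurable_fun_ifT => //; exact: measurable_fun_ltr.
have iG : (mu \x mu)%E.-integrable setT (EFin \o G).
  apply/integrable12ltyP; first exact/measurable_EFinP.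
  have gfin : (\int[mu]_y `|g0 y|%:E)%E \is a fin_num.
    by apply: integrable_fin_num => //; exact: integrable_abse ig0.
  under eq_integral => x _.
    under eq_integral do rewrite /G/= normrM EFinM.
    rewrite ge0_integralZl//; last first.
      by apply/measurable_EFinP; exact: measurableT_comp.
    rewrite -(fineK gfin).
    over.
  rewrite ge0_integralZr//; last 2 first.
  - by apply/measurable_EFinP; exact: measurableT_comp.
  - by rewrite lee_fin fine_ge0// integral_ge0.
  rewrite lte_mul_pinfty//; [exact: integral_ge0|by apply: integrable_fin_num => //; exact: integrable_abse if0|exact: ltry].
have iH : (mu \x mu)%E.-integrable setT (EFin \o H).
  apply: le_integrable iG => //; first exact/measurable_EFinP.
  move=> z _ /=; rewrite lee_fin /H normrM; case: ifP => _; rewrite ?normr1 ?mulr1//.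
  by rewrite normr0 mulr0.
have := Fubini iH; rewrite /= /H /G /= => FH.
transitivity (Rintegral mu setT ((fun t => g t * Int a t f) \_ I)); first exact: Rintegral_mkcond.
transitivity (Rintegral mu setT ((fun s => f s * Int s b g) \_ I)); last first.
  by symmetry; exact: Rintegral_mkcond.
congr fine.
transitivity (\int[mu]_y \int[mu]_x (f0 x * g0 y * (if x < y then 1 else 0))%:E)%E.
  apply: eq_integral => t _; rewrite {1}patchE; case: ifPn => tI; last first.
    rewrite (_ : (fun x => _) = cst 0%E) ?integral0//.
    by apply/funext => x; rewrite /g0 patchE (negbTE tI) mulr0 mul0r.
  have tI' := tI; have {}tI : t \in `]a, b[ by move: tI; rewrite inE.
  have -> : (fun x => (f0 x * g0 t * (if x < t then 1 else 0))%:E) =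
      (EFin \o (fun x => (f \_ `]a, t[) x * g t)).
    apply/funext => x; rewrite /g0 [X in _ * X * _]patchE tI' mulrAC /=.
    by rewrite patch_mul_lt//; case/andP: tI => _ /ltW.
  have tb : t <= b by case/andP: tI => _ /ltW.
  have ift : mu.-integrable setT (EFin \o f \_ `]a, t[).
    exact: integrable_on_patch (integrable_on_sub (lexx a) tb (square_integrable_integrable sf)).
  rewrite -[RHS]fineK; last first.
    apply: integrable_fin_num => //.
    have := integrableZr measurableT (g t) ift.
    by congr (_.-integrable _ _); apply/funext => x /=; rewrite EFinM.
  congr EFin; rewrite -[RHS]/(Rintegral mu setT (fun x => (f \_ `]a, t[) x * g t)).
  by rewrite RintegralZr// -Rintegral_mkcond mulrC.
rewrite -FH; apply: eq_integral => t _; rewrite [in RHS]patchE; case: ifPn => tI; last first.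
  rewrite (_ : (fun x => _) = cst 0%E) ?integral0//.
  by apply/funext => x; rewrite /f0 patchE (negbTE tI) !mul0r.
have tI' := tI; have {}tI : t \in `]a, b[ by move: tI; rewrite inE.
have -> : (fun x => (f0 t * g0 x * (if t < x then 1 else 0))%:E) =
    (EFin \o (fun x => f t * (g \_ `]t, b[) x)).
  apply/funext => x; rewrite /f0 [X in X * _ * _]patchE tI' -mulrA /=.
  by rewrite patch_mul_gt//; case/andP: tI => /ltW.
have ta : a <= t by case/andP: tI => /ltW.
have ift : mu.-integrable setT (EFin \o g \_ `]t, b[).
  exact: integrable_on_patch (integrable_on_sub ta (lexx b) (square_integrable_integrable sg)).
rewrite -[LHS]fineK; last first.
  apply: integrable_fin_num => //.
  have := integrableZl measurableT (f t) ift.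
  by congr (_.-integrable _ _); apply/funext => x /=; rewrite EFinM.
congr EFin; rewrite -[LHS]/(Rintegral mu setT (fun x => f t * (g \_ `]t, b[) x)).
by rewrite RintegralZl// -Rintegral_mkcond.
Qed.

End Integrals.

(** * Completeness of the space of square integrable functions *)

Section L2Completeness.
Context {R : realType}.
Local Notation mu := (@lebesgue_measure R).

Lemma sum_half_pow (k : nat) : \sum_(0 <= j < k) (2^-1 : R) ^+ j <= 2.
Proof.
suff -> : \sum_(0 <= j < k) (2^-1 : R) ^+ j = 2 - 2 * 2^-1 ^+ k.
  by rewrite gerBl mulr_ge0// exprn_ge0// invr_ge0.
elim: k => [|k IH]; first by rewrite big_nil expr0; lra.
by rewrite big_nat_recr//= IH exprS; lra.
Qed.

(** The increments form an absolutely convergent series, and the sequence is its partial sums up to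
    a constant. *)
Lemma bounded_variation_cvg (x d : nat -> R) (S : R) :
  (forall j, `|x j.+1 - x j| <= d j) -> (forall k, \sum_(0 <= j < k) d j <= S) ->
  cvgn x.
Proof.
move=> xd dS.
have cn : cvgn [normed series (fun j => x j.+1 - x j)].
  apply: nondecreasing_is_cvgn.
    by apply: nondecreasing_series => j _ _; exact: normr_ge0.
  exists S => _ [k _ <-]; rewrite /series/=; apply: le_trans (dS k).
  by apply: ler_sum => j _; exact: xd.
have := normed_cvg cn.
have -> : series (fun j => x j.+1 - x j) = (fun k => x k - x 0%N).
  by apply/funext => k; rewrite /series/= telescope_sumr.
move=> c.
have -> : x = (fun k => (x k - x 0%N) + x 0%N) by apply/funext => k; rewrite subrK.
by apply: is_cvgD => //; exact: is_cvg_cst.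
Qed.

Lemma Int_EFin a b (f : R -> R) : integrable_on a b f ->
  (\int[mu]_(t in `]a, b[) (f t)%:E)%E = (Int a b f)%:E.
Proof. by move=> iF; rewrite fineK//; exact: integrable_fin_num. Qed.

(** The total variation of [x ^~ t] is integrable in [t] by monotone convergence, hence finite
    almost everywhere. *)
Lemma ae_limit_of_fast_cauchy a b (x : nat -> R -> R) : a <= b ->
  (forall j, square_integrable a b (x j)) ->
  (forall j, Int a b (fun t => (x j.+1 t - x j t) ^+ 2) <= 4^-1 ^+ j) ->
  {ae mu, forall t, `]a, b[%classic t -> cvgn (x ^~ t)}.
Proof.
move=> ab sx xfast; pose d j t := `|x j.+1 t - x j t|.
have sd j : square_integrable a b (d j).
  by apply: square_integrable_norm; exact: square_integrableB.
have id j : integrable_on a b (d j) by exact: square_integrable_integrable.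
have d0 j t : 0 <= d j t by exact: normr_ge0.
(* The L^1 norm is at most the square root of [(b - a) * 4^-1 ^+ j]; the factor [b - a + 1] bounds
   the square root of [b - a]. *)
have Id j : Int a b (d j) <= (b - a + 1) * 2^-1 ^+ j.
  have ba0 : 0 <= b - a by rewrite subr_ge0.
  have r0 : 0 <= (b - a + 1) * 2^-1 ^+ j.
    by rewrite mulr_ge0 ?exprn_ge0 ?invr_ge0//; lra.
  rewrite -ler_sqr ?nnegrE//; last by apply: Int_ge0.
  apply: (le_trans (Int_sqr_le ab (sd j))).
  rewrite exprMn -exprM mulnC exprM (_ : 2^-1 ^+ 2 = 4^-1 :> R); last by field.
  rewrite (@eq_Int _ _ _ _ (fun t => (x j.+1 t - x j t) ^+ 2)); last first.
    by move=> t _; rewrite real_normK ?num_real.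
  apply: (@le_trans _ _ ((b - a) * 4^-1 ^+ j)); first by rewrite ler_wpM2l.
  by rewrite ler_wpM2r ?exprn_ge0 ?invr_ge0//; nra.
pose S t := (\sum_(0 <= j <oo) (d j t)%:E)%E.
have mS : measurable_fun `]a, b[ S.
  apply: ge0_emeasurable_sum => [j t tab _|j _]; first by rewrite lee_fin.
  by apply/measurable_EFinP; case: (sd j).
have iS : mu.-integrable `]a, b[ S.
  apply/integrableP; split=> //.
  apply: (@le_lt_trans _ _ ((b - a + 1) * 2)%:E); last exact: ltry.
  have -> : (\int[mu]_(t in `]a, b[) `|S t| = \int[mu]_(t in `]a, b[) S t)%E.
    apply: eq_integral => t _; rewrite gee0_abs// nneseries_ge0// => j _ _.
    by rewrite lee_fin.
  rewrite /S integral_nneseries//; last 2 first.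
    by move=> j; apply/measurable_EFinP; case: (sd j).
    by move=> j t _; rewrite lee_fin.
  apply: lime_le; first by apply: is_cvg_nneseries => j _ _; apply: integral_ge0 => t _; rewrite lee_fin.
  apply: nearW => k; rewrite (eq_bigr (fun j => (Int a b (d j))%:E)); last first.
    by move=> j _; rewrite Int_EFin.
  rewrite sumEFin lee_fin; apply: (@le_trans _ _ (\sum_(0 <= j < k) (b - a + 1) * 2^-1 ^+ j)).
    by apply: ler_sum => j _; exact: Id.
  rewrite -mulr_sumr ler_wpM2l ?sum_half_pow//; lra.
have mI : measurable (`]a, b[%classic : set R) by exact: measurable_itv.
have := @integrable_ae _ _ _ mu _ mI S iS.
apply: (@filterS _ _ (ae_filter_ringOfSetsType mu)) => t St tab; have {}St := St tab.
apply: (@bounded_variation_cvg _ (d ^~ t) (fine (S t))) => // k.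
rewrite -lee_fin fineK// -sumEFin.
by apply: nneseries_lim_ge => j _ _; rewrite lee_fin.
Qed.

(** Riesz-Fischer: a subsequence with geometric increments converges almost everywhere, and Fatou's
    lemma carries the Cauchy estimates over to the pointwise limit. *)
Lemma L2_complete a b (u : nat -> R -> R) : a <= b ->
  (forall k, square_integrable a b (u k)) ->
  (forall e, 0 < e -> exists K, forall k l, (K <= k)%N -> (K <= l)%N ->
    Int a b (fun t => (u k t - u l t) ^+ 2) <= e) ->
  exists v, square_integrable a b v /\
    (fun k => Int a b (fun t => (u k t - v t) ^+ 2)) @ \oo --> 0.
Proof.
move=> ab su uC.
have /choice[K KP] : forall j, exists K, forall k l, (K <= k)%N -> (K <= l)%N ->
    Int a b (fun t => (u k t - u l t) ^+ 2) <= 4^-1 ^+ j.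
  by move=> j; apply: uC; rewrite exprn_gt0// invr_gt0.
(* A sum of thresholds dominates each [K i] with [i <= j], so [x j] and [x j.+1] both lie beyond
   [K j]. *)
pose s j := (\sum_(i < j.+1) K i)%N.
have sK i j : (i <= j)%N -> (K i <= s j)%N.
  move=> ij; rewrite /s (bigD1 (Ordinal (ij : (i < j.+1)%N)))//=; exact: leq_addr.
pose x j := u (s j).
have sx j : square_integrable a b (x j) by exact: su.
have xfast j : Int a b (fun t => (x j.+1 t - x j t) ^+ 2) <= 4^-1 ^+ j.
  by apply: KP; apply: sK.
have aecv := ae_limit_of_fast_cauchy ab sx xfast.
(* The upper limit is measurable without any convergence assumption and agrees with the limit
   wherever the latter exists. *)
pose v t := fine (limn_esup (fun j => (x j t)%:E)).
have mI : measurable (`]a, b[%classic : set R) by exact: measurable_itv.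
have mv : measurable_fun `]a, b[ v.
  apply: (@measurableT_comp _ _ _ _ _ _ fine); first exact: fine_measurable.
  by apply: measurable_fun_limn_esup => j; apply/measurable_EFinP; case: (sx j).
have aev : {ae mu, forall t, `]a, b[%classic t -> x ^~ t @ \oo --> v t}.
  apply: (@filterS _ _ (ae_filter_ringOfSetsType mu)) aecv => t cv tab; have {}cv := cv tab.
  rewrite /v; set l := lim _ in cv.
  have cE : (fun j => (x j t)%:E) @ \oo --> l%:E by apply: cvg_EFin; first exact: nearW.
  by have [_ ->] := cvg_limn_einf_sup cE.
(* Fatou in the index [i] of [x i], with [k] fixed. The bound is stated for the extended integral
   because integrability of the square is not known yet. *)
have est j k : (K j <= k)%N -> (\int[mu]_(t in `]a, b[) ((u k t - v t) ^+ 2)%:E <= (4^-1 ^+ j)%:E)%E.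
  move=> jk; pose f i t := ((u k t - x i t) ^+ 2)%:E.
  have mf i : measurable_fun `]a, b[ (f i).
    apply/measurable_EFinP; apply: measurable_funX; apply: measurable_funB.
      by case: (su k).
    by case: (sx i).
  have f0 i t : `]a, b[%classic t -> (0 <= f i t)%E by rewrite lee_fin sqr_ge0.
  have := fatou mu mI mf f0 => F.
  have mlim : measurable_fun `]a, b[ (fun t => limn_einf (f ^~ t)).
    have -> : (fun t => limn_einf (f ^~ t)) = -%E \o (fun t => limn_esup (fun i => - f i t)%E).
      apply/funext => t; rewrite [RHS]/comp -limn_einfN; congr limn_einf; apply/funext => i.
      exact/esym/oppeK.
    apply: measurableT_comp => //; apply: measurable_fun_limn_esup => i.
    exact: measurableT_comp.
  rewrite (@ge0_ae_eq_integral _ _ _ mu _ _ (fun t => limn_einf (f ^~ t)))//.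
  - apply: (le_trans F); rewrite limn_einf_lim.
    apply: lime_le; first exact: is_cvg_einfs.
    exists j => // i /= ji; apply: (@le_trans _ _ (\int[mu]_(t in `]a, b[) f i t)%E).
      by apply: ereal_inf_lbound; exists i => /=.
    rewrite Int_EFin ?lee_fin; last by apply: square_integrable_sqr; exact: square_integrableB.
    by apply: KP => //; exact: sK.
  - apply/measurable_EFinP; apply: measurable_funX; apply: measurable_funB => //.
    by case: (su k).
  - by move=> t _; rewrite lee_fin sqr_ge0.
  - move=> t tab; rewrite limn_einf_lim; apply: lime_ge; first exact: is_cvg_einfs.
    by apply: nearW => i; apply: le_ereal_inf_tmp => _ [l _ <-]; exact: f0.
  - apply: (@filterS _ _ (ae_filter_ringOfSetsType mu)) aev => t cv tab; have {}cv := cv tab.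
    have cE : f ^~ t @ \oo --> ((u k t - v t) ^+ 2)%:E.
      apply: cvg_EFin; first exact: nearW.
      rewrite (_ : fine \o _ = fun i => (u k t - x i t) * (u k t - x i t)); last first.
        by apply/funext => i; rewrite /= -expr2.
      by rewrite expr2; apply: cvgM; apply: cvgB => //; exact: cvg_cst.
    by have [-> _] := cvg_limn_einf_sup cE.
have sd j k : (K j <= k)%N -> square_integrable a b (fun t => u k t - v t).
  move=> jk; have md : measurable_fun `]a, b[ (fun t => u k t - v t).
    by apply: measurable_funB => //; case: (su k).
  split=> //; apply/integrableP; split; first by apply/measurable_EFinP; exact: measurable_funX.
  apply: le_lt_trans (ltry (4^-1 ^+ j)); apply: le_trans (est j k jk).
  rewrite le_eqVlt; apply/orP; left; apply/eqP; apply: eq_integral => t _.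
  by rewrite gee0_abs// lee_fin sqr_ge0.
have sv : square_integrable a b v.
  have := square_integrableB (su (K 0%N)) (sd 0%N (K 0%N) (leqnn _)).
  by apply: eq_square_integrable => t _; rewrite opprB addrC subrK.
exists v; split=> //; apply/cvgrPdist_le => e e0.
have [j jP] : exists j, 4^-1 ^+ j <= e.
  have : (fun j => 4^-1 ^+ j : R) @ \oo --> 0.
    by apply: cvg_expr; rewrite ger0_norm ?invr_ge0//; lra.
  move/cvgrPdist_le => /(_ _ e0)[j _ /(_ j (leqnn j))].
  by rewrite /= sub0r normrN ger0_norm ?exprn_ge0 ?invr_ge0//; exists j.
exists (K j) => // k /= jk; rewrite sub0r normrN ger0_norm; last first.
  by apply: Int_ge0 => t _; exact: sqr_ge0.
apply: le_trans jP; rewrite -lee_fin -Int_EFin; first exact: est.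
exact: square_integrable_sqr (sd j k jk).
Qed.

End L2Completeness.

(** * Primitives and weak derivatives *)

(** Integral form of the statement that [v] is the weak derivative of the continuous function [y];
    [primitive_weak_derivative] and [weak_derivative_primitive] give the two directions of the
    equivalence. *)
Definition is_primitive {R : realType} (a b : R) (y v : R -> R) : Prop :=
  [/\ {within `[a, b], continuous y}, square_integrable a b v &
      forall t, t \in `[a, b] -> y t = y a + Int a t v].

Section Primitives.
Context {R : realType}.
Local Notation mu := (@lebesgue_measure R).
Implicit Types (a b c d s t x h e : R) (f g y v w : R -> R).

Lemma in_segment a b t : t \in `]a, b[ -> t \in `[a, b].
Proof. by move=> tab; exact: subset_itv_oo_cc. Qed.

Lemma is_primitive_val a b y v t : is_primitive a b y v -> t \in `[a, b] ->
  y t = y a + Int a t v.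
Proof. by case=> _ _; exact. Qed.

Lemma is_primitive_end a b y v : a <= b -> is_primitive a b y v ->
  Int a b v = y b - y a.
Proof.
move=> ab pv; rewrite (is_primitive_val pv (t := b)) ?in_itv/= ?ab ?lexx//.
by rewrite addrC addKr.
Qed.

Lemma is_primitive_diff a b y v s t : is_primitive a b y v ->
  a <= s -> s <= t -> t <= b -> y t - y s = Int s t v.
Proof.
move=> pv sa st tb; rewrite (is_primitive_val pv (t := t)); last first.
  by rewrite in_itv/= (le_trans sa st).
rewrite (is_primitive_val pv (t := s)); last by rewrite in_itv/= sa (le_trans st tb).
have sv : square_integrable a b v by case: pv.
rewrite -(@Int_additive _ a b v s t)//; last exact: square_integrable_integrable.
by rewrite opprD addrACA subrr add0r.
Qed.

Lemma is_primitive_continuous a b y v : is_primitive a b y v -> {within `[a, b], continuous y}.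
Proof. by case. Qed.

Lemma is_primitive_sqi a b y v : is_primitive a b y v -> square_integrable a b v.
Proof. by case. Qed.

Lemma is_primitive_intro a b c v : square_integrable a b v ->
  is_primitive a b (fun t => c + Int a t v) v.
Proof.
move=> sv; split=> //.
  by move=> x; apply: cvgD; [exact: cvg_cst|exact: primitive_continuous].
by move=> t _; rewrite Int_nil addr0.
Qed.

Lemma eq_is_primitive a b y z v w : a <= b -> (forall t, t \in `[a, b] -> y t = z t) ->
  (forall t, t \in `]a, b[ -> v t = w t) -> is_primitive a b y v -> is_primitive a b z w.
Proof.
move=> ab yz vw [cy sv yE]; split.
- by apply: subspace_eq_continuous cy => t; rewrite inE/=; exact: yz.
- exact: eq_square_integrable sv.
move=> t tab; rewrite -!yz//; last by rewrite in_itv/= lexx.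
rewrite yE//; congr (_ + _); apply: eq_Int => s; rewrite in_itv/= => /andP[sa st].
apply: vw; rewrite in_itv/= sa/= (lt_le_trans st)//.
by move: tab; rewrite in_itv/= => /andP[].
Qed.

Lemma is_primitive_sub a b c d y v : a <= c -> c <= d -> d <= b -> is_primitive a b y v ->
  is_primitive c d y v.
Proof.
move=> ac cd db pv; split.
- apply: continuous_subspaceW (is_primitive_continuous pv).
  by apply: subset_itv; rewrite bnd_simp.
- exact: square_integrable_sub (is_primitive_sqi pv).
- move=> t; rewrite in_itv/= => /andP[ct td].
  rewrite -(is_primitive_diff pv ac ct (le_trans td db)).
  by rewrite addrC subrK.
Qed.

Lemma is_primitiveD a b y z v w : is_primitive a b y v -> is_primitive a b z w ->
  is_primitive a b (fun t => y t + z t) (fun t => v t + w t).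
Proof.
move=> pv pw; split.
- by move=> x; apply: cvgD; [case: pv => + _ _|case: pw => + _ _]; apply.
- by apply: square_integrableD; [case: pv|case: pw].
move=> t tab; rewrite (is_primitive_val pv tab) (is_primitive_val pw tab).
have tb : t <= b by move: tab; rewrite in_itv/= => /andP[].
have iv := square_integrable_integrable (is_primitive_sqi pv).
have iw := square_integrable_integrable (is_primitive_sqi pw).
rewrite IntD; first by rewrite addrACA.
- exact: (integrable_on_sub (lexx a) tb iv).
- exact: (integrable_on_sub (lexx a) tb iw).
Qed.

Lemma is_primitiveZ a b k y v : is_primitive a b y v ->
  is_primitive a b (fun t => k * y t) (fun t => k * v t).
Proof.
move=> pv; split.
- by move=> x; apply: cvgM; [exact: cvg_cst|case: pv => + _ _; apply].
- by apply: square_integrableZ; case: pv.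
move=> t tab; rewrite (is_primitive_val pv tab) mulrDr IntZ//.
have tb : t <= b by move: tab; rewrite in_itv/= => /andP[].
exact: (integrable_on_sub (lexx a) tb (square_integrable_integrable (is_primitive_sqi pv))).
Qed.

Lemma is_primitiveB a b y z v w : is_primitive a b y v -> is_primitive a b z w ->
  is_primitive a b (fun t => y t - z t) (fun t => v t - w t).
Proof.
move=> pv pw; have := is_primitiveD pv (is_primitiveZ (-1) pw).
by congr is_primitive; apply/funext => t; rewrite mulN1r.
Qed.

(** Insert the integral representations of [y] and [z]; what remains is the exchange of integrals
    over a triangle. *)
Lemma Int_by_parts a b y v z w : a <= b -> is_primitive a b y v -> is_primitive a b z w ->
  Int a b (fun t => v t * z t) + Int a b (fun t => y t * w t) = y b * z b - y a * z a.
Proof.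
move=> ab pv pw; have [cy sv _] := pv; have [cz sw _] := pw.
have iv := square_integrable_integrable sv; have iw := square_integrable_integrable sw.
have sy := continuous_square_integrable cy.
have sP := continuous_square_integrable (primitive_continuous sw).
have -> : Int a b (fun t => v t * z t) =
    z a * Int a b v + Int a b (fun t => v t * Int a t w).
  rewrite -IntZ// -IntD; [|exact: integrable_onZ|exact: integrable_onM].
  by apply: eq_Int => t tab; rewrite (is_primitive_val pw (in_segment tab)); ring.
rewrite Int_triangle//.
have -> : Int a b (fun s => w s * Int s b v) = y b * Int a b w - Int a b (fun t => y t * w t).
  rewrite -IntZ// -IntB; [|exact: integrable_onZ|exact: integrable_onM].
  apply: eq_Int => t tab; move: (tab); rewrite in_itv/= => /andP[/ltW ta /ltW tb].
  by rewrite -(is_primitive_diff pv ta tb (lexx b)); ring.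
by rewrite (is_primitive_end ab pv) (is_primitive_end ab pw); ring.
Qed.

Lemma C1_is_primitive a b f : a <= b -> (forall t : R, derivable f t 1) ->
  continuous (derive1 f) -> is_primitive a b f (derive1 f).
Proof.
move=> ab df cf'; split.
- apply: continuous_subspaceT => t.
  by apply: differentiable_continuous; exact/derivable1_diffP.
- by apply: continuous_square_integrable; exact: continuous_subspaceT.
move=> t; rewrite in_itv/= => /andP[ta _]; rewrite (Int_derive ta df erefl cf').
by rewrite addrC subrK.
Qed.

Lemma primitive_weak_derivative a b y v (phi : R -> R) : a <= b -> is_primitive a b y v ->
  test_fun a b phi -> Int a b (fun t => y t * derive1 phi t) = - Int a b (fun t => v t * phi t).
Proof.
move=> ab pv [dphi cphi [c [d [ac db phi0]]]].
have pphi := C1_is_primitive ab dphi cphi.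
have := Int_by_parts ab pv pphi.
rewrite (phi0 b) ?(phi0 a); last 2 first.
  by rewrite in_itv/= leNgt ac.
  by rewrite in_itv/= [b <= d]leNgt db andbF.
rewrite !mulr0 subrr addrC => /eqP; rewrite addr_eq0 => /eqP; exact.
Qed.

(** The difference quotient with step [h] differs from [2 * |x - s|] by at most [|h|], by cases on
    the signs. This makes explicit C^1 test functions available. *)
Lemma is_derive_mul_abs s x : is_derive x 1 (fun z : R => (z - s) * `|z - s|) (2 * `|x - s|).
Proof.
have H : (fun h : R => h^-1 *: (((fun z : R => (z - s) * `|z - s|) \o shift x) (h *: 1) -
    (x - s) * `|x - s|)) @ 0^' --> 2 * `|x - s|.
  apply/cvgrPdist_le => e e0; near=> h.
  have h0 : h != 0 by near: h; exact: nbhs_dnbhs_neq.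
  have he : `|h| <= e by near: h; apply: dnbhs0_le.
  apply: le_trans he; rewrite /= /GRing.scale/= mulr1.
  rewrite -(ler_pM2l (_ : 0 < `|h|)) ?normr_gt0// -normrM -normrM mulrBr (mulrA h h^-1) divff// mul1r.
  set z := x - s; have -> : h + x - s = z + h by rewrite /z; ring.
  rewrite [X in _ <= X]ger0_norm; last by rewrite -expr2 sqr_ge0.
  rewrite ler_norml; case: (ger0P z) => z0; case: (ger0P (z + h)) => zh0;
    apply/andP; split; nra.
by apply: DeriveDef; [exact: cvgP H|exact: cvg_lim H].
Unshelve. all: by end_near. Qed.

(* Tent function of mass 1 on [s, s + 2h], written with absolute values so that
   [hat_primitive] is an explicit C^1 primitive of it. *)
Definition hat s h x : R := (`|x - s| - 2 * `|x - (s + h)| + `|x - (s + 2 * h)|) / (2 * h ^+ 2).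

Definition hat_primitive s h x : R :=
  ((x - s) * `|x - s| - 2 * ((x - (s + h)) * `|x - (s + h)|)
   + (x - (s + 2 * h)) * `|x - (s + 2 * h)|) / (4 * h ^+ 2).

Lemma is_derive_hat s h x : h != 0 -> is_derive x 1 (hat_primitive s h) (hat s h x).
Proof.
move=> h0; have D1 := is_derive_mul_abs s x; have D2 := is_derive_mul_abs (s + h) x.
have D3 := is_derive_mul_abs (s + 2 * h) x.
have := is_deriveZ ((4 * h ^+ 2)^-1) (is_deriveD (is_deriveB D1 (is_deriveZ 2 D2)) D3).
have -> : hat s h x = (4 * h ^+ 2)^-1 *:
    (2 * `|x - s| - 2 *: (2 * `|x - (s + h)|) + 2 * `|x - (s + 2 * h)|).
  by rewrite /hat /GRing.scale/=; field; rewrite h0.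
congr is_derive; apply/funext => z; rewrite /hat_primitive [RHS]mulrC.
by [].
Qed.

Lemma hat_primitive_left s h x : 0 < h -> x <= s -> hat_primitive s h x = - 2^-1.
Proof.
move=> h0 xs; rewrite /hat_primitive !ler0_norm; [|lra..].
by field; rewrite gt_eqF.
Qed.

Lemma hat_primitive_right s h x : 0 < h -> s + 2 * h <= x -> hat_primitive s h x = 2^-1.
Proof.
move=> h0 xs; rewrite /hat_primitive !ger0_norm; [|lra..].
by field; rewrite gt_eqF.
Qed.

Lemma hat_ge0 s h x : 0 < h -> 0 <= hat s h x.
Proof.
move=> h0; rewrite /hat divr_ge0 ?(mulr_ge0, sqr_ge0, ltW h0)//.
have := ler_normD (x - s) (x - (s + 2 * h)).
have -> : x - s + (x - (s + 2 * h)) = 2 * (x - (s + h)) by ring.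
by rewrite normrM (ger0_norm (ler0n _ 2)); lra.
Qed.

Lemma hat_out s h x : 0 < h -> x \notin `[s, s + 2 * h] -> hat s h x = 0.
Proof.
move=> h0; rewrite in_itv/= negb_and -!ltNge /hat => /orP[xs|xs].
  by rewrite !ler0_norm; [|lra..]; rewrite (_ : _ + _ = 0) ?mul0r//; lra.
by rewrite !ger0_norm; [|lra..]; rewrite (_ : _ + _ = 0) ?mul0r//; lra.
Qed.

Lemma hat_continuous s h : continuous (hat s h).
Proof.
have C c : continuous (fun x => `|x - c|).
  by move=> x; apply: cvg_norm; apply: cvgB; [exact: cvg_id|exact: cvg_cst].
move=> x; apply: cvgM; last exact: cvg_cst.
apply: cvgD; last exact: C.
by apply: cvgB; [exact: C|apply: cvgM; [exact: cvg_cst|exact: C]].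
Qed.

Lemma derivable_hat_primitive s h x : h != 0 -> derivable (hat_primitive s h) x 1.
Proof. by move=> h0; have := is_derive_hat s x h0 => -[]. Qed.

Lemma derive1_hat_primitive s h : h != 0 -> derive1 (hat_primitive s h) = hat s h.
Proof.
by move=> h0; apply/funext => x; rewrite derive1E; have := is_derive_hat s x h0 => -[].
Qed.

Lemma Int_hat a b s h : 0 < h -> a <= s -> s + 2 * h <= b -> Int a b (hat s h) = 1.
Proof.
move=> h0 sa sb; have hn0 : h != 0 by rewrite gt_eqF.
rewrite (@Int_derive _ _ _ _ (hat_primitive s h))//.
- by rewrite hat_primitive_right// hat_primitive_left//; lra.
- lra.
- by move=> t; exact: derivable_hat_primitive.
- exact: derive1_hat_primitive.
- exact: hat_continuous.
Qed.

(** [hat s h] is a probability density supported in [[s, s + 2 * h]]. *)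
Lemma Int_hat_approx a b w s h e : {within `[a, b], continuous w} ->
  0 < h -> a <= s -> s + 2 * h <= b ->
  (forall x, x \in `[s, s + 2 * h] -> `|w x - w s| <= e) ->
  `|Int a b (fun t => w t * hat s h t) - w s| <= e.
Proof.
move=> cw h0 sa sb we.
have shat : square_integrable a b (hat s h).
  by apply: continuous_square_integrable; apply: continuous_subspaceT; exact: hat_continuous.
have sw := continuous_square_integrable cw.
have swB : square_integrable a b (fun t => w t - w s).
  by apply: square_integrableB => //; exact: square_integrable_cst.
have -> : Int a b (fun t => w t * hat s h t) - w s = Int a b (fun t => (w t - w s) * hat s h t).
  rewrite -[X in _ - X]mulr1 -(Int_hat h0 sa sb) -IntZ; last exact: square_integrable_integrable.
  rewrite -IntB; [|exact: integrable_onM|exact/integrable_onZ/square_integrable_integrable].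
  by apply: eq_Int => t _; rewrite mulrBl.
apply: (le_trans (Int_norm (integrable_onM swB shat))).
rewrite -[leRHS]mulr1 -(Int_hat h0 sa sb) -IntZ; last exact: square_integrable_integrable.
apply: Int_le; [exact/integrable_on_norm/integrable_onM|exact/integrable_onZ/square_integrable_integrable|].
move=> t _; rewrite normrM (ger0_norm (hat_ge0 _ _ h0)).
have [tin|tout] := boolP (t \in `[s, s + 2 * h]).
  by rewrite ler_wpM2r ?hat_ge0// we.
by rewrite hat_out// !mulr0.
Qed.

Lemma derive1_hat_primitiveB s t h : h != 0 ->
  derive1 (fun x => hat_primitive s h x - hat_primitive t h x) =
    (fun x => hat s h x - hat t h x).
Proof.
move=> hn0; apply/funext => x; rewrite derive1E.
have := is_deriveB (is_derive_hat s x hn0) (is_derive_hat t x hn0) => D.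
exact: (@derive_val _ _ _ _ _ _ _ D).
Qed.

(** Each [hat_primitive] is [-1/2] to the left of its support and [1/2] to the right, so the
    difference of two of them has compact support. *)
Lemma test_fun_hat a b s t h : 0 < h -> a < s -> s <= t -> t + 2 * h < b ->
  test_fun a b (fun x => hat_primitive s h x - hat_primitive t h x).
Proof.
move=> h0 sa st tb; have hn0 : h != 0 by rewrite gt_eqF.
have dE := derive1_hat_primitiveB s t hn0.
split.
- by move=> x; apply: derivableB; exact: derivable_hat_primitive.
- by rewrite dE => x; apply: cvgB; exact: hat_continuous.
exists s, (t + 2 * h); split=> // x; rewrite in_itv/= negb_and -!ltNge => /orP[xs|xs].
  by rewrite !hat_primitive_left ?subrr//; lra.
by rewrite !hat_primitive_right ?subrr//; lra.
Qed.


(** The lemma of du Bois-Reymond. Testing with a difference of two hat primitives shows that local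
    averages of [w] at two points agree; shrinking the width gives equality of the values. *)
Lemma constant_of_weak_derivative0 a b w : a < b -> {within `[a, b], continuous w} ->
  (forall phi, test_fun a b phi -> Int a b (fun t => w t * derive1 phi t) = 0) ->
  forall t, t \in `[a, b] -> w t = w a.
Proof.
move=> ab cw w0.
have cwP := (subspace_continuousP _ _).1 cw.
have inner s t : a < s -> s <= t -> t < b -> w s = w t.
  move=> sa st tb; apply/eqP; rewrite -subr_eq0 -normr_le0.
  apply/ler_addgt0Pl => e e0; rewrite addr0.
  have near_const x : a < x -> x < b ->
      \forall h \near 0^'+, forall z, z \in `[x, x + 2 * h] -> `|w z - w x| <= e / 2.
    move=> ax xb.
    have xab : `[a, b]%classic x by rewrite /= in_itv/= !ltW.
    have e20 : 0 < e / 2 by lra.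
    have /cvgrPdist_le/(_ (e / 2) e20) := cwP x xab.
    rewrite near_withinE => -[r /= r0 rP].
    near=> h => z; rewrite in_itv/= => /andP[xz zh]; rewrite distrC; apply: rP.
      rewrite /ball_/= distrC ger0_norm; last lra.
      have : h < r / 2 by near: h; apply: nbhs_right_lt; rewrite divr_gt0.
      lra.
    rewrite /= in_itv/= (le_trans (ltW ax) xz)/=.
    have : h < (b - x) / 2 by near: h; apply: nbhs_right_lt; rewrite divr_gt0// subr_gt0.
    lra.
  have [h [h0 hb ws wt]] : exists h, [/\ 0 < h, t + 2 * h < b,
      forall z, z \in `[s, s + 2 * h] -> `|w z - w s| <= e / 2 &
      forall z, z \in `[t, t + 2 * h] -> `|w z - w t| <= e / 2].
    have : \forall h \near (0 : R)^'+, [/\ 0 < h, t + 2 * h < b,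
        forall z, z \in `[s, s + 2 * h] -> `|w z - w s| <= e / 2 &
        forall z, z \in `[t, t + 2 * h] -> `|w z - w t| <= e / 2].
      near=> h; split.
      - by near: h; exact: nbhs_right_gt.
      - have : h < (b - t) / 2 by near: h; apply: nbhs_right_lt; rewrite divr_gt0// subr_gt0.
        lra.
      - by near: h; apply: near_const => //; exact: le_lt_trans tb.
      - by near: h; apply: near_const => //; exact: lt_le_trans st.
    by move=> /filter_ex.
  have hn0 : h != 0 by rewrite gt_eqF.
  (* The derivative of this test function is the difference of the two hats, so the averages of [w]
     next to [s] and next to [t] coincide. *)
  have := w0 _ (test_fun_hat h0 sa st hb).
  have -> : derive1 (fun x => hat_primitive s h x - hat_primitive t h x) =
      (fun x => hat s h x - hat t h x) by exact: derive1_hat_primitiveB.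
  have sh c : square_integrable a b (hat c h).
    by apply: continuous_square_integrable; apply: continuous_subspaceT; exact: hat_continuous.
  have sw := continuous_square_integrable cw.
  rewrite (@eq_Int _ _ _ _ (fun x => w x * hat s h x - w x * hat t h x)); last first.
    by move=> x _; rewrite mulrBr.
  rewrite IntB; [|exact: integrable_onM..].
  have As : `|Int a b (fun x => w x * hat s h x) - w s| <= e / 2.
    by apply: Int_hat_approx => //; lra.
  have At : `|Int a b (fun x => w x * hat t h x) - w t| <= e / 2.
    by apply: Int_hat_approx => //; lra.
  move: As At; set I1 := Int a b _; set I2 := Int a b _ => As At I12.
  rewrite (_ : w s - w t = (I2 - w t) - (I1 - w s)); last by lra.
  by apply: (le_trans (ler_normB _ _)); lra.
have w_mid t : t \in `]a, b[ -> w t = w ((a + b) / 2).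
  rewrite in_itv/= => /andP[ta tb]; have [tm|/ltW tm] := leP t ((a + b) / 2).
    by apply: inner => //; lra.
  by symmetry; apply: inner => //; lra.
have w_all t : t \in `[a, b] -> w t = w ((a + b) / 2).
  move=> tab; apply/eqP; rewrite -subr_eq0 -normr_le0.
  apply/ler_addgt0Pl => e e0; rewrite addr0.
  have /(cwP t)/cvgrPdist_le/(_ e e0) : `[a, b]%classic t by [].
  rewrite near_withinE => -[r /= r0 rP].
  (* A nearby interior point, found by stepping towards the midpoint; the bound [(b - a) / 4] keeps
     the step inside the interval. *)
  have [z [zab zt]] : exists z, (z \in `]a, b[) /\ `|t - z| < r.
    move: tab; rewrite in_itv/= => /andP[ta tb].
    have [tm|tm] := leP t ((a + b) / 2).
      exists (t + Num.min (r / 2) ((b - a) / 4)); split.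
        rewrite in_itv/=; case: (leP (r / 2) ((b - a) / 4)) => ?; apply/andP; split; lra.
      rewrite opprD addrA subrr sub0r normrN.
      by case: (leP (r / 2) ((b - a) / 4)) => ?; rewrite ger0_norm; lra.
    exists (t - Num.min (r / 2) ((b - a) / 4)); split.
      rewrite in_itv/=; case: (leP (r / 2) ((b - a) / 4)) => ?; apply/andP; split; lra.
    rewrite opprB addrC subrK.
    by case: (leP (r / 2) ((b - a) / 4)) => ?; rewrite ger0_norm; lra.
  by rewrite -(w_mid z zab); exact: (rP z zt (in_segment zab)).
by move=> t tab; rewrite (w_all t tab) (w_all a)// in_itv/= lexx ltW.
Unshelve. all: by end_near. Qed.

(** The difference of [y] and the primitive of [v] has weak derivative zero, hence is constant. *)
Lemma weak_derivative_primitive a b y v : a < b -> {within `[a, b], continuous y} ->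
  square_integrable a b v ->
  (forall phi, test_fun a b phi ->
    Int a b (fun t => y t * derive1 phi t) = - Int a b (fun t => v t * phi t)) ->
  is_primitive a b y v.
Proof.
move=> ab cy sv yv; have pV := is_primitive_intro 0 sv.
split=> // t tab; pose w s := y s - (0 + Int a s v).
have cw : {within `[a, b], continuous w}.
  by move=> x; apply: cvgB; [exact: cy|case: pV => + _ _; apply].
have := @constant_of_weak_derivative0 a b w ab cw _ t tab.
rewrite /w Int_nil !add0r subr0 => H.
rewrite -H; first by rewrite subrK.
move=> phi tphi; have [dphi cphi _] := tphi.
have sphi : square_integrable a b (derive1 phi).
  by apply: continuous_square_integrable; exact: continuous_subspaceT.
have sy := continuous_square_integrable cy.
have sV : square_integrable a b (fun s => 0 + Int a s v).
  by apply: continuous_square_integrable; case: pV.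
rewrite (@eq_Int _ _ _ _ (fun x => y x * derive1 phi x - (0 + Int a x v) * derive1 phi x)); last first.
  by move=> x _; rewrite mulrBl.
rewrite IntB; [|exact: integrable_onM..].
by rewrite yv// (primitive_weak_derivative (ltW ab) pV tphi) subrr.
Qed.

(** The primitive of [f], extended by zero, vanishes identically, and by Lebesgue differentiation
    its derivative equals [f] almost everywhere. Uniqueness of weak derivatives follows. *)
Lemma Int_sqr_eq0 a b f : a <= b -> square_integrable a b f ->
  (forall t, t \in `[a, b] -> Int a t f = 0) -> Int a b (fun t => f t ^+ 2) = 0.
Proof.
move=> ab sf f0; have iF := square_integrable_integrable sf.
have mI : measurable (`]a, b[%classic : set R) by exact: measurable_itv.
have loc := integrable_locally mI iF.
have iy (x : R) : mu.-integrable `]-oo, x] (EFin \o (f \_ `]a, b[)).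
  by apply: integrableS (integrable_on_patch iF).
have F0 (y : R) : Rintegral mu `]-oo, y]%classic (f \_ `]a, b[) = 0.
  rewrite -Rintegral_mkcondr.
  have [yb|yb] := leP b y.
    rewrite (_ : _ `&` _ = `]a, b[%classic); last first.
      apply/seteqP; split=> x; rewrite /= !in_itv/=; first by case.
      by move=> xab; split=> //; case/andP: xab => _ /ltW/le_trans; apply.
    by apply: f0; rewrite in_itv/= ab lexx.
  have [ya|ay] := leP y a.
    rewrite (_ : _ `&` _ = set0) ?Rintegral_set0//.
    apply/seteqP; split=> x //=; rewrite !in_itv/= => -[xy /andP[ax _]].
    by have := le_lt_trans (le_trans xy ya) ax; rewrite ltxx.
  rewrite (_ : _ `&` _ = `]a, y]%classic); last first.
    apply/seteqP; split=> x; rewrite /= !in_itv/=; first by case=> -> /andP[-> _].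
    by move=> /andP[-> xy]; split=> //; exact: le_lt_trans yb.
  rewrite -Rintegral_itv_bndo_bndc.
    by apply: f0; rewrite in_itv/= !ltW.
  exact: integrable_on_sub (lexx a) (ltW yb) iF.
have ae0 := FTC1Ny iy loc.
rewrite /Rintegral.
have -> : (\int[mu]_(t in `]a, b[) (f t ^+ 2)%:E = \int[mu]_(t in `]a, b[) (cst 0 t))%E.
  apply: ge0_ae_eq_integral => //.
  - by apply/measurable_EFinP; apply: measurable_funX; case: sf.
  - by move=> t _; rewrite lee_fin sqr_ge0.
  apply: (@filterS _ _ (ae_filter_ringOfSetsType mu)) ae0 => t [_ Ft] tab.
  move: Ft; rewrite (_ : (fun x => _) = cst 0); last by apply/funext.
  by rewrite derive1_cst patchE mem_set// => <-; rewrite expr0n.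
by rewrite integral0.
Qed.

End Primitives.

(** Entrywise, so that the scalar results on primitives apply. With a velocity that depends on [y]
    it is the integral form of a differential equation. *)
Definition trajectory {R : realType} {n : nat} (a b : R) (y v : R -> 'cV[R]_n) : Prop :=
  forall i, is_primitive a b (fun t => y t i 0) (fun t => v t i 0).

(** * Maximum norm and Euclidean norm of vectors and matrices *)

Section MatrixNorm.
Context {R : realType}.

Lemma entry_le_mx_norm m n (A : 'M[R]_(m, n)) i j : `|A i j| <= `|A|.
Proof. by rewrite [leRHS]/Num.Def.normr/= mx_normrE; exact: (le_bigmax _ (fun ij => `|A ij.1 ij.2|) (i, j)). Qed.

Lemma mx_norm_le m n (A : 'M[R]_(m, n)) (c : R) : 0 <= c ->
  (forall i j, `|A i j| <= c) -> `|A| <= c.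
Proof.
move=> c0 Ac; rewrite [leLHS]/Num.Def.normr/= mx_normrE.
by apply/bigmax_leP; split=> // -[i j] _; exact: Ac.
Qed.

Lemma cV_norm_le n (A : 'cV[R]_n) (c : R) : 0 <= c ->
  (forall i, `|A i 0| <= c) -> `|A| <= c.
Proof. by move=> c0 Ac; apply: mx_norm_le => // i j; rewrite ord1. Qed.

Lemma mulmx_norm_le m n p (A : 'M[R]_(m, n)) (B : 'M[R]_(n, p)) :
  `|A *m B| <= n%:R * `|A| * `|B|.
Proof.
apply: mx_norm_le => [|i j]; first by rewrite !mulr_ge0.
rewrite mxE; apply: (le_trans (ler_norm_sum _ _ _)).
apply: (@le_trans _ _ (\sum_(k < n) `|A| * `|B|)).
  by apply: ler_sum => k _; rewrite normrM ler_pM ?entry_le_mx_norm.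
by rewrite sumr_const card_ord -mulrA mulr_natl.
Qed.

Lemma trmx_norm m n (A : 'M[R]_(m, n)) : `|A^T| = `|A|.
Proof.
apply/eqP; rewrite eq_le; apply/andP; split; apply: mx_norm_le => // i j.
  by rewrite mxE entry_le_mx_norm.
by have := entry_le_mx_norm A^T j i; rewrite mxE.
Qed.

Lemma cvg_mxP (T : Type) (F : set_system T) (FF : Filter F) m n
    (f : T -> 'M[R]_(m, n)) (l : 'M[R]_(m, n)) :
  (f @ F --> l) <-> (forall i j, (fun x => f x i j) @ F --> l i j).
Proof.
split=> [fl i j|fl].
  exact: (@cvg_comp _ _ _ f (fun M : 'M[R]_(m, n) => M i j) F (nbhs l) (nbhs (l i j)) fl
    (@coord_continuous R m n i j l)).
apply/cvgrPdist_le => e e0.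
have : \forall x \near F, forall i j, `|l i j - f x i j| <= e.
  apply: filter_forall => i; apply: filter_forall => j.
  by have /cvgrPdist_le := fl i j; apply.
apply: filterS => x H; apply: mx_norm_le; first exact: ltW.
by move=> i j; rewrite !mxE; exact: H.
Qed.

Lemma within_continuous_mx (T : topologicalType) (A : set T) m n (f : T -> 'M[R]_(m, n)) :
  {within A, continuous f} <-> forall i j, {within A, continuous (fun x => f x i j)}.
Proof.
split=> [cf i j x|cf x].
  by have /cvg_mxP := cf x; apply.
by apply/cvg_mxP => i j; exact: cf.
Qed.

Lemma within_continuous_cV (T : topologicalType) (A : set T) n (f : T -> 'cV[R]_n) :
  {within A, continuous f} <-> forall i, {within A, continuous (fun x => f x i 0)}.
Proof.
rewrite within_continuous_mx; split=> H i; first exact: H.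
by move=> j; rewrite ord1.
Qed.

Lemma enorm_sqr n (x : 'cV[R]_n) : enorm x ^+ 2 = \sum_i x i 0 ^+ 2.
Proof.
rewrite /enorm sqr_sqrtr; last first.
  by apply: sumr_ge0 => i _; apply: sumr_ge0 => j _; exact: sqr_ge0.
by apply: eq_bigr => i _; rewrite big_ord1.
Qed.

Lemma enorm_ge0 m n (x : 'M[R]_(m, n)) : 0 <= enorm x.
Proof. exact: sqrtr_ge0. Qed.

Lemma entry_le_enorm m n (x : 'M[R]_(m, n)) i j : `|x i j| <= enorm x.
Proof.
rewrite -sqrtr_sqr /enorm ler_wsqrtr// (bigD1 i)//= (bigD1 j)//= -addrA lerDl.
by rewrite addr_ge0// !sumr_ge0// => k _; rewrite ?sumr_ge0 ?sqr_ge0// => l _; rewrite sqr_ge0.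
Qed.

Lemma mx_norm_le_enorm m n (x : 'M[R]_(m, n)) : `|x| <= enorm x.
Proof. by apply: mx_norm_le => [|i j]; [exact: enorm_ge0|exact: entry_le_enorm]. Qed.

Lemma enorm_sqr_le n (x : 'cV[R]_n) : enorm x ^+ 2 <= n%:R * `|x| ^+ 2.
Proof.
rewrite enorm_sqr -[X in X%:R]card_ord -sumr_const mulr_suml; apply: ler_sum => i _.
by rewrite mul1r -[leLHS]real_normK ?num_real// lerXn2r ?nnegrE ?entry_le_mx_norm.
Qed.

End MatrixNorm.

(** * Vector-valued trajectories and the space W_T *)

Section Trajectories.
Context {R : realType} {n : nat}.
Local Notation mu := (@lebesgue_measure R).
Implicit Types (a b t : R) (y v z w : R -> 'cV[R]_n).

Lemma trajectory_continuous a b y v : trajectory a b y v -> {within `[a, b], continuous y}.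
Proof. by move=> H; apply/within_continuous_cV => i; case: (H i). Qed.

Lemma trajectory_inL2 a b y v : trajectory a b y v -> inL2 a b v.
Proof. by move=> H i; case: (H i) => _ []. Qed.

Lemma continuous_inL2 a b y : {within `[a, b], continuous y} -> inL2 a b y.
Proof. by move=> /within_continuous_cV H i; exact: continuous_square_integrable. Qed.

Lemma trajectory_weak_deriv a b y v : a <= b -> trajectory a b y v -> weak_deriv a b y v.
Proof.
move=> ab H; split; first exact: trajectory_inL2 H.
by move=> phi tphi i; exact: primitive_weak_derivative (H i) tphi.
Qed.

Lemma trajectory_inH1 a b y v : a <= b -> trajectory a b y v -> inH1 a b y.
Proof.
move=> ab H; have cy := trajectory_continuous H; split=> //.
  exact: continuous_inL2.
by exists v; exact: trajectory_weak_deriv.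
Qed.

Lemma weak_deriv_trajectory a b y v : a < b -> {within `[a, b], continuous y} ->
  weak_deriv a b y v -> trajectory a b y v.
Proof.
move=> ab /within_continuous_cV cy [vL2 H] i.
by apply: weak_derivative_primitive => // phi tphi; exact: H.
Qed.

Lemma L2norm_sqr a b v : inL2 a b v -> L2norm a b v ^+ 2 = \sum_i Int a b (fun t => v t i 0 ^+ 2).
Proof.
move=> vL2; rewrite /L2norm sqr_sqrtr; last first.
  by apply: Int_ge0 => t _; exact: sqr_ge0.
rewrite -Int_sum => [|i]; last by have [] := vL2 i.
by apply: eq_Int => t _; rewrite enorm_sqr.
Qed.

Lemma L2norm_ge0 a b v : 0 <= L2norm a b v.
Proof. exact: sqrtr_ge0. Qed.

(** [wderiv] is a chosen weak derivative, so its norm must be independent of the choice. The squares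
    differ by [(v + w) * (v - w)], whose integral vanishes by Cauchy-Schwarz. *)
Lemma trajectory_unique a b y v w : a <= b -> trajectory a b y v -> trajectory a b y w ->
  L2norm a b v = L2norm a b w.
Proof.
move=> ab Hv Hw; apply/eqP; rewrite -(@eqrXn2 _ 2)// ?L2norm_ge0//.
rewrite !L2norm_sqr; [|exact: trajectory_inL2 Hw|exact: trajectory_inL2 Hv].
apply/eqP/eq_bigr => i _; have sv := is_primitive_sqi (Hv i); have sw := is_primitive_sqi (Hw i).
have sd := square_integrableB sv sw.
have d0 : Int a b (fun t => (v t i 0 - w t i 0) ^+ 2) = 0.
  apply: Int_sqr_eq0 => // t tab; have tb : t <= b by case/andP: tab.
  rewrite IntB.
  - apply/eqP; rewrite subr_eq0; apply/eqP; apply: (@addrI _ (y a i 0)).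
    by rewrite -(is_primitive_val (Hv i) tab) -(is_primitive_val (Hw i) tab).
  - exact: integrable_on_sub (lexx a) tb (square_integrable_integrable sv).
  - exact: integrable_on_sub (lexx a) tb (square_integrable_integrable sw).
have vd0 : Int a b (fun t => (v t i 0 + w t i 0) * (v t i 0 - w t i 0)) = 0.
  have := cauchy_schwarz (square_integrableD sv sw) sd; rewrite d0 mulr0.
  by move=> le0; apply/eqP; rewrite -sqrf_eq0 eq_le le0 sqr_ge0.
apply/eqP; rewrite -subr_eq0 -IntB; [|exact: square_integrable_sqr..].
apply/eqP; rewrite -[RHS]vd0; apply: eq_Int => t _; ring.
Qed.

Lemma L2norm_wderiv a b y v : a < b -> trajectory a b y v ->
  L2norm a b (wderiv a b y) = L2norm a b v.
Proof.
move=> ab Hv; have wv := trajectory_weak_deriv (ltW ab) Hv.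
apply: (trajectory_unique (ltW ab) _ Hv).
apply: (weak_deriv_trajectory ab (trajectory_continuous Hv)).
exact: (@xgetPex _ (fun=> 0) [set v | weak_deriv a b y v]) (ex_intro _ _ wv).
Qed.

Lemma Wnorm_sqr T y v : 0 < T -> trajectory 0 T y v ->
  Wnorm T y ^+ 2 = L2norm 0 T v ^+ 2 + L2norm 0 T y ^+ 2.
Proof.
move=> T0 Hv; rewrite /Wnorm (L2norm_wderiv T0 Hv) sqr_sqrtr; first by [].
by rewrite addr_ge0 ?sqr_ge0.
Qed.

Lemma Wnorm_ge0 T y : 0 <= Wnorm T y.
Proof. exact: sqrtr_ge0. Qed.

Lemma inH1_trajectory a b y : a < b -> inH1 a b y -> exists v, trajectory a b y v.
Proof. by move=> ab [cy _ [v wv]]; exists v; exact: weak_deriv_trajectory. Qed.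

(** Compare [y t] with [y s] by the Hoelder estimate, square, and average over [s]; dividing by [T]
    produces the constant [2 / T + 2 * T]. *)
Lemma embedding_bound T y t : 0 < T -> inH1 0 T y -> t \in `[0, T] ->
  enorm (y t) ^+ 2 <= (2 / T + 2 * T) * Wnorm T y ^+ 2.
Proof.
move=> T0 yH1 tT; have [v Hv] := inH1_trajectory T0 yH1.
rewrite (Wnorm_sqr T0 Hv) enorm_sqr !L2norm_sqr; last 2 first.
  by apply: continuous_inL2; exact: trajectory_continuous Hv.
  exact: trajectory_inL2 Hv.
rewrite -big_split/= mulr_sumr; apply: ler_sum => i _.
have pv := Hv i; have sv := is_primitive_sqi pv.
have sy := continuous_square_integrable (is_primitive_continuous pv).
set V := Int 0 T (fun s => v s i 0 ^+ 2); set Y := Int 0 T (fun s => y s i 0 ^+ 2).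
have V0 : 0 <= V by apply: Int_ge0 => s _; exact: sqr_ge0.
have Y0 : 0 <= Y by apply: Int_ge0 => s _; exact: sqr_ge0.
have pt s : s \in `]0, T[ -> y t i 0 ^+ 2 <= 2 * y s i 0 ^+ 2 + 2 * T * V.
  move=> sT; have sT' := in_segment sT.
  have := primitive_hoelder sv sT' tT; rewrite -/V.
  have -> : Int 0 t (fun s => v s i 0) - Int 0 s (fun s => v s i 0) = y t i 0 - y s i 0.
    by rewrite (is_primitive_val pv tT) (is_primitive_val pv sT'); ring.
  have : `|t - s| <= T.
    move: tT sT; rewrite !in_itv/= => /andP[? ?] /andP[? ?].
    by rewrite ler_norml; apply/andP; split; lra.
  have := sqr_ge0 (y t i 0 - 2 * y s i 0); have := normr_ge0 (t - s); nra.
have : Int 0 T (fun=> y t i 0 ^+ 2) <= Int 0 T (fun s => 2 * y s i 0 ^+ 2 + 2 * T * V).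
  apply: Int_le => //; first exact: integrable_on_cst.
  by apply: integrable_onD; [apply: integrable_onZ; case: sy|exact: integrable_on_cst].
rewrite IntD; [|by apply: integrable_onZ; case: sy|exact: integrable_on_cst].
rewrite IntZ; last by case: sy.
rewrite !Int_cst ?(ltW T0)// subr0 -/Y => H.
rewrite -(ler_pM2r T0); apply: (le_trans H).
have -> : (2 / T + 2 * T) * (V + Y) * T = 2 * (V + Y) + 2 * T ^+ 2 * (V + Y).
  by field; rewrite gt_eqF.
have := sqr_ge0 T; nra.
Qed.

End Trajectories.

(** * Gronwall estimates and existence of solutions *)

(* The flag [fw] selects between initial value and terminal value problems. *)
Definition volterra {R : realType} (fw : bool) (a b t : R) (f : R -> R) : R :=
  if fw then Int a t f else Int t b f.

(** Weight of a Bielecki norm, growing away from the endpoint at which the data are prescribed. *)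
Definition exp_weight {R : realType} (fw : bool) (a b L t : R) : R :=
  expR (L * (if fw then t - a else b - t)).

(** The bound of [gronwall] for the data [3 * A] and [3 * (K + 1)], divided by [A]. The factor 3
    arises from squaring a sum of three terms, and the added 1 makes the kernel constant
    positive. *)
Definition gronwall_factor {R : realType} (K d : R) : R := 6 * expR (6 * (K + 1) * d).

(** For [0 <= r], the projection onto the ball of radius [r] about [c] in the maximum norm; acting
    coordinatewise, it does not increase distances. *)
Definition clip {R : realType} {n : nat} (r : R) (c x : 'cV[R]_n) : 'cV[R]_n :=
  c + \col_i Num.max (- r) (Num.min r (x i 0 - c i 0)).

Section Volterra.
Context {R : realType} (fw : bool) (a b : R) (ab : a <= b).
Implicit Types (f g : R -> R) (t : R).
Local Notation V := (volterra fw a b).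

Lemma volterra_le t f g : t \in `[a, b] -> integrable_on a b f -> integrable_on a b g ->
  (forall s, s \in `]a, b[ -> f s <= g s) -> V t f <= V t g.
Proof.
rewrite in_itv/= => /andP[ta tb] iF iG fg; rewrite /volterra.
by case: fw; (apply: Int_le; [apply: integrable_on_sub iF => //|apply: integrable_on_sub iG => //|]);
  move=> s; rewrite in_itv/= => /andP[s1 s2]; apply: fg; rewrite in_itv/=; lra.
Qed.

Lemma volterraZ t k f : t \in `[a, b] -> integrable_on a b f ->
  V t (fun s => k * f s) = k * V t f.
Proof.
rewrite in_itv/= => /andP[ta tb] iF; rewrite /volterra.
by case: fw; rewrite IntZ//; apply: integrable_on_sub iF.
Qed.

Lemma volterraD t f g : t \in `[a, b] -> integrable_on a b f -> integrable_on a b g ->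
  V t (fun s => f s + g s) = V t f + V t g.
Proof.
rewrite in_itv/= => /andP[ta tb] iF iG; rewrite /volterra.
by case: fw; rewrite IntD//; [apply: integrable_on_sub iF|apply: integrable_on_sub iG|apply: integrable_on_sub iF|apply: integrable_on_sub iG].
Qed.

Lemma volterraB t f g : t \in `[a, b] -> integrable_on a b f -> integrable_on a b g ->
  V t (fun s => f s - g s) = V t f - V t g.
Proof.
rewrite in_itv/= => /andP[ta tb] iF iG; rewrite /volterra.
by case: fw; rewrite IntB//; [apply: integrable_on_sub iF|apply: integrable_on_sub iG|apply: integrable_on_sub iF|apply: integrable_on_sub iG].
Qed.

Lemma eq_volterra t f g : t \in `[a, b] -> (forall s, s \in `]a, b[ -> f s = g s) -> V t f = V t g.
Proof.
rewrite in_itv/= => /andP[ta tb] fg; rewrite /volterra.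
by case: fw; apply: eq_Int => s; rewrite in_itv/= => /andP[s1 s2]; apply: fg; rewrite in_itv/=; lra.
Qed.

Lemma volterra_ge0 t f : t \in `[a, b] -> (forall s, s \in `]a, b[ -> 0 <= f s) -> 0 <= V t f.
Proof.
rewrite in_itv/= => /andP[ta tb] f0; rewrite /volterra.
by case: fw; apply: Int_ge0 => s; rewrite in_itv/= => /andP[s1 s2]; apply: f0; rewrite in_itv/=; lra.
Qed.

Lemma volterra_le_Int t f : t \in `[a, b] -> integrable_on a b f ->
  (forall s, s \in `]a, b[ -> 0 <= f s) -> V t f <= Int a b f.
Proof.
move=> tab iF f0; move: (tab); rewrite in_itv/= => /andP[ta tb].
rewrite (Int_split ta tb iF) /volterra.
by case: fw; rewrite (lerDl, lerDr); apply: Int_ge0 => s; rewrite in_itv/= => /andP[s1 s2];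
  apply: f0; rewrite in_itv/=; lra.
Qed.

Lemma volterra_norm t f : t \in `[a, b] -> integrable_on a b f ->
  `|V t f| <= V t (fun s => `|f s|).
Proof.
rewrite in_itv/= => /andP[ta tb] iF; rewrite /volterra.
by case: fw; apply: Int_norm; apply: integrable_on_sub iF.
Qed.

Lemma volterra_sqr_le t f g : t \in `[a, b] -> square_integrable a b f ->
  square_integrable a b g ->
  V t (fun s => f s * g s) ^+ 2 <= Int a b (fun s => f s ^+ 2) * V t (fun s => g s ^+ 2).
Proof.
move=> tab sf sg; move: (tab); rewrite in_itv/= => /andP[ta tb].
have sq0 h s : s \in `]a, b[ -> 0 <= h s ^+ 2 :> R by move=> _; exact: sqr_ge0.
apply: (@le_trans _ _ (V t (fun s => f s ^+ 2) * V t (fun s => g s ^+ 2))).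
  by rewrite /volterra; case: fw; apply: cauchy_schwarz;
    (apply: square_integrable_sub sf => //) || (apply: square_integrable_sub sg => //).
rewrite ler_wpM2r ?volterra_ge0//; [exact: sq0|].
by apply: volterra_le_Int => //; [exact: square_integrable_sqr|exact: sq0].
Qed.

Lemma volterra_continuous f : square_integrable a b f ->
  {within `[a, b], continuous (fun t => V t f)}.
Proof.
move=> sf; rewrite /volterra; case: fw; first exact: primitive_continuous.
have : {within `[a, b], continuous (fun t => Int a b f - Int a t f)}.
  by move=> x; apply: cvgB; [exact: cvg_cst|exact: primitive_continuous].
apply: subspace_eq_continuous => t; rewrite inE/= in_itv/= => /andP[ta tb].
by rewrite /from_subspace (Int_split ta tb (square_integrable_integrable sf)) addrAC subrr add0r.
Qed.

Local Notation w L := (exp_weight fw a b L).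

Lemma exp_weight_ge1 L t : 0 <= L -> t \in `[a, b] -> 1 <= w L t.
Proof.
move=> L0; rewrite in_itv/= => /andP[ta tb]; rewrite /exp_weight -expR0 ler_expR mulr_ge0//.
by case: fw; lra.
Qed.

Lemma exp_weight_le L t : 0 <= L -> t \in `[a, b] -> w L t <= expR (L * (b - a)).
Proof.
move=> L0; rewrite in_itv/= => /andP[ta tb]; rewrite /exp_weight ler_expR ler_wpM2l//.
by case: fw; lra.
Qed.

Lemma exp_weight_continuous L : continuous (w L).
Proof.
move=> x; rewrite /exp_weight; case: fw.
  apply: (@continuous_comp _ _ _ (fun t => L * (t - a)) expR); last exact: continuous_expR.
  by apply: cvgM; [exact: cvg_cst|apply: cvgB; [exact: cvg_id|exact: cvg_cst]].
apply: (@continuous_comp _ _ _ (fun t => L * (b - t)) expR); last exact: continuous_expR.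
by apply: cvgM; [exact: cvg_cst|apply: cvgB; [exact: cvg_cst|exact: cvg_id]].
Qed.

Lemma exp_weight_integrable L : integrable_on a b (w L).
Proof.
by apply: continuous_integrable_on; apply: continuous_subspaceT; exact: exp_weight_continuous.
Qed.

(** The primitive of the weight that vanishes at the starting endpoint is [(w - 1) / L]. *)
Lemma volterra_exp_weight L t : 0 < L -> t \in `[a, b] -> V t (w L) <= w L t / L.
Proof.
move=> L0; rewrite in_itv/= => /andP[ta tb].
(* Both directions of time have a weight of the form [exp (k s + d)]. *)
pose k : R := if fw then L else - L; pose d : R := if fw then - L * a else L * b.
have wE s : w L s = expR (k * s + d).
  by rewrite /exp_weight /k /d; congr expR; case: fw; ring.
have k0 : k != 0 by rewrite /k; case: fw; rewrite ?oppr_eq0 gt_eqF.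
pose F s := k^-1 * expR (k * s + d).
have DF (s : R) : is_derive s 1 F (w L s).
  have D : is_derive s 1 (fun s : R => k * s + d) k.
    have -> : (fun s => k * s + d) = (k *: id + cst d)%R by apply/funext.
    rewrite -[X in is_derive _ _ _ X](_ : k *: 1 + 0 = k); last by rewrite addr0 /GRing.scale/= mulr1.
    exact: is_deriveD.
  have := is_deriveZ k^-1 (@is_derive1_comp R expR (fun s => k * s + d) s _ _ (is_derive_expR (k * s + d)) D).
  have -> : k^-1 *: (expR (k * s + d) * k) = w L s.
    by rewrite wE /GRing.scale/=; field.
  by [].
have dF : derive1 F = w L by apply/funext => s; rewrite derive1E; have := DF s => -[].
have cw := @exp_weight_continuous L.
have E u v : u <= v -> Int u v (w L) = F v - F u.
  by move=> uv; apply: (Int_derive uv _ dF cw) => s; have := DF s => -[].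
have FE s : F s = k^-1 * w L s by rewrite /F wE.
have e1 : w L (if fw then a else b) = 1.
  by rewrite /exp_weight; case: fw; rewrite subrr mulr0 expR0.
clear DF dF; clearbody F; move: E FE e1; rewrite /volterra /k; case: fw => E FE e1.
  rewrite E// !FE e1 mulrC lerBlDr lerDl mulr1 invr_ge0; exact: ltW.
rewrite E// !FE e1 mulr1 invrN mulNr opprK mulrC addrC.
by rewrite lerBlDr lerDl invr_ge0; exact: ltW.
Qed.

(** If [phi] is below [C] times the weight of rate [2 * K], the integral inequality returns the
    constant [A + C / 2]. Starting from the crude bound [B], its contribution is halved in each
    round and disappears in the limit, leaving [2 * A]. *)
Lemma gronwall (phi : R -> R) A B K : 0 <= A -> 0 < K -> integrable_on a b phi ->
  (forall t, t \in `[a, b] -> phi t <= B) ->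
  (forall t, t \in `[a, b] -> phi t <= A + K * V t phi) ->
  forall t, t \in `[a, b] -> phi t <= 2 * A * expR (2 * K * (b - a)).
Proof.
move=> A0 K0 iphi phiB phiV t tab.
have L0 : 0 < 2 * K by lra.
pose B' := Num.max B 0; have B0 : 0 <= B' by rewrite le_max lexx orbT.
have step j s : s \in `[a, b] -> phi s <= (2 * A + B' * 2^-1 ^+ j) * w (2 * K) s.
  elim: j s => [|j IH] s sab.
    have w1 := exp_weight_ge1 (ltW L0) sab.
    have BB : phi s <= B' by apply: (le_trans (phiB s sab)); rewrite le_max lexx.
    by rewrite expr0 mulr1; nra.
  set C := 2 * A + B' * 2^-1 ^+ j.
  have C0 : 0 <= C by rewrite addr_ge0 ?mulr_ge0 ?exprn_ge0 ?invr_ge0.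
  apply: (le_trans (phiV s sab)).
  have V1 : V s phi <= C * (w (2 * K) s / (2 * K)).
    apply: (@le_trans _ _ (V s (fun x => C * w (2 * K) x))).
      apply: volterra_le => //; first exact/integrable_onZ/exp_weight_integrable.
      by move=> x xab; apply: IH; exact: in_segment.
    rewrite volterraZ//; last exact: exp_weight_integrable.
    by rewrite ler_wpM2l// volterra_exp_weight.
  have w1 := exp_weight_ge1 (ltW L0) sab.
  apply: (@le_trans _ _ (A + K * (C * (w (2 * K) s / (2 * K))))).
    by rewrite lerD2l ler_wpM2l// ltW.
  have -> : K * (C * (w (2 * K) s / (2 * K))) = C * w (2 * K) s / 2 by field; rewrite gt_eqF.
  have -> : 2 * A + B' * 2^-1 ^+ j.+1 = A + C / 2 by rewrite exprS /C; field.
  have : A <= A * w (2 * K) s by rewrite ler_peMr.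
  lra.
have lim : phi t <= 2 * A * w (2 * K) t.
  apply/ler_addgt0Pl => e e0.
  have : (fun j => 2^-1 ^+ j : R) @ \oo --> 0.
    by apply: cvg_expr; rewrite ger0_norm ?invr_ge0//; lra.
  have w0 : 0 < w (2 * K) t by exact: expR_gt0.
  have d0 : 0 < e / ((B' + 1) * w (2 * K) t) by rewrite divr_gt0// mulr_gt0//; lra.
  move/cvgrPdist_le => /(_ _ d0)[j _ /(_ j (leqnn j))] /=.
  rewrite sub0r normrN ger0_norm ?exprn_ge0 ?invr_ge0//.
  rewrite ler_pdivlMr ?mulr_gt0//; last by lra.
  have p0 : 0 <= 2^-1 ^+ j :> R by rewrite exprn_ge0 ?invr_ge0.
  move=> H; apply: (le_trans (step j t tab)).
  rewrite mulrDl addrC lerD2r; apply: le_trans H.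
  rewrite mulrAC -!mulrA mulrCA [X in X <= _](_ : _ = (2^-1 ^+ j * w (2 * K) t) * B'); last by ring.
  rewrite [X in _ <= X](_ : _ = (2^-1 ^+ j * w (2 * K) t) * (B' + 1)); last by ring.
  by rewrite ler_wpM2l ?mulr_ge0 ?(ltW w0)// lerDl.
apply: (le_trans lim); rewrite ler_wpM2l ?mulr_ge0//.
by rewrite exp_weight_le// ltW.
Qed.

End Volterra.

(** * Picard iteration with a square integrable Lipschitz coefficient *)

Section Picard.
Context {R : realType} {n : nat} (fw : bool) (a b : R) (ab : a <= b).
Implicit Types (y z : R -> 'cV[R]_n).
Local Notation V := (volterra fw a b).

Lemma continuous_norm_sqr_integrable y z : {within `[a, b], continuous y} ->
  {within `[a, b], continuous z} -> square_integrable a b (fun s => `|y s - z s|).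
Proof.
move=> cy cz; apply: continuous_square_integrable => x.
by apply: cvg_norm; apply: cvgB; [exact: cy|exact: cz].
Qed.

(** Since [l] is only square integrable in time, the estimate relates the square of the integral to
    the integral of squared distances. *)
Lemma volterra_kernel_bound y z (f l : R -> R) t : {within `[a, b], continuous y} ->
  {within `[a, b], continuous z} -> square_integrable a b f -> square_integrable a b l ->
  (forall s, s \in `]a, b[ -> `|f s| <= l s * `|y s - z s|) -> t \in `[a, b] ->
  V t f ^+ 2 <= Int a b (fun s => l s ^+ 2) * V t (fun s => `|y s - z s| ^+ 2).
Proof.
move=> cy cz sf sl fl tab; have syz := continuous_norm_sqr_integrable cy cz.
apply: (le_trans _ (volterra_sqr_le fw tab sl syz)).
have iF := square_integrable_integrable sf.
rewrite -[leLHS]real_normK ?num_real// lerXn2r ?nnegrE//.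
  apply: volterra_ge0 => // s sab; exact: le_trans (fl s sab).
apply: (le_trans (volterra_norm fw tab iF)); apply: volterra_le => //.
  exact: integrable_on_norm.
exact: integrable_onM.
Qed.

Context (F : R -> 'cV[R]_n -> 'cV[R]_n) (l : R -> R).
Context (F_L2 : forall y, {within `[a, b], continuous y} -> inL2 a b (fun s => F s (y s))).
Context (l_L2 : square_integrable a b l).
Context (F_lip : forall s, s \in `]a, b[ -> forall x x', `|F s x - F s x'| <= l s * `|x - x'|).

Definition picard_map (y0 : 'cV[R]_n) (y : R -> 'cV[R]_n) (t : R) : 'cV[R]_n :=
  \col_i (y0 i 0 + V t (fun s => F s (y s) i 0)).

(** The added 1 makes [K] positive, so that it can serve in the rate of the exponential weight. *)
Let K := Int a b (fun s => l s ^+ 2) + 1.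

Lemma picard_map_continuous (y0 : 'cV[R]_n) y : {within `[a, b], continuous y} ->
  {within `[a, b], continuous (picard_map y0 y)}.
Proof.
move=> cy; apply/within_continuous_cV => i.
rewrite (_ : (fun x => _) = fun t => y0 i 0 + V t (fun s => F s (y s) i 0)); last first.
  by apply/funext => t; rewrite mxE.
move=> x; apply: cvgD; first exact: cvg_cst.
by apply: volterra_continuous => //; exact: (F_L2 cy i).
Qed.

Lemma picard_kernel_ge1 : 1 <= K.
Proof. by rewrite lerDr; apply: Int_ge0 => s _; exact: sqr_ge0. Qed.

Lemma picard_map_bound (y0 : 'cV[R]_n) y z t : {within `[a, b], continuous y} ->
  {within `[a, b], continuous z} -> t \in `[a, b] ->
  `|picard_map y0 y t - picard_map y0 z t| ^+ 2 <= K * V t (fun s => `|y s - z s| ^+ 2).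
Proof.
move=> cy cz tab.
have V0 : 0 <= V t (fun s => `|y s - z s| ^+ 2).
  by apply: volterra_ge0 => // s _; exact: sqr_ge0.
have K0 : 0 <= K by have := picard_kernel_ge1; lra.
rewrite -[leRHS]sqr_sqrtr ?mulr_ge0// lerXn2r ?nnegrE ?sqrtr_ge0//.
apply: cV_norm_le => [|i]; first exact: sqrtr_ge0.
rewrite -(ler_pXn2r (_ : 0 < 2)%N) ?nnegrE ?sqrtr_ge0// sqr_sqrtr ?mulr_ge0//.
rewrite !mxE real_normK ?num_real//.
have sy := F_L2 cy i; have sz := F_L2 cz i.
rewrite (_ : _ - _ = V t (fun s => F s (y s) i 0 - F s (z s) i 0)); last first.
  by rewrite volterraB//; [ring|exact: square_integrable_integrable..].
apply: (@le_trans _ _ (Int a b (fun s => l s ^+ 2) * V t (fun s => `|y s - z s| ^+ 2))).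
  apply: volterra_kernel_bound => //; first exact: square_integrableB.
  move=> s sab; apply: le_trans (F_lip sab _ _).
  by have := entry_le_mx_norm (F s (y s) - F s (z s)) i 0; rewrite !mxE.
by rewrite ler_wpM2r// lerDl.
Qed.

Lemma geometric_cauchy_limit (Y : nat -> R -> 'cV[R]_n) (C : R) : 0 <= C ->
  (forall j t, t \in `[a, b] -> `|Y j.+1 t - Y j t| <= C * 2^-1 ^+ j) ->
  exists y, forall j t, t \in `[a, b] -> `|y t - Y j t| <= 2 * C * 2^-1 ^+ j.
Proof.
move=> C0 YC.
exists (fun t => \col_i lim ((fun j => Y j t i 0) @ \oo)) => j t tab.
have cv i : cvgn (fun j => Y j t i 0).
  apply: (@bounded_variation_cvg _ _ (fun j => C * 2^-1 ^+ j) (C * 2)) => k.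
    by apply: le_trans (YC k t tab); have := entry_le_mx_norm (Y k.+1 t - Y k t) i 0; rewrite !mxE.
  by rewrite -mulr_sumr ler_wpM2l// sum_half_pow.
(* Keeping the exact remainder of the geometric series on the right makes the induction close. *)
have tail k : `|Y (j + k)%N t - Y j t| <= 2 * C * 2^-1 ^+ j - 2 * C * 2^-1 ^+ (j + k).
  elim: k => [|k IH]; first by rewrite addn0 !subrr normr0.
  rewrite addnS -(subrK (Y (j + k)%N t) (Y (j + k).+1 t)) -addrA.
  apply: (le_trans (ler_normD _ _)).
  apply: (le_trans (lerD (YC _ t tab) IH)).
  by rewrite [2^-1 ^+ (j + k).+1]exprS; lra.
have p0 k : 0 <= 2^-1 ^+ k :> R by rewrite exprn_ge0 ?invr_ge0.
apply: cV_norm_le => [|i]; first by rewrite !mulr_ge0.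
rewrite !mxE.
have : (fun k => `|Y k t i 0 - Y j t i 0|) @ \oo --> `|lim ((fun j => Y j t i 0) @ \oo) - Y j t i 0|.
  by apply: cvg_norm; apply: cvgB; [exact: cv|exact: cvg_cst].
move=> H; rewrite -(cvg_lim _ H)//; apply: limr_le; first exact: cvgP H.
exists j => // k /= jk; rewrite -(subnKC jk).
apply: (@le_trans _ _ `|Y (j + (k - j))%N t - Y j t|).
  by have := entry_le_mx_norm (Y (j + (k - j))%N t - Y j t) i 0; rewrite !mxE.
apply: (le_trans (tail _)); rewrite gerBl !mulr_ge0//.
Qed.

Lemma uniform_limit_continuous (Y : nat -> R -> 'cV[R]_n) y (c : nat -> R) :
  (forall j, {within `[a, b], continuous (Y j)}) -> c @ \oo --> 0 ->
  (forall j t, t \in `[a, b] -> `|y t - Y j t| <= c j) ->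
  {within `[a, b], continuous y}.
Proof.
move=> cY c0 yY; apply/subspace_continuousP => t tab; apply/cvgrPdist_le => e e0.
have e3 : 0 < e / 3 by lra.
have /cvgrPdist_le/(_ _ e3)[j _ /(_ j (leqnn j))] := c0.
rewrite /= sub0r normrN => cj; have {}cj : c j <= e / 3 := le_trans (ler_norm _) cj.
have /subspace_continuousP/(_ t tab)/cvgrPdist_le/(_ _ e3) := cY j.
rewrite near_withinE => H; rewrite near_withinE; apply: filterS H => s H sab.
have := H sab; rewrite /from_subspace => {}H.
rewrite (_ : y t - y s = (y t - Y j t) + (Y j t - Y j s) + - (y s - Y j s)); last first.
  by rewrite addrA subrK opprB addrA subrK.
apply: (le_trans (ler_normD _ _)); rewrite normrN.
apply: (@le_trans _ _ (e / 3 + e / 3 + e / 3)); last lra.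
apply: lerD; last by apply: le_trans (yY j s sab) cj.
by apply: (le_trans (ler_normD _ _)); apply: lerD => //; apply: le_trans (yY j t tab) cj.
Qed.

(** The integral operator is a contraction on the whole interval once squared distances are measured
    with an exponential weight, so no subdivision into short intervals occurs. *)
Lemma picard_exists (y0 : 'cV[R]_n) : exists y, {within `[a, b], continuous y} /\
  forall t, t \in `[a, b] -> y t = picard_map y0 y t.
Proof.
pose Y j := iter j (picard_map y0) (fun=> y0).
have cY j : {within `[a, b], continuous (Y j)}.
  elim: j => [|j IH]; last exact: picard_map_continuous.
  by move=> x; exact: cvg_cst.
have YS j : Y j.+1 = picard_map y0 (Y j) by [].
have K1 := picard_kernel_ge1; have K0 : 0 < K by lra.
have cd j : {within `[a, b], continuous (fun s => `|Y j.+1 s - Y j s|)}.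
  by move=> x; apply: cvg_norm; apply: cvgB; exact: cY.
have [B B0 YB] := continuous_bounded (cd 0%N).
(* The rate [4 * K] contracts squared distances by 1/4, hence distances by 1/2. *)
pose w := exp_weight fw a b (4 * K).
have step j t : t \in `[a, b] -> `|Y j.+1 t - Y j t| ^+ 2 <= B ^+ 2 * 4^-1 ^+ j * w t.
  elim: j t => [|j IH] t tab.
    rewrite expr0 mulr1; have := YB t tab; rewrite normr_id => H.
    have w1 : 1 <= w t by apply: exp_weight_ge1 => //; lra.
    apply: (@le_trans _ _ (B ^+ 2)); first by rewrite lerXn2r ?nnegrE.
    by rewrite ler_peMr// sqr_ge0.
  have := picard_map_bound y0 (cY j.+1) (cY j) tab; rewrite -!YS => /le_trans; apply.
  have C0 : 0 <= B ^+ 2 * 4^-1 ^+ j by rewrite mulr_ge0 ?sqr_ge0 ?exprn_ge0 ?invr_ge0.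
  apply: (@le_trans _ _ (K * (B ^+ 2 * 4^-1 ^+ j * (w t / (4 * K))))).
    rewrite ler_wpM2l ?(ltW K0)//.
    apply: (@le_trans _ _ (V t (fun s => B ^+ 2 * 4^-1 ^+ j * w s))).
      apply: volterra_le => //.
      - by apply: square_integrable_sqr; apply: continuous_norm_sqr_integrable; exact: cY.
      - by apply: integrable_onZ; exact: exp_weight_integrable.
      - by move=> s sab; apply: IH; exact: in_segment.
    rewrite volterraZ//; last exact: exp_weight_integrable.
    by rewrite ler_wpM2l// volterra_exp_weight//; lra.
  rewrite (exprS 4^-1) le_eqVlt; apply/orP; left; apply/eqP.
  by field; rewrite gt_eqF.
pose W := expR (4 * K * (b - a)).
have W1 : 1 <= W by rewrite /W -expR0 ler_expR !mulr_ge0 ?subr_ge0 ?(ltW K0).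
have stepB j t : t \in `[a, b] -> `|Y j.+1 t - Y j t| <= B * W * 2^-1 ^+ j.
  move=> tab; have p0 : 0 <= 2^-1 ^+ j :> R by rewrite exprn_ge0 ?invr_ge0.
  rewrite -(ler_pXn2r (_ : 0 < 2)%N) ?nnegrE ?mulr_ge0 ?(ltW (lt_le_trans ltr01 W1))//.
  apply: (le_trans (step j t tab)).
  have -> : (B * W * 2^-1 ^+ j) ^+ 2 = B ^+ 2 * 4^-1 ^+ j * W ^+ 2.
    rewrite !exprMn -exprM mulnC exprM (_ : 2^-1 ^+ 2 = 4^-1 :> R); last by field.
    by ring.
  rewrite ler_wpM2l ?mulr_ge0 ?sqr_ge0 ?exprn_ge0 ?invr_ge0//.
  apply: (@le_trans _ _ W); first by apply: exp_weight_le => //; lra.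
  by rewrite expr2 ler_peMr//; lra.
have BW0 : 0 <= B * W by rewrite mulr_ge0//; lra.
have [y yP] := geometric_cauchy_limit BW0 stepB.
have half0 : (fun j => 2^-1 ^+ j : R) @ \oo --> 0.
  by apply: cvg_expr; rewrite ger0_norm ?invr_ge0//; lra.
have c0 : (fun j => 2 * (B * W) * 2^-1 ^+ j : R) @ \oo --> 0.
  by rewrite -(mulr0 (2 * (B * W))); apply: cvgM => //; exact: cvg_cst.
have cy := uniform_limit_continuous cY c0 yP.
exists y; split=> // t tab; apply/eqP; rewrite -subr_eq0 -normr_le0.
apply/ler_addgt0Pl => e e0; rewrite addr0.
set C := 2 * (B * W) in c0 yP; have C0 : 0 <= C by rewrite mulr_ge0.
pose D := K * (b - a) + 1; have D0 : 1 <= D by rewrite /D lerDr mulr_ge0 ?subr_ge0 ?(ltW K0).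
(* Pass through the next iterate, which is the image of [Y j]; both errors are of the order of the
   distance of [Y j] from [y]. *)
have est j : `|y t - picard_map y0 y t| <= C * 2^-1 ^+ j * (1 + D).
  have p0 : 0 <= C * 2^-1 ^+ j by rewrite mulr_ge0 ?exprn_ge0 ?invr_ge0.
  rewrite -(subrK (Y j.+1 t) (y t)) -addrA mulrDr mulr1.
  apply: (le_trans (ler_normD _ _)); apply: lerD.
    apply: (le_trans (yP _ _ tab)); rewrite exprS ler_wpM2l// ler_piMl ?exprn_ge0 ?invr_ge0//; lra.
  have cD0 : 0 <= C * 2^-1 ^+ j * D by apply: mulr_ge0 => //; exact: le_trans D0.
  rewrite -(ler_pXn2r (_ : 0 < 2)%N) ?nnegrE//.
  have := picard_map_bound y0 (cY j) cy tab; rewrite -YS => /le_trans; apply.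
  apply: (@le_trans _ _ (K * Int a b (fun=> (C * 2^-1 ^+ j) ^+ 2))).
    rewrite ler_wpM2l ?(ltW K0)//.
    apply: (@le_trans _ _ (V t (fun=> (C * 2^-1 ^+ j) ^+ 2))).
      apply: volterra_le => //; first by apply: square_integrable_sqr; exact: continuous_norm_sqr_integrable.
        exact: integrable_on_cst.
      move=> s sab; rewrite lerXn2r ?nnegrE// distrC; apply: yP; exact: in_segment.
    by apply: volterra_le_Int => //; [exact: integrable_on_cst|move=> s _; exact: sqr_ge0].
  rewrite Int_cst// [leRHS]exprMn (_ : K * _ = (C * 2^-1 ^+ j) ^+ 2 * (D - 1)); last first.
    by rewrite /D addrK; ring.
  rewrite ler_wpM2l ?sqr_ge0//.
  apply: (@le_trans _ _ D); first by rewrite gerBl.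
  by rewrite expr2 ler_peMr// (le_trans ler01).
have /cvgrPdist_le/(_ (e / (1 + D))) : (fun j => C * 2^-1 ^+ j : R) @ \oo --> 0 by [].
rewrite divr_gt0//; last by lra.
move=> /(_ isT)[j _ /(_ j (leqnn j))]; rewrite /= sub0r normrN => H.
apply: (le_trans (est j)); rewrite -ler_pdivlMr; last by lra.
exact: le_trans (ler_norm _) H.
Qed.

End Picard.

Section TrajectoryODE.
Context {R : realType} {n : nat} (a b : R) (ab : a <= b).
Implicit Types (y z v w : R -> 'cV[R]_n).

Lemma picard_forward (F : R -> 'cV[R]_n -> 'cV[R]_n) (l : R -> R) (y0 : 'cV[R]_n) :
  (forall y, {within `[a, b], continuous y} -> inL2 a b (fun s => F s (y s))) ->
  square_integrable a b l ->
  (forall s, s \in `]a, b[ -> forall x x', `|F s x - F s x'| <= l s * `|x - x'|) ->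
  exists y, trajectory a b y (fun s => F s (y s)) /\ y a = y0.
Proof.
move=> FL2 lL2 Flip; have [y [cy yE]] := picard_exists true ab FL2 lL2 Flip y0.
have aab : a \in `[a, b] by rewrite in_itv/= lexx.
have ya : y a = y0.
  by rewrite yE//; apply/matrixP => i j; rewrite mxE /volterra Int_nil addr0 ord1.
exists y; split=> // i; split.
- exact: (within_continuous_cV _ _).1 cy i.
- exact: FL2 cy i.
by move=> t tab; rewrite {1}(yE t tab) mxE ya.
Qed.

(** Integrating from [t] to [b] turns the terminal value problem into a Volterra equation with
    right-hand side [-F]. *)
Lemma picard_backward (F : R -> 'cV[R]_n -> 'cV[R]_n) (l : R -> R) (y0 : 'cV[R]_n) :
  (forall y, {within `[a, b], continuous y} -> inL2 a b (fun s => F s (y s))) ->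
  square_integrable a b l ->
  (forall s, s \in `]a, b[ -> forall x x', `|F s x - F s x'| <= l s * `|x - x'|) ->
  exists y, trajectory a b y (fun s => F s (y s)) /\ y b = y0.
Proof.
move=> FL2 lL2 Flip.
have NL2 y : {within `[a, b], continuous y} -> inL2 a b (fun s => - F s (y s)).
  move=> cy i; apply: eq_square_integrable (square_integrableN (FL2 y cy i)).
  by move=> t _; rewrite mxE.
have Nlip s : s \in `]a, b[ -> forall x x', `|- F s x - - F s x'| <= l s * `|x - x'|.
  by move=> sab x x'; rewrite -opprD normrN; exact: Flip.
have [y [cy yE]] := picard_exists false ab NL2 lL2 Nlip y0.
have bab : b \in `[a, b] by rewrite in_itv/= lexx andbT.
have aab : a \in `[a, b] by rewrite in_itv/= lexx.
have yb : y b = y0.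
  by rewrite yE//; apply/matrixP => i j; rewrite mxE /volterra Int_nil addr0 ord1.
exists y; split=> // i; have sF := FL2 y cy i; have iF := square_integrable_integrable sF.
split=> //; first exact: (within_continuous_cV _ _).1 cy i.
have E t : t \in `[a, b] -> y t i 0 = y0 i 0 - Int t b (fun s => F s (y s) i 0).
  move=> tab; rewrite (yE t tab) mxE /volterra -IntN.
    by congr (_ + _); apply: eq_Int => s _; rewrite mxE.
  move: tab; rewrite in_itv/= => /andP[ta tb].
  exact: integrable_on_sub ta (lexx b) iF.
move=> t tab; move: (tab); rewrite in_itv/= => /andP[ta tb].
by rewrite (E t tab) (E a aab) (Int_split ta tb iF); ring.
Qed.

Lemma trajectory_volterra (fw : bool) y v t i : trajectory a b y v -> t \in `[a, b] ->
  y t i 0 = y (if fw then a else b) i 0 +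
    (if fw then 1 else -1) * volterra fw a b t (fun s => v s i 0).
Proof.
move=> H tab; rewrite /volterra; case: fw; first by rewrite mul1r (is_primitive_val (H i) tab).
move: tab; rewrite in_itv/= => /andP[ta tb].
by rewrite -(is_primitive_diff (H i) ta tb (lexx b)); ring.
Qed.

(** The stability estimate behind all comparisons of states and of adjoints: [l] is the Lipschitz
    coefficient and [d] the defect of one trajectory in the equation of the other, both only square
    integrable. *)
Lemma trajectory_gronwall (fw : bool) y v z w (l d : R -> R) :
  trajectory a b y v -> trajectory a b z w ->
  square_integrable a b l -> square_integrable a b d ->
  (forall s, s \in `]a, b[ -> `|v s - w s| <= l s * `|y s - z s| + d s) ->
  forall t, t \in `[a, b] -> `|y t - z t| ^+ 2 <=
    gronwall_factor (Int a b (fun s => l s ^+ 2)) (b - a) *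
    (`|y (if fw then a else b) - z (if fw then a else b)| ^+ 2
     + (b - a) * Int a b (fun s => d s ^+ 2)).
Proof.
move=> Hy Hz sl sd vw.
set K := Int a b _; set D := Int a b _; set c := if fw then a else b.
have K0 : 0 <= K by apply: Int_ge0 => s _; exact: sqr_ge0.
have D0 : 0 <= D by apply: Int_ge0 => s _; exact: sqr_ge0.
have ba0 : 0 <= b - a by rewrite subr_ge0.
have cy := trajectory_continuous Hy; have cz := trajectory_continuous Hz.
have syz := continuous_norm_sqr_integrable cy cz.
set A := `|y c - z c| ^+ 2 + (b - a) * D.
have A0 : 0 <= A by rewrite addr_ge0 ?sqr_ge0 ?mulr_ge0.
pose phi s := `|y s - z s| ^+ 2.
have iphi : integrable_on a b phi by exact: square_integrable_sqr.
have phi0 s : s \in `]a, b[ -> 0 <= phi s by move=> _; exact: sqr_ge0.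
have step t : t \in `[a, b] -> phi t <= 3 * A + 3 * (K + 1) * volterra fw a b t phi.
  move=> tab.
  have V0 : 0 <= volterra fw a b t phi by exact: volterra_ge0.
  set rhs := 3 * A + _; have rhs0 : 0 <= rhs by rewrite addr_ge0 ?mulr_ge0//; lra.
  rewrite /phi -[leRHS]sqr_sqrtr// lerXn2r ?nnegrE ?sqrtr_ge0//.
  apply: cV_norm_le => [|i]; first exact: sqrtr_ge0.
  rewrite -(ler_pXn2r (_ : 0 < 2)%N) ?nnegrE ?sqrtr_ge0// sqr_sqrtr//.
  rewrite !mxE (trajectory_volterra fw i Hy tab) (trajectory_volterra fw i Hz tab) -/c.
  have sv := is_primitive_sqi (Hy i); have sw := is_primitive_sqi (Hz i).
  have iv := square_integrable_integrable sv; have iw := square_integrable_integrable sw.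
  pose sg : R := if fw then 1 else -1.
  set Vy := volterra _ _ _ _ _; set Vz := volterra _ _ _ _ _.
  have E : Vy - Vz = volterra fw a b t (fun s => v s i 0 - w s i 0) by rewrite volterraB.
  have -> : y c i 0 + (if fw then 1 else -1) * Vy - (z c i 0 + (if fw then 1 else -1) * Vz) =
     (y c i 0 - z c i 0) + sg * (Vy - Vz) by rewrite /sg; ring.
  rewrite E.
  pose P1 := volterra fw a b t (fun s => l s * `|y s - z s|).
  pose P2 := volterra fw a b t d.
  have ivw := integrable_onB iv iw.
  have ilyz := integrable_onM sl syz; have id := square_integrable_integrable sd.
  have bound : `|volterra fw a b t (fun s => v s i 0 - w s i 0)| <= P1 + P2.
    apply: (le_trans (volterra_norm fw tab ivw)).
    rewrite /P1 /P2 -volterraD//; apply: volterra_le => //.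
    - exact: integrable_on_norm.
    - exact: integrable_onD.
    move=> s sab; apply: le_trans (vw s sab).
    by have := entry_le_mx_norm (v s - w s) i 0; rewrite !mxE.
  have P1b : P1 ^+ 2 <= K * volterra fw a b t phi by exact: volterra_sqr_le.
  have P2b : P2 ^+ 2 <= (b - a) * D.
    have := volterra_sqr_le fw tab sd (square_integrable_cst a b 1).
    rewrite -/D (_ : (fun s => 1 ^+ 2) = fun=> 1); last by apply/funext => s; rewrite expr1n.
    have -> : volterra fw a b t (fun s => d s * 1) = P2.
      by apply: eq_volterra => // s _; rewrite mulr1.
    move=> H; apply: (le_trans H); rewrite mulrC ler_wpM2r//.
    by move: (tab); rewrite in_itv/= /volterra => /andP[ta tb]; case: (fw); rewrite Int_cst// mul1r; lra.
  have e0 : (y c i 0 - z c i 0) ^+ 2 <= `|y c - z c| ^+ 2.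
    rewrite -[leLHS]real_normK ?num_real// lerXn2r ?nnegrE//.
    by have := entry_le_mx_norm (y c - z c) i 0; rewrite !mxE.
  have sgE : `|sg * volterra fw a b t (fun s => v s i 0 - w s i 0)| <= P1 + P2.
    by rewrite normrM /sg; case: (fw) bound; rewrite ?normrN normr1 mul1r.
  rewrite real_normK ?num_real// /rhs /A.
  move: (sg * _) sgE P1b P2b e0 => q; move: (y c i 0 - z c i 0) => x0.
  move: (`|y c - z c| ^+ 2) ((b - a) * D) (volterra _ _ _ _ _) V0 => X Y Z Z0.
  clear bound; move: P1 P2 => p1 p2; rewrite ler_norml => /andP[q1 q2] h1 h2 h3.
  (* Origin of the factor 3: [(x0 + q)^2 <= 3 x0^2 + 3/2 q^2] and [q^2 <= 2 p1^2 + 2 p2^2]. *)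
  have q3 : q ^+ 2 <= (p1 + p2) ^+ 2 by nra.
  have := sqr_ge0 (x0 - p1); have := sqr_ge0 (x0 - p2); have := sqr_ge0 (p1 - p2).
  have : (x0 + q) ^+ 2 <= (3 / 1) * x0 ^+ 2 + 3 / 2 * q ^+ 2 by have := sqr_ge0 (2 * x0 - q); nra.
  by have := sqr_ge0 (p1 - p2); nra.
have [B _ phiB] : exists2 B, 0 <= B & forall t, t \in `[a, b] -> `|phi t| <= B.
  apply: continuous_bounded; rewrite (_ : phi = fun s => `|y s - z s| * `|y s - z s|) => [x|].
    by apply: cvgM; (apply: cvg_norm; apply: cvgB; [exact: cy|exact: cz]).
  by apply/funext => s; rewrite /phi expr2.
move=> t tab; have K3 : 0 < 3 * (K + 1) by lra.
have A3 : 0 <= 3 * A by lra.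
have phiB' s : s \in `[a, b] -> phi s <= B.
  by move=> sab; exact: le_trans (ler_norm _) (phiB s sab).
have := gronwall A3 K3 iphi phiB' step tab.
rewrite /gronwall_factor (_ : 2 * (3 * A) * _ = 6 * expR (6 * (K + 1) * (b - a)) * A) //.
by rewrite (_ : 2 * (3 * (K + 1)) = 6 * (K + 1)); ring.
Qed.

Lemma gronwall_factor_ge0 (K d : R) : 0 <= gronwall_factor K d.
Proof. by rewrite mulr_ge0// expR_ge0. Qed.

Lemma gronwall_factor_le (K K' d : R) : 0 <= d -> K <= K' ->
  gronwall_factor K d <= gronwall_factor K' d.
Proof.
move=> d0 KK; rewrite ler_wpM2l// ler_expR ler_wpM2r// ler_wpM2l//; lra.
Qed.

End TrajectoryODE.

(** * Clamping to boxes and solutions in a tube *)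

Section Clamp.
Context {R : realType}.
Implicit Types (r z : R).

Lemma clamp_norm r z : 0 <= r -> `|Num.max (- r) (Num.min r z)| <= r.
Proof.
move=> r0; rewrite ler_norml; case: (lerP r z) => ?.
  by case: (lerP (- r) r) => ?; apply/andP; split; lra.
by case: (lerP (- r) z) => ?; apply/andP; split; lra.
Qed.

Lemma clamp_contract r z : 0 <= r -> `|Num.max (- r) (Num.min r z)| <= `|z|.
Proof.
move=> r0; rewrite ler_norml; case: (ger0P z) => ?; case: (lerP r z) => ?.
- by case: (lerP (- r) r) => ?; apply/andP; split; lra.
- by case: (lerP (- r) z) => ?; apply/andP; split; lra.
- by case: (lerP (- r) r) => ?; apply/andP; split; lra.
- by case: (lerP (- r) z) => ?; apply/andP; split; lra.
Qed.

Lemma clamp_lipschitz r z (z' : R) : 0 <= r ->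
  `|Num.max (- r) (Num.min r z) - Num.max (- r) (Num.min r z')| <= `|z - z'|.
Proof.
have H x : 0 <= r -> Num.max (- r) (Num.min r x) =
    if x <= - r then - r else if r <= x then r else x.
  move=> r0; case: (lerP r x) => h1; case: (lerP x (- r)) => h2.
  - by rewrite max_l//; lra.
  - by rewrite max_r//; lra.
  - by [].
  - by [].
move=> r0; rewrite !H// ler_norml; case: (ger0P (z - z')) => ?;
  case: (lerP z (- r)) => ?; case: (lerP r z) => ?;
  case: (lerP z' (- r)) => ?; case: (lerP r z') => ?; apply/andP; split; lra.
Qed.

Lemma clamp_id r z : `|z| <= r -> Num.max (- r) (Num.min r z) = z.
Proof.
rewrite ler_norml => /andP[? ?]; by rewrite min_r// max_r.
Qed.

Lemma cvg_clamp r (T : Type) (F : set_system T) (FF : Filter F) (f : T -> R) (x : R) :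
  0 <= r -> f @ F --> x -> (fun t => Num.max (- r) (Num.min r (f t))) @ F --> Num.max (- r) (Num.min r x).
Proof.
move=> r0 /cvgrPdist_le fx; apply/cvgrPdist_le => e e0; apply: filterS (fx e e0) => t.
exact: le_trans (clamp_lipschitz _ _ r0).
Qed.

End Clamp.

Section Clip.
Context {R : realType} {n : nat} (r : R) (r0 : 0 <= r).
Implicit Types (c x y : 'cV[R]_n).

Lemma clip_dist c x : `|clip r c x - c| <= r.
Proof.
have r0' := r0; rewrite /clip addrAC subrr add0r; apply: cV_norm_le => // i; rewrite mxE.
exact: clamp_norm.
Qed.

Lemma clip_contract c x : `|clip r c x - c| <= `|x - c|.
Proof.
rewrite /clip addrAC subrr add0r; apply: cV_norm_le => // i; rewrite mxE.
have := entry_le_mx_norm (x - c) i 0; rewrite !mxE; apply: le_trans.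
exact: clamp_contract.
Qed.

Lemma clip_lipschitz c x y : `|clip r c x - clip r c y| <= `|x - y|.
Proof.
rewrite /clip opprD addrACA subrr add0r; apply: cV_norm_le => // i; rewrite !mxE.
have := entry_le_mx_norm (x - y) i 0; rewrite !mxE; apply: le_trans.
have -> : x i 0 - y i 0 = (x i 0 - c i 0) - (y i 0 - c i 0) by ring.
exact: clamp_lipschitz.
Qed.

Lemma clip_id c x : `|x - c| <= r -> clip r c x = x.
Proof.
move=> xc; rewrite /clip; apply/matrixP => i j; rewrite ord1 !mxE.
have := le_trans (entry_le_mx_norm (x - c) i 0) xc; rewrite !mxE => xci.
by rewrite clamp_id// addrC subrK.
Qed.

Lemma clip_continuous (a b : R) (c x : R -> 'cV[R]_n) : {within `[a, b], continuous c} ->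
  {within `[a, b], continuous x} -> {within `[a, b], continuous (fun s => clip r (c s) (x s))}.
Proof.
move=> /within_continuous_cV cc /within_continuous_cV cx; apply/within_continuous_cV => i.
rewrite (_ : (fun s => _) = fun s => c s i 0 + Num.max (- r) (Num.min r (x s i 0 - c s i 0))); last first.
  by apply/funext => s; rewrite !mxE.
move=> s; apply: cvgD; first exact: cc.
apply: cvg_clamp => //.
by apply: cvgB; [exact: cx|exact: cc].
Qed.

End Clip.

Section Tube.
Context {R : realType} {n : nat} (a b : R) (ab : a <= b).

(* Clipping the argument of [F] to the tube around [yr] makes [F] globally Lipschitz; by
   Gronwall the solution stays in the tube, where clipping is inactive. *)
Lemma tube_solution (yr vr : R -> 'cV[R]_n) (r : R) (F : R -> 'cV[R]_n -> 'cV[R]_n)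
    (lF l d : R -> R) (y0 : 'cV[R]_n) :
  0 <= r -> trajectory a b yr vr ->
  (forall y : R -> 'cV[R]_n, {within `[a, b], continuous y} ->
    (forall s, s \in `[a, b] -> `|y s - yr s| <= r) -> inL2 a b (fun s => F s (y s))) ->
  square_integrable a b lF ->
  (forall s, s \in `]a, b[ -> forall x x', `|x - yr s| <= r -> `|x' - yr s| <= r ->
    `|F s x - F s x'| <= lF s * `|x - x'|) ->
  square_integrable a b l -> square_integrable a b d ->
  (forall s, s \in `]a, b[ -> 0 <= l s) ->
  (forall s, s \in `]a, b[ -> forall x, `|x - yr s| <= r ->
    `|F s x - vr s| <= l s * `|x - yr s| + d s) ->
  let C := gronwall_factor (Int a b (fun s => l s ^+ 2)) (b - a) *
    (`|y0 - yr a| ^+ 2 + (b - a) * Int a b (fun s => d s ^+ 2)) in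
  C <= r ^+ 2 ->
  exists y, [/\ trajectory a b y (fun s => F s (y s)), y a = y0 &
    forall t, t \in `[a, b] -> `|y t - yr t| ^+ 2 <= C].
Proof.
move=> r0 Hr FL2 lFL2 Flip sl sd l0 Fd C Cr.
have cyr := trajectory_continuous Hr.
pose G s x := F s (clip r (yr s) x).
have GL2 y : {within `[a, b], continuous y} -> inL2 a b (fun s => G s (y s)).
  move=> cy; apply: (FL2 (fun s => clip r (yr s) (y s))); first exact: clip_continuous.
  by move=> s _; exact: clip_dist.
have lF0 : square_integrable a b (fun s => `|lF s|) by exact: square_integrable_norm.
have Glip s : s \in `]a, b[ -> forall x x', `|G s x - G s x'| <= `|lF s| * `|x - x'|.
  move=> sab x x'; apply: (le_trans (Flip s sab _ _ (clip_dist r0 _ _) (clip_dist r0 _ _))).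
  apply: (@le_trans _ _ (`|lF s| * `|clip r (yr s) x - clip r (yr s) x'|)).
    by rewrite ler_wpM2r// ler_norm.
  by rewrite ler_wpM2l// clip_lipschitz.
have [y [Hy ya]] := picard_forward ab y0 GL2 lF0 Glip.
have near_yr t : t \in `[a, b] -> `|y t - yr t| ^+ 2 <= C.
  move=> tab; rewrite /C -ya; apply: (trajectory_gronwall ab true Hy Hr sl sd _ tab).
  move=> s sab; apply: (le_trans (Fd s sab _ (clip_dist r0 _ _))).
  by rewrite lerD2r ler_wpM2l ?l0// clip_contract.
have in_tube t : t \in `[a, b] -> `|y t - yr t| <= r.
  by move=> tab; rewrite -(ler_pXn2r (_ : 0 < 2)%N) ?nnegrE//; apply: le_trans Cr; exact: near_yr.
exists y; split=> // i; apply: (eq_is_primitive ab) (Hy i) => // t tab.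
by rewrite /G clip_id//; apply: in_tube; exact: in_segment.
Qed.

End Tube.

(** * Gradients relative to a set *)

Definition dotv {R : realType} {n : nat} (G v : 'cV[R]_n) : R := (G^T *m v) 0 0.

(* The condition under which [grad_in] selects its value. *)
Definition has_grad_in {R : realType} {n : nat} (B : set 'cV[R]_n)
    (h : 'cV[R]_n -> R) (x G : 'cV[R]_n) : Prop :=
  forall d : R, 0 < d -> \forall z \near within B (nbhs x),
    `|h z - h x - dotv G (z - x)| <= d * `|z - x|.

Section Gradients.
Context {R : realType} {n : nat}.
Implicit Types (G H v x z : 'cV[R]_n) (h g : 'cV[R]_n -> R) (B : set 'cV[R]_n).

Lemma dotvE G v : dotv G v = \sum_k G k 0 * v k 0.
Proof. by rewrite /dotv mxE; apply: eq_bigr => k _; rewrite mxE. Qed.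

Lemma dotvZr G (k : R) v : dotv G (k *: v) = k * dotv G v.
Proof. by rewrite /dotv -scalemxAr mxE. Qed.

Lemma dotvBl G H v : dotv (G - H) v = dotv G v - dotv H v.
Proof. by rewrite /dotv linearB/= mulmxBl !mxE. Qed.

Lemma dotv_delta G k : dotv G (delta_mx k 0) = G k 0.
Proof.
rewrite dotvE (bigD1 k)//= big1 ?addr0 => [|i /negPf ik].
  by rewrite mxE !eqxx mulr1.
by rewrite mxE ik mulr0.
Qed.

Lemma dotv_norm_le G v : `|dotv G v| <= n%:R * `|G| * `|v|.
Proof.
rewrite dotvE; apply: (le_trans (ler_norm_sum _ _ _)).
apply: (@le_trans _ _ (\sum_(k < n) `|G| * `|v|)).
  by apply: ler_sum => k _; rewrite normrM ler_pM ?entry_le_mx_norm.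
by rewrite sumr_const card_ord -mulrA mulr_natl.
Qed.

Lemma dotv_bound_entries G v (c : R) : (forall k, `|G k 0| <= c) ->
  `|dotv G v| <= n%:R * c * `|v|.
Proof.
move=> Gc; rewrite dotvE; apply: (le_trans (ler_norm_sum _ _ _)).
apply: (@le_trans _ _ (\sum_(k < n) c * `|v|)).
  by apply: ler_sum => k _; rewrite normrM ler_pM ?entry_le_mx_norm.
by rewrite sumr_const card_ord -mulrA mulr_natl.
Qed.

(** The directional limit only concerns points on the line through [x], so it suffices that [B]
    contains a piece of that line; this also serves at boundary points of [B]. *)
Lemma has_grad_in_cvg B h x G v : has_grad_in B h x G ->
  (\forall e \near (0 : R), B (x + e *: v)) ->
  (fun e : R => e^-1 *: (h (e *: v + x) - h x)) @ 0^' --> dotv G v.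
Proof.
move=> hG Bx; apply/cvgrPdist_le => e e0.
have d0 : 0 < e / (`|v| + 1) by rewrite divr_gt0// ltr_wpDl.
have := hG _ d0; rewrite near_withinE => hGd.
have cvl : (fun s : R => x + s *: v) @ 0 --> x.
  rewrite -[X in _ --> X]addr0 -(scale0r v); apply: cvgD; first exact: cvg_cst.
  by apply: cvgZr_tmp; exact: cvg_id.
have nh := cvl _ hGd.
near=> s.
have s0 : s != 0 by near: s; exact: nbhs_dnbhs_neq.
have Bs : B (x + s *: v) by near: s; exact: nbhs_dnbhs.
have : B (x + s *: v) -> `|h (x + s *: v) - h x - dotv G (x + s *: v - x)| <=
    e / (`|v| + 1) * `|x + s *: v - x| by near: s; exact: nbhs_dnbhs.
move=> /(_ Bs); rewrite [x + _]addrC addrK dotvZr normrZ => H.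
rewrite -(ler_pM2l (_ : 0 < `|s|)) ?normr_gt0// -normrM mulrBr /GRing.scale/=.
rewrite mulrA divff// mul1r distrC; apply: (le_trans H).
rewrite mulrCA ler_wpM2l// mulrAC ler_pdivrMr ?ltr_wpDl// mulrDr mulr1 lerDl ltW//.
Unshelve. all: by end_near. Qed.

Lemma has_grad_in_is_derive B h x G v : has_grad_in B h x G ->
  (\forall e \near (0 : R), B (x + e *: v)) -> is_derive x v h (dotv G v).
Proof.
move=> hG Bx; have H := has_grad_in_cvg hG Bx.
by apply: DeriveDef; [exact: cvgP H|exact: cvg_lim H].
Qed.

Lemma near_direction B x v : nbhs x B -> \forall e \near (0 : R), B (x + e *: v).
Proof.
move=> Bx; have cvl : (fun s : R => x + s *: v) @ 0 --> x.
  rewrite -[X in _ --> X]addr0 -(scale0r v); apply: cvgD; first exact: cvg_cst.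
  by apply: cvgZr_tmp; exact: cvg_id.
exact: cvl.
Qed.

Lemma has_grad_in_grad B h x G : has_grad_in B h x G -> nbhs x B -> grad h x = G.
Proof.
move=> hG Bx; apply/matrixP => k j; rewrite mxE ord1.
have := has_grad_in_is_derive hG (near_direction (delta_mx k 0) Bx).
by move=> D; rewrite (@derive_val _ _ _ _ _ _ _ D) dotv_delta.
Qed.

Lemma has_grad_in_unique B h x G H : has_grad_in B h x G -> has_grad_in B h x H ->
  nbhs x B -> G = H.
Proof.
by move=> hG hH Bx; rewrite -(has_grad_in_grad hG Bx) -(has_grad_in_grad hH Bx).
Qed.

Lemma grad_in_spec B h x G : has_grad_in B h x G -> has_grad_in B h x (grad_in B h x).
Proof. by move=> hG; exact: (xgetPex 0 (ex_intro _ G hG)). Qed.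

Lemma has_grad_in_grad_in B h x G : has_grad_in B h x G -> nbhs x B -> grad_in B h x = G.
Proof. by move=> hG Bx; exact: has_grad_in_unique (grad_in_spec hG) hG Bx. Qed.

Lemma has_grad_inB B h g x G H : has_grad_in B h x G -> has_grad_in B g x H ->
  has_grad_in B (fun z => h z - g z) x (G - H).
Proof.
move=> hG gH d d0; have d20 : 0 < d / 2 by lra.
have := hG _ d20; have := gH _ d20; apply: filterS2 => z h1 h2.
rewrite dotvBl (_ : _ - _ - _ = (h z - h x - dotv G (z - x)) - (g z - g x - dotv H (z - x))); last by ring.
by apply: (le_trans (ler_normB _ _)); apply: (le_trans (lerD h2 h1)); lra.
Qed.

Lemma has_grad_in_sub B B' h x G : B' `<=` B -> has_grad_in B h x G -> has_grad_in B' h x G.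
Proof.
move=> sB hG d d0; have := hG _ d0; rewrite !near_withinE; apply: filterS => z H /sB.
exact: H.
Qed.

Lemma has_grad_in_continuous B h x G : has_grad_in B h x G -> h @ within B (nbhs x) --> h x.
Proof.
move=> hG; apply/cvgrPdist_le => e e0.
set c := n%:R * `|G| + 1; have c0 : 0 < c by rewrite ltr_wpDl// mulr_ge0.
have := hG 1 ltr01 => H.
have N : \forall z \near within B (nbhs x), `|x - z| <= e / c.
  apply: cvg_within; apply: (@cvgr_dist_le _ _ _ (nbhs x) _ id) => //.
  by rewrite divr_gt0.
move: H N; apply: filterS2 => z H1 H2.
rewrite distrC -[h z - h x](subrK (dotv G (z - x))).
apply: (le_trans (ler_normD _ _)).
apply: (@le_trans _ _ (c * `|z - x|)).
  rewrite /c mulrDl addrC; apply: lerD => //.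
  exact: dotv_norm_le.
by rewrite distrC mulrC -ler_pdivlMr.
Qed.

(** The mean value theorem along the segment. An inner point of the segment can be moved both ways
    along it inside [B], which is what differentiating [phi] requires. *)
Lemma gradient_mean_value B h x x' (G : R -> 'cV[R]_n) :
  (forall s, s \in `[0, 1] -> B (x + s *: (x' - x))) ->
  (forall s, s \in `[0, 1] -> has_grad_in B h (x + s *: (x' - x)) (G s)) ->
  exists2 s, s \in `]0, 1[ & h x' - h x = dotv (G s) (x' - x).
Proof.
move=> Bs hG; set v := x' - x; pose phi s := h (x + s *: v).
have dphi (s : R) : s \in `]0, 1[ -> is_derive s 1 phi (dotv (G s) v).
  move=> s01; have s01' := in_segment s01.
  have nB : \forall e \near (0 : R), B (x + s *: v + e *: v).
    have : \forall e \near (0 : R), e + s \in `]0, 1[.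
      have cv : (fun e : R => e + s) @ 0 --> s.
        by rewrite -[X in _ --> X]add0r; apply: cvgD; [exact: cvg_id|exact: cvg_cst].
      exact: cv _ (near_in_itvoo s01).
    apply: filterS => e es; rewrite -addrA -scalerDl addrC [s + e]addrC [X in B X]addrC.
    by apply: Bs; exact: in_segment.
  have H := has_grad_in_cvg (hG s s01') nB.
  have E : (fun e : R => e^-1 *: ((phi \o shift s) (e *: 1) - phi s)) =
      (fun e : R => e^-1 *: (h (e *: v + (x + s *: v)) - h (x + s *: v))).
    apply/funext => e; have -> : e *: (1 : R) = e by exact: mulr1.
    by rewrite /phi /comp /shift scalerDl addrCA.
  apply: DeriveDef; first by rewrite /derivable E; exact: cvgP H.
  by rewrite /derive E; exact: cvg_lim H.
have cphi : {within `[0, 1], continuous phi}.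
  apply/subspace_continuousP => s s01; have := has_grad_in_continuous (hG s s01).
  move=> cvh A nA; have HA : \forall z \near nbhs (x + s *: v), B z -> A (h z).
    exact: cvh A nA.
  change (\forall e \near nbhs s, `[0, 1]%classic e -> A (phi e)).
  have cvl : (fun e : R => x + e *: v) @ s --> x + s *: v.
    by apply: cvgD; [exact: cvg_cst|apply: cvgZr_tmp; exact: cvg_id].
  have H2 : \forall e \near nbhs s, B (x + e *: v) -> A (h (x + e *: v)) by exact: cvl _ HA.
  by apply: filterS H2 => e He e01; exact: He (Bs e e01).
have [s s01 E] := MVT ltr01 dphi cphi.
exists s => //; move: E; rewrite /phi scale1r scale0r addr0 subr0 mulr1.
by rewrite (_ : x + v = x') // /v addrC subrK.
Qed.

End Gradients.

(** The gradient [G] is carried as data, since a gradient relative to an arbitrary set need not be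
    unique. Joint continuity in time and state gives bounds that are uniform in time. *)
Definition C1_field {R : realType} {n : nat} (I : set R) (B : set 'cV[R]_n)
    (h : R -> 'cV[R]_n -> R) (G : R -> 'cV[R]_n -> 'cV[R]_n) : Prop :=
  [/\ forall t x, I t -> B x -> has_grad_in B (h t) x (G t x),
      {within I `*` B, continuous (fun z => h z.1 z.2)} &
      forall k, {within I `*` B, continuous (fun z => G z.1 z.2 k 0)}].

Section C1Fields.
Context {R : realType} {n : nat}.

Lemma Ck_on_continuous (E F : normedModType R) (K : set E) k (h : E -> F) :
  Ck_on K k h -> {within K, continuous h}.
Proof.
case: k => [//|k] /= [dh [dhP _]]; apply/subspace_continuousP => x Kx.
have [cL H] := dhP x Kx.
apply/cvgrPdist_le => e e0.
have L0 : (fun z => dh x (z - x)) @ x --> (0 : F).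
  rewrite -(linear0 (dh x)) -(subrr x).
  apply: (@continuous_comp _ _ _ (fun z => z - x) (dh x)); last exact: cL.
  by apply: cvgB; [exact: cvg_id|exact: cvg_cst].
have e20 : 0 < e / 2 by lra.
have N1 : \forall z \near within K (nbhs x), `|dh x (z - x)| <= e / 2.
  apply: cvg_within; move/cvgrPdist_le : L0 => /(_ _ e20).
  by apply: filterS => z; rewrite sub0r normrN.
have N2 : \forall z \near within K (nbhs x), `|x - z| <= e / 2.
  by apply: cvg_within; apply: (@cvgr_dist_le _ _ _ (nbhs x) _ id).
near=> z.
have h1 : `|h z - h x - dh x (z - x)| <= 1 * `|z - x| by near: z; exact: H.
have h2 : `|dh x (z - x)| <= e / 2 by near: z.
have h3 : `|x - z| <= e / 2 by near: z.
rewrite /from_subspace distrC -[h z - h x](subrK (dh x (z - x))).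
have h4 : `|z - x| <= e / 2 by rewrite distrC.
apply: (le_trans (ler_normD _ _)); lra.
Unshelve. all: by end_near. Qed.

(** [iota] places time and state in the domain of [h], [kappa] is the matching inclusion of state
    increments, and [l] reads off a scalar component. One argument thus covers fields of time and
    state and fields with a frozen parameter. *)
Lemma C1_field_of_diff (E F : normedModType R) (K : set E) (h : E -> F) (dh : E -> {linear E -> F})
    (I : set R) (B : set 'cV[R]_n) (iota : R -> 'cV[R]_n -> E) (kappa : 'cV[R]_n -> E)
    (l : F -> R) :
  (forall x, K x -> is_diff_in K h x (dh x)) -> (forall v, {within K, continuous (fun x => dh x v)}) ->
  (forall t x z, iota t z - iota t x = kappa (z - x)) -> (forall v, `|kappa v| <= `|v|) ->
  (forall v, kappa v = \sum_k v k 0 *: kappa (delta_mx k 0)) ->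
  continuous (fun z => iota z.1 z.2) ->
  (forall t x, I t -> B x -> K (iota t x)) ->
  {morph l : u v / u + v} -> (forall k u, l (k *: u) = k * l u) -> (forall u, `|l u| <= `|u|) ->
  C1_field I B (fun t x => l (h (iota t x)))
    (fun t x => \col_k l (dh (iota t x) (kappa (delta_mx k 0)))).
Proof.
move=> dhP cdh iotaB kN kE ci KI lD lZ lN.
have lB u v : l (u - v) = l u - l v by rewrite lD -scaleN1r lZ mulN1r.
have l0 : l 0 = 0 by have := lZ 0 0; rewrite scale0r mul0r.
have lS (G : 'I_n -> F) : l (\sum_k G k) = \sum_k l (G k).
  by elim/big_ind2 : _ => // [u x v z <- <-]; rewrite lD.
have cl : continuous l.
  move=> u; apply/cvgrPdist_le => e e0; near=> v.
  by rewrite -lB; apply: (le_trans (lN _)); near: v; apply: (@cvgr_dist_le _ _ _ (nbhs u) _ id).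
have chain (w : E -> F) : {within K, continuous w} ->
    {within I `*` B, continuous (fun z : R * 'cV[R]_n => l (w (iota z.1 z.2)))}.
  move=> /subspace_continuousP cw; apply/subspace_continuousP => -[t x] [/= It Bx].
  apply: (@cvg_comp _ _ _ (fun z : R * 'cV[R]_n => w (iota z.1 z.2)) l); last exact: cl.
  move=> A nA; have HA : \forall z \near nbhs (iota t x), K z -> A (w z).
    exact: cw _ (KI t x It Bx) A nA.
  change (\forall z \near nbhs (t, x), (I `*` B) z -> A (w (iota z.1 z.2))).
  have H2 : \forall z \near nbhs (t, x), K (iota z.1 z.2) -> A (w (iota z.1 z.2)).
    exact: ci (t, x) _ HA.
  by apply: filterS H2 => -[s z] /= Hz [Is Bz]; exact: Hz (KI _ _ Is Bz).
split.
- move=> t x It Bx d d0; have [_ H] := dhP _ (KI t x It Bx).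
  have := H d d0; rewrite !near_withinE => Hd.
  have cvi : (fun z => iota t z) @ x --> iota t x.
    apply: (@cvg_comp _ _ _ (fun z => (t, z)) (fun z : R * 'cV[R]_n => iota z.1 z.2) _ (nbhs (t, x))).
      move=> A [[P Q] /= [Pt Qx] PQ]; have Qx' : \forall z \near nbhs x, Q z by exact: Qx.
      change (\forall z \near nbhs x, A (t, z)).
      by apply: filterS Qx' => z Qz; apply: PQ; split=> //; exact: nbhs_singleton Pt.
    exact: (ci (t, x)).
  have H2 : \forall z \near nbhs x, K (iota t z) -> `|h (iota t z) - h (iota t x) -
      dh (iota t x) (iota t z - iota t x)| <= d * `|iota t z - iota t x| by exact: cvi _ Hd.
  change (\forall z \near nbhs x, B z -> `|l (h (iota t z)) - l (h (iota t x)) -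
    dotv (\col_k l (dh (iota t x) (kappa (delta_mx k 0)))) (z - x)| <= d * `|z - x|).
  apply: filterS H2 => z Hz Bz; have := Hz (KI _ _ It Bz).
  rewrite iotaB => Hz'.
  have -> : dotv (\col_k l (dh (iota t x) (kappa (delta_mx k 0)))) (z - x) =
      l (dh (iota t x) (kappa (z - x))).
    rewrite dotvE [in RHS]kE linear_sum/= lS; apply: eq_bigr => k _.
    by rewrite mxE linearZ/= lZ mulrC.
  rewrite -!lB; apply: (le_trans (lN _)); apply: (le_trans Hz').
  by rewrite ler_wpM2l// ltW.
- apply: chain; apply/subspace_continuousP => x Kx.
  have C1 : Ck_on K 1 h by exists dh.
  by have /subspace_continuousP := Ck_on_continuous C1; apply.
- move=> k; rewrite (_ : (fun z => _) = fun z : R * 'cV[R]_n =>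
      l (dh (iota z.1 z.2) (kappa (delta_mx k 0)))); last by apply/funext => z; rewrite mxE.
  by apply: (chain (fun e => dh e (kappa (delta_mx k 0)))).
Unshelve. all: by end_near. Qed.

End C1Fields.

Definition C2_field {R : realType} {n : nat} (I : set R) (B : set 'cV[R]_n)
    (h : R -> 'cV[R]_n -> R) (G : R -> 'cV[R]_n -> 'cV[R]_n) : Prop :=
  C1_field I B h G /\ forall k, exists H, C1_field I B (fun t x => G t x k 0) H.

Section C2Fields.
Context {R : realType} {n : nat}.

Lemma Ck_on_succ (E F : normedModType R) (K : set E) k (h : E -> F) :
  Ck_on K k.+1 h -> Ck_on K k h.
Proof.
elim: k h => [|k IH] h Hh; first exact: Ck_on_continuous Hh.
by case: Hh => dh [dhP H]; exists dh; split=> // v; apply: IH; exact: H.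
Qed.

Lemma C2_field_of_Ck (E F : normedModType R) (K : set E) (h : E -> F)
    (I : set R) (B : set 'cV[R]_n) (iota : R -> 'cV[R]_n -> E) (kappa : 'cV[R]_n -> E)
    (l : F -> R) :
  Ck_on K 2 h ->
  (forall t x z, iota t z - iota t x = kappa (z - x)) -> (forall v, `|kappa v| <= `|v|) ->
  (forall v, kappa v = \sum_k v k 0 *: kappa (delta_mx k 0)) ->
  continuous (fun z => iota z.1 z.2) ->
  (forall t x, I t -> B x -> K (iota t x)) ->
  {morph l : u v / u + v} -> (forall k u, l (k *: u) = k * l u) -> (forall u, `|l u| <= `|u|) ->
  exists G, C2_field I B (fun t x => l (h (iota t x))) G.
Proof.
move=> [dh [dhP dhC]] iB kN kE ci KI lD lZ lN.
exists (fun t x => \col_k l (dh (iota t x) (kappa (delta_mx k 0)))); split.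
  exact: (C1_field_of_diff dhP (fun v => @Ck_on_continuous R E F K 1 _ (dhC v)) iB kN kE ci KI lD lZ lN).
move=> k; have [dh2 [dh2P dh2C]] := dhC (kappa (delta_mx k 0)).
exists (fun t x => \col_j l (dh2 (iota t x) (kappa (delta_mx j 0)))).
rewrite (_ : (fun t x => _) = fun t x => l (dh (iota t x) (kappa (delta_mx k 0)))); last first.
  by apply/funext => t; apply/funext => x; rewrite mxE.
exact: (C1_field_of_diff dh2P dh2C iB kN kE ci KI lD lZ lN).
Qed.

Lemma pair0_norm (E : normedModType R) (v : 'cV[R]_n) : `|((0 : E), v)| <= `|v|.
Proof. by rewrite prod_normE/= normr0 max_r. Qed.

Lemma pair0_sum (E : normedModType R) (v : 'cV[R]_n) :
  ((0 : E), v) = \sum_k v k 0 *: ((0 : E), (delta_mx k 0 : 'cV[R]_n)).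
Proof.
rewrite [LHS](_ : _ = (0, \sum_k v k 0 *: delta_mx k 0)); last first.
  congr pair; apply/matrixP => i j; rewrite summxE (bigD1 i)//= big1 => [|k ki].
    by rewrite addr0 !mxE !eqxx ord1 mulr1.
  by rewrite !mxE eq_sym (negPf ki) mulr0.
elim/big_ind2 : _ => // [[a u] w [b x] z /= [<- <-] [<- <-]|k _].
  by congr pair; rewrite addr0.
by rewrite /GRing.scale/=; congr pair; rewrite scaler0.
Qed.

Lemma has_grad_in_ext (B : set 'cV[R]_n) h (x G : 'cV[R]_n) :
  B x -> has_grad_in B h x G -> forall g, (forall z, B z -> h z = g z) -> has_grad_in B g x G.
Proof.
move=> Bx hG g hg d d0; have := hG d d0; rewrite !near_withinE.
by apply: filterS => z H Bz; rewrite -!hg//; exact: H.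
Qed.

Lemma eq_C1_field (I : set R) (B : set 'cV[R]_n) h G G' :
  (forall t x, I t -> B x -> G t x = G' t x) -> C1_field I B h G -> C1_field I B h G'.
Proof.
move=> GG [H1 H2 H3]; split=> // [t x It Bx|k]; first by rewrite -GG//; exact: H1.
by apply: subspace_eq_continuous (H3 k) => -[t x]; rewrite inE/= => -[It Bx]; rewrite /from_subspace/= GG.
Qed.

Lemma eq_C1_field_fun (I : set R) (B : set 'cV[R]_n) h g G :
  (forall t x, I t -> B x -> h t x = g t x) -> C1_field I B h G -> C1_field I B g G.
Proof.
move=> hg [H1 H2 H3]; split=> // [t x It Bx|].
  by apply: (has_grad_in_ext Bx (H1 t x It Bx)) => z Bz; exact: hg.
by apply: subspace_eq_continuous H2 => -[t x]; rewrite inE/= => -[It Bx]; rewrite /from_subspace/= hg.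
Qed.

Lemma eq_C2_field (I : set R) (B : set 'cV[R]_n) h G G' :
  (forall t x, I t -> B x -> G t x = G' t x) -> C2_field I B h G -> C2_field I B h G'.
Proof.
move=> GG [H1 H2]; split; first exact: eq_C1_field H1.
move=> k; have [H HP] := H2 k; exists H; apply: eq_C1_field_fun HP => t x It Bx.
by rewrite GG.
Qed.

Lemma C2_field_grad (I : set R) (h : R -> 'cV[R]_n -> R) G : C2_field I setT h G ->
  C2_field I setT h (fun t x => grad (h t) x).
Proof.
move=> HG; apply: eq_C2_field (HG) => t x It _.
have [[H1 _ _] _] := HG; apply/esym.
exact: (has_grad_in_grad (H1 t x It Logic.I) filterT).
Qed.

(** The transposed image of a product of compact segments. *)
Lemma box_compact (rho : R) : compact [set x : 'cV[R]_n | `|x| <= rho].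
Proof.
have [rho0|rho0] := leP 0 rho; last first.
  rewrite (_ : mkset _ = set0); first exact: compact0.
  apply/seteqP; split=> x //= xr; have := le_lt_trans xr rho0.
  by rewrite ltNge normr_ge0.
have C : compact [set v : 'rV[R]_n | forall i, `[- rho, rho]%classic (v ord0 i)].
  by apply: (@rV_compact _ _ (fun=> `[- rho, rho]%classic)) => i; exact: segment_compact.
have -> : [set x : 'cV[R]_n | `|x| <= rho] =
    (@trmx R 1 n) @` [set v : 'rV[R]_n | forall i, `[- rho, rho]%classic (v ord0 i)].
  apply/seteqP; split=> x /=.
    move=> xr; exists x^T; last by rewrite trmxK.
    by move=> i; rewrite mxE in_itv/= -ler_norml; exact: le_trans (entry_le_mx_norm _ _ _) xr.
  move=> [v vr <-]; apply: cV_norm_le => // i; rewrite mxE.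
  by have := vr i; rewrite in_itv/= -ler_norml.
apply: continuous_compact => //; apply: continuous_subspaceT => v.
apply: (proj2 (@cvg_mxP R _ (nbhs v) _ _ _ (@trmx R 1 n) v^T)) => i j.
rewrite (_ : (fun x => _) = fun x : 'rV[R]_n => x j i); last first.
  by apply/funext => x; rewrite mxE.
by rewrite mxE; exact: coord_continuous.
Qed.

Lemma continuous_bounded_box (a b rho : R) (phi : R * 'cV[R]_n -> R) :
  {within `[a, b] `*` setT, continuous phi} ->
  exists2 L, 0 <= L & forall t x, t \in `[a, b] -> `|x| <= rho -> `|phi (t, x)| <= L.
Proof.
move=> cphi; pose K : set (R * 'cV[R]_n) := `[a, b] `*` [set x : 'cV[R]_n | `|x| <= rho].
have cK : compact K by apply: compact_setX; [exact: segment_compact|exact: box_compact].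
have cphiK : {within K, continuous phi}.
  by apply: continuous_subspaceW cphi => -[t x] [/= ? ?].
have [M [_ HM]] := compact_bounded (continuous_compact cphiK cK).
exists (`|M| + 1); first by rewrite addr_ge0.
move=> t x tab xr; apply: (HM (`|M| + 1)).
  by rewrite (le_lt_trans (ler_norm M))// ltrDl.
by exists (t, x).
Qed.

Lemma box_convex (rho : R) (x x' : 'cV[R]_n) s : s \in `[0, 1] -> `|x| <= rho -> `|x'| <= rho ->
  `|x + s *: (x' - x)| <= rho.
Proof.
rewrite in_itv/= => /andP[s0 s1] xr xr'.
rewrite (_ : x + _ = (1 - s) *: x + s *: x'); last first.
  by rewrite scalerBr scalerBl scale1r addrA addrAC.
apply: (le_trans (ler_normD _ _)); rewrite !normrZ !ger0_norm//; last by rewrite subr_ge0.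
have := normr_ge0 x; have := normr_ge0 x'; nra.
Qed.

(** The gradient is bounded on the compact box, and convexity of the box turns this bound into a
    Lipschitz constant. *)
Lemma C1_field_box (a b : R) h G (rho : R) : C1_field `[a, b]%classic [set: 'cV[R]_n] h G ->
  exists2 L, 0 <= L & forall t x x', t \in `[a, b] -> `|x| <= rho -> `|x'| <= rho ->
    [/\ `|h t x| <= L, forall k, `|G t x k 0| <= L & `|h t x' - h t x| <= L * `|x' - x|].
Proof.
move=> [hG ch cG].
have [L1 L10 HL1] := continuous_bounded_box rho ch.
have /choice[L2 HL2] : forall k, exists L, 0 <= L /\ forall t x, t \in `[a, b] -> `|x| <= rho ->
    `|G t x k 0| <= L.
  by move=> k; have [L L0 HL] := continuous_bounded_box rho (cG k); exists L.
(* A sum of nonnegative constants replaces their maximum over the coordinates. *)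
pose L := \sum_k L2 k; have L0 : 0 <= L by apply: sumr_ge0 => k _; have [] := HL2 k.
have GL k t x : t \in `[a, b] -> `|x| <= rho -> `|G t x k 0| <= L.
  move=> tab xr; apply: (le_trans ((HL2 k).2 t x tab xr)); rewrite /L (bigD1 k)//= lerDl.
  by apply: sumr_ge0 => j _; have [] := HL2 j.
exists (L1 + L + n%:R * L); first by rewrite !addr_ge0// mulr_ge0.
have nL0 : 0 <= n%:R * L by rewrite mulr_ge0.
move=> t x x' tab xr xr'; split.
- by apply: (le_trans (HL1 t x tab xr)); rewrite -addrA lerDl addr_ge0.
- by move=> k; apply: (le_trans (GL k t x tab xr)); rewrite -addrA [L + _]addrC addrA lerDr addr_ge0.
have [|s _|s s01 ->] := @gradient_mean_value _ _ setT (h t) x x' (fun s => G t (x + s *: (x' - x))).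
- by [].
- exact: hG.
apply: (le_trans (dotv_bound_entries _ (fun k => GL k t _ tab (box_convex (in_segment s01) xr xr')))).
by rewrite ler_wpM2r// lerDr addr_ge0.
Qed.

(** Mean value form of Taylor's formula: the remainder is the difference of the gradients at a point
    of the segment and at [x], and the gradient is Lipschitz on the box. *)
Lemma C2_field_box (a b : R) h G (rho : R) : C2_field `[a, b]%classic [set: 'cV[R]_n] h G ->
  exists2 L, 0 <= L & forall t x x', t \in `[a, b] -> `|x| <= rho -> `|x'| <= rho ->
    (forall k, `|G t x' k 0 - G t x k 0| <= L * `|x' - x|) /\
    `|h t x' - h t x - dotv (G t x) (x' - x)| <= L * `|x' - x| ^+ 2.
Proof.
move=> [[hG _ _] /choice[H HP]].
have /choice[L1 HL1] : forall k, exists L, 0 <= L /\ forall t x x', t \in `[a, b] -> `|x| <= rho ->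
    `|x'| <= rho -> `|G t x' k 0 - G t x k 0| <= L * `|x' - x|.
  move=> k; have [L L0 HL] := C1_field_box rho (HP k); exists L; split=> // t x x' tab xr xr'.
  by have [] := HL t x x' tab xr xr'.
pose L := \sum_k L1 k; have L0 : 0 <= L by apply: sumr_ge0 => k _; have [] := HL1 k.
have GL k t x x' : t \in `[a, b] -> `|x| <= rho -> `|x'| <= rho ->
    `|G t x' k 0 - G t x k 0| <= L * `|x' - x|.
  move=> tab xr xr'; apply: (le_trans ((HL1 k).2 t x x' tab xr xr')).
  by rewrite ler_wpM2r// /L (bigD1 k)//= lerDl; apply: sumr_ge0 => j _; have [] := HL1 j.
have nL0 : 0 <= n%:R * L by rewrite mulr_ge0.
exists (L + n%:R * L); first exact: addr_ge0.
move=> t x x' tab xr xr'; split=> [k|].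
  by apply: (le_trans (GL k t x x' tab xr xr')); rewrite ler_wpM2r// lerDl.
have [|s _|s s01 ->] := @gradient_mean_value _ _ setT (h t) x x' (fun s => G t (x + s *: (x' - x))).
- by [].
- exact: hG.
rewrite -dotvBl; set z := x + _.
have zr : `|z| <= rho by exact: box_convex (in_segment s01) xr xr'.
have zx : `|z - x| <= `|x' - x|.
  rewrite /z addrAC subrr add0r normrZ; move: s01; rewrite in_itv/= => /andP[s0 s1].
  by rewrite ger0_norm ?(ltW s0)// ler_piMl// ltW.
have GB k : `|(G t z - G t x) k 0| <= L * `|x' - x|.
  by rewrite !mxE; apply: (le_trans (GL k t x z tab xr zr)); rewrite ler_wpM2l.
apply: (le_trans (dotv_bound_entries _ GB)).
by rewrite expr2 !mulrA ler_wpM2r// ler_wpM2r// lerDr.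
Qed.

End C2Fields.

(** The regularity of coefficients that all later estimates use: joint continuity together with
    bounds and Lipschitz constants in the state on bounded sets, uniform in time. It is stable under
    the matrix operations from which the closed-loop right-hand side is built. *)
Definition loc_lip {R : realType} {n p q : nat} (a b : R)
    (F : R -> 'cV[R]_n -> 'M[R]_(p, q)) : Prop :=
  {within `[a, b] `*` setT, continuous (fun z => F z.1 z.2)} /\
  forall rho, exists2 L, 0 <= L & forall t x x', t \in `[a, b] -> `|x| <= rho -> `|x'| <= rho ->
    `|F t x| <= L /\ `|F t x' - F t x| <= L * `|x' - x|.

Section LocLip.
Context {R : realType} {n : nat} (a b : R).

Lemma cvg_sum_seq (T I : Type) (F : set_system T) (FF : Filter F) (s : seq I)
    (f : I -> T -> R) (l : I -> R) : (forall i, f i @ F --> l i) ->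
  (fun x => \sum_(i <- s) f i x) @ F --> \sum_(i <- s) l i.
Proof.
move=> fl; elim: s => [|i s IH].
  by under eq_fun do rewrite big_nil; rewrite big_nil; exact: cvg_cst.
by under eq_fun do rewrite big_cons; rewrite big_cons; apply: cvgD.
Qed.

Lemma loc_lip_of_C1 p q (F : R -> 'cV[R]_n -> 'M[R]_(p, q)) :
  (forall i j, exists G, C1_field `[a, b]%classic [set: 'cV[R]_n] (fun t x => F t x i j) G) ->
  loc_lip a b F.
Proof.
move=> HF; split.
  by apply/within_continuous_mx => i j; have [G []] := HF i j.
move=> rho.
have /choice[L HL] : forall ij : 'I_p * 'I_q, exists L, 0 <= L /\ forall t x x', t \in `[a, b] ->
    `|x| <= rho -> `|x'| <= rho -> `|F t x ij.1 ij.2| <= L /\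
    `|F t x' ij.1 ij.2 - F t x ij.1 ij.2| <= L * `|x' - x|.
  move=> [i j]; have [G HG] := HF i j; have [L L0 H] := C1_field_box rho HG.
  by exists L; split=> // t x x' tab xr xr'; have [] := H t x x' tab xr xr'.
pose M := \sum_ij L ij; have M0 : 0 <= M by apply: sumr_ge0 => k _; have [] := HL k.
have LM ij : L ij <= M.
  by rewrite /M (bigD1 ij)//= lerDl; apply: sumr_ge0 => k _; have [] := HL k.
exists M => // t x x' tab xr xr'; split; apply: mx_norm_le => //.
- by move=> i j; have [_ /(_ t x x' tab xr xr')[H _]] := HL (i, j); exact: le_trans H (LM _).
- by rewrite mulr_ge0.
- move=> i j; have [_ /(_ t x x' tab xr xr')[_ H]] := HL (i, j); rewrite !mxE.
  by apply: (le_trans H); rewrite ler_wpM2r.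
Qed.

Lemma loc_lipD p q (F G : R -> 'cV[R]_n -> 'M[R]_(p, q)) : loc_lip a b F -> loc_lip a b G ->
  loc_lip a b (fun t x => F t x + G t x).
Proof.
move=> [cF HF] [cG HG]; split; first by move=> z; apply: cvgD; [exact: cF|exact: cG].
move=> rho; have [L1 L10 H1] := HF rho; have [L2 L20 H2] := HG rho.
exists (L1 + L2); first exact: addr_ge0.
move=> t x x' tab xr xr'; have [F1 F2] := H1 t x x' tab xr xr'.
have [G1 G2] := H2 t x x' tab xr xr'; split.
  by apply: (le_trans (ler_normD _ _)); exact: lerD.
rewrite opprD addrACA mulrDl; apply: (le_trans (ler_normD _ _)); exact: lerD.
Qed.

Lemma loc_lipZ p q k (F : R -> 'cV[R]_n -> 'M[R]_(p, q)) : loc_lip a b F ->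
  loc_lip a b (fun t x => k *: F t x).
Proof.
move=> [/within_continuous_mx cF HF]; split.
  apply/within_continuous_mx => i j; rewrite (_ : (fun z => _) = fun z => k * F z.1 z.2 i j).
    by move=> z; apply: cvgM; [exact: cvg_cst|exact: cF].
  by apply/funext => z; rewrite mxE.
move=> rho; have [L1 L10 H1] := HF rho; exists (`|k| * L1); first exact: mulr_ge0.
move=> t x x' tab xr xr'; have [F1 F2] := H1 t x x' tab xr xr'.
by rewrite -scalerBr !normrZ -mulrA; split; rewrite ler_wpM2l.
Qed.

Lemma loc_lip_tr p q (F : R -> 'cV[R]_n -> 'M[R]_(p, q)) : loc_lip a b F ->
  loc_lip a b (fun t x => (F t x)^T).
Proof.
move=> [/within_continuous_mx cF HF]; split.
  apply/within_continuous_mx => i j; rewrite (_ : (fun z => _) = fun z => F z.1 z.2 j i); first exact: cF.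
  by apply/funext => z; rewrite mxE.
move=> rho; have [L1 L10 H1] := HF rho; exists L1 => //.
move=> t x x' tab xr xr'; have [F1 F2] := H1 t x x' tab xr xr'.
by rewrite -linearB/= !trmx_norm.
Qed.

Lemma loc_lipM p q r (F : R -> 'cV[R]_n -> 'M[R]_(p, q)) (G : R -> 'cV[R]_n -> 'M[R]_(q, r)) :
  loc_lip a b F -> loc_lip a b G -> loc_lip a b (fun t x => F t x *m G t x).
Proof.
move=> [/within_continuous_mx cF HF] [/within_continuous_mx cG HG]; split.
  apply/within_continuous_mx => i j.
  rewrite (_ : (fun z => _) = fun z => \sum_k F z.1 z.2 i k * G z.1 z.2 k j); last first.
    by apply/funext => z; rewrite mxE.
  by move=> z; apply: cvg_sum_seq => k; apply: cvgM; [exact: cF|exact: cG].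
move=> rho; have [L1 L10 H1] := HF rho; have [L2 L20 H2] := HG rho.
exists (2 * (q%:R * L1 * L2)); first by rewrite !mulr_ge0.
move=> t x x' tab xr xr'; have [F1 F2] := H1 t x x' tab xr xr'.
have [G1 G2] := H2 t x x' tab xr xr'; have [F1' _] := H1 t x' x tab xr' xr.
have q0 : 0 <= q%:R :> R by [].
have qL : 0 <= q%:R * L1 * L2 by rewrite !mulr_ge0.
split.
  apply: (le_trans (mulmx_norm_le _ _)).
  apply: (@le_trans _ _ (q%:R * L1 * L2)); last lra.
  by apply: ler_pM => //; rewrite ler_wpM2l.
rewrite (_ : _ - _ = F t x' *m (G t x' - G t x) + (F t x' - F t x) *m G t x); last first.
  by rewrite mulmxBr mulmxBl addrA subrK.
apply: (le_trans (ler_normD _ _)).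
rewrite (_ : 2 * _ * _ = q%:R * L1 * (L2 * `|x' - x|) + q%:R * (L1 * `|x' - x|) * L2); last by ring.
apply: lerD; apply: (le_trans (mulmx_norm_le _ _)); by apply: ler_pM => //; rewrite ler_wpM2l.
Qed.

Lemma loc_lip_along p q (F : R -> 'cV[R]_n -> 'M[R]_(p, q)) (y : R -> 'cV[R]_n) :
  loc_lip a b F -> {within `[a, b], continuous y} -> {within `[a, b], continuous (fun t => F t (y t))}.
Proof.
move=> [/subspace_continuousP cF _] /subspace_continuousP cy.
apply/subspace_continuousP => t tab A nA.
have H1 : \forall z \near nbhs (t, y t), (`[a, b] `*` setT) z -> A (F z.1 z.2).
  by apply: (cF (t, y t)) => //; split.
have [[P Q] /= [Pt Qy] PQ] := H1.
have H2 : \forall s \near nbhs t, `[a, b]%classic s -> Q (y s) by exact: cy t tab Q Qy.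
have H3 : \forall s \near nbhs t, P s by exact: Pt.
change (\forall s \near nbhs t, `[a, b]%classic s -> A (F s (y s))).
apply: filterS2 H2 H3 => s Qs Ps sab.
by apply: (PQ (s, y s)); [split=> //; exact: Qs|split].
Qed.

Lemma loc_lip_sub p q (c d : R) (F : R -> 'cV[R]_n -> 'M[R]_(p, q)) : a <= c -> d <= b ->
  loc_lip a b F -> loc_lip c d F.
Proof.
move=> ac db [cF HF]; split.
  apply: continuous_subspaceW cF => -[t x] [/=]; rewrite !in_itv/= => /andP[tc td] _.
  by split=> //; rewrite (le_trans ac tc) (le_trans td db).
move=> rho; have [L L0 H] := HF rho; exists L => // t x x'; rewrite in_itv/= => /andP[tc td].
by apply: H; rewrite in_itv/= (le_trans ac tc) (le_trans td db).
Qed.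

End LocLip.

(** * State and adjoint equations *)

Section VectorL2.
Context {R : realType}.
Implicit Types (a b c d : R).

Lemma inL2D n a b (u v : R -> 'cV[R]_n) : inL2 a b u -> inL2 a b v -> inL2 a b (fun t => u t + v t).
Proof.
move=> uL2 vL2 i; apply: eq_square_integrable (square_integrableD (uL2 i) (vL2 i)) => t _.
by rewrite mxE.
Qed.

Lemma inL2Z n a b k (u : R -> 'cV[R]_n) : inL2 a b u -> inL2 a b (fun t => k *: u t).
Proof.
move=> uL2 i; apply: eq_square_integrable (square_integrableZ k (uL2 i)) => t _.
by rewrite mxE.
Qed.

Lemma inL2N n a b (u : R -> 'cV[R]_n) : inL2 a b u -> inL2 a b (fun t => - u t).
Proof.
by move=> /(inL2Z (-1)); congr inL2; apply/funext => t; rewrite scaleN1r.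
Qed.

Lemma inL2B n a b (u v : R -> 'cV[R]_n) : inL2 a b u -> inL2 a b v -> inL2 a b (fun t => u t - v t).
Proof. by move=> uL2 vL2; apply: inL2D => //; exact: inL2N. Qed.

Lemma inL2_sub n a b c d (u : R -> 'cV[R]_n) : a <= c -> d <= b -> inL2 a b u -> inL2 c d u.
Proof. by move=> ac db uL2 i; exact: square_integrable_sub ac db (uL2 i). Qed.

Lemma inL2_cst n a b (c : 'cV[R]_n) : inL2 a b (fun=> c).
Proof. by move=> i; exact: square_integrable_cst. Qed.

Lemma continuous_mul_sqi a b (f g : R -> R) : {within `[a, b], continuous f} ->
  square_integrable a b g -> square_integrable a b (fun t => f t * g t).
Proof.
move=> cf sg; have [k _ fk] := continuous_bounded cf.
apply: (@square_integrable_bounded_mul _ _ _ k) => //; first exact: continuous_measurable.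
by move=> t tab; apply: fk; exact: in_segment.
Qed.

Lemma mulmx_inL2 n p a b (A : R -> 'M[R]_(p, n)) (u : R -> 'cV[R]_n) :
  {within `[a, b], continuous A} -> inL2 a b u -> inL2 a b (fun t => A t *m u t).
Proof.
move=> /within_continuous_mx cA uL2 i.
apply: (@eq_square_integrable _ _ _ (fun t => \sum_k A t i k * u t k 0)) => [t _|].
  by rewrite mxE.
by apply: square_integrable_sum => k; exact: continuous_mul_sqi (cA i k) (uL2 k).
Qed.

Lemma sum_inL2 n a b (u : R -> 'cV[R]_n) : inL2 a b u ->
  integrable_on a b (fun t => enorm (u t) ^+ 2).
Proof.
move=> uL2; apply: (@eq_integrable_on _ _ _ (fun t => \sum_i u t i 0 ^+ 2)) => [t _|].
  by rewrite enorm_sqr.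
by apply: integrable_on_sum => i; case: (uL2 i).
Qed.

Lemma enorm_sqi n a b (u : R -> 'cV[R]_n) : inL2 a b u ->
  square_integrable a b (fun t => enorm (u t)).
Proof.
move=> uL2; split; last exact: sum_inL2.
apply: (@eq_measurable_fun _ _ _ _ _ (fun t => Num.sqrt (\sum_i u t i 0 ^+ 2))) => [t _|].
  rewrite -[RHS]ger0_norm ?enorm_ge0// -sqrtr_sqr enorm_sqr//.
rewrite (_ : (fun t => _) = Num.sqrt \o (fun t => \sum_i u t i 0 ^+ 2))//.
apply: measurableT_comp; first by apply: continuous_measurable_fun; exact: sqrt_continuous.
apply: integrable_on_measurable; apply: integrable_on_sum => i; by case: (uL2 i).
Qed.

Lemma Int_enorm_sqr n a b (u : R -> 'cV[R]_n) : inL2 a b u ->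
  Int a b (fun t => enorm (u t) ^+ 2) = \sum_i Int a b (fun t => u t i 0 ^+ 2).
Proof.
move=> uL2; rewrite -Int_sum => [|i]; last by case: (uL2 i).
by apply: eq_Int => t _; rewrite enorm_sqr.
Qed.

Lemma Int_enormD n a b (u v : R -> 'cV[R]_n) : inL2 a b u -> inL2 a b v ->
  Int a b (fun t => enorm (u t + v t) ^+ 2) = Int a b (fun t => enorm (u t) ^+ 2) +
    2 * \sum_i Int a b (fun t => u t i 0 * v t i 0) + Int a b (fun t => enorm (v t) ^+ 2).
Proof.
move=> uL2 vL2; rewrite !Int_enorm_sqr//; last exact: inL2D.
rewrite mulr_sumr -!big_split/=; apply: eq_bigr => i _.
have su := square_integrable_sqr (uL2 i); have sv := square_integrable_sqr (vL2 i).
have suv := integrable_onM (uL2 i) (vL2 i).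
rewrite -IntZ// -IntD//; last exact: integrable_onZ.
rewrite -IntD//; last by apply: integrable_onD => //; exact: integrable_onZ.
by apply: eq_Int => t _; rewrite !mxE; ring.
Qed.

Lemma Int_enormZ n a b k (u : R -> 'cV[R]_n) : inL2 a b u ->
  Int a b (fun t => enorm (k *: u t) ^+ 2) = k ^+ 2 * Int a b (fun t => enorm (u t) ^+ 2).
Proof.
move=> uL2; rewrite -IntZ; last exact: sum_inL2.
apply: eq_Int => t _; rewrite !enorm_sqr mulr_sumr; apply: eq_bigr => i _.
by rewrite mxE exprMn.
Qed.

(** Strict convexity of the control cost in quantitative form; it is what later forces nearly
    optimal controls together. *)
Lemma parallelogram n a b (u v : R -> 'cV[R]_n) : inL2 a b u -> inL2 a b v ->
  Int a b (fun t => enorm (u t - v t) ^+ 2) =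
  2 * Int a b (fun t => enorm (u t) ^+ 2) + 2 * Int a b (fun t => enorm (v t) ^+ 2)
  - 4 * Int a b (fun t => enorm (2^-1 *: (u t + v t)) ^+ 2).
Proof.
move=> uL2 vL2; rewrite (Int_enormZ _ (inL2D uL2 vL2)) (Int_enormD uL2 vL2).
rewrite (Int_enormD uL2 (inL2N vL2)).
have -> : Int a b (fun t => enorm (- v t) ^+ 2) = Int a b (fun t => enorm (v t) ^+ 2).
  by apply: eq_Int => t _; rewrite !enorm_sqr; apply: eq_bigr => i _; rewrite mxE sqrrN.
have -> : \sum_i Int a b (fun t => u t i 0 * (- v t) i 0) = - \sum_i Int a b (fun t => u t i 0 * v t i 0).
  rewrite -sumrN; apply: eq_bigr => i _; rewrite -IntN; last exact: integrable_onM.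
  by apply: eq_Int => t _; rewrite mxE mulrN.
by field.
Qed.

Lemma enorm0 m n : enorm (0 : 'M[R]_(m, n)) = 0.
Proof. by rewrite /enorm !big1 ?sqrtr0// => i _; rewrite big1// => j _; rewrite mxE expr0n. Qed.

Lemma enormD_sqr n (x w : 'cV[R]_n) : enorm (x + w) ^+ 2 = enorm x ^+ 2 + 2 * dotv x w + enorm w ^+ 2.
Proof.
rewrite !enorm_sqr dotvE mulr_sumr -!big_split/=; apply: eq_bigr => i _.
by rewrite mxE; ring.
Qed.

End VectorL2.

Section PairFields.
Context {R : realType} {n : nat}.

Lemma C2_field_pair (F : normedModType R) (I : set R) (B : set 'cV[R]_n) (h : R * 'cV[R]_n -> F)
    (l : F -> R) : Ck_on (I `*` B) 2 h ->
  {morph l : u v / u + v} -> (forall k u, l (k *: u) = k * l u) -> (forall u, `|l u| <= `|u|) ->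
  exists G, C2_field I B (fun t x => l (h (t, x))) G.
Proof.
move=> hC lD lZ lN.
apply: (C2_field_of_Ck (iota := fun t x => (t, x)) (kappa := fun v => (0, v)) hC) => //.
- by move=> t x z; rewrite -[LHS]/(t - t, z - x) subrr.
- exact: pair0_norm.
- exact: pair0_sum.
- rewrite (_ : (fun z => _) = id); first by move=> z; exact: cvg_id.
  by apply/funext => -[].
Qed.

Lemma entry_functional p q (i : 'I_p) (j : 'I_q) :
  [/\ {morph (fun A : 'M[R]_(p, q) => A i j) : u v / u + v},
      forall (k : R) (u : 'M[R]_(p, q)), (k *: u) i j = k * u i j &
      forall u : 'M[R]_(p, q), `|u i j| <= `|u|].
Proof.
split=> [u v|k u|u]; [by rewrite mxE|by rewrite mxE|exact: entry_le_mx_norm].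
Qed.

Lemma C2_field_entry p q (I : set R) (h : R * 'cV[R]_n -> 'M[R]_(p, q)) i j :
  Ck_on (I `*` setT) 2 h ->
  C2_field I setT (fun t x => h (t, x) i j) (fun t x => grad (fun z => h (t, z) i j) x).
Proof.
move=> hC; have [lD lZ lN] := entry_functional i j.
by have [G /C2_field_grad] := C2_field_pair hC lD lZ lN.
Qed.

Lemma C2_field_loc_lip (a b : R) h G : C2_field `[a, b]%classic [set: 'cV[R]_n] h G ->
  loc_lip a b G.
Proof.
by move=> [_ H]; apply: loc_lip_of_C1 => i j; rewrite ord1.
Qed.

End PairFields.

Section System.
Context {R : realType} {n m : nat} (P : ocp R n m).
Local Notation T := (hor P).

Definition control_rhs (u : R -> 'cV[R]_m) (t : R) (x : 'cV[R]_n) : 'cV[R]_n :=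
  fdyn P t x + gdyn P t x *m u t.

Definition adjoint_rhs (y : R -> 'cV[R]_n) (u : R -> 'cV[R]_m) (t : R) (p : 'cV[R]_n) : 'cV[R]_n :=
  - ((jac (fdyn P t) (y t))^T *m p + Dgt P t (y t) (u t) p
     + (Q1 P)^T *m Q1 P *m (y t - yd P t)).

Context (A1 : regA1 P) (std : standing P).

Lemma hor_gt0 : 0 < T. Proof. by case: std. Qed.

Lemma f_field i : C2_field `[0, T]%classic setT (fun t x => fdyn P t x i 0)
  (fun t x => grad (fun z => fdyn P t z i 0) x).
Proof. by case: A1 => H _ _; exact: C2_field_entry i 0 H. Qed.

Lemma g_field i j : C2_field `[0, T]%classic setT (fun t x => gdyn P t x i j)
  (fun t x => grad (fun z => gdyn P t z i j) x).
Proof. by case: A1 => _ H _; exact: C2_field_entry i j H. Qed.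

Lemma f_loc_lip : loc_lip 0 T (fdyn P).
Proof.
apply: loc_lip_of_C1 => i j; rewrite ord1; have [H _] := f_field i.
by exists (fun t x => grad (fun z => fdyn P t z i 0) x).
Qed.

Lemma g_loc_lip : loc_lip 0 T (gdyn P).
Proof.
apply: loc_lip_of_C1 => i j; have [H _] := g_field i j.
by exists (fun t x => grad (fun z => gdyn P t z i j) x).
Qed.

Lemma jac_entry t x i k : jac (fdyn P t) x i k = grad (fun z => fdyn P t z i 0) x k 0.
Proof. by rewrite !mxE. Qed.

Lemma jac_loc_lip : loc_lip 0 T (fun t x => jac (fdyn P t) x).
Proof.
apply: loc_lip_of_C1 => i j; have [_ /(_ j)[H HH]] := f_field i; exists H.
rewrite (_ : (fun t x => _) = fun t x => grad (fun z => fdyn P t z i 0) x j 0)//.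
by apply/funext => t; apply/funext => x; rewrite jac_entry.
Qed.

Lemma grad_g_loc_lip i j : loc_lip 0 T (fun t x => grad (fun z => gdyn P t z i j) x).
Proof. exact: C2_field_loc_lip (g_field i j). Qed.

Lemma jac_mul_entry t x v i : (jac (fdyn P t) x *m v) i 0 = dotv (grad (fun z => fdyn P t z i 0) x) v.
Proof. by rewrite dotvE mxE; apply: eq_bigr => k _; rewrite jac_entry. Qed.

Lemma control_rhs_inL2 a b (y : R -> 'cV[R]_n) (u : R -> 'cV[R]_m) : 0 <= a -> b <= T ->
  {within `[a, b], continuous y} -> inL2 a b u -> inL2 a b (fun s => control_rhs u s (y s)).
Proof.
move=> a0 bT cy uL2; apply: inL2D.
  by apply: continuous_inL2; exact: loc_lip_along (loc_lip_sub a0 bT f_loc_lip) cy.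
by apply: mulmx_inL2 => //; exact: loc_lip_along (loc_lip_sub a0 bT g_loc_lip) cy.
Qed.

(** The Lipschitz coefficient in the state grows with [u t] and is therefore only square integrable
    in time. Only the size of [u] enters; [u'] appears through the difference. *)
Lemma control_rhs_lip (rho : R) : exists2 L, 0 <= L & forall t x x' u u', t \in `[0, T] ->
  `|x| <= rho -> `|x'| <= rho -> `|control_rhs u' t x' - control_rhs u t x| <=
    L * (1 + enorm (u t)) * `|x' - x| + L * enorm (u' t - u t).
Proof.
have [_ /(_ rho)[L1 L10 H1]] := f_loc_lip; have [_ /(_ rho)[L2 L20 H2]] := g_loc_lip.
have m0 : 0 <= m%:R :> R by [].
have mL : 0 <= m%:R * L2 by exact: mulr_ge0.
exists (L1 + m%:R * L2); first by rewrite addr_ge0.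
move=> t x x' u u' tT xr xr'; have [_ F1] := H1 t x x' tT xr xr'.
have [_ F2] := H2 t x x' tT xr xr'; have [F3 _] := H2 t x' x tT xr' xr.
rewrite /control_rhs (_ : _ - _ = (fdyn P t x' - fdyn P t x) +
  ((gdyn P t x' - gdyn P t x) *m u t + gdyn P t x' *m (u' t - u t))); last first.
  rewrite opprD addrACA; congr (_ + _).
  by rewrite mulmxBl mulmxBr [RHS]addrC addrA subrK.
have e0 := enorm_ge0 (u t); have e1 := enorm_ge0 (u' t - u t); have d0 := normr_ge0 (x' - x).
apply: (le_trans (ler_normD _ _)).
have B1 : `|(gdyn P t x' - gdyn P t x) *m u t| <= m%:R * L2 * `|x' - x| * enorm (u t).
  apply: (le_trans (mulmx_norm_le _ _)); rewrite -[m%:R * L2 * _]mulrA.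
  by apply: ler_pM; rewrite ?mulr_ge0 ?mx_norm_le_enorm// ler_wpM2l.
have B2 : `|gdyn P t x' *m (u' t - u t)| <= m%:R * L2 * enorm (u' t - u t).
  apply: (le_trans (mulmx_norm_le _ _)).
  by apply: ler_pM; rewrite ?mulr_ge0 ?mx_norm_le_enorm// ler_wpM2l.
have B3 := ler_normD ((gdyn P t x' - gdyn P t x) *m u t) (gdyn P t x' *m (u' t - u t)).
have L1e : 0 <= L1 * enorm (u t) * `|x' - x| by rewrite !mulr_ge0.
have L1f : 0 <= L1 * enorm (u' t - u t) by rewrite mulr_ge0.
have mLx : 0 <= m%:R * L2 * `|x' - x| by rewrite mulr_ge0.
have -> : (L1 + m%:R * L2) * (1 + enorm (u t)) * `|x' - x| + (L1 + m%:R * L2) * enorm (u' t - u t) =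
  L1 * `|x' - x| + m%:R * L2 * `|x' - x| * enorm (u t) + m%:R * L2 * enorm (u' t - u t)
  + (L1 * enorm (u t) * `|x' - x| + m%:R * L2 * `|x' - x| + L1 * enorm (u' t - u t)) by ring.
lra.
Qed.

Lemma Dgt_lin t x u p p' : Dgt P t x u p' - Dgt P t x u p = Dgt P t x u (p' - p).
Proof.
apply/matrixP => k j; rewrite !mxE -sumrB; apply: eq_bigr => i _.
by rewrite -sumrB; apply: eq_bigr => l _; rewrite !mxE mulrBr.
Qed.

Lemma Dgt_linu t x u u' p : Dgt P t x u' p - Dgt P t x u p = Dgt P t x (u' - u) p.
Proof.
apply/matrixP => k j; rewrite !mxE -sumrB; apply: eq_bigr => i _.
by rewrite -sumrB; apply: eq_bigr => l _; rewrite !mxE mulrBr mulrBl.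
Qed.

Lemma double_sum_bound (c : R) (F : 'I_n -> 'I_m -> R) : (forall i j, `|F i j| <= c) ->
  `|\sum_i \sum_j F i j| <= n%:R * m%:R * c.
Proof.
move=> Fc; apply: (le_trans (ler_norm_sum _ _ _)).
apply: (@le_trans _ _ (\sum_(i < n) m%:R * c)); last first.
  by rewrite sumr_const card_ord -[leRHS]mulrA [leRHS]mulr_natl.
apply: ler_sum => i _; apply: (le_trans (ler_norm_sum _ _ _)).
apply: (@le_trans _ _ (\sum_(j < m) c)); last by rewrite sumr_const card_ord mulr_natl.
by apply: ler_sum => j _.
Qed.

Lemma Dgt_bounds (rho : R) : exists2 L, 0 <= L & forall t x x' u p, t \in `[0, T] ->
  `|x| <= rho -> `|x'| <= rho -> `|Dgt P t x u p| <= L * enorm u * `|p| /\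
  `|Dgt P t x' u p - Dgt P t x u p| <= L * `|x' - x| * enorm u * `|p|.
Proof.
have /choice[L HL] : forall ij : 'I_n * 'I_m, exists L, 0 <= L /\ forall t x x', t \in `[0, T] ->
    `|x| <= rho -> `|x'| <= rho ->
    `|grad (fun z => gdyn P t z ij.1 ij.2) x| <= L /\
    `|grad (fun z => gdyn P t z ij.1 ij.2) x' - grad (fun z => gdyn P t z ij.1 ij.2) x| <= L * `|x' - x|.
  move=> [i j]; have [_ /(_ rho)[L L0 H]] := grad_g_loc_lip i j; exists L; split=> //.
pose M := \sum_ij L ij; have M0 : 0 <= M by apply: sumr_ge0 => k _; have [] := HL k.
have LM ij : L ij <= M.
  by rewrite /M (bigD1 ij)//= lerDl; apply: sumr_ge0 => k _; have [] := HL k.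
exists (n%:R * m%:R * M); first by rewrite !mulr_ge0.
move=> t x x' u p tT xr xr'; have e0 := enorm_ge0 u; split.
  apply: cV_norm_le => [|k]; first by rewrite !mulr_ge0.
  rewrite mxE -!mulrA mulrA; apply: double_sum_bound => i j.
  rewrite !normrM -mulrA; apply: ler_pM; rewrite ?mulr_ge0//.
    have [_ /(_ t x x' tT xr xr')[H _]] := HL (i, j).
    exact: le_trans (entry_le_mx_norm _ _ _) (le_trans H (LM _)).
  by apply: ler_pM; rewrite ?entry_le_enorm ?entry_le_mx_norm.
apply: cV_norm_le => [|k]; first by rewrite !mulr_ge0.
rewrite !mxE -sumrB; under eq_bigr do rewrite -sumrB.
rewrite -!mulrA mulrA; apply: double_sum_bound => i j.
rewrite -mulrBl -mulrBl !normrM -[leLHS]mulrA [leRHS]mulrA; apply: ler_pM; rewrite ?mulr_ge0//.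
  have [_ /(_ t x x' tT xr xr')[_ H]] := HL (i, j).
  have := entry_le_mx_norm (grad (fun z => gdyn P t z i j) x' - grad (fun z => gdyn P t z i j) x) k 0.
  rewrite !mxE => /le_trans; apply; apply: (le_trans H).
  by rewrite ler_wpM2r.
by apply: ler_pM; rewrite ?entry_le_enorm ?entry_le_mx_norm.
Qed.

End System.

(** The part of the cost that depends on the state alone; it is continuous under uniform
    convergence, whereas the control energy needs convergence in L^2. *)
Definition tracking_cost {R : realType} {n m : nat} (P : ocp R n m) (t : R) (y : R -> 'cV[R]_n) : R :=
  2^-1 * Int t (hor P) (fun s => enorm (Q1 P *m (y s - yd P s)) ^+ 2)
  + 2^-1 * enorm (Q2 P *m (y (hor P) - ydT P)) ^+ 2.

Section AdjointAndCost.
Context {R : realType} {n m : nat} (P : ocp R n m).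
Local Notation T := (hor P).
Context (A1 : regA1 P) (std : standing P).
Implicit Types (y p : R -> 'cV[R]_n) (u : R -> 'cV[R]_m).

Lemma const_continuous (a b : R) k l (A : 'M[R]_(k, l)) : {within `[a, b], continuous (fun _ : R => A)}.
Proof. by move=> x; exact: cvg_cst. Qed.

Lemma continuousB_within (a b : R) k (y z : R -> 'cV[R]_k) : {within `[a, b], continuous y} ->
  {within `[a, b], continuous z} -> {within `[a, b], continuous (fun s : R => y s - z s : 'cV[R]_k)}.
Proof. by move=> cy cz x; apply: cvgB; [exact: cy|exact: cz]. Qed.

Lemma continuous_sub_itv (U : topologicalType) a b c d (f : R -> U) : a <= c -> d <= b ->
  {within `[a, b], continuous f} -> {within `[c, d], continuous f}.
Proof.
by move=> ac db; apply: continuous_subspaceW; apply: subset_itv; rewrite bnd_simp.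
Qed.

Lemma yd_inL2 a b : 0 <= a -> b <= T -> inL2 a b (yd P).
Proof. by move=> a0 bT; case: std => _ _ _ _; exact: inL2_sub. Qed.

Lemma Dgt_inL2 a b y u p : 0 <= a -> b <= T -> {within `[a, b], continuous y} ->
  inL2 a b u -> {within `[a, b], continuous p} ->
  inL2 a b (fun s => Dgt P s (y s) (u s) (p s)).
Proof.
move=> a0 bT cy uL2 /within_continuous_cV cp k.
apply: (@eq_square_integrable _ _ _ (fun s => \sum_i \sum_j
   (grad (fun z => gdyn P s z i j) (y s) k 0 * p s i 0) * u s j 0)) => [s _|].
  by rewrite mxE; apply: eq_bigr => i _; apply: eq_bigr => j _; rewrite mulrAC.
apply: square_integrable_sum => i; apply: square_integrable_sum => j.
apply: continuous_mul_sqi (uL2 j) => s; apply: cvgM; last exact: cp.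
have H := loc_lip_sub a0 bT (grad_g_loc_lip A1 i j).
by have /within_continuous_cV := loc_lip_along H cy; apply.
Qed.

Lemma adjoint_rhs_inL2 y u p : {within `[0, T], continuous y} -> inL2 0 T u ->
  {within `[0, T], continuous p} -> inL2 0 T (fun s => adjoint_rhs P y u s (p s)).
Proof.
move=> cy uL2 cp; apply: inL2N; apply: inL2D; first apply: inL2D.
- apply: mulmx_inL2; last exact: continuous_inL2.
  have := loc_lip_along (jac_loc_lip A1) cy => /within_continuous_mx cj.
  apply/within_continuous_mx => i j; rewrite (_ : (fun s => _) = fun s => jac (fdyn P s) (y s) j i).
    exact: cj.
  by apply/funext => s; rewrite mxE.
- exact: Dgt_inL2.
- apply: mulmx_inL2; first exact: const_continuous.
  by apply: inL2B; [exact: continuous_inL2|exact: yd_inL2].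
Qed.

(** A telescoping sum in which each term changes one argument. Arranged so that only [u] and [p']
    enter through their size. *)
Lemma adjoint_rhs_diff (rho : R) : exists2 L, 0 <= L & forall t y y' u u' (p p' : 'cV[R]_n),
  t \in `[0, T] -> `|y t| <= rho -> `|y' t| <= rho ->
  `|adjoint_rhs P y u t p - adjoint_rhs P y' u' t p'| <= L * (1 + enorm (u t)) * `|p - p'| +
    L * (`|y t - y' t| * (1 + enorm (u t)) + enorm (u t - u' t)) * (1 + `|p'|).
Proof.
have [_ /(_ rho)[L1 L10 H1]] := jac_loc_lip A1; have [L2 L20 H2] := Dgt_bounds A1 rho.
pose q := n%:R * `|(Q1 P)^T *m Q1 P|.
have q0 : 0 <= q by rewrite mulr_ge0.
have n0 : 0 <= n%:R :> R by [].
have nL : 0 <= n%:R * L1 by exact: mulr_ge0.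
exists (n%:R * L1 + L2 + q); first by rewrite !addr_ge0.
move=> t y y' u u' p p' tT yr yr'.
have [F1 F2] := H1 t (y t) (y' t) tT yr yr'.
have [D1 _] := H2 t (y t) (y' t) (u t) (p - p') tT yr yr'.
have [_ D2] := H2 t (y t) (y' t) (u t) p' tT yr yr'.
have [D3 _] := H2 t (y' t) (y t) (u' t - u t) p' tT yr' yr.
set J := jac (fdyn P t) (y t) in F1 F2; set J' := jac (fdyn P t) (y' t) in F2.
have -> : adjoint_rhs P y u t p - adjoint_rhs P y' u' t p' =
   - (J^T *m (p - p')) + (J' - J)^T *m p' - Dgt P t (y t) (u t) (p - p')
   + (Dgt P t (y' t) (u t) p' - Dgt P t (y t) (u t) p')
   + Dgt P t (y' t) (u' t - u t) p' - ((Q1 P)^T *m Q1 P) *m (y t - y' t).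
  rewrite /adjoint_rhs -Dgt_lin -Dgt_linu -/J -/J' [(J' - J)^T]linearB/= !mulmxBr mulmxBl.
  move: (J^T *m p) (J^T *m p') (J'^T *m p') => a1 a2 a3.
  move: (Dgt _ _ _ _ _) (Dgt P t (y' t) (u' t) p') (Dgt P t (y' t) (u t) p') (Dgt P t (y t) (u t) p') => b1 b2 b3 b4.
  move: ((Q1 P)^T *m Q1 P) => Q; move: (Q *m y t) (Q *m y' t) (Q *m yd P t) => c1 c2 c3.
  by apply/matrixP => i j; rewrite !mxE; ring.
have e0 := enorm_ge0 (u t); have e1 := enorm_ge0 (u t - u' t).
have dE : enorm (u' t - u t) = enorm (u t - u' t).
  rewrite /enorm; congr Num.sqrt; apply: eq_bigr => i _; apply: eq_bigr => j _.
  by rewrite !mxE -sqrrN opprB.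
rewrite dE in D3.
have B1 : `|J^T *m (p - p')| <= n%:R * L1 * `|p - p'|.
  apply: (le_trans (mulmx_norm_le _ _)); rewrite trmx_norm.
  by apply: ler_wpM2r => //; rewrite ler_wpM2l.
have B2 : `|(J' - J)^T *m p'| <= n%:R * L1 * `|y t - y' t| * `|p'|.
  apply: (le_trans (mulmx_norm_le _ _)); rewrite trmx_norm -[n%:R * L1 * _]mulrA.
  by apply: ler_wpM2r => //; rewrite ler_wpM2l// [`|y t - _|]distrC.
have B3 : `|(Q1 P)^T *m Q1 P *m (y t - y' t)| <= q * `|y t - y' t| by exact: mulmx_norm_le.
rewrite [`|y' t - y t|]distrC in D2.
have tri (x1 x2 x3 x4 x5 x6 : 'cV[R]_n) : `|- x1 + x2 - x3 + x4 + x5 - x6| <=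
    `|x1| + `|x2| + `|x3| + `|x4| + `|x5| + `|x6|.
  apply: (le_trans (ler_normB _ _)); rewrite lerD2r.
  apply: (le_trans (ler_normD _ _)); rewrite lerD2r.
  apply: (le_trans (ler_normD _ _)); rewrite lerD2r.
  apply: (le_trans (ler_normB _ _)); rewrite lerD2r.
  by apply: (le_trans (ler_normD _ _)); rewrite normrN.
apply: (le_trans (tri _ _ _ _ _ _)).
apply: (@le_trans _ _ (n%:R * L1 * `|p - p'| + n%:R * L1 * `|y t - y' t| * `|p'|
  + L2 * enorm (u t) * `|p - p'| + L2 * `|y t - y' t| * enorm (u t) * `|p'|
  + L2 * enorm (u t - u' t) * `|p'| + q * `|y t - y' t|)).
  by do 5 (apply: lerD => //).
move: (n%:R * L1) nL => N N0; move: (enorm (u t)) (enorm (u t - u' t)) e0 e1 => e d e0 d0.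
move: `|p - p'| `|y t - y' t| `|p'| (normr_ge0 (p - p')) (normr_ge0 (y t - y' t)) (normr_ge0 p') => x z w x0 z0 w0.
rewrite -subr_ge0.
have -> : (N + L2 + q) * (1 + e) * x + (N + L2 + q) * (z * (1 + e) + d) * (1 + w) -
  (N * x + N * z * w + L2 * e * x + L2 * z * e * w + L2 * d * w + q * z) =
  L2 * x + q * x + N * e * x + q * e * x + (N * z + L2 * z) + (N * z * e + L2 * z * e + q * z * e)
  + (N * d + L2 * d + q * d) + (L2 * z * w + q * z * w) + (N * z * e * w + q * z * e * w)
  + (N * d * w + q * d * w) by ring.
by rewrite !addr_ge0 ?mulr_ge0.
Qed.

Lemma continuous_bounded_norm a b k (y : R -> 'cV[R]_k) : {within `[a, b], continuous y} ->
  exists2 c, 0 <= c & forall t, t \in `[a, b] -> `|y t| <= c.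
Proof.
move=> cy; have [|c c0 H] := @continuous_bounded R a b (fun t => `|y t|).
  by move=> x; apply: cvg_norm; exact: cy.
by exists c => // t tab; have := H t tab; rewrite normr_id.
Qed.

Lemma one_plus_enorm_sqi a b k (u : R -> 'cV[R]_k) : inL2 a b u ->
  square_integrable a b (fun s => 1 + enorm (u s)).
Proof.
by move=> uL2; apply: square_integrableD; [exact: square_integrable_cst|exact: enorm_sqi].
Qed.

Lemma Int_one_plus_enorm a b k (u : R -> 'cV[R]_k) : a <= b -> inL2 a b u ->
  Int a b (fun s => (1 + enorm (u s)) ^+ 2) <= 2 * ((b - a) + Int a b (fun s => enorm (u s) ^+ 2)).
Proof.
move=> ab uL2; have iu := sum_inL2 uL2.
have -> : (b - a) = Int a b (fun=> 1 : R) by rewrite Int_cst// mul1r.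
rewrite -IntD//; last exact: integrable_on_cst.
rewrite -IntZ; last by apply: integrable_onD => //; exact: integrable_on_cst.
apply: Int_le.
- exact: square_integrable_sqr (one_plus_enorm_sqi uL2).
- by apply: integrable_onZ; apply: integrable_onD => //; exact: integrable_on_cst.
- by move=> s _; have := sqr_ge0 (1 - enorm (u s)); nra.
Qed.

(** The adjoint equation is affine in [p], so its right-hand side is globally Lipschitz and the
    backward problem is solvable on the whole interval. *)
Lemma adjoint_exists y u : {within `[0, T], continuous y} -> inL2 0 T u ->
  exists p, trajectory 0 T p (fun s => adjoint_rhs P y u s (p s)) /\
    p T = (Q2 P)^T *m Q2 P *m (y T - ydT P).
Proof.
move=> cy uL2; have T0 := hor_gt0 std.
have [rho _ yr] := continuous_bounded_norm cy; have [L L0 HL] := adjoint_rhs_diff rho.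
apply: (picard_backward (ltW T0) _ (l := fun s => L * (1 + enorm (u s)))).
- by move=> p cp; exact: adjoint_rhs_inL2.
- exact/square_integrableZ/one_plus_enorm_sqi.
move=> s sT p p'; have sT' := in_segment sT.
have := HL s y y u u p p' sT' (yr s sT') (yr s sT').
by rewrite !subrr normr0 enorm0 mul0r addr0 mulr0 mul0r addr0.
Qed.

(** Backward Gronwall estimate with [p'] as reference. The changes of state and control form the
    defect, and the terminal values differ by a multiple of [Delta]. The constant depends only on
    the system and on the bounds [rho], [E], [B], so it serves whole sequences. *)
Lemma adjoint_stability (rho E B : R) : 0 <= E -> 0 <= B -> exists2 C, 0 <= C &
  forall y y' u u' p p' (Delta : R), 0 <= Delta ->
  {within `[0, T], continuous y} -> {within `[0, T], continuous y'} -> inL2 0 T u -> inL2 0 T u' ->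
  (forall t, t \in `[0, T] -> `|y t| <= rho) -> (forall t, t \in `[0, T] -> `|y' t| <= rho) ->
  (forall t, t \in `[0, T] -> `|y t - y' t| <= Delta) ->
  Int 0 T (fun s => enorm (u s) ^+ 2) <= E ->
  trajectory 0 T p (fun s => adjoint_rhs P y u s (p s)) ->
  trajectory 0 T p' (fun s => adjoint_rhs P y' u' s (p' s)) ->
  p T = (Q2 P)^T *m Q2 P *m (y T - ydT P) ->
  p' T = (Q2 P)^T *m Q2 P *m (y' T - ydT P) ->
  (forall t, t \in `[0, T] -> `|p' t| <= B) ->
  forall t, t \in `[0, T] -> `|p t - p' t| ^+ 2 <=
    C * (Delta ^+ 2 + Int 0 T (fun s => enorm (u s - u' s) ^+ 2)).
Proof.
move=> E0 B0; have T0 := hor_gt0 std; have [L L0 HL] := adjoint_rhs_diff rho.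
pose K := L ^+ 2 * (2 * (T + E)).
have K0 : 0 <= K by rewrite mulr_ge0 ?sqr_ge0// mulr_ge0// addr_ge0// ltW.
pose q := n%:R * `|(Q2 P)^T *m Q2 P|; have q0 : 0 <= q by rewrite mulr_ge0.
pose M := L * (1 + B); have M0 : 0 <= M by rewrite mulr_ge0// addr_ge0.
pose N := q ^+ 2 + T * (2 * M ^+ 2 * (2 * (T + E)) + 2 * M ^+ 2).
have N0 : 0 <= N.
  by rewrite addr_ge0 ?sqr_ge0// mulr_ge0 ?(ltW T0)// !(addr_ge0, mulr_ge0) ?sqr_ge0// ltW.
exists (gronwall_factor K T * N); first by rewrite mulr_ge0// /gronwall_factor mulr_ge0// expR_ge0.
move=> y y' u u' p p' Delta D0 cy cy' uL2 uL2' yr yr' yD uE Hp Hp' pT pT' pB t tT.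
have sl : square_integrable 0 T (fun s => L * (1 + enorm (u s))).
  exact/square_integrableZ/one_plus_enorm_sqi.
have duL2 := inL2B uL2 uL2'.
set D2 := Int 0 T (fun s => enorm (u s - u' s) ^+ 2).
have D20 : 0 <= D2 by apply: Int_ge0 => s _; exact: sqr_ge0.
pose d s := M * (Delta * (1 + enorm (u s)) + enorm (u s - u' s)).
have sd : square_integrable 0 T d.
  apply: square_integrableZ; apply: square_integrableD; last exact: (enorm_sqi duL2).
  exact/square_integrableZ/one_plus_enorm_sqi.
have := trajectory_gronwall (ltW T0) false Hp Hp' sl sd; rewrite subr0 => G.
apply: (le_trans (G _ t tT)) => [s sT|].
  have sT' := in_segment sT; apply: (le_trans (HL s y y' u u' (p s) (p' s) sT' (yr s sT') (yr' s sT'))).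
  rewrite lerD2l /d /M mulrAC; have e0 := enorm_ge0 (u s).
  apply: ler_pM.
  - by rewrite mulr_ge0// addr_ge0.
  - by rewrite addr_ge0 ?enorm_ge0// mulr_ge0// addr_ge0.
  - by rewrite ler_wpM2l// lerD2l pB.
  - by rewrite lerD2r ler_wpM2r ?yD// addr_ge0.
have lK : Int 0 T (fun s => (L * (1 + enorm (u s))) ^+ 2) <= K.
  rewrite (@eq_Int _ _ _ _ (fun s => L ^+ 2 * (1 + enorm (u s)) ^+ 2)); last first.
    by move=> s _; rewrite exprMn.
  rewrite IntZ; last by have [] := one_plus_enorm_sqi uL2.
  rewrite ler_wpM2l ?sqr_ge0//; apply: (le_trans (Int_one_plus_enorm (ltW T0) uL2)).
  by rewrite subr0 ler_wpM2l// lerD2l.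
rewrite -[leRHS]mulrA; apply: ler_pM.
- exact: gronwall_factor_ge0.
- rewrite addr_ge0 ?sqr_ge0// mulr_ge0 ?(ltW T0)//; apply: Int_ge0 => s _; exact: sqr_ge0.
- exact: gronwall_factor_le (ltW T0) lK.
have eT : `|p T - p' T| ^+ 2 <= q ^+ 2 * Delta ^+ 2.
  rewrite -exprMn lerXn2r ?nnegrE ?mulr_ge0// pT pT' -mulmxBr.
  apply: (le_trans (mulmx_norm_le _ _)); apply: ler_wpM2l => //.
  by rewrite opprB addrA subrK yD// in_itv/= lexx andbT ltW.
have dI : Int 0 T (fun s => d s ^+ 2) <= 2 * M ^+ 2 * (2 * (T + E)) * Delta ^+ 2 + 2 * M ^+ 2 * D2.
  have i1 := square_integrable_sqr (one_plus_enorm_sqi uL2); have i2 := sum_inL2 duL2.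
  apply: (@le_trans _ _ (Int 0 T (fun s => (2 * M ^+ 2 * Delta ^+ 2) * (1 + enorm (u s)) ^+ 2
      + (2 * M ^+ 2) * enorm (u s - u' s) ^+ 2))).
    apply: Int_le.
    - exact: square_integrable_sqr.
    - by apply: integrable_onD; exact: integrable_onZ.
    - move=> s _; rewrite /d exprMn; have M20 := sqr_ge0 M.
      have := sqr_ge0 (Delta * (1 + enorm (u s)) - enorm (u s - u' s)).
      move: (1 + enorm (u s)) (enorm (u s - u' s)) => X Y XY.
      have : (Delta * X + Y) ^+ 2 <= 2 * Delta ^+ 2 * X ^+ 2 + 2 * Y ^+ 2 by nra.
      by move=> /(ler_wpM2l M20)/le_trans; apply; rewrite le_eqVlt; apply/orP; left; apply/eqP; ring.
  rewrite IntD; [|exact: integrable_onZ|exact: integrable_onZ].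
  rewrite IntZ// IntZ//; apply: lerD => //.
  rewrite [leRHS]mulrAC; apply: ler_wpM2l.
    by rewrite mulr_ge0 ?sqr_ge0// mulr_ge0 ?sqr_ge0.
  apply: (le_trans (Int_one_plus_enorm (ltW T0) uL2)).
  by rewrite subr0 ler_wpM2l// lerD2l.
have TdI := ler_wpM2l (ltW T0) dI.
apply: (le_trans (lerD eT TdI)); rewrite -subr_ge0 /N.
have -> : (q ^+ 2 + T * (2 * M ^+ 2 * (2 * (T + E)) + 2 * M ^+ 2)) * (Delta ^+ 2 + D2) -
  (q ^+ 2 * Delta ^+ 2 + T * (2 * M ^+ 2 * (2 * (T + E)) * Delta ^+ 2 + 2 * M ^+ 2 * D2)) =
  q ^+ 2 * D2 + T * (2 * M ^+ 2 * (2 * (T + E)) * D2 + 2 * M ^+ 2 * Delta ^+ 2) by ring.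
by rewrite addr_ge0 ?mulr_ge0 ?sqr_ge0 ?(ltW T0)// !(addr_ge0, mulr_ge0) ?sqr_ge0// ltW.
Qed.

Lemma tracking_inL2 t y : 0 <= t -> {within `[t, T], continuous y} ->
  inL2 t T (fun s => Q1 P *m (y s - yd P s)).
Proof.
move=> t0 cy; apply: mulmx_inL2; first exact: const_continuous.
by apply: inL2B; [exact: continuous_inL2|exact: yd_inL2].
Qed.

Lemma cost_split t y u : 0 <= t -> {within `[t, T], continuous y} -> inL2 t T u ->
  cost P t y u = tracking_cost P t y + beta P / 2 * Int t T (fun s => enorm (u s) ^+ 2).
Proof.
move=> t0 cy uL2; have iQ := sum_inL2 (tracking_inL2 t0 cy); have iu := sum_inL2 uL2.
rewrite /cost /tracking_cost IntD//; last exact: integrable_onZ.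
by rewrite IntZ//; ring.
Qed.

(** Exact because the tracking cost is quadratic: first the linear term, then half of the quadratic
    one. *)
Lemma tracking_expand t y y' : 0 <= t -> {within `[t, T], continuous y} ->
  {within `[t, T], continuous y'} ->
  tracking_cost P t y' = tracking_cost P t y
  + (Int t T (fun s => dotv (Q1 P *m (y s - yd P s)) (Q1 P *m (y' s - y s)))
     + dotv (Q2 P *m (y T - ydT P)) (Q2 P *m (y' T - y T)))
  + 2^-1 * (Int t T (fun s => enorm (Q1 P *m (y' s - y s)) ^+ 2) + enorm (Q2 P *m (y' T - y T)) ^+ 2).
Proof.
move=> t0 cy cy'; have sQ := tracking_inL2 t0 cy.
have sd : inL2 t T (fun s => Q1 P *m (y' s - y s)).
  apply: mulmx_inL2; first exact: const_continuous.
  by apply: continuous_inL2; exact: continuousB_within.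
have iQ := sum_inL2 sQ; have id := sum_inL2 sd.
have ix : integrable_on t T (fun s => dotv (Q1 P *m (y s - yd P s)) (Q1 P *m (y' s - y s))).
  apply: (@eq_integrable_on _ _ _ (fun s => \sum_i (Q1 P *m (y s - yd P s)) i 0 * (Q1 P *m (y' s - y s)) i 0)).
    by move=> s _; rewrite dotvE.
  by apply: integrable_on_sum => i; exact: integrable_onM (sQ i) (sd i).
rewrite /tracking_cost.
have -> : Q2 P *m (y' T - ydT P) = Q2 P *m (y T - ydT P) + Q2 P *m (y' T - y T).
  by rewrite -mulmxDr; congr (_ *m _); rewrite [RHS]addrC addrA subrK.
rewrite enormD_sqr.
rewrite (@eq_Int _ _ _ _ (fun s => enorm (Q1 P *m (y s - yd P s)) ^+ 2 +
   2 * dotv (Q1 P *m (y s - yd P s)) (Q1 P *m (y' s - y s)) + enorm (Q1 P *m (y' s - y s)) ^+ 2)); last first.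
  move=> s _; rewrite -enormD_sqr -mulmxDr; congr (enorm (_ *m _) ^+ 2).
  by rewrite [RHS]addrC addrA subrK.
rewrite IntD//; last by apply: integrable_onD => //; exact: integrable_onZ.
rewrite IntD//; last exact: integrable_onZ.
rewrite IntZ//; move: (Int t T _) (Int t T _) (Int t T _) (dotv _ _) (enorm _) (enorm _) => a b c d e f.
by field.
Qed.

Lemma quadratic_bound t y y' (Delta : R) : 0 <= t -> t <= T -> 0 <= Delta ->
  {within `[t, T], continuous y} -> {within `[t, T], continuous y'} ->
  (forall s, s \in `[t, T] -> `|y' s - y s| <= Delta) ->
  Int t T (fun s => enorm (Q1 P *m (y' s - y s)) ^+ 2) + enorm (Q2 P *m (y' T - y T)) ^+ 2 <=
  n%:R * (n%:R ^+ 2) * (T * `|Q1 P| ^+ 2 + `|Q2 P| ^+ 2) * Delta ^+ 2.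
Proof.
move=> t0 tT D0 cy cy' yD.
have bd (Q : 'M[R]_n) s : s \in `[t, T] -> enorm (Q *m (y' s - y s)) ^+ 2 <=
    n%:R * (n%:R ^+ 2) * `|Q| ^+ 2 * Delta ^+ 2.
  move=> st; apply: (le_trans (enorm_sqr_le _)).
  have H : `|Q *m (y' s - y s)| <= n%:R * `|Q| * Delta.
    by apply: (le_trans (mulmx_norm_le _ _)); rewrite ler_wpM2l ?mulr_ge0// yD.
  have /(ler_wpM2l (ler0n R n)) : `|Q *m (y' s - y s)| ^+ 2 <= (n%:R * `|Q| * Delta) ^+ 2.
    by rewrite lerXn2r ?nnegrE ?mulr_ge0.
  by rewrite !exprMn !mulrA.
have sd : inL2 t T (fun s => Q1 P *m (y' s - y s)).
  apply: mulmx_inL2; first exact: const_continuous.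
  by apply: continuous_inL2; exact: continuousB_within.
rewrite mulrDr mulrDl; apply: lerD; last first.
  by apply: bd; rewrite in_itv/= tT lexx.
apply: (@le_trans _ _ (Int t T (fun=> n%:R * (n%:R ^+ 2) * `|Q1 P| ^+ 2 * Delta ^+ 2))).
  apply: Int_le; [exact: sum_inL2|exact: integrable_on_cst|].
  by move=> s st; apply: bd; exact: in_segment.
rewrite Int_cst//.
have X0 : 0 <= n%:R * n%:R ^+ 2 * `|Q1 P| ^+ 2 * Delta ^+ 2 by rewrite !mulr_ge0 ?sqr_ge0.
have H : (n%:R * n%:R ^+ 2 * `|Q1 P| ^+ 2 * Delta ^+ 2) * (T - t) <=
    (n%:R * n%:R ^+ 2 * `|Q1 P| ^+ 2 * Delta ^+ 2) * T by rewrite ler_wpM2l// gerBl.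
by apply: (le_trans H); rewrite le_eqVlt; apply/orP; left; apply/eqP; ring.
Qed.

Lemma tracking_lipschitz y : {within `[0, T], continuous y} -> exists2 C, 0 <= C &
  forall t y' (Delta : R), 0 <= t -> t <= T -> 0 <= Delta -> {within `[t, T], continuous y'} ->
  (forall s, s \in `[t, T] -> `|y' s - y s| <= Delta) ->
  `|tracking_cost P t y' - tracking_cost P t y| <= C * (Delta + Delta ^+ 2).
Proof.
move=> cy; have T0 := hor_gt0 std.
pose e s := enorm (Q1 P *m (y s - yd P s)).
have se : square_integrable 0 T e by exact: enorm_sqi (tracking_inL2 (lexx 0) cy).
have ie := square_integrable_integrable se.
pose C1 := n%:R * n%:R * `|Q1 P| * Int 0 T e + n%:R * `|Q2 P *m (y T - ydT P)| * (n%:R * `|Q2 P|).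
have Ie0 : 0 <= Int 0 T e by apply: Int_ge0 => s _; exact: enorm_ge0.
have C10 : 0 <= C1 by rewrite addr_ge0// !mulr_ge0.
pose C2 := n%:R * (n%:R ^+ 2) * (T * `|Q1 P| ^+ 2 + `|Q2 P| ^+ 2).
have C20 : 0 <= C2.
  by rewrite mulr_ge0// ?mulr_ge0 ?sqr_ge0// addr_ge0 ?sqr_ge0// mulr_ge0 ?sqr_ge0// ltW.
exists (C1 + C2); first exact: addr_ge0.
move=> t y' Delta t0 tT D0 cy' yD.
have cyt : {within `[t, T], continuous y} by exact: continuous_sub_itv cy.
have sQ := tracking_inL2 t0 cyt.
have sd : inL2 t T (fun s => Q1 P *m (y' s - y s)).
  apply: mulmx_inL2; first exact: const_continuous.
  by apply: continuous_inL2; exact: continuousB_within.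
have ix : integrable_on t T (fun s => dotv (Q1 P *m (y s - yd P s)) (Q1 P *m (y' s - y s))).
  apply: (@eq_integrable_on _ _ _ (fun s => \sum_i (Q1 P *m (y s - yd P s)) i 0 * (Q1 P *m (y' s - y s)) i 0)).
    by move=> s _; rewrite dotvE.
  by apply: integrable_on_sum => i; exact: integrable_onM (sQ i) (sd i).
rewrite (tracking_expand t0 cyt cy').
have cancel (x a b : R) : x + a + b - x = a + b by ring.
rewrite cancel.
have QB := quadratic_bound t0 tT D0 cyt cy' yD; rewrite -/C2 in QB.
set q := Int t T _ + _ in QB *.
have q0 : 0 <= q by rewrite addr_ge0 ?sqr_ge0// Int_ge0// => s _; exact: sqr_ge0.
set x := _ + dotv _ _.
have xB : `|x| <= C1 * Delta.
  rewrite /x /C1 mulrDl; apply: (le_trans (ler_normD _ _)); apply: lerD; last first.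
    apply: (le_trans (dotv_norm_le _ _)); rewrite -!mulrA !ler_wpM2l// mulrA.
    apply: (le_trans (mulmx_norm_le _ _)); rewrite ler_wpM2l ?mulr_ge0// yD//.
    by rewrite in_itv/= tT lexx.
  apply: (le_trans (Int_norm ix)).
  have iet : integrable_on t T e by exact: integrable_on_sub ie.
  apply: (@le_trans _ _ (Int t T (fun s => n%:R * n%:R * `|Q1 P| * Delta * e s))).
    apply: Int_le; [exact: integrable_on_norm|exact: integrable_onZ|].
    move=> s st; apply: (le_trans (dotv_norm_le _ _)).
    have a1 : `|Q1 P *m (y s - yd P s)| <= e s by exact: mx_norm_le_enorm.
    have a2 : `|Q1 P *m (y' s - y s)| <= n%:R * `|Q1 P| * Delta.
      apply: (le_trans (mulmx_norm_le _ _)); rewrite ler_wpM2l ?mulr_ge0// yD//; exact: in_segment.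
    rewrite -[leLHS]mulrA (_ : n%:R * n%:R * `|Q1 P| * Delta * e s = n%:R * (e s * (n%:R * `|Q1 P| * Delta))); last by ring.
    by rewrite ler_wpM2l// ler_pM.
  rewrite IntZ//.
  have -> : n%:R * n%:R * `|Q1 P| * Int 0 T e * Delta = n%:R * n%:R * `|Q1 P| * Delta * Int 0 T e by ring.
  rewrite ler_wpM2l ?mulr_ge0// (Int_split t0 tT ie) lerDr.
  by apply: Int_ge0 => s _; exact: enorm_ge0.
apply: (le_trans (ler_normD _ _)); rewrite [`|2^-1 * q|]ger0_norm ?mulr_ge0//.
have D20 := sqr_ge0 Delta; have := mulr_ge0 C10 D20; have := mulr_ge0 C20 D0.
move: q0 QB xB; move: (Delta ^+ 2) => D2; clearbody x q C1 C2; rewrite mulrDl !mulrDr; lra.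
Qed.

(** Young's inequality for the cross term. The parameter [eta] trades a small multiple of the energy
    of [u] against a large multiple of the squared distance. *)
Lemma energy_diff a b k (u u' : R -> 'cV[R]_k) (eta : R) : 0 < eta -> inL2 a b u -> inL2 a b u' ->
  `|Int a b (fun s => enorm (u' s) ^+ 2) - Int a b (fun s => enorm (u s) ^+ 2)| <=
  eta * Int a b (fun s => enorm (u s) ^+ 2) + (1 + eta^-1) * Int a b (fun s => enorm (u' s - u s) ^+ 2).
Proof.
move=> eta0 uL2 uL2'; have duL2 := inL2B uL2' uL2.
have iu := sum_inL2 uL2; have iu' := sum_inL2 uL2'; have id := sum_inL2 duL2.
rewrite -IntB// -IntZ// -IntZ// -IntD; [|exact: integrable_onZ|exact: integrable_onZ].
have i1 := integrable_onB iu' iu.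
apply: (le_trans (Int_norm i1)); apply: Int_le.
- exact: integrable_on_norm.
- by apply: integrable_onD; exact: integrable_onZ.
move=> s _; rewrite !enorm_sqr -sumrB !mulr_sumr -big_split/=.
apply: (le_trans (ler_norm_sum _ _ _)); apply: ler_sum => i _; rewrite !mxE.
move: (u' s i 0) (u s i 0) => x z.
have -> : x ^+ 2 - z ^+ 2 = (x - z) ^+ 2 + 2 * z * (x - z) by ring.
apply: (le_trans (ler_normD _ _)); rewrite ger0_norm ?sqr_ge0//.
suff : `|2 * z * (x - z)| <= eta * z ^+ 2 + eta^-1 * (x - z) ^+ 2 by lra.
rewrite ler_norml; apply/andP; split.
  have := sqr_ge0 (eta * z + (x - z)); rewrite -(pmulr_rge0 _ (_ : 0 < eta^-1)) ?invr_gt0//.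
  have -> : eta^-1 * (eta * z + (x - z)) ^+ 2 = eta * z ^+ 2 + 2 * z * (x - z) + eta^-1 * (x - z) ^+ 2.
    by field; rewrite gt_eqF.
  lra.
have := sqr_ge0 (eta * z - (x - z)); rewrite -(pmulr_rge0 _ (_ : 0 < eta^-1)) ?invr_gt0//.
have -> : eta^-1 * (eta * z - (x - z)) ^+ 2 = eta * z ^+ 2 - 2 * z * (x - z) + eta^-1 * (x - z) ^+ 2.
  by field; rewrite gt_eqF.
lra.
Qed.

End AdjointAndCost.

(** * Dynamic programming and sensitivity of the cost *)

Section Glue.
Context {R : realType}.
Implicit Types (a b c : R).

Lemma square_integrable_glue a b c (f g : R -> R) : a <= c -> c <= b ->
  square_integrable a c f -> square_integrable c b g ->
  square_integrable a b (fun s => if s < c then f s else if c < s then g s else 0).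
Proof.
move=> ac cb sf sg.
have E (F G : R -> R) s : s \in `]a, b[ -> (F \_ `]a, c[) s + (G \_ `]c, b[) s =
    if s < c then F s else if c < s then G s else 0.
  rewrite in_itv/= /patch !mem_setE !in_itv/= => /andP[-> ->]; rewrite andbT/=.
  by case: ltgtP => _; rewrite ?addr0 ?add0r.
have I (F G : R -> R) : integrable_on a c F -> integrable_on c b G ->
    integrable_on a b (fun s => if s < c then F s else if c < s then G s else 0).
  move=> /integrable_on_patch iF /integrable_on_patch iG.
  apply: eq_integrable_on (E F G) _; apply: integrable_onD.
    by apply: integrableS iF => //; exact: measurable_itv.
  by apply: integrableS iG => //; exact: measurable_itv.
split.
  apply: integrable_on_measurable; apply: I; exact: square_integrable_integrable.
have := I _ _ (square_integrable_sqr sf) (square_integrable_sqr sg).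
apply: eq_integrable_on => s _.
by case: ifP => // _; case: ifP => // _; rewrite expr0n.
Qed.

Lemma is_primitive_glue a b c (y z V : R -> R) : a <= c -> c <= b ->
  square_integrable a b V -> is_primitive a c y V -> is_primitive c b z V -> y c = z c ->
  is_primitive a b (fun s => if s <= c then y s else z s) V.
Proof.
move=> ac cb sV py pz yz.
apply: (eq_is_primitive (le_trans ac cb) _ _ (is_primitive_intro (y a) sV)) => // t tab.
have := tab; rewrite in_itv/= => /andP[ta tb]; case: ifPn => [tc|]; last rewrite -ltNge => ct.
  by rewrite [RHS](is_primitive_val py)// in_itv/= ta tc.
have iV : integrable_on a t V.
  by apply: (integrable_on_sub (lexx a) tb); exact: square_integrable_integrable.
rewrite (Int_split ac (ltW ct) iV) addrA (_ : y a + _ = y c).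
  by rewrite yz [RHS](is_primitive_val pz)// in_itv/= tb ltW.
by rewrite [RHS](is_primitive_val py)// in_itv/= ac lexx.
Qed.

Lemma inL2_glue n a b c (u u' : R -> 'cV[R]_n) : a <= c -> c <= b -> inL2 a c u -> inL2 c b u' ->
  inL2 a b (fun s => if s < c then u s else if c < s then u' s else 0).
Proof.
move=> ac cb uL2 uL2' i.
apply: eq_square_integrable (square_integrable_glue ac cb (uL2 i) (uL2' i)) => s _.
by case: ifP => // _; case: ifP => // _; rewrite mxE.
Qed.

Lemma trajectory_sub n a b c d (y v : R -> 'cV[R]_n) : a <= c -> c <= d -> d <= b ->
  trajectory a b y v -> trajectory c d y v.
Proof. by move=> ac cd db H i; exact: is_primitive_sub ac cd db (H i). Qed.

Lemma eq_trajectory n a b (y z v w : R -> 'cV[R]_n) : a <= b ->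
  (forall t, t \in `[a, b] -> y t = z t) -> (forall t, t \in `]a, b[ -> v t = w t) ->
  trajectory a b y v -> trajectory a b z w.
Proof.
by move=> ab yz vw H i; apply: (eq_is_primitive ab _ _ (H i)) => t tab; rewrite ?yz ?vw.
Qed.

Lemma trajectory_glue n a b c (y z V : R -> 'cV[R]_n) : a <= c -> c <= b ->
  inL2 a b V -> trajectory a c y V -> trajectory c b z V -> y c = z c ->
  trajectory a b (fun s => if s <= c then y s else z s) V.
Proof.
move=> ac cb VL2 py pz yz i.
have yzi : y c i 0 = z c i 0 by rewrite yz.
apply: eq_is_primitive (is_primitive_glue ac cb (VL2 i) (py i) (pz i) yzi) => //.
  exact: le_trans cb.
by move=> t _ /=; case: ifP.
Qed.

End Glue.

Section DynamicProgramming.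
Context {R : realType} {n m : nat} (P : ocp R n m).
Local Notation T := (hor P).
Context (A1 : regA1 P) (std : standing P).
Implicit Types (y p : R -> 'cV[R]_n) (u : R -> 'cV[R]_m).

Definition controlled (a b : R) y u :=
  inL2 a b u /\ trajectory a b y (fun s => control_rhs P u s (y s)).

Lemma admissible_controlled t x y u : t < T -> admissible P t x y u -> controlled t T y u /\ y t = x.
Proof.
move=> tT [[cy _ _] uL2 [wy yt]]; split=> //; split=> //.
exact: weak_deriv_trajectory tT cy wy.
Qed.

Lemma controlled_admissible t y u : t <= T -> controlled t T y u -> admissible P t (y t) y u.
Proof.
move=> tT [uL2 ty]; split=> //; first exact: trajectory_inH1 ty.
by split=> //; exact: trajectory_weak_deriv.
Qed.

Lemma controlled_sub a b c d y u : a <= c -> c <= d -> d <= b -> controlled a b y u ->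
  controlled c d y u.
Proof.
move=> ac cd db [uL2 ty]; split; first exact: inL2_sub uL2.
exact: trajectory_sub ty.
Qed.

Lemma controlled_glue t y u z w : 0 <= t -> t <= T -> controlled 0 t y u -> controlled t T z w ->
  y t = z t -> controlled 0 T (fun s => if s <= t then y s else z s)
    (fun s => if s < t then u s else if t < s then w s else 0).
Proof.
move=> t0 tT [uL2 ty] [wL2 tz] yz; set yg := fun s => _; set ug := fun s => _.
have ugL2 : inL2 0 T ug by exact: inL2_glue uL2 wL2.
(* [control_rhs_inL2] asks for a continuous path, so continuity is obtained beforehand from the
   glued velocities. *)
have cg : {within `[0, T], continuous yg}.
  pose V s := if s < t then control_rhs P u s (y s) else if t < s then control_rhs P w s (z s) else 0.
  apply: (@trajectory_continuous _ _ _ _ _ V); apply: trajectory_glue => //.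
  - apply: inL2_glue => //; exact: trajectory_inL2; eassumption.
  - by apply: eq_trajectory ty => // s; rewrite in_itv/= /V => /andP[_ ->].
  - apply: eq_trajectory tz => // s; rewrite in_itv/= /V => /andP[ts _].
    by rewrite ltNge (ltW ts)/= ts.
split=> //; apply: trajectory_glue => //.
- exact: control_rhs_inL2.
- apply: eq_trajectory ty => // s; rewrite in_itv/= => /andP[_ st].
  by rewrite /control_rhs /yg /ug st (ltW st).
- apply: eq_trajectory tz => // s; rewrite in_itv/= => /andP[ts _].
  by rewrite /control_rhs /yg /ug ts leNgt ts/= ltNge (ltW ts).
Qed.

Definition running y u (s : R) : R :=
  enorm (Q1 P *m (y s - yd P s)) ^+ 2 + beta P * enorm (u s) ^+ 2.

Lemma running_integrable t y u : 0 <= t -> {within `[t, T], continuous y} -> inL2 t T u ->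
  integrable_on t T (running y u).
Proof.
move=> t0 cy uL2; apply: integrable_onD; first by exact: sum_inL2 (tracking_inL2 std t0 cy).
by apply: integrable_onZ; exact: sum_inL2.
Qed.

Lemma cost_additive t y u : 0 <= t -> t <= T -> {within `[0, T], continuous y} -> inL2 0 T u ->
  cost P 0 y u = 2^-1 * Int 0 t (running y u) + cost P t y u.
Proof.
move=> t0 tT cy uL2; rewrite /cost -/(running y u).
rewrite (Int_split t0 tT (running_integrable (lexx 0) cy uL2)); ring.
Qed.

Lemma cost_ge0 t y u : 0 <= cost P t y u.
Proof.
have b0 : 0 <= beta P by case: std => _ _ _ /ltW.
rewrite /cost; apply: addr_ge0; last by rewrite mulr_ge0 ?sqr_ge0.
rewrite mulr_ge0//; apply: Int_ge0 => s _.
by apply: addr_ge0; rewrite ?sqr_ge0// mulr_ge0// sqr_ge0.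
Qed.

Lemma value_le_cost t x y u : admissible P t x y u -> (0 <= value P t x)%E /\ (value P t x <= (cost P t y u)%:E)%E.
Proof.
move=> yu; split; last by apply: ereal_inf_lbound; exists (y, u).
by apply: le_ereal_inf_tmp => _ [[y' u'] _ <-]; rewrite lee_fin cost_ge0.
Qed.

(** Costs are nonnegative and one of them is attained by an admissible pair, so the infimum is
    finite and [fine] is faithful. *)
Lemma Vstar_le_cost t x y u : admissible P t x y u -> Vstar P t x <= cost P t y u.
Proof.
move=> /value_le_cost[V0 VC]; rewrite /Vstar -lee_fin fineK//.
by rewrite fin_real// (lt_le_trans _ V0)//= (le_lt_trans VC)// ltry.
Qed.

(** Principle of optimality: a cheaper continuation from [y t], attached to [y] on [[0, t]], would
    beat the minimizer. *)
Lemma Vstar_along_minimizer (y0 : 'cV[R]_n) y u t : minimizer P y0 y u -> t \in `]0, T[ ->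
  Vstar P t (y t) = cost P t y u.
Proof.
move=> [yu ymin]; rewrite in_itv/= => /andP[t0 tT]; have T0 := hor_gt0 std.
have [cyu y00] := admissible_controlled T0 yu.
have cyt := controlled_sub (ltW t0) (ltW tT) (lexx T) cyu.
have ayt := controlled_admissible (ltW tT) cyt.
apply/eqP; rewrite eq_le Vstar_le_cost//=.
suff : ((cost P t y u)%:E <= value P t (y t))%E.
  have [V0 VC] := value_le_cost ayt.
  by rewrite -lee_fin fineK// fin_real// (lt_le_trans _ V0)//= (le_lt_trans VC)// ltry.
apply: le_ereal_inf_tmp => _ [[y' u'] /= yu' <-]; rewrite lee_fin.
have [cyu' yt'] := admissible_controlled tT yu'.
have c0t := controlled_sub (lexx 0) (ltW t0) (ltW tT) cyu.
have cg := controlled_glue (ltW t0) (ltW tT) c0t cyu' (esym yt').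
have ag := controlled_admissible (ltW T0) cg; rewrite (ltW t0) y00 in ag.
have := ymin _ _ ag.
have cc := trajectory_continuous cyu.2.
rewrite (cost_additive (ltW t0) (ltW tT) cc cyu.1).
rewrite (cost_additive (ltW t0) (ltW tT) (trajectory_continuous cg.2) cg.1).
have -> : Int 0 t (running (fun s => if s <= t then y s else y' s)
    (fun s => if s < t then u s else if t < s then u' s else 0)) = Int 0 t (running y u).
  apply: eq_Int; by move=> s; rewrite in_itv/= => /andP[_ st]; rewrite /running (ltW st) st.
rewrite lerD2l; congr (_ <= _); rewrite /cost leNgt tT/=; congr (_ * _ + _).
by apply: eq_Int => s; rewrite in_itv/= => /andP[ts _]; rewrite leNgt ts ltNge (ltW ts).
Qed.

End DynamicProgramming.

(** * The embedding norm and the ball on which the value function is regular *)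

Section BigBall.
Context {R : realType} {n : nat}.

Lemma enorm_le k (x : 'cV[R]_k) : enorm x <= k%:R * `|x|.
Proof.
rewrite -(@ler_pXn2r _ 2) ?nnegrE ?enorm_ge0 ?mulr_ge0//.
apply: (le_trans (enorm_sqr_le _)); rewrite exprMn ler_wpM2r ?sqr_ge0// -natrX ler_nat.
by case: k x => // k x; rewrite expnS leq_pmulr.
Qed.

Lemma enormZ_sqr (k : R) (x : 'cV[R]_n) : enorm (k *: x) ^+ 2 = k ^+ 2 * enorm x ^+ 2.
Proof.
rewrite !enorm_sqr mulr_sumr; apply: eq_bigr => i _.
by rewrite mxE exprMn.
Qed.

Lemma enormD_sqr_le (x z : 'cV[R]_n) : enorm (x + z) ^+ 2 <= 2 * enorm x ^+ 2 + 2 * enorm z ^+ 2.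
Proof.
rewrite !enorm_sqr !mulr_sumr -big_split/=; apply: ler_sum => i _; rewrite mxE.
by have := sqr_ge0 (x i 0 - z i 0); nra.
Qed.

Lemma trajectoryZ a b (k : R) (y v : R -> 'cV[R]_n) : a <= b -> trajectory a b y v ->
  trajectory a b (fun t => k *: y t) (fun t => k *: v t).
Proof.
move=> ab H i; apply: eq_is_primitive (is_primitiveZ k (H i)) => // t _; by rewrite mxE.
Qed.

Lemma Wnorm_scale (T k : R) (y v : R -> 'cV[R]_n) : 0 < T -> trajectory 0 T y v ->
  Wnorm T (fun t => k *: y t) ^+ 2 = k ^+ 2 * Wnorm T y ^+ 2.
Proof.
move=> T0 ty; rewrite (Wnorm_sqr T0 (trajectoryZ k (ltW T0) ty)) (Wnorm_sqr T0 ty).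
have yL2 := continuous_inL2 (trajectory_continuous ty); have vL2 := trajectory_inL2 ty.
rewrite !L2norm_sqr//; try exact: inL2Z.
rewrite mulrDr !mulr_sumr; congr (_ + _); apply: eq_bigr => i _; rewrite -IntZ;
  try exact: square_integrable_sqr.
  by apply: eq_Int => t _; rewrite mxE exprMn.
by apply: eq_Int => t _; rewrite mxE exprMn.
Qed.

Lemma embedding_norm_ub (T : R) (y : R -> 'cV[R]_n) t : 0 < T -> inH1 0 T y -> Wnorm T y <= 1 ->
  t \in `[0, T] -> enorm (y t) <= embedding_norm n T.
Proof.
move=> T0 yH yW tT; apply: sup_upper_bound; last by exists y, t.
split; first by exists (enorm (y t)); exists y, t.
exists (2 / T + 2 * T + 1) => _ [z [s [zH zW sT ->]]].
have K0 : 0 <= 2 / T + 2 * T by rewrite addr_ge0 ?divr_ge0 ?mulr_ge0 ?(ltW T0).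
have := embedding_bound T0 zH sT.
have : Wnorm T z ^+ 2 <= 1 by rewrite expr_le1// Wnorm_ge0.
move=> /(ler_wpM2l K0); rewrite mulr1 => H1 /le_trans/(_ H1) H2.
have := enorm_ge0 (z s); nra.
Qed.

Lemma embedding_norm_scale (T M : R) (y : R -> 'cV[R]_n) t : 0 < T -> 0 < M -> inH1 0 T y ->
  Wnorm T y <= M -> t \in `[0, T] -> enorm (y t) <= M * embedding_norm n T.
Proof.
move=> T0 M0 yH yW tT; have [v ty] := inH1_trajectory T0 yH.
have tz := trajectoryZ M^-1 (ltW T0) ty.
have zW : Wnorm T (fun t => M^-1 *: y t) <= 1.
  rewrite -(@ler_pXn2r _ 2) ?nnegrE ?Wnorm_ge0// (Wnorm_scale _ T0 ty) expr1n -exprMn.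
  by rewrite expr_le1// ?mulr_ge0 ?Wnorm_ge0 ?invr_ge0 ?(ltW M0)// mulrC ler_pdivrMr ?mul1r.
have := embedding_norm_ub T0 (trajectory_inH1 (ltW T0) tz) zW tT.
rewrite -(ler_pM2l M0); apply: le_trans.
rewrite -(@ler_pXn2r _ 2) ?nnegrE ?mulr_ge0 ?enorm_ge0 ?(ltW M0)//.
by rewrite exprMn enormZ_sqr exprVn mulrA mulfV ?mul1r// expf_eq0/= gt_eqF.
Qed.

Lemma embedding_norm_ge0 (T : R) : 0 < T -> 0 <= embedding_norm n T.
Proof.
move=> T0.
have t0 : trajectory 0 T (fun=> 0 : 'cV[R]_n) (fun=> 0).
  move=> i; apply: eq_is_primitive (is_primitive_intro 0 (square_integrable_cst 0 T 0)) => //.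
  - exact: ltW.
  - move=> t; rewrite in_itv/= => /andP[tt _]; by rewrite Int_cst// mxE mul0r addr0.
  - by move=> t _; rewrite mxE.
apply: le_trans (embedding_norm_ub T0 (trajectory_inH1 (ltW T0) t0) _ (_ : 0 \in `[0, T])).
- exact: enorm_ge0.
- rewrite -(@ler_pXn2r _ 2) ?nnegrE ?Wnorm_ge0// (Wnorm_sqr T0 t0) expr1n.
  rewrite L2norm_sqr; last exact: inL2_cst.
  rewrite big1 ?addr0//; move=> i _; by rewrite (@eq_Int _ _ _ _ (fun=> 0)) ?Int_cst ?mul0r// ?ltW// => t _; rewrite mxE expr0n.
by rewrite in_itv/= lexx ltW.
Qed.

(** A nonzero constant function already gives a positive lower bound for the supremum. *)
Lemma embedding_norm_gt0 (T : R) : 0 < T -> (0 < n)%N -> 0 < embedding_norm n T.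
Proof.
(* This [k] makes the constant function [k] on [[0, T]] have norm 1 in W_T. *)
move=> T0 n0; pose i0 := Ordinal n0; pose k := (Num.sqrt T)^-1.
have sT0 : 0 < Num.sqrt T by rewrite sqrtr_gt0.
have k0 : 0 < k by rewrite invr_gt0.
pose c : 'cV[R]_n := \col_i (k * (i == i0)%:R).
have tc : trajectory 0 T (fun=> c) (fun=> 0).
  move=> i; apply: eq_is_primitive (is_primitive_intro (c i 0) (square_integrable_cst 0 T 0)) => //.
  - exact: ltW.
  - move=> t; rewrite in_itv/= => /andP[tt _]; by rewrite Int_cst// mul0r addr0.
  - by move=> t _; rewrite [RHS]mxE.
have ce : enorm c ^+ 2 = k ^+ 2.
  rewrite enorm_sqr (bigD1 i0)//= big1 ?addr0; first by rewrite mxE eqxx mulr1.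
  by move=> i /negbTE ii; rewrite mxE ii mulr0 expr0n.
apply: (@lt_le_trans _ _ (enorm c)).
  rewrite lt0r enorm_ge0 andbT; apply/eqP => ce0; move: ce; rewrite ce0 expr0n/= => /eqP.
  by rewrite eq_sym expf_eq0/= gt_eqF.
apply: (embedding_norm_ub (y := fun=> c) (t := 0) T0 (trajectory_inH1 (ltW T0) tc)); last first.
  by rewrite in_itv/= lexx ltW.
rewrite -(@ler_pXn2r _ 2) ?nnegrE ?Wnorm_ge0// (Wnorm_sqr T0 tc) expr1n.
rewrite !L2norm_sqr; [|exact: inL2_cst|exact: inL2_cst].
rewrite big1 ?add0r; last first.
  by move=> i _; rewrite (@eq_Int _ _ _ _ (fun=> 0)) ?Int_cst ?mul0r// ?ltW// => t _; rewrite mxE expr0n.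
rewrite (eq_bigr (fun i => c i 0 ^+ 2 * T)) => [|i _]; last by rewrite Int_cst ?subr0 ?ltW.
by rewrite -mulr_suml -enorm_sqr ce /k exprVn sqr_sqrtr ?(ltW T0)// mulVf ?lexx ?lt0r_neq0.
Qed.

End BigBall.

(** A trajectory of norm at most [M] stays in the ball of radius [e], half the radius of [bigball],
    so a margin [e] remains. The tube radius [e / n] accounts for the passage from the maximum norm
    to the Euclidean norm. *)
Lemma bigball_tube {R : realType} {n m : nat} (P : ocp R n m) (M : R) : 0 < hor P -> 0 < M ->
  exists2 r : R, 0 < r & forall (y : R -> 'cV[R]_n) t, inH1 0 (hor P) y -> Wnorm (hor P) y <= M ->
    t \in `[0, hor P] -> forall x, `|x - y t| <= r -> bigball P M x.
Proof.
move=> T0 M0; set e := M * embedding_norm n (hor P).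
have e0 : 0 <= e by rewrite mulr_ge0 ?(ltW M0)// embedding_norm_ge0.
(* In dimension 0 every vector has norm zero, so any radius serves. *)
have [n0|n0] := posnP n.
  exists 1 => // y t _ _ _ x _; rewrite /bigball /= -/e.
  have x0 : enorm x ^+ 2 = 0.
    by rewrite enorm_sqr big1// => i; have := ltn_ord i; rewrite {2}n0.
  by move/eqP: x0; rewrite expf_eq0/= => /eqP ->; rewrite mulr_ge0.
have e1 : 0 < e by rewrite mulr_gt0// embedding_norm_gt0.
have nR : 0 < n%:R :> R by rewrite ltr0n.
exists (e / n%:R); first by rewrite divr_gt0.
move=> y t yH yW tT x xy; rewrite /bigball/= -/e.
have := embedding_norm_scale T0 M0 yH yW tT; rewrite -/e => ye.
have we : enorm (x - y t) <= e.
  by apply: (le_trans (enorm_le _)); rewrite mulrC -ler_pdivlMr.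
rewrite -(@ler_pXn2r _ 2) ?nnegrE ?enorm_ge0//; last by rewrite mulr_ge0.
rewrite -[x](subrK (y t)); apply: (le_trans (enormD_sqr_le _ _)).
have : enorm (x - y t) ^+ 2 <= e ^+ 2 by rewrite lerXn2r ?nnegrE ?enorm_ge0.
have : enorm (y t) ^+ 2 <= e ^+ 2 by rewrite lerXn2r ?nnegrE ?enorm_ge0.
suff H (A B E : R) : A <= E ^+ 2 -> B <= E ^+ 2 -> 2 * B + 2 * A <= (2 * E) ^+ 2 by exact: H.
by rewrite exprMn; lra.
Qed.

Section GradientBound.
Context {R : realType} {n : nat}.

Lemma norm_le_sqr (x c : R) : 0 <= c -> x ^+ 2 <= c ^+ 2 -> `|x| <= c.
Proof. by move=> c0; rewrite -[x ^+ 2]real_normK ?num_real// ler_pXn2r ?nnegrE. Qed.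

(** A function that is differentiable at [x] and touched there from above by a quadratic polynomial
    has the gradient of that polynomial: small displacements in both directions of a coordinate axis
    give the two inequalities. *)
Lemma grad_of_upper_bound (B : set 'cV[R]_n) (h : 'cV[R]_n -> R) (x G q : 'cV[R]_n) (C r : R) :
  nbhs x B -> has_grad_in B h x G -> 0 <= C -> 0 < r ->
  (forall v, `|v| <= r -> h (x + v) - h x <= dotv q v + C * `|v| ^+ 2) -> G = q.
Proof.
move=> xB hG C0 r0 hq.
suff H k : (G - q) k 0 = 0.
  apply/matrixP => i j; rewrite ord1; have := H i; rewrite !mxE => /eqP.
  by rewrite subr_eq0 => /eqP.
have bd (s : R) : (s = 1 \/ s = -1) -> forall d : R, 0 < d -> s * (G - q) k 0 <= d.
  move=> ss d d0; have d2 : 0 < d / 2 by rewrite divr_gt0.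
  have N : \forall z \near nbhs x, `|h z - h x - dotv G (z - x)| <= d / 2 * `|z - x|.
    have W : \forall z \near nbhs x, B z -> `|h z - h x - dotv G (z - x)| <= d / 2 * `|z - x| := hG _ d2.
    by apply: filterS2 xB W => z Bz /(_ Bz).
  have /nbhs_ballP[e /= e0 He] := N.
  (* Small enough for the upper bound, for the differentiability estimate, and for the quadratic
     term to cost at most half of [d]. *)
  pose t := Num.min (Num.min r (e / 2)) (d / (2 * (C + 1))).
  have C1 : 0 < C + 1 by rewrite ltr_wpDl.
  have t0 : 0 < t by rewrite !lt_min r0 !divr_gt0// mulr_gt0.
  have tr : t <= r by rewrite !ge_min lexx.
  have te : t < e.
    apply: (@le_lt_trans _ _ (e / 2)); first by rewrite !ge_min lexx orbT.
    by rewrite ltr_pdivrMr// mulr2n mulrDr mulr1 ltrDl.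
  have tC : t * (C + 1) <= d / 2.
    have : t <= d / (2 * (C + 1)) by rewrite !ge_min lexx orbT.
    by rewrite ler_pdivlMr ?mulr_gt0// ler_pdivlMr// mulrA mulrAC.
  pose v : 'cV[R]_n := (t * s) *: delta_mx k 0.
  have s1 : `|s| = 1 by case: ss => ->; rewrite ?normrN normr1.
  have vN : `|v| <= t.
    apply: cV_norm_le => [|i]; first exact: ltW.
    rewrite !mxE normrM normrM s1 mulr1 (gtr0_norm t0) eqxx andbT.
    by case: (i == k); rewrite ?normr1 ?normr0 ?mulr1 ?mulr0// ltW.
  have A1 := hq v (le_trans vN tr).
  have : `|h (x + v) - h x - dotv G v| <= d / 2 * `|v|.
    have xv : x + v - x = v by rewrite addrAC subrr add0r.
    have := He (x + v); rewrite /= xv; apply.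
    by rewrite -ball_normE /ball_/= opprD addrA subrr add0r normrN (le_lt_trans vN).
  rewrite ler_norml => /andP[A2 _].
  have A3 : dotv G v - dotv q v = t * (s * (G - q) k 0).
    by rewrite -dotvBl dotvZr dotv_delta mulrA.
  have v2 : `|v| ^+ 2 <= t ^+ 2 by rewrite ler_pXn2r ?nnegrE ?(ltW t0).
  have : t * (s * (G - q) k 0) <= t * d.
    have := ler_wpM2l C0 v2; have := ler_wpM2l (ltW d2) vN; rewrite -A3.
    have := ler_wpM2l (ltW t0) tC; have : 0 <= t ^+ 2 by exact: sqr_ge0.
    move: A1 A2; clear => *; nra.
  by rewrite ler_pM2l.
apply/eqP; rewrite eq_le; apply/andP; split; apply/ler_addgt0Pr => d d0.
  have := bd 1 (or_introl erefl) d d0; lra.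
have := bd (-1) (or_intror erefl) d d0; lra.
Qed.

End GradientBound.

Lemma exists_of_exists2 (T : Type) (P Q : T -> Prop) :
  (exists2 x, P x & Q x) -> exists x, P x /\ Q x.
Proof. by move=> [x Px Qx]; exists x. Qed.

(** * Expansion of the cost in the initial value under a fixed control *)

Section Sensitivity.
Context {R : realType} {n m : nat} (P : ocp R n m).
Local Notation T := (hor P).
Context (A1 : regA1 P) (std : standing P).
Implicit Types (y p : R -> 'cV[R]_n) (u : R -> 'cV[R]_m).

Lemma gronwall_factor_mono (K K' d d' : R) : 0 <= K -> K <= K' -> 0 <= d -> d <= d' ->
  gronwall_factor K d <= gronwall_factor K' d'.
Proof.
move=> K0 KK d0 dd; apply: (le_trans (gronwall_factor_le d0 KK)).
rewrite /gronwall_factor ler_wpM2l// ler_expR ler_wpM2l// mulr_ge0// addr_ge0//; exact: le_trans KK.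
Qed.

Lemma dotv_mulmx k (A : 'M[R]_(k, n)) (x : 'cV[R]_k) (v : 'cV[R]_n) :
  dotv (A^T *m x) v = dotv x (A *m v).
Proof. by rewrite /dotv trmx_mul trmxK mulmxA. Qed.

Lemma dotvDl (G H v : 'cV[R]_n) : dotv (G + H) v = dotv G v + dotv H v.
Proof. by rewrite !dotvE -big_split/=; apply: eq_bigr => i _; rewrite mxE mulrDl. Qed.

Lemma dotvNl (G v : 'cV[R]_n) : dotv (- G) v = - dotv G v.
Proof. by rewrite !dotvE -sumrN; apply: eq_bigr => i _; rewrite mxE mulNr. Qed.

Lemma dotv_integrable a b (v w : R -> 'cV[R]_n) : inL2 a b v -> inL2 a b w ->
  integrable_on a b (fun s => dotv (v s) (w s)).
Proof.
move=> vL2 wL2; apply: (@eq_integrable_on _ _ _ (fun s => \sum_i v s i 0 * w s i 0)) => [s _|].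
  by rewrite dotvE.
by apply: integrable_on_sum => i; exact: integrable_onM (vL2 i) (wL2 i).
Qed.

Lemma trajectory_by_parts a b (y v z w : R -> 'cV[R]_n) : a <= b ->
  trajectory a b y v -> trajectory a b z w ->
  Int a b (fun s => dotv (v s) (z s)) + Int a b (fun s => dotv (y s) (w s)) =
  dotv (y b) (z b) - dotv (y a) (z a).
Proof.
move=> ab ty tz.
have yL2 := continuous_inL2 (trajectory_continuous ty); have vL2 := trajectory_inL2 ty.
have zL2 := continuous_inL2 (trajectory_continuous tz); have wL2 := trajectory_inL2 tz.
have E (g h : R -> 'cV[R]_n) : inL2 a b g -> inL2 a b h ->
    Int a b (fun s => dotv (g s) (h s)) = \sum_i Int a b (fun s => g s i 0 * h s i 0).
  move=> gL2 hL2; rewrite -Int_sum => [|i]; last exact: integrable_onM (gL2 i) (hL2 i).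
  by apply: eq_Int => s _; rewrite dotvE.
rewrite !E// !dotvE -big_split -sumrB; apply: eq_bigr => i _ /=.
exact: Int_by_parts ab (ty i) (tz i).
Qed.

Lemma trajectoryB a b (y v z w : R -> 'cV[R]_n) : a <= b -> trajectory a b y v ->
  trajectory a b z w -> trajectory a b (fun t => y t - z t) (fun t => v t - w t).
Proof.
move=> ab ty tz i; apply: eq_is_primitive (is_primitiveB (ty i) (tz i)) => // t _; by rewrite !mxE.
Qed.

(** The adjoint operator is the transpose of the linearized dynamics, so pairing with [p] leaves the
    second-order Taylor remainder, with a factor linear in the size of the control. *)
Lemma control_rhs_expansion (rho : R) : exists2 L, 0 <= L &
  forall t u (x x' p : 'cV[R]_n), t \in `[0, T] -> `|x| <= rho -> `|x'| <= rho ->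
  `|dotv p (control_rhs P u t x' - control_rhs P u t x)
    - dotv ((jac (fdyn P t) x)^T *m p + Dgt P t x (u t) p) (x' - x)| <=
  L * (1 + enorm (u t)) * `|p| * `|x' - x| ^+ 2.
Proof.
have /choice[Lf HLf] i := exists_of_exists2 (C2_field_box rho (f_field A1 i)).
have /choice[Lg HLg] (ij : 'I_n * 'I_m) := exists_of_exists2 (C2_field_box rho (g_field A1 ij.1 ij.2)).
pose Mc := \sum_i Lf i + \sum_ij Lg ij.
have f0 i : 0 <= Lf i by have [] := HLf i.
have g0 ij : 0 <= Lg ij by have [] := HLg ij.
have sf0 : 0 <= \sum_i Lf i by apply: sumr_ge0.
have sg0 : 0 <= \sum_ij Lg ij by apply: sumr_ge0.
have fM i : Lf i <= Mc.
  by apply: ler_wpDr => //; rewrite (bigD1 i)//= lerDl; apply: sumr_ge0.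
have gM ij : Lg ij <= Mc.
  by apply: ler_wpDl => //; rewrite (bigD1 ij)//= lerDl; apply: sumr_ge0.
have Mc0 : 0 <= Mc by rewrite addr_ge0.
exists (n%:R * ((1 + m%:R) * Mc)); first by rewrite !mulr_ge0// addr_ge0.
move=> t u x x' p tT xr xr'; set d := x' - x; have e0 := enorm_ge0 (u t).
rewrite dotvDl dotv_mulmx.
have -> : dotv (Dgt P t x (u t) p) d =
    \sum_i p i 0 * \sum_j u t j 0 * dotv (grad (fun z => gdyn P t z i j) x) d.
  rewrite dotvE; under eq_bigr => k _ do rewrite mxE mulr_suml.
  rewrite exchange_big/=; apply: eq_bigr => i _.
  under eq_bigr => k _ do rewrite mulr_suml.
  rewrite exchange_big mulr_sumr/=; apply: eq_bigr => j _.
  rewrite dotvE !mulr_sumr; apply: eq_bigr => k _; ring.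
rewrite !dotvE -big_split/= -sumrB; apply: (le_trans (ler_norm_sum _ _ _)).
apply: (@le_trans _ _ (\sum_(i < n) (1 + m%:R) * Mc * (1 + enorm (u t)) * `|p| * `|d| ^+ 2)); last first.
  rewrite sumr_const card_ord -[leLHS]mulr_natl le_eqVlt; apply/orP; left; apply/eqP; ring.
apply: ler_sum => i _; rewrite jac_mul_entry.
have -> : (control_rhs P u t x' - control_rhs P u t x) i 0 = (fdyn P t x' i 0 - fdyn P t x i 0)
    + \sum_j u t j 0 * (gdyn P t x' i j - gdyn P t x i j).
  rewrite !mxE opprD addrACA -sumrB; congr (_ + _); apply: eq_bigr => j _.
  by rewrite -mulrBl mulrC.
rewrite -mulrDr -mulrBr normrM.
have -> : (1 + m%:R) * Mc * (1 + enorm (u t)) * `|p| * `|d| ^+ 2 =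
    `|p| * ((1 + m%:R) * Mc * (1 + enorm (u t)) * `|d| ^+ 2) by ring.
apply: ler_pM => //; first exact: entry_le_mx_norm.
rewrite opprD addrACA -sumrB.
have [_ /(_ t x x' tT xr xr')[_ F]] := HLf i.
have D0 := sqr_ge0 `|d|.
have G : `|\sum_j (u t j 0 * (gdyn P t x' i j - gdyn P t x i j) -
     u t j 0 * dotv (grad (fun z => gdyn P t z i j) x) d)| <= m%:R * (Mc * enorm (u t) * `|d| ^+ 2).
  apply: (le_trans (ler_norm_sum _ _ _)).
  apply: (@le_trans _ _ (\sum_(j < m) Mc * enorm (u t) * `|d| ^+ 2)); last first.
    by rewrite sumr_const card_ord mulr_natl.
  apply: ler_sum => j _; rewrite -mulrBr normrM [Mc * _]mulrC -mulrA.
  have [_ /(_ t x x' tT xr xr')[_ H]] := HLg (i, j).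
  apply: ler_pM => //; first exact: entry_le_enorm.
  by apply: (le_trans H); rewrite ler_wpM2r.
have F' := le_trans F (ler_wpM2r D0 (fM i)).
apply: (le_trans (ler_normD _ _)); apply: (le_trans (lerD F' G)).
rewrite -/d -subr_ge0.
have -> : (1 + m%:R) * Mc * (1 + enorm (u t)) * `|d| ^+ 2
    - (Mc * `|d| ^+ 2 + m%:R * (Mc * enorm (u t) * `|d| ^+ 2)) =
    Mc * `|d| ^+ 2 * (m%:R + enorm (u t)) by ring.
by rewrite !mulr_ge0// addr_ge0.
Qed.

(** [z] is driven by the same control from a shifted initial value. Integrating [p] by parts against
    [z - y] cancels all first-order terms except [p t] paired with [h]. The constants are uniform in
    [t]. *)
Lemma cost_expansion y u p : controlled P 0 T y u ->
  trajectory 0 T p (fun s => adjoint_rhs P y u s (p s)) ->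
  p T = (Q2 P)^T *m Q2 P *m (y T - ydT P) ->
  exists C r : R, [/\ 0 <= C, 0 < r & forall t h, t \in `]0, T[ -> `|h| <= r ->
    exists z, [/\ controlled P t T z u, z t = y t + h &
      cost P t z u - cost P t y u <= dotv (p t) h + C * `|h| ^+ 2]].
Proof.
move=> [uL2 ty] tp pT; have T0 := hor_gt0 std.
have cy := trajectory_continuous ty.
have [rho0 rho00 yr0] := continuous_bounded_norm cy.
have [B B0 pB] := continuous_bounded_norm (trajectory_continuous tp).
pose rho := rho0 + 1.
have yr t : t \in `[0, T] -> `|y t| <= rho.
  by move=> tT; apply: (le_trans (yr0 t tT)); rewrite lerDl.
have [L L0 HL] := control_rhs_lip A1 rho.
have [L2 L20 HL2] := control_rhs_expansion rho.
pose l s := L * (1 + enorm (u s)).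
have sl : square_integrable 0 T l by apply: square_integrableZ; exact: one_plus_enorm_sqi.
have l0 s : 0 <= l s by rewrite mulr_ge0// addr_ge0// enorm_ge0.
pose K := Int 0 T (fun s => l s ^+ 2).
have K0 : 0 <= K by apply: Int_ge0 => s _; exact: sqr_ge0.
pose S := Num.sqrt (gronwall_factor K T).
have S0 : 0 <= S by exact: sqrtr_ge0.
have S2 : S ^+ 2 = gronwall_factor K T by rewrite sqr_sqrtr// gronwall_factor_ge0.
have e1 : square_integrable 0 T (fun s => 1 + enorm (u s)) by exact: one_plus_enorm_sqi.
have ie1 := square_integrable_integrable e1.
pose E := Int 0 T (fun s => 1 + enorm (u s)).
have E0 : 0 <= E by apply: Int_ge0 => s _; rewrite addr_ge0// enorm_ge0.
pose C2 := n%:R * (n%:R ^+ 2) * (T * `|Q1 P| ^+ 2 + `|Q2 P| ^+ 2).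
have C20 : 0 <= C2.
  by rewrite mulr_ge0// ?mulr_ge0 ?sqr_ge0// addr_ge0 ?sqr_ge0// mulr_ge0 ?sqr_ge0// ltW.
have S1 : 0 < S + 1 by rewrite ltr_wpDl.
(* The first summand is the integrated remainder of the dynamics, the second the quadratic part of
   the tracking cost. The radius ensures [S * |h| <= 1], so that [z] stays where the constants for
   [rho] are valid. *)
exists (L2 * B * S ^+ 2 * E + C2 * S ^+ 2), (S + 1)^-1; split.
- have S20 := sqr_ge0 S; clearbody C2 E; clear -L20 B0 S20 E0 C20.
  by apply: addr_ge0; do ?[exact: mulr_ge0 | apply: mulr_ge0 => //].
- by rewrite invr_gt0.
move=> t h; rewrite in_itv/= => /andP[t0 tT] hr.
have tsub s : s \in `[t, T] -> s \in `[0, T].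
  by rewrite !in_itv/= => /andP[ts ->]; rewrite (le_trans (ltW t0) ts).
have Sh : S * `|h| <= 1.
  apply: (@le_trans _ _ (S * (S + 1)^-1)); first by rewrite ler_wpM2l.
  by rewrite ler_pdivrMr// mul1r lerDl.
have tyt := trajectory_sub (ltW t0) (ltW tT) (lexx T) ty.
have slt : square_integrable t T l by exact: square_integrable_sub (ltW t0) (lexx T) sl.
have uL2t : inL2 t T u by exact: inL2_sub (ltW t0) (lexx T) uL2.
have near1 s x : s \in `[0, T] -> `|x - y s| <= 1 -> `|x| <= rho.
  move=> sT xy; rewrite -[x](subrK (y s)) addrC; apply: (le_trans (ler_normD _ _)).
  by rewrite lerD// yr0.
have Glip s x x' : s \in `[0, T] -> `|x| <= rho -> `|x'| <= rho ->
    `|control_rhs P u s x - control_rhs P u s x'| <= l s * `|x - x'|.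
  move=> sT xr xr'; have := HL s x' x u u sT xr' xr.
  by rewrite subrr enorm0 mulr0 addr0.
have Kt : Int t T (fun s => l s ^+ 2) <= K.
  rewrite /K (Int_split (ltW t0) (ltW tT) (square_integrable_sqr sl)) lerDr.
  by apply: Int_ge0 => s _; exact: sqr_ge0.
have Kt0 : 0 <= Int t T (fun s => l s ^+ 2) by apply: Int_ge0 => s _; exact: sqr_ge0.
have GF : gronwall_factor (Int t T (fun s => l s ^+ 2)) (T - t) *
    (`|y t + h - y t| ^+ 2 + (T - t) * Int t T (fun=> 0 ^+ 2)) <= (S * `|h|) ^+ 2.
  rewrite Int_cst ?(ltW tT)// expr0n mul0r mulr0 addr0 [y t + h]addrC addrK exprMn S2.
  by rewrite ler_wpM2r ?sqr_ge0// gronwall_factor_mono// ?subr_ge0 ?(ltW tT)// gerBl ltW.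
have [||||||||z [tz zt zy]] := tube_solution (ltW tT) (lF := l) (l := l) (d := fun=> 0)
    (F := fun s x => control_rhs P u s x) (y0 := y t + h) ler01 tyt.
- by move=> w cw _; exact: (control_rhs_inL2 A1 (ltW t0) (lexx T) cw uL2t).
- exact: slt.
- move=> s st x x' xy xy'; have sT := tsub _ (in_segment st).
  by apply: Glip => //; exact: near1 xy || exact: near1 xy'.
- exact: slt.
- exact: square_integrable_cst.
- by move=> s _.
- move=> s st x xy; have sT := tsub _ (in_segment st); rewrite addr0.
  by apply: Glip => //; [exact: near1 xy|exact: yr].
- by apply: (le_trans GF); rewrite expr1n expr_le1// mulr_ge0.
have dB s : s \in `[t, T] -> `|z s - y s| <= S * `|h|.
  move=> st; rewrite -(@ler_pXn2r _ 2) ?nnegrE ?mulr_ge0//.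
  exact: le_trans (zy s st) GF.
exists z; split=> //.
have cz := trajectory_continuous tz; have cyt := trajectory_continuous tyt.
rewrite (cost_split std (ltW t0) cz uL2t) (cost_split std (ltW t0) cyt uL2t).
rewrite (tracking_expand std (ltW t0) cyt cz).
have QB := quadratic_bound (ltW t0) (ltW tT) (mulr_ge0 S0 (normr_ge0 h)) cyt cz dB.
rewrite -/C2 exprMn in QB.
have td := trajectoryB (ltW tT) tz tyt.
have tpt := trajectory_sub (ltW t0) (ltW tT) (lexx T) tp.
(* The boundary terms are the terminal gradient of the cost at [T] and the pairing of [p t] with [h]
   at [t]. *)
have BP := trajectory_by_parts (ltW tT) tpt td.
have dL2 := continuous_inL2 (trajectory_continuous td).
have QL2 := tracking_inL2 std (ltW t0) cyt.
have QdL2 : inL2 t T (fun s => Q1 P *m (z s - y s)).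
  by apply: mulmx_inL2 => //; exact: const_continuous.
have i1 := dotv_integrable (trajectory_inL2 tpt) dL2.
have i2 := dotv_integrable (continuous_inL2 (trajectory_continuous tpt)) (trajectory_inL2 td).
have i3 := dotv_integrable QL2 QdL2.
(* By the adjoint equation the three integrands add up to the remainder bounded in
   [control_rhs_expansion]. *)
have Irem : Int t T (fun s => dotv (adjoint_rhs P y u s (p s)) (z s - y s)) +
   Int t T (fun s => dotv (p s) (control_rhs P u s (z s) - control_rhs P u s (y s))) +
   Int t T (fun s => dotv (Q1 P *m (y s - yd P s)) (Q1 P *m (z s - y s)))
   <= L2 * B * (S ^+ 2 * `|h| ^+ 2) * E.
  rewrite -IntD// -IntD//; last exact: integrable_onD.
  have ie1t : integrable_on t T (fun s => 1 + enorm (u s)) by exact: integrable_on_sub (ltW t0) (lexx T) ie1.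
  apply: (@le_trans _ _ (Int t T (fun s => L2 * B * (S ^+ 2 * `|h| ^+ 2) * (1 + enorm (u s))))).
    apply: Int_le; [by do 2 apply: integrable_onD => //|exact: integrable_onZ|].
    move=> s st; have sT := tsub _ (in_segment st); have st' := in_segment st.
    have zr : `|z s| <= rho.
      by apply: (near1 _ _ sT); exact: le_trans (dB s st') Sh.
    have := HL2 s u (y s) (z s) (p s) sT (yr s sT) zr.
    have -> : dotv (adjoint_rhs P y u s (p s)) (z s - y s) =
       - dotv ((jac (fdyn P s) (y s))^T *m p s + Dgt P s (y s) (u s) (p s)) (z s - y s)
       - dotv (Q1 P *m (y s - yd P s)) (Q1 P *m (z s - y s)).
      by rewrite /adjoint_rhs dotvNl dotvDl opprD -mulmxA dotv_mulmx.
    set a1 := dotv (_ + _) _; set a2 := dotv (p s) _; set a3 := dotv (Q1 P *m _) _.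
    have -> : - a1 - a3 + a2 + a3 = a2 - a1 by ring.
    move=> H; apply: (le_trans (ler_norm _)); apply: (le_trans H).
    have dB2 : `|z s - y s| ^+ 2 <= S ^+ 2 * `|h| ^+ 2.
      by rewrite -exprMn lerXn2r ?nnegrE ?mulr_ge0// dB.
    have -> : L2 * B * (S ^+ 2 * `|h| ^+ 2) * (1 + enorm (u s)) =
       (L2 * (1 + enorm (u s)) * B) * (S ^+ 2 * `|h| ^+ 2) by ring.
    have ue : 0 <= 1 + enorm (u s) by rewrite addr_ge0// enorm_ge0.
    apply: ler_pM => //; rewrite ?sqr_ge0 ?mulr_ge0//.
    by rewrite ler_wpM2l ?mulr_ge0// pB.
  rewrite IntZ// ler_wpM2l ?mulr_ge0 ?sqr_ge0//.
  rewrite /E (Int_split (ltW t0) (ltW tT) ie1) lerDr.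
  by apply: Int_ge0 => s _; rewrite addr_ge0// enorm_ge0.
rewrite zt [y t + h]addrC addrK pT -mulmxA dotv_mulmx in BP.
set I1 := Int _ _ _ in BP Irem; set I2 := Int _ _ _ in BP Irem; set I3 := Int _ _ _ in Irem *.
set a := tracking_cost _ _ _; set b := beta P / 2 * _; set d2 := dotv (Q2 P *m _) _ in BP *.
set q := Int _ _ _ + _ in QB *.
have q0 : 0 <= q by rewrite addr_ge0 ?sqr_ge0// Int_ge0// => s _; exact: sqr_ge0.
have -> : a + (I3 + d2) + 2^-1 * q + b - (a + b) = I3 + d2 + 2^-1 * q by ring.
have -> : (L2 * B * S ^+ 2 * E + C2 * S ^+ 2) * `|h| ^+ 2 =
  L2 * B * (S ^+ 2 * `|h| ^+ 2) * E + C2 * (S ^+ 2 * `|h| ^+ 2) by ring.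
move: q0 QB Irem BP; clear; lra.
Qed.

End Sensitivity.

(** * The competitor built from the approximating parameter *)

Section ValueGradient.
Context {R : realType} {n m : nat} (P : ocp R n m) (M : R).
Local Notation T := (hor P).
Context (A1 : regA1 P) (std : standing P) (A2 : regA2 P M).
Local Notation B := (bigball P M).
Implicit Types (y p : R -> 'cV[R]_n) (u : R -> 'cV[R]_m).

Lemma nbhs_tube (x : 'cV[R]_n) (D : set 'cV[R]_n) (r : R) : 0 < r ->
  (forall z, `|z - x| <= r -> D z) -> nbhs x D.
Proof.
move=> r0 H; apply/nbhs_ballP; exists r => // z.
by rewrite -ball_normE /ball_/= distrC => /ltW; exact: H.
Qed.

Lemma Vstar_has_grad t x : t \in `[0, T] -> B x ->
  has_grad_in B (Vstar P t) x (grad_in B (Vstar P t) x).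
Proof.
case: A2 => _ _ HC _ tT Bx.
have [G [[HG _ _] _]] : exists G, C2_field `[0, T]%classic B (fun t x => Vstar P t x) G.
  by apply: (@C2_field_pair _ _ _ _ _ (fun z => Vstar P z.1 z.2) id HC) => // u; exact: lexx.
exact: grad_in_spec (HG t x tT Bx).
Qed.

Lemma grad_Vstar_adjoint (y0 : 'cV[R]_n) y u p t (r : R) : minimizer P y0 y u ->
  trajectory 0 T p (fun s => adjoint_rhs P y u s (p s)) ->
  p T = (Q2 P)^T *m Q2 P *m (y T - ydT P) ->
  0 < r -> (forall x, `|x - y t| <= r -> B x) -> t \in `]0, T[ ->
  grad_in B (Vstar P t) (y t) = p t.
Proof.
move=> ymin tp pT r0 tube tT; have T0 := hor_gt0 std.
have [cyu _] := admissible_controlled T0 ymin.1.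
have [C [r' [C0 r'0 H]]] := cost_expansion A1 std cyu tp pT.
have By : B (y t) by apply: tube; rewrite subrr normr0 ltW.
(* The costs of the shifted trajectories bound the value from above, with equality at [v = 0] by
   optimality of [y]. *)
apply: (grad_of_upper_bound (nbhs_tube r0 tube) (Vstar_has_grad (in_segment tT) By) C0 r'0) => v vr.
have [z [cz zt zc]] := H t v tT vr.
rewrite (Vstar_along_minimizer A1 std ymin tT); apply: le_trans zc; rewrite lerD2r -zt.
apply: Vstar_le_cost => //; apply: controlled_admissible cz.
by move: tT; rewrite in_itv/= => /andP[_ /ltW].
Qed.

End ValueGradient.

(** * Feedback laws built from gradient fields *)

Section Feedback.
Context {R : realType} {n m : nat} (P : ocp R n m).
Local Notation T := (hor P).
Context (A1 : regA1 P) (std : standing P).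

(** Arranged so that only the second field enters through its size; in the application this is the
    value gradient along the optimal trajectory, which is the bounded adjoint. *)
Lemma feedback_diff (rho : R) : exists2 K, 0 <= K &
  forall (G G' : R -> 'cV[R]_n -> 'cV[R]_n) t x x', t \in `[0, T] -> `|x| <= rho -> `|x'| <= rho ->
  `|feedback P G t x - feedback P G' t x'| <= K * (`|x - x'| * `|G' t x'| + `|G t x - G' t x'|).
Proof.
have [_ /(_ rho)[L L0 HL]] := g_loc_lip A1.
have b0 : 0 <= (beta P)^-1 by rewrite invr_ge0; case: std => _ _ _ /ltW.
exists ((beta P)^-1 * (n%:R * L)); first by rewrite !mulr_ge0.
move=> G G' t x x' tT xr xr'; rewrite /feedback.
have [F1 _] := HL t x x' tT xr xr'; have [_ F2] := HL t x' x tT xr' xr.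
move: (G t x) (G' t x') => a a'.
have -> : - ((beta P)^-1 *: ((gdyn P t x)^T *m a)) - - ((beta P)^-1 *: ((gdyn P t x')^T *m a')) =
   - ((beta P)^-1 *: ((gdyn P t x - gdyn P t x')^T *m a' + (gdyn P t x)^T *m (a - a'))).
  rewrite [(gdyn P t x - _)^T]linearB/= mulmxBl mulmxBr.
  by apply/matrixP => i j; rewrite !mxE; ring.
rewrite normrN normrZ ger0_norm// -[leRHS]mulrA; apply: ler_wpM2l => //.
apply: (le_trans (ler_normD _ _)); rewrite mulrDr; apply: lerD.
  apply: (le_trans (mulmx_norm_le _ _)); rewrite trmx_norm -!mulrA ler_wpM2l// mulrA.
  by apply: ler_wpM2r.
apply: (le_trans (mulmx_norm_le _ _)); rewrite trmx_norm.
by apply: ler_wpM2r => //; rewrite ler_wpM2l.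
Qed.

Lemma feedback_loc_lip (G : R -> 'cV[R]_n -> 'cV[R]_n) : loc_lip 0 T G -> loc_lip 0 T (feedback P G).
Proof.
move=> lG.
have -> : feedback P G = fun t x => (- (beta P)^-1) *: ((gdyn P t x)^T *m G t x).
  by apply/funext => t; apply/funext => x; rewrite /feedback scaleNr.
apply: loc_lipZ; apply: loc_lipM => //; apply: loc_lip_tr; exact: g_loc_lip.
Qed.

Lemma closed_loop_loc_lip (G : R -> 'cV[R]_n -> 'cV[R]_n) : loc_lip 0 T G ->
  loc_lip 0 T (fun t x => fdyn P t x + gdyn P t x *m feedback P G t x).
Proof.
move=> lG; apply: loc_lipD; first exact: f_loc_lip.
by apply: loc_lipM; [exact: g_loc_lip|exact: feedback_loc_lip].
Qed.

End Feedback.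

Section Ansatz.
Context {R : realType} {n : nat}.

Lemma Vth_field (a b : R) (A : ansatz R n) e (th : 'cV[R]_(pdim A e)) :
  Ck_on [set: 'cV[R]_(pdim A e) * R * 'cV[R]_n] 4 (fun z => Vth z.1.1 z.1.2 z.2) ->
  C2_field `[a, b]%classic setT (fun t x => Vth th t x) (fun t x => grad (Vth th t) x).
Proof.
move=> /Ck_on_succ/Ck_on_succ HC; suff [G] : exists G, C2_field `[a, b]%classic setT (fun t x => Vth th t x) G.
  exact: C2_field_grad.
apply: (@C2_field_of_Ck _ _ _ _ _ (fun z => Vth z.1.1 z.1.2 z.2) _ _
  (fun t x => ((th, t), x)) (fun v => (0, v)) id HC) => //.
- by move=> t x z; rewrite -[LHS]/((th - th, t - t), z - x) !subrr.
- exact: pair0_norm.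
- exact: pair0_sum.
- move=> z; have c1 : (fun w : R * 'cV[R]_n => (th, w.1)) @ z --> (th, z.1).
    by apply: (@cvg_pair _ _ _ _ (nbhs th) (nbhs z.1)); [exact: cvg_cst|exact: cvg_fst].
  by apply: (@cvg_pair _ _ _ _ (nbhs (th, z.1)) (nbhs z.2)); [exact: c1|exact: cvg_snd].
Qed.

(** A scalar field is regarded as a 1 by 1 matrix field, to which [loc_lip_along] applies. *)
Lemma C1_field_along (a b : R) (h : R -> 'cV[R]_n -> R) G (y : R -> 'cV[R]_n) :
  C1_field `[a, b]%classic setT h G -> {within `[a, b], continuous y} ->
  {within `[a, b], continuous (fun t => h t (y t))}.
Proof.
move=> hG cy.
have : loc_lip a b (fun t x => h t x *: (1%:M : 'M[R]_1)).
  apply: loc_lip_of_C1 => i j; exists G; move: hG; apply: eq_C1_field_fun => t x _ _.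
  by rewrite !mxE !ord1 eqxx mulr1.
move=> /loc_lip_along/(_ cy)/within_continuous_mx/(_ 0 0).
rewrite (_ : (fun t => _) = fun t => h t (y t))//; apply/funext => t.
by rewrite !mxE eqxx mulr1.
Qed.

End Ansatz.

Section CostMonotone.
Context {R : realType} {n m : nat} (P : ocp R n m) (std : standing P).
Local Notation T := (hor P).

(** On [[0, T]] the remaining cost is nonincreasing in time, because the running cost is
    nonnegative. *)
Lemma cost_measurable (y : R -> 'cV[R]_n) (u : R -> 'cV[R]_m) : {within `[0, T], continuous y} ->
  inL2 0 T u -> measurable_fun `]0, T[ (fun t => cost P t y u).
Proof.
move=> cy uL2; have T0 := hor_gt0 std.
(* Clamping the time to [[0, T]] makes the function monotone on the whole line. *)
apply: (@eq_measurable_fun _ _ _ _ _ (fun t => cost P (Num.max 0 (Num.min T t)) y u)) => [t|].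
  by rewrite inE/= in_itv/= => /andP[t0 tT]; rewrite min_r ?max_r// ltW.
apply: nonincreasing_measurable => // s' t' st'.
set s := Num.max 0 (Num.min T s'); set t := Num.max 0 (Num.min T t').
have st : s <= t by rewrite /s /t ge_max !le_max lexx/= le_min !ge_min lexx st' !orbT.
have s0 : 0 <= s by rewrite le_max lexx.
have t0 : 0 <= t by rewrite le_max lexx.
have tT : t <= T by rewrite ge_max ge_min lexx ltW.
have sT := le_trans st tT.
have iF := running_integrable std (lexx 0) cy uL2.
have E1 := cost_additive std t0 tT cy uL2.
have E2 := cost_additive std s0 sT cy uL2.
have : 0 <= Int s t (running P y u).
  have b0 : 0 <= beta P by case: std => _ _ _ /ltW.
  by apply: Int_ge0 => x _; apply: addr_ge0; rewrite ?sqr_ge0// mulr_ge0// sqr_ge0.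
rewrite -(Int_additive s0 _ tT iF)//.
lra.
Qed.

End CostMonotone.

Section Competitor.
Context {R : realType} {n m : nat} (P : ocp R n m) (M : R).
Local Notation T := (hor P).
Local Notation B := (bigball P M).
Context (A1 : regA1 P) (std : standing P) (A2 : regA2 P M).
Context (A : ansatz R n) (e0 : R) (thapp : forall e, 'cV[R]_(pdim A e)).
Context (AP : approx_assumption P M e0 thapp).
Implicit Types (y p : R -> 'cV[R]_n) (u : R -> 'cV[R]_m).

Lemma Vth_approx_field e : 0 < e <= e0 ->
  C2_field `[0, T]%classic setT (fun t x => Vth (thapp e) t x) (fun t x => grad (Vth (thapp e) t) x).
Proof. by case: AP => _ + _ => /[apply] -[_ HC _]; exact: Vth_field. Qed.

(** At interior points of the ball the gradient relative to the ball is unique, so the assumed bound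
    on the gradient of the difference bounds the difference of the gradients. *)
Lemma approx_gradient : exists2 c, 0 <= c & forall e, 0 < e <= e0 -> forall t x, t \in `[0, T] ->
  nbhs x B -> `|Vth (thapp e) t x - Vstar P t x| <= c * e /\
  `|grad (Vth (thapp e) t) x - grad_in B (Vstar P t) x| <= c * e.
Proof.
case: (AP) => _ _ [c [c0 Hc]]; exists c; first exact: ltW.
move=> e ee t x tT xB; have Bx := nbhs_singleton xB.
have := Hc e ee t x tT Bx; set D := fun z => _.
have [[/(_ t x tT Logic.I) hV _ _] _] := Vth_approx_field ee.
have hD : has_grad_in B D x (grad (Vth (thapp e) t) x - grad_in B (Vstar P t) x).
  apply: has_grad_inB; first exact: has_grad_in_sub hV.
  exact: Vstar_has_grad.
rewrite /= (has_grad_in_grad_in hD xB) => H.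
have := enorm_ge0 (hess_in B D x); have := mx_norm_le_enorm (grad (Vth (thapp e) t) x - grad_in B (Vstar P t) x).
have := normr_ge0 (D x); have := enorm_ge0 (grad (Vth (thapp e) t) x - grad_in B (Vstar P t) x).
rewrite -/(D x); move: H; move: (enorm (hess_in _ _ _)) (enorm _) `|D x| `|_ - _| => a b d f *.
by split; lra.
Qed.

(** Two errors add up: the approximation error of the gradient at [x], and the variation of the
    gradient of V* between [x] and [y t], where it equals [p t]. *)
Lemma approx_feedback (y0 : 'cV[R]_n) y p (r : R) : minimizer P y0 y (Fstar P M y) ->
  trajectory 0 T p (fun s => adjoint_rhs P y (Fstar P M y) s (p s)) ->
  p T = (Q2 P)^T *m Q2 P *m (y T - ydT P) -> 0 < r ->
  (forall t x, t \in `[0, T] -> `|x - y t| <= r -> nbhs x B) ->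
  exists2 K, 0 <= K & forall e, 0 < e <= e0 -> forall t x, t \in `]0, T[ -> `|x - y t| <= r ->
    `|grad (Vth (thapp e) t) x - p t| <= K * (`|x - y t| + e) /\
    `|feedback P (fun s => grad (Vth (thapp e) s)) t x - Fstar P M y t| <= K * (`|x - y t| + e).
Proof.
move=> ymin tp pT r0 tube; have T0 := hor_gt0 std.
have [cyu _] := admissible_controlled T0 ymin.1.
have [rho0 rho00 yr0] := continuous_bounded_norm (trajectory_continuous cyu.2).
have [Bp Bp0 pB] := continuous_bounded_norm (trajectory_continuous tp).
have [c c0 Hc] := approx_gradient.
case: (A2) => _ _ _ [Ls0 HLs].
(* The assumption does not fix the sign of the Lipschitz constant. *)
pose Ls : R := `|Ls0|; have Ls0' : 0 <= Ls by exact: normr_ge0.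
have BcL : 0 <= Bp + c + Ls by exact: addr_ge0 (addr_ge0 Bp0 c0) Ls0'.
have [K K0 HK] := feedback_diff A1 std (rho0 + r).
exists (c + Ls + K * (Bp + c + Ls)); first exact: addr_ge0 (addr_ge0 c0 Ls0') (mulr_ge0 K0 BcL).
move=> e ee t x tT xy; have tT' := in_segment tT.
have /andP[e_gt0 _] := ee.
have xB := tube t x tT' xy.
have yB : nbhs (y t) B by apply: (tube t (y t) tT'); rewrite subrr normr0 ltW.
have Gy : grad_in B (Vstar P t) (y t) = p t.
  apply: (grad_Vstar_adjoint A1 std A2 ymin tp pT r0 _ tT) => z zy.
  exact: nbhs_singleton (tube t z tT' zy).
have G1 : `|grad (Vth (thapp e) t) x - p t| <= c * e + Ls * `|x - y t|.
  have [_ H1] := Hc e ee t x tT' xB.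
  have [H2 _] := HLs t tT'.
  have := H2 (x, y t) (conj (nbhs_singleton xB) (nbhs_singleton yB)); rewrite /= Gy => H3.
  rewrite -[_ - p t](subrKA (grad_in B (Vstar P t) x)).
  apply: (le_trans (ler_normD _ _)); apply: lerD => //; apply: (le_trans H3).
  by rewrite ler_wpM2r// ler_norm.
have d0 := normr_ge0 (x - y t).
have KB : 0 <= K * (Bp + c + Ls) by exact: mulr_ge0.
split.
  apply: (le_trans G1); clear -c0 Ls0' KB d0 e_gt0.
  move: (K * _) `|x - y t| KB d0 => k d KB d0.
  have := mulr_ge0 c0 d0; have := mulr_ge0 Ls0' (ltW e_gt0).
  have := mulr_ge0 KB d0; have := mulr_ge0 KB (ltW e_gt0); lra.
have xr : `|x| <= rho0 + r.
  rewrite -[x](subrK (y t)) addrC; apply: (le_trans (ler_normD _ _)).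
  by rewrite lerD// yr0.
have yr : `|y t| <= rho0 + r by rewrite (le_trans (yr0 t tT'))// lerDl ltW.
have := HK (fun s => grad (Vth (thapp e) s)) (fun s => grad_in B (Vstar P s)) t x (y t) tT' xr yr.
rewrite Gy => /le_trans; apply.
have pBt := pB t tT'.
have H : `|x - y t| * `|p t| + `|grad (Vth (thapp e) t) x - p t| <= (Bp + c + Ls) * (`|x - y t| + e).
  have := ler_wpM2l d0 pBt; have := mulr_ge0 c0 d0; have := mulr_ge0 Ls0' (ltW e_gt0).
  have := mulr_ge0 Bp0 (ltW e_gt0).
  move: G1; move: `|grad _ _ - _| `|p t| `|x - y t| => g q d *; lra.
have := ler_wpM2l K0 H => /le_trans; apply.
rewrite [leRHS]mulrDl mulrA lerDr mulr_ge0 ?addr_ge0// ltW//.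
Qed.

Lemma Fth_loc_lip e : 0 < e <= e0 ->
  loc_lip 0 T (feedback P (fun s => grad (Vth (thapp e) s))).
Proof.
move=> ee; apply: feedback_loc_lip => //; exact: C2_field_loc_lip (Vth_approx_field ee).
Qed.

(** The approximate closed loop is a perturbation of the equation driven by the open-loop control
    [u], and the tube lemma gives existence and closeness at once. *)
Lemma closed_loop_competitor (y0 : 'cV[R]_n) y p (r : R) : minimizer P y0 y (Fstar P M y) ->
  trajectory 0 T p (fun s => adjoint_rhs P y (Fstar P M y) s (p s)) ->
  p T = (Q2 P)^T *m Q2 P *m (y T - ydT P) -> 0 < r ->
  (forall t x, t \in `[0, T] -> `|x - y t| <= r -> nbhs x B) ->
  exists S e1, [/\ 0 <= S, 0 < e1 & forall e, 0 < e <= e0 -> e <= e1 -> exists y',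
    [/\ controlled P 0 T y' (Fth P (thapp e) y'), y' 0 = y0,
      forall t, t \in `[0, T] -> `|y' t - y t| <= S * e /\ `|y' t - y t| <= r,
      forall t, t \in `]0, T[ -> `|Fth P (thapp e) y' t - Fstar P M y t| <= S * e &
      forall t, t \in `]0, T[ -> `|grad (Vth (thapp e) t) (y' t) - p t| <= S * e]].
Proof.
move=> ymin tp pT r0 tube; have T0 := hor_gt0 std.
have [K K0 HK] := approx_feedback ymin tp pT r0 tube.
set u := Fstar P M y in ymin tp HK *.
have [[uL2 ty] yy0] := admissible_controlled T0 ymin.1.
have [rho0 rho00 yr0] := continuous_bounded_norm (trajectory_continuous ty).
pose rho := rho0 + r.
have [L L0 HL] := control_rhs_lip A1 rho.
have mK0 : 0 <= m%:R * K by rewrite mulr_ge0.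
(* The feedback differs from [u] by at most [K * (|x - y| + e)]: the first part enlarges the
   Lipschitz coefficient, the second becomes a constant defect of order [e]. The factor [m%:R]
   passes from the maximum norm to the Euclidean norm. *)
pose l s := L * (1 + enorm (u s)) + L * (m%:R * K).
have LmK0 : 0 <= L * (m%:R * K) by rewrite mulr_ge0.
have sl : square_integrable 0 T l.
  apply: square_integrableD; last exact: square_integrable_cst.
  by apply: square_integrableZ; exact: one_plus_enorm_sqi.
have l0 s : 0 <= l s by rewrite addr_ge0// mulr_ge0// addr_ge0// enorm_ge0.
pose K1 := Int 0 T (fun s => l s ^+ 2).
pose S := Num.sqrt (gronwall_factor K1 T) * (T * (L * (m%:R * K))).
have S0 : 0 <= S by rewrite mulr_ge0 ?sqrtr_ge0// mulr_ge0 ?(ltW T0).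
have S2 : S ^+ 2 = gronwall_factor K1 T * (T * (L * (m%:R * K))) ^+ 2.
  by rewrite exprMn sqr_sqrtr// gronwall_factor_ge0.
have S1 : 0 < S + 1 by rewrite ltr_wpDl.
(* [S] bounds the state error and [K * (S + 1)] the errors of control and gradient; the threshold
   keeps [S * e] within the tube radius. *)
exists (S + K * (S + 1)), (r / (S + 1)); split; [|by rewrite divr_gt0|].
  by rewrite addr_ge0// mulr_ge0// ltW.
move=> e ee ee1; have /andP[e_gt0 _] := ee.
have Se : S * e <= r.
  have : e * (S + 1) <= r by rewrite -ler_pdivlMr.
  by rewrite mulrDr mulr1 mulrC; apply: le_trans; rewrite lerDl ltW.
pose G := fun s => grad (Vth (thapp e) s).
pose F s x := fdyn P s x + gdyn P s x *m feedback P G s x.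
have lF : loc_lip 0 T F by apply: closed_loop_loc_lip => //; exact: C2_field_loc_lip (Vth_approx_field ee).
have [_ /(_ rho)[LF LF0 HLF]] := lF.
have xr s x : s \in `[0, T] -> `|x - y s| <= r -> `|x| <= rho.
  move=> sT xy; rewrite -[x](subrK (y s)) addrC; apply: (le_trans (ler_normD _ _)).
  by rewrite lerD// yr0.
have GFE : gronwall_factor (Int 0 T (fun s => l s ^+ 2)) (T - 0) *
    (`|y0 - y 0| ^+ 2 + (T - 0) * Int 0 T (fun=> (L * (m%:R * K) * e) ^+ 2)) = (S * e) ^+ 2.
  rewrite Int_cst ?(ltW T0)// subr0 yy0 subrr normr0 expr0n add0r [RHS]exprMn S2 -/K1.
  by move: (gronwall_factor K1 T) => gf; ring.
have [||||||||y' [ty' y'0 yy']] := tube_solution (ltW T0) (lF := fun=> LF) (l := l)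
    (d := fun=> L * (m%:R * K) * e) (F := F) (y0 := y0) (ltW r0) ty.
- move=> w cw _; apply: continuous_inL2; exact: loc_lip_along lF cw.
- exact: square_integrable_cst.
- move=> s /in_segment sT x x' xy xy'.
  by have [_] := HLF s x' x sT (xr s x' sT xy') (xr s x sT xy).
- exact: sl.
- exact: square_integrable_cst.
- by move=> s _.
- move=> s sT x xy; have sT' := in_segment sT.
  have yr : `|y s| <= rho by rewrite (le_trans (yr0 s sT'))// lerDl ltW.
  have := HL s (y s) x u (fun s => feedback P G s x) sT' yr (xr s x sT' xy).
  move=> /le_trans; apply; rewrite /l mulrDl -addrA lerD2l -!mulrA -mulrDr ler_wpM2l//.
  apply: (le_trans (enorm_le _)); rewrite -mulrDr ler_wpM2l// -mulrDr.
  by have [_] := HK e ee s x sT xy.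
- by rewrite GFE lerXn2r ?nnegrE ?mulr_ge0// ltW.
have dB s : s \in `[0, T] -> `|y' s - y s| <= S * e.
  move=> sT; have Se0 := mulr_ge0 S0 (ltW e_gt0).
  rewrite -(@ler_pXn2r _ 2) ?nnegrE ?Se0//.
  by apply: (le_trans (yy' s sT)); rewrite GFE.
have dK s : s \in `[0, T] -> K * (`|y' s - y s| + e) <= (S + K * (S + 1)) * e.
  move=> sT; rewrite [leRHS]mulrDl -[K * _ * e]mulrA.
  apply: (@le_trans _ _ (K * ((S + 1) * e))); last by rewrite lerDr mulr_ge0 ?(ltW e_gt0).
  by rewrite ler_wpM2l// mulrDl mul1r lerD2r dB.
exists y'; split=> //.
- split; last exact: ty'.
  apply: continuous_inL2; apply: (loc_lip_along (Fth_loc_lip ee)).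
  exact: trajectory_continuous ty'.
- move=> t tT; have H := dB t tT; split; last exact: le_trans H Se.
  apply: (le_trans H); rewrite ler_wpM2r ?(ltW e_gt0)// lerDl; exact: mulr_ge0 K0 (ltW S1).
- move=> t tT; have tT' := in_segment tT; have [_ H] := HK e ee t (y' t) tT (le_trans (dB t tT') Se).
  exact: le_trans H (dK t tT').
- move=> t tT; have tT' := in_segment tT; have [H _] := HK e ee t (y' t) tT (le_trans (dB t tT') Se).
  exact: le_trans H (dK t tT').
Qed.

End Competitor.

Lemma Int_tail_le {R : realType} (a b t : R) (f : R -> R) : a <= t -> t <= b ->
  integrable_on a b f -> (forall s, 0 <= f s) -> Int t b f <= Int a b f.
Proof.
move=> at_ tb iF f0; rewrite (Int_split at_ tb iF) lerDr.
by apply: Int_ge0 => s _.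
Qed.

Lemma Int_le_cst {R : realType} (a b c : R) (f : R -> R) : a <= b -> integrable_on a b f ->
  (forall s, s \in `]a, b[ -> f s <= c) -> Int a b f <= c * (b - a).
Proof.
move=> ab iF fc; rewrite -Int_cst//; apply: Int_le => //; exact: integrable_on_cst.
Qed.

Section CompetitorCost.
Context {R : realType} {n m : nat} (P : ocp R n m) (M : R).
Local Notation T := (hor P).
Local Notation B := (bigball P M).
Context (A1 : regA1 P) (std : standing P) (A2 : regA2 P M).
Implicit Types (y p : R -> 'cV[R]_n) (u : R -> 'cV[R]_m).

Lemma cost_perturbation y u (S : R) : controlled P 0 T y u -> 0 <= S ->
  exists2 C, 0 <= C & forall y' u' e, controlled P 0 T y' u' -> 0 < e -> e <= 1 ->
  (forall t, t \in `[0, T] -> `|y' t - y t| <= S * e) ->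
  (forall t, t \in `]0, T[ -> `|u' t - u t| <= S * e) ->
  (forall t, t \in `[0, T] -> `|cost P t y' u' - cost P t y u| <= C * e) /\
  Int 0 T (fun s => enorm (u' s - u s) ^+ 2) <= C * e ^+ 2.
Proof.
move=> [uL2 ty] S0; have T0 := hor_gt0 std; have cy := trajectory_continuous ty.
have b0 : 0 <= beta P by case: std => _ _ _ /ltW.
have [C1 C10 H1] := tracking_lipschitz std cy.
pose E := Int 0 T (fun s => enorm (u s) ^+ 2).
have E0 : 0 <= E by apply: Int_ge0 => s _; exact: sqr_ge0.
pose W := m%:R * S ^+ 2 * T.
have W0 : 0 <= W by rewrite !mulr_ge0 ?sqr_ge0// ltW.
have C0 : 0 <= C1 * (S + S ^+ 2) by rewrite mulr_ge0// addr_ge0// sqr_ge0.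
have D0 : 0 <= beta P / 2 * (E + 2 * W) by rewrite !mulr_ge0// addr_ge0// mulr_ge0.
exists (C1 * (S + S ^+ 2) + beta P / 2 * (E + 2 * W) + W); first exact: addr_ge0 (addr_ge0 C0 D0) W0.
move=> y' u' e [uL2' ty'] e0 e1 yy uu; have duL2 := inL2B uL2' uL2.
have cy' := trajectory_continuous ty'.
have ee : e ^+ 2 <= e by rewrite expr2 -[leRHS]mulr1 ler_wpM2l// ltW.
have DW : Int 0 T (fun s => enorm (u' s - u s) ^+ 2) <= W * e ^+ 2.
  have := Int_le_cst (c := m%:R * S ^+ 2 * e ^+ 2) (ltW T0) (sum_inL2 duL2).
  rewrite subr0 /W [leRHS]mulrAC; apply => s sT.
  apply: (le_trans (enorm_sqr_le _)); rewrite -mulrA ler_wpM2l// -exprMn.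
  by rewrite lerXn2r ?nnegrE ?mulr_ge0 ?(ltW e0)// uu.
split; last first.
  by apply: (le_trans DW); rewrite ler_wpM2r ?sqr_ge0// lerDr addr_ge0.
move=> t; rewrite in_itv/= => /andP[t0 tT].
have sub s : s \in `[t, T] -> s \in `[0, T] by rewrite !in_itv/= => /andP[ts ->]; rewrite (le_trans t0 ts).
have cyt := continuous_sub_itv t0 (lexx T) cy; have cyt' := continuous_sub_itv t0 (lexx T) cy'.
have uL2t := inL2_sub t0 (lexx T) uL2; have uL2t' := inL2_sub t0 (lexx T) uL2'.
rewrite !cost_split// opprD addrACA -mulrBr.
apply: (le_trans (ler_normD _ _)); rewrite normrM ger0_norm ?mulr_ge0//.
have Se : 0 <= S * e by rewrite mulr_ge0// ltW.
have A1' : `|tracking_cost P t y' - tracking_cost P t y| <= C1 * (S + S ^+ 2) * e.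
  apply: (le_trans (H1 t y' (S * e) t0 tT Se cyt' (fun s st => yy s (sub s st)))).
  rewrite -mulrA ler_wpM2l// exprMn mulrDl lerD2l.
  by rewrite ler_wpM2l// sqr_ge0.
have A2' : `|Int t T (fun s => enorm (u' s) ^+ 2) - Int t T (fun s => enorm (u s) ^+ 2)| <= (E + 2 * W) * e.
  (* With [e] itself as the Young parameter, both resulting terms are of order [e]. *)
  apply: (le_trans (energy_diff e0 uL2t uL2t')).
  have F1 : Int t T (fun s => enorm (u s) ^+ 2) <= E.
    by apply: Int_tail_le => // [|s]; [exact: sum_inL2|exact: sqr_ge0].
  have F2 : Int t T (fun s => enorm (u' s - u s) ^+ 2) <= W * e ^+ 2.
    apply: le_trans DW.
    by apply: Int_tail_le => // [|s]; [exact: sum_inL2|exact: sqr_ge0].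
  have ie : 0 <= 1 + e^-1 by rewrite addr_ge0// invr_ge0 ltW.
  apply: (le_trans (lerD (ler_wpM2l (ltW e0) F1) (ler_wpM2l ie F2))).
  have -> : e * E + (1 + e^-1) * (W * e ^+ 2) = E * e + W * (e ^+ 2 + e) by field; rewrite gt_eqF.
  rewrite -subr_ge0 (_ : _ - _ = W * (e - e ^+ 2)); last by ring.
  by rewrite mulr_ge0// subr_ge0.
have A3' := ler_wpM2l (_ : 0 <= beta P / 2) A2'.
apply: (le_trans (lerD A1' (A3' _))); first by rewrite mulr_ge0.
rewrite mulrA -mulrDl ler_wpM2r ?(ltW e0)// lerDl//.
Qed.

Context (A : ansatz R n) (e0 : R) (thapp : forall e, 'cV[R]_(pdim A e)).
Context (AP : approx_assumption P M e0 thapp).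

(** In the tube the value gradient differs from the bounded adjoint [p t] by at most [|Ls0| * r],
    and the mean value theorem applies on the segment to [y t]. *)
Lemma Vstar_lipschitz_along (y0 : 'cV[R]_n) y p (r : R) : minimizer P y0 y (Fstar P M y) ->
  trajectory 0 T p (fun s => adjoint_rhs P y (Fstar P M y) s (p s)) ->
  p T = (Q2 P)^T *m Q2 P *m (y T - ydT P) -> 0 < r ->
  (forall t x, t \in `[0, T] -> `|x - y t| <= r -> nbhs x B) ->
  exists2 L, 0 <= L & forall t x, t \in `]0, T[ -> `|x - y t| <= r ->
    `|Vstar P t x - Vstar P t (y t)| <= L * `|x - y t|.
Proof.
move=> ymin tp pT r0 tube.
have [Bp Bp0 pB] := continuous_bounded_norm (trajectory_continuous tp).
case: (A2) => _ _ _ [Ls0 HLs].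
have Br : 0 <= Bp + `|Ls0| * r by rewrite addr_ge0// mulr_ge0// ltW.
exists (n%:R * (Bp + `|Ls0| * r)); first by rewrite mulr_ge0.
move=> t x tT xy; have tT' := in_segment tT.
have seg s : s \in `[0, 1] -> `|y t + s *: (x - y t) - y t| <= r.
  rewrite in_itv/= => /andP[s0 s1]; rewrite addrAC subrr add0r normrZ ger0_norm//.
  by rewrite -[leRHS]mul1r; apply: ler_pM.
have nb s : s \in `[0, 1] -> nbhs (y t + s *: (x - y t)) B by move=> /seg; exact: tube.
have yB : nbhs (y t) B by apply: (tube t (y t) tT'); rewrite subrr normr0 ltW.
have [||s s01 ->] := @gradient_mean_value _ _ B (Vstar P t) (y t) x
    (fun s => grad_in B (Vstar P t) (y t + s *: (x - y t))).
- by move=> s /nb; exact: nbhs_singleton.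
- by move=> s /nb/nbhs_singleton Bs; exact: Vstar_has_grad.
have s01' := in_segment s01.
apply: (le_trans (dotv_norm_le _ _)); rewrite ler_wpM2r// ler_wpM2l//.
have Gy : grad_in B (Vstar P t) (y t) = p t.
  apply: (grad_Vstar_adjoint A1 std A2 ymin tp pT r0 _ tT) => z zy.
  exact: nbhs_singleton (tube t z tT' zy).
have [H2 _] := HLs t tT'.
have := H2 (_, y t) (conj (nbhs_singleton (nb s s01')) (nbhs_singleton yB)); rewrite /= Gy => H3.
rewrite -[grad_in _ _ _](subrK (p t)) addrC; apply: (le_trans (ler_normD _ _)).
apply: lerD; first exact: pB.
apply: (le_trans H3); apply: (le_trans (ler_wpM2r (normr_ge0 _) (ler_norm Ls0))).
by rewrite ler_wpM2l// seg.
Qed.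


(** Both penalty integrands are squares of quantities of order [e], so the penalties are of order
    [e^2]; the excess of the cost itself is of order [e]. *)
Lemma competitor (y0 : 'cV[R]_n) y p (r g1 g2 : R) : 0 <= g1 -> 0 <= g2 ->
  minimizer P y0 y (Fstar P M y) ->
  trajectory 0 T p (fun s => adjoint_rhs P y (Fstar P M y) s (p s)) ->
  p T = (Q2 P)^T *m Q2 P *m (y T - ydT P) -> 0 < r ->
  (forall t x, t \in `[0, T] -> `|x - y t| <= r -> nbhs x B) ->
  exists C e1, [/\ 0 <= C, 0 < e1 & forall e, 0 < e <= e0 -> e <= e1 -> exists y' p',
    [/\ inH1 0 T y', inH1 0 T p', state_eq P 0 y0 y' (Fth P (thapp e) y'),
      adjoint_eq P y' (Fth P (thapp e) y') p' &
      Jeps P g1 g2 y' p' (thapp e) <= cost P 0 y (Fstar P M y) + C * e]].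
Proof.
move=> g10 g20 ymin tp pT r0 tube; have T0 := hor_gt0 std.
have [S [e1 [S0 e10 HS]]] := closed_loop_competitor A1 std A2 AP ymin tp pT r0 tube.
have [Lv Lv0 HLv] := Vstar_lipschitz_along ymin tp pT r0 tube.
have [c c0 Hc] := approx_gradient A2 AP.
set u := Fstar P M y in ymin tp HS *.
have [cyu yy0] := admissible_controlled T0 ymin.1; have [uL2 ty] := cyu.
have cy := trajectory_continuous ty.
have [rho0 rho00 yr0] := continuous_bounded_norm cy.
have [Bp Bp0 pB] := continuous_bounded_norm (trajectory_continuous tp).
have [C3 C30 H3] := cost_perturbation cyu S0.
(* Energy bound for the competing control [u' = u + (u' - u)] when [e <= 1], as required by
   [adjoint_stability]. *)
pose E := 2 * Int 0 T (fun s => enorm (u s) ^+ 2) + 2 * C3.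
have Eu0 : 0 <= Int 0 T (fun s => enorm (u s) ^+ 2) by apply: Int_ge0 => s _; exact: sqr_ge0.
have E0 : 0 <= E by apply: addr_ge0; exact: mulr_ge0.
have [Ca Ca0 HCa] := adjoint_stability A1 std (rho0 + r) E0 Bp0.
pose Sp := Num.sqrt (Ca * (S ^+ 2 + C3)).
have Sp0 : 0 <= Sp by exact: sqrtr_ge0.
have Sp2 : Sp ^+ 2 = Ca * (S ^+ 2 + C3) by rewrite sqr_sqrtr// mulr_ge0// addr_ge0// sqr_ge0.
pose C4 := c + Lv * S + C3.
have C40 : 0 <= C4 by exact: addr_ge0 (addr_ge0 c0 (mulr_ge0 Lv0 S0)) C30.
pose C5 := g1 / 2 * C4 ^+ 2 + g2 / 2 * (n%:R * (S + Sp) ^+ 2).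
have h1 : 0 <= g1 / 2 by rewrite divr_ge0.
have h2 : 0 <= g2 / 2 by rewrite divr_ge0.
have C50 : 0 <= C5.
  apply: addr_ge0; first exact: mulr_ge0 h1 (sqr_ge0 _).
  exact: mulr_ge0 h2 (mulr_ge0 (ler0n _ _) (sqr_ge0 _)).
exists (C3 + C5 * T), (Num.min e1 1); split.
- by rewrite addr_ge0// mulr_ge0// ltW.
- by rewrite lt_min e10 ltr01.
move=> e ee; rewrite le_min => /andP[ee1 e_le1]; have /andP[e_gt0 _] := ee.
have e_sq : e ^+ 2 <= e by rewrite expr2 -[leRHS]mulr1 ler_wpM2l// ltW.
have [y' [cyu' y'0 yy uu gg]] := HS e ee ee1; have [uL2' ty'] := cyu'.
set u' := Fth P (thapp e) y' in uL2' ty' cyu' uu *.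
have cy' := trajectory_continuous ty'.
have yy1 t : t \in `[0, T] -> `|y' t - y t| <= S * e by move=> /yy[].
have yyr t : t \in `[0, T] -> `|y' t - y t| <= r by move=> /yy[].
have [dcost duE] := H3 y' u' e cyu' e_gt0 e_le1 yy1 uu.
have [p' [tp' p'T]] := adjoint_exists A1 std cy' uL2'.
have duL2 := inL2B uL2' uL2.
have uE' : Int 0 T (fun s => enorm (u' s) ^+ 2) <= E.
  apply: (@le_trans _ _ (Int 0 T (fun s => 2 * enorm (u s) ^+ 2 + 2 * enorm (u' s - u s) ^+ 2))).
    apply: Int_le.
    - exact: sum_inL2.
    - by apply: integrable_onD; apply: integrable_onZ; exact: sum_inL2.
    - by move=> s _; rewrite -{1}[u' s](subrK (u s)) addrC; exact: enormD_sqr_le.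
  rewrite IntD; [|by apply: integrable_onZ; exact: sum_inL2..].
  rewrite !IntZ; [|exact: sum_inL2..].
  rewrite lerD2l ler_wpM2l//; apply: (le_trans duE).
  by rewrite -[leRHS]mulr1 ler_wpM2l// (le_trans e_sq).
have Se : 0 <= S * e by rewrite mulr_ge0// ltW.
have pp t : t \in `[0, T] -> `|p' t - p t| <= Sp * e.
  move=> tT; rewrite -(@ler_pXn2r _ 2) ?nnegrE ?(mulr_ge0 Sp0 (ltW e_gt0))//.
  have yB s : s \in `[0, T] -> `|y' s| <= rho0 + r.
    move=> sT; rewrite -[y' s](subrK (y s)) addrC; apply: (le_trans (ler_normD _ _)).
    by rewrite lerD ?yr0 ?yyr.
  have yB' s : s \in `[0, T] -> `|y s| <= rho0 + r.
    by move=> sT; rewrite (le_trans (yr0 s sT))// lerDl ltW.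
  apply: (le_trans (HCa y' y u' u p' p (S * e) Se cy' cy uL2' uL2 yB yB' yy1 uE' tp' tp p'T pT pB t tT)).
  rewrite [leRHS]exprMn Sp2 -mulrA ler_wpM2l// exprMn mulrDl lerD2l.
  exact: duE.
exists y', p'; split.
- exact: trajectory_inH1 (ltW T0) ty'.
- exact: trajectory_inH1 (ltW T0) tp'.
- by have [_ _] := controlled_admissible (ltW T0) cyu'; rewrite y'0.
- by split=> //; exact: trajectory_weak_deriv (ltW T0) tp'.
have [[hV cV cG] _] := Vth_approx_field AP ee.
have c1 : {within `[0, T], continuous (fun t => Vth (thapp e) t (y' t))}.
  exact: C1_field_along (And3 hV cV cG) cy'.
have lG : loc_lip 0 T (fun t => grad (Vth (thapp e) t)).
  exact: C2_field_loc_lip (Vth_approx_field AP ee).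
have c2 := loc_lip_along lG cy'.
(* The ansatz is compared with the cost through V* at [y' t], then V* at [y t], which is the
   remaining optimal cost, and then the perturbation of that cost. *)
have dV t : t \in `]0, T[ -> `|Vth (thapp e) t (y' t) - cost P t y' u'| <= C4 * e.
  move=> tT; have tT' := in_segment tT.
  have [V1 _] := Hc e ee t (y' t) tT' (tube t (y' t) tT' (yyr t tT')).
  have V2 := HLv t (y' t) tT (yyr t tT').
  rewrite (Vstar_along_minimizer A1 std ymin tT) in V2.
  have V3 := dcost t tT'.
  have V2' : `|Vstar P t (y' t) - cost P t y u| <= Lv * S * e.
    by apply: (le_trans V2); rewrite -mulrA ler_wpM2l// yy1.
  rewrite (_ : _ - _ = (Vth (thapp e) t (y' t) - Vstar P t (y' t))
     + (Vstar P t (y' t) - cost P t y u) - (cost P t y' u' - cost P t y u)); last by ring.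
  apply: (le_trans (ler_normB _ _)); rewrite /C4 [leRHS]mulrDl; apply: lerD => //.
  by apply: (le_trans (ler_normD _ _)); rewrite mulrDl; exact: lerD.
have dG t : t \in `]0, T[ -> enorm (grad (Vth (thapp e) t) (y' t) - p' t) ^+ 2 <= n%:R * (S + Sp) ^+ 2 * e ^+ 2.
  move=> tT; have tT' := in_segment tT.
  apply: (le_trans (enorm_sqr_le _)); rewrite -mulrA ler_wpM2l// -exprMn.
  rewrite lerXn2r ?nnegrE ?(mulr_ge0 (addr_ge0 S0 Sp0) (ltW e_gt0))//.
  rewrite -[_ - p' t](subrKA (p t)); apply: (le_trans (ler_normD _ _)); rewrite mulrDl.
  by apply: lerD; [exact: gg|rewrite distrC pp].
have i1 : integrable_on 0 T (fun t => `|Vth (thapp e) t (y' t) - cost P t y' u'| ^+ 2).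
  apply: (@square_integrable_sqr _ _ _ (fun t => `|Vth (thapp e) t (y' t) - cost P t y' u'|)).
  apply: square_integrable_norm.
  apply: (@square_integrable_le _ _ _ _ (fun=> C4 * e)) => //; last exact: square_integrable_cst.
  apply: measurable_funB; first exact: continuous_measurable.
  exact: cost_measurable.
have i2 : integrable_on 0 T (fun t => enorm (grad (Vth (thapp e) t) (y' t) - p' t) ^+ 2).
  apply: sum_inL2; apply: inL2B; first exact: continuous_inL2.
  exact: continuous_inL2 (trajectory_continuous tp').
have /(_ 0) dc0 := dcost; have T00 : 0 \in `[0, T] by rewrite in_itv/= lexx ltW.
have dc1 := le_trans (ler_norm _) (dc0 T00).
rewrite /Jeps -/u' mulrDl addrA; apply: lerD; first by rewrite -lerBlDl.
have IC : Int 0 T (fun t => g1 / 2 * `|Vth (thapp e) t (y' t) - cost P t y' u'| ^+ 2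
     + g2 / 2 * enorm (grad (Vth (thapp e) t) (y' t) - p' t) ^+ 2) <= C5 * e ^+ 2 * (T - 0).
  apply: Int_le_cst; [exact: ltW|by apply: integrable_onD; exact: integrable_onZ|].
  move=> t tT; rewrite (_ : C5 * e ^+ 2 = g1 / 2 * (C4 * e) ^+ 2
    + g2 / 2 * (n%:R * (S + Sp) ^+ 2 * e ^+ 2)); last by rewrite /C5; ring.
  apply: lerD; rewrite ler_wpM2l ?dG//.
  by rewrite lerXn2r ?nnegrE ?(mulr_ge0 C40 (ltW e_gt0))// dV.
apply: (le_trans IC); rewrite subr0 -mulrA [_ * T]mulrC mulrA ler_wpM2l//; exact: mulr_ge0 C50 (ltW T0).
Qed.

End CompetitorCost.

(** * Passage to the limit *)

Section NullSequences.
Context {R : realType}.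
Implicit Types (a b : nat -> R).

Lemma null_le a b : (forall k, 0 <= a k <= b k) -> b @ \oo --> 0 -> a @ \oo --> 0.
Proof.
move=> ab b0; apply: (squeeze_cvgr (f := fun=> 0) (h := b)) => //; last exact: cvg_cst.
by near=> k; exact: ab.
Unshelve. all: by end_near. Qed.

Lemma null_sqr a : (fun k => a k ^+ 2) @ \oo --> 0 -> a @ \oo --> 0.
Proof.
move=> /cvgrPdist_le H; apply/cvgrPdist_le => e e0.
have e2 : 0 < e ^+ 2 by rewrite exprn_gt0.
apply: filterS (H _ e2) => k; rewrite !sub0r !normrN ger0_norm ?sqr_ge0// => ak.
exact: norm_le_sqr (ltW e0) ak.
Qed.

Lemma null_of_norm_le a b : (forall k, `|a k| <= b k) -> b @ \oo --> 0 -> a @ \oo --> 0.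
Proof.
move=> ab /cvgrPdist_le b0; apply/cvgrPdist_le => e e0; apply: filterS (b0 e e0) => k.
rewrite !sub0r !normrN; apply: le_trans; exact: le_trans (ab k) (ler_norm _).
Qed.

Lemma null_sub_cvg a (l : R) : (fun k => a k - l) @ \oo --> 0 -> a @ \oo --> l.
Proof.
move=> /cvgrPdist_le H; apply/cvgrPdist_le => e e0; apply: filterS (H e e0) => k.
by rewrite sub0r opprB.
Qed.

Lemma nullZ (c : R) a : a @ \oo --> 0 -> (fun k => c * a k) @ \oo --> 0.
Proof. by move=> a0; rewrite -(mulr0 c); apply: cvgMr a0; exact: cvg_cst. Qed.

Lemma nullD a b : a @ \oo --> 0 -> b @ \oo --> 0 -> (fun k => a k + b k) @ \oo --> 0.
Proof. by move=> a0 b0; rewrite -(addr0 0); exact: cvgD. Qed.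

Lemma null_square a : a @ \oo --> 0 -> (fun k => a k ^+ 2) @ \oo --> 0.
Proof. by move=> a0; have H := cvgM a0 a0; rewrite mulr0 in H; exact: H. Qed.

Lemma null_bounded a : a @ \oo --> 0 -> exists2 K, 0 <= K & forall k, `|a k| <= K.
Proof.
move=> a0; have /cvg_seq_bounded : cvgn a by apply/cvg_ex; exists 0.
move=> [M [_ HM]]; exists (`|M| + 1); first by rewrite addr_ge0.
by move=> k; apply: (HM (`|M| + 1)) => //; rewrite (le_lt_trans (ler_norm M))// ltrDl.
Qed.

End NullSequences.

Section Limits.
Context {R : realType}.

(** Passage to the limit in the integrated equation at each time: uniform convergence takes care of
    the point values, Cauchy-Schwarz of the integrated velocities. *)
Lemma trajectory_limit n a b (yk vk : nat -> R -> 'cV[R]_n) (y v : R -> 'cV[R]_n) (D : nat -> R) : a <= b ->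
  (forall k, trajectory a b (yk k) (vk k)) -> inL2 a b v -> D @ \oo --> 0 ->
  (forall k t, t \in `[a, b] -> `|yk k t - y t| <= D k) ->
  (fun k => Int a b (fun s => enorm (vk k s - v s) ^+ 2)) @ \oo --> 0 ->
  trajectory a b y v.
Proof.
move=> ab tk vL2 D0 yD vD i.
apply: (eq_is_primitive ab _ _ (is_primitive_intro (y a i 0) (vL2 i))) => // t tab.
have aab : a \in `[a, b] by rewrite in_itv/= lexx ab.
have := tab; rewrite in_itv/= => /andP[ta tb].
have cy s : s \in `[a, b] -> (fun k => yk k s i 0) @ \oo --> y s i 0.
  move=> sab; apply: null_sub_cvg.
  apply: null_of_norm_le D0 => k; apply: le_trans (yD k s sab).
  by have := entry_le_mx_norm (yk k s - y s) i 0; rewrite !mxE.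
have cI : (fun k => Int a t (fun s => vk k s i 0) - Int a t (fun s => v s i 0)) @ \oo --> 0.
  apply: null_sqr; apply: (null_le (b := fun k => (b - a) * Int a b (fun s => enorm (vk k s - v s) ^+ 2))); last first.
    exact: nullZ.
  move=> k; rewrite sqr_ge0/=; have dL2 := inL2B (trajectory_inL2 (tk k)) vL2.
  have sk := square_integrable_sub (lexx a) tb (trajectory_inL2 (tk k) i).
  have sv := square_integrable_sub (lexx a) tb (vL2 i).
  have sd := square_integrableB sk sv.
  rewrite -IntB; [|exact: square_integrable_integrable..].
  apply: (le_trans (Int_sqr_le ta sd)); apply: ler_pM.
  - by rewrite subr_ge0.
  - by apply: Int_ge0 => s _; exact: sqr_ge0.
  - by rewrite lerD2r.
  have id := sum_inL2 dL2; rewrite (Int_split ta tb id).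
  apply: (@le_trans _ _ (Int a t (fun s => enorm (vk k s - v s) ^+ 2))); last first.
    by rewrite lerDl; apply: Int_ge0 => s _; exact: sqr_ge0.
  apply: Int_le.
  - exact: square_integrable_sqr.
  - exact: integrable_on_sub id.
  move=> s _; have := entry_le_enorm (vk k s - v s) i 0; rewrite !mxE => H.
  by rewrite -[leLHS]real_normK ?num_real// lerXn2r ?nnegrE ?enorm_ge0.
have E k : yk k t i 0 - yk k a i 0 = Int a t (fun s => vk k s i 0).
  by rewrite (is_primitive_val (tk k i) tab) addrC addKr.
have L1 : (fun k => yk k t i 0 - yk k a i 0) @ \oo --> y t i 0 - y a i 0.
  by apply: cvgB; exact: cy.
have L2 : (fun k => yk k t i 0 - yk k a i 0) @ \oo --> Int a t (fun s => v s i 0).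
  by apply: null_sub_cvg; rewrite (_ : (fun k => _) = fun k => Int a t (fun s => vk k s i 0) - Int a t (fun s => v s i 0))//; apply/funext => k; rewrite E.
by rewrite -(cvg_unique _ L1 L2)// addrC subrK.
Qed.

(** Common to state and adjoint velocities, whose differences both satisfy such a pointwise bound
    with an L^2 coefficient. *)
Lemma Int_enorm_sqr_bound n m a b (w : R -> 'cV[R]_n) (u du : R -> 'cV[R]_m) (K Delta E : R) :
  a <= b -> inL2 a b w -> inL2 a b u -> inL2 a b du -> Int a b (fun s => enorm (u s) ^+ 2) <= E ->
  (forall s, s \in `]a, b[ -> `|w s| <= K * ((1 + enorm (u s)) * Delta + enorm (du s))) ->
  Int a b (fun s => enorm (w s) ^+ 2) <=
  2 * n%:R * K ^+ 2 * (2 * ((b - a) + E) * Delta ^+ 2 + Int a b (fun s => enorm (du s) ^+ 2)).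
Proof.
move=> ab wL2 uL2 duL2 uE wB.
have i1 := square_integrable_sqr (one_plus_enorm_sqi uL2); have i2 := sum_inL2 duL2.
have nK : 0 <= 2 * n%:R * K ^+ 2 by apply: mulr_ge0; [exact: mulr_ge0|exact: sqr_ge0].
apply: (@le_trans _ _ (Int a b (fun s => 2 * n%:R * K ^+ 2 * (Delta ^+ 2 * (1 + enorm (u s)) ^+ 2 + enorm (du s) ^+ 2)))).
  apply: Int_le; [exact: sum_inL2| |].
    by apply: integrable_onZ; apply: integrable_onD => //; exact: integrable_onZ.
  move=> s sab; apply: (le_trans (enorm_sqr_le _)).
  have : `|w s| ^+ 2 <= (K * ((1 + enorm (u s)) * Delta + enorm (du s))) ^+ 2.
    by have H := wB s sab; rewrite lerXn2r ?nnegrE// (le_trans _ H).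
  move=> /(ler_wpM2l (ler0n R n))/le_trans; apply.
  have arr (X : R) : 2 * n%:R * K ^+ 2 * X = n%:R * (K ^+ 2 * (2 * X)) by ring.
  rewrite arr ler_wpM2l// exprMn ler_wpM2l ?sqr_ge0//.
  have := sqr_ge0 ((1 + enorm (u s)) * Delta - enorm (du s)).
  by move: (1 + enorm (u s)) (enorm (du s)) => x z; nra.
rewrite IntZ; last by apply: integrable_onD => //; exact: integrable_onZ.
rewrite ler_wpM2l// IntD//; last exact: integrable_onZ.
rewrite IntZ// lerD2r mulrC ler_wpM2r ?sqr_ge0//.
apply: (le_trans (Int_one_plus_enorm ab uL2)).
by rewrite ler_wpM2l// lerD2l.
Qed.

End Limits.

Section SystemLimits.
Context {R : realType} {n m : nat} (P : ocp R n m).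
Local Notation T := (hor P).
Context (A1 : regA1 P) (std : standing P).
Implicit Types (y p : R -> 'cV[R]_n) (u : R -> 'cV[R]_m).

Lemma control_rhs_stability (rho E : R) : 0 <= E -> exists2 C, 0 <= C & forall y y' u u' (Delta : R), 0 <= Delta ->
  {within `[0, T], continuous y} -> {within `[0, T], continuous y'} -> inL2 0 T u -> inL2 0 T u' ->
  (forall t, t \in `[0, T] -> `|y t| <= rho) -> (forall t, t \in `[0, T] -> `|y' t| <= rho) ->
  (forall t, t \in `[0, T] -> `|y' t - y t| <= Delta) ->
  Int 0 T (fun s => enorm (u s) ^+ 2) <= E ->
  Int 0 T (fun s => enorm (control_rhs P u' s (y' s) - control_rhs P u s (y s)) ^+ 2) <=
    C * (Delta ^+ 2 + Int 0 T (fun s => enorm (u' s - u s) ^+ 2)).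
Proof.
move=> E0; have T0 := hor_gt0 std; have [L L0 HL] := control_rhs_lip A1 rho.
pose C := 2 * n%:R * L ^+ 2; have C0 : 0 <= C by apply: mulr_ge0; [exact: mulr_ge0|exact: sqr_ge0].
have TE : 0 <= 2 * ((T - 0) + E) by rewrite mulr_ge0// subr0 addr_ge0// ltW.
exists (C * (2 * ((T - 0) + E) + 1)); first by rewrite mulr_ge0// addr_ge0.
move=> y y' u u' Delta D0 cy cy' uL2 uL2' yr yr' yD uE.
have wL2 := inL2B (control_rhs_inL2 A1 (lexx 0) (lexx T) cy' uL2') (control_rhs_inL2 A1 (lexx 0) (lexx T) cy uL2).
apply: (le_trans (Int_enorm_sqr_bound (ltW T0) wL2 uL2 (inL2B uL2' uL2) uE (K := L) (Delta := Delta) _)).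
  move=> s sT; have sT' := in_segment sT.
  apply: (le_trans (HL s _ _ u u' sT' (yr s sT') (yr' s sT'))).
  by rewrite [leRHS]mulrDr lerD2r -mulrA ler_wpM2l// ler_wpM2l ?yD// addr_ge0// enorm_ge0.
rewrite -/C -[leRHS]mulrA ler_wpM2l//.
have I0 : 0 <= Int 0 T (fun s => enorm (u' s - u s) ^+ 2) by apply: Int_ge0 => s _; exact: sqr_ge0.
have D2 := sqr_ge0 Delta.
move: (Int 0 T _) (2 * _) I0 TE => I X I0 X0.
by rewrite mulrDl mul1r mulrDr; have := mulr_ge0 X0 I0; lra.
Qed.

Lemma adjoint_rhs_stability (rho E B : R) : 0 <= E -> 0 <= B -> exists2 C, 0 <= C &
  forall y y' u u' p p' (Delta : R), 0 <= Delta ->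
  {within `[0, T], continuous y} -> {within `[0, T], continuous y'} -> inL2 0 T u -> inL2 0 T u' ->
  {within `[0, T], continuous p} -> {within `[0, T], continuous p'} ->
  (forall t, t \in `[0, T] -> `|y t| <= rho) -> (forall t, t \in `[0, T] -> `|y' t| <= rho) ->
  (forall t, t \in `[0, T] -> `|p t| <= B) ->
  (forall t, t \in `[0, T] -> `|y' t - y t| <= Delta) ->
  (forall t, t \in `[0, T] -> `|p' t - p t| <= Delta) ->
  Int 0 T (fun s => enorm (u' s) ^+ 2) <= E ->
  Int 0 T (fun s => enorm (adjoint_rhs P y' u' s (p' s) - adjoint_rhs P y u s (p s)) ^+ 2) <=
    C * (Delta ^+ 2 + Int 0 T (fun s => enorm (u' s - u s) ^+ 2)).
Proof.
move=> E0 B0; have T0 := hor_gt0 std; have [L L0 HL] := adjoint_rhs_diff A1 rho.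
pose K := 2 * L * (1 + B); have K0 : 0 <= K by rewrite !mulr_ge0// addr_ge0.
pose C := 2 * n%:R * K ^+ 2; have C0 : 0 <= C by apply: mulr_ge0; [exact: mulr_ge0|exact: sqr_ge0].
have TE : 0 <= 2 * ((T - 0) + E) by rewrite mulr_ge0// subr0 addr_ge0// ltW.
exists (C * (2 * ((T - 0) + E) + 1)); first by rewrite mulr_ge0// addr_ge0.
move=> y y' u u' p p' Delta D0 cy cy' uL2 uL2' cp cp' yr yr' pB yD pD uE.
have wL2 := inL2B (adjoint_rhs_inL2 A1 std cy' uL2' cp') (adjoint_rhs_inL2 A1 std cy uL2 cp).
apply: (le_trans (Int_enorm_sqr_bound (ltW T0) wL2 uL2' (inL2B uL2' uL2) uE (K := K) (Delta := Delta) _)).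
  move=> s sT; have sT' := in_segment sT.
  apply: (le_trans (HL s _ _ u' u (p' s) (p s) sT' (yr' s sT') (yr s sT'))).
  have e0 := enorm_ge0 (u' s); have d0 := enorm_ge0 (u' s - u s).
  have x0 : 0 <= 1 + enorm (u' s) by rewrite addr_ge0.
  have B1 : L * (1 + enorm (u' s)) * `|p' s - p s| <= L * (1 + B) * ((1 + enorm (u' s)) * Delta).
    rewrite -!mulrA ler_wpM2l//; apply: (@le_trans _ _ ((1 + enorm (u' s)) * Delta)).
      by rewrite ler_wpM2l// pD.
    by rewrite [leRHS]mulrDl mul1r lerDl; exact: mulr_ge0 B0 (mulr_ge0 x0 D0).
  have B2 : L * (`|y' s - y s| * (1 + enorm (u' s)) + enorm (u' s - u s)) * (1 + `|p s|) <=
     L * (1 + B) * ((1 + enorm (u' s)) * Delta + enorm (u' s - u s)).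
    rewrite -!mulrA ler_wpM2l// mulrC; apply: ler_pM.
    - by rewrite addr_ge0.
    - by rewrite addr_ge0// mulr_ge0.
    - by rewrite lerD2l pB.
    - by rewrite lerD2r mulrC ler_wpM2l// yD.
  apply: (le_trans (lerD B1 B2)); rewrite /K -(mulrA 2).
  have : 0 <= L * (1 + B) * enorm (u' s - u s) by rewrite !mulr_ge0// addr_ge0.
  by move: ((1 + _) * Delta) (enorm (_ - _)) (L * (1 + B)) => x z l; lra.
rewrite -/C -[leRHS]mulrA ler_wpM2l//.
have I0 : 0 <= Int 0 T (fun s => enorm (u' s - u s) ^+ 2) by apply: Int_ge0 => s _; exact: sqr_ge0.
have D2 := sqr_ge0 Delta.
move: (Int 0 T _) (2 * _) I0 TE => I X I0 X0.
by rewrite mulrDl mul1r mulrDr; have := mulr_ge0 X0 I0; lra.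
Qed.

End SystemLimits.

(** * Compactness of minimizing sequences *)

Section Compactness.
Context {R : realType} {n m : nat} (P : ocp R n m).
Local Notation T := (hor P).
Context (A1 : regA1 P) (std : standing P).
Implicit Types (y p : R -> 'cV[R]_n) (u : R -> 'cV[R]_m).

Lemma control_rhs_bound (rho : R) : exists2 K, 0 <= K & forall t u x, t \in `[0, T] ->
  `|x| <= rho -> `|control_rhs P u t x| <= K * (1 + enorm (u t)).
Proof.
have [_ /(_ rho)[L1 L10 H1]] := f_loc_lip A1; have [_ /(_ rho)[L2 L20 H2]] := g_loc_lip A1.
have mL : 0 <= m%:R * L2 by rewrite mulr_ge0.
exists (L1 + m%:R * L2); first by rewrite addr_ge0.
move=> t u x tT xr; have [F1 _] := H1 t x x tT xr xr; have [F2 _] := H2 t x x tT xr xr.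
have e0 := enorm_ge0 (u t).
have B2 : `|gdyn P t x *m u t| <= m%:R * L2 * enorm (u t).
  apply: (le_trans (mulmx_norm_le _ _)).
  by apply: ler_pM; rewrite ?mulr_ge0 ?mx_norm_le_enorm// ler_wpM2l.
apply: (le_trans (ler_normD _ _)); apply: (le_trans (lerD F1 B2)).
have := mulr_ge0 L10 e0; rewrite mulrDl !mulrDr; move: mL; clear; lra.
Qed.

(** The velocity is bounded by a multiple of [1 + enorm (u s)], hence bounded in L^2. The resulting
    modulus of continuity is shared by all trajectories with the same bounds. *)
Lemma controlled_hoelder (rho E : R) : 0 <= E -> exists2 V, 0 <= V & forall y u, controlled P 0 T y u ->
  (forall t, t \in `[0, T] -> `|y t| <= rho) -> Int 0 T (fun s => enorm (u s) ^+ 2) <= E ->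
  forall s t, s \in `[0, T] -> t \in `[0, T] -> `|y t - y s| ^+ 2 <= V * `|t - s|.
Proof.
move=> E0; have T0 := hor_gt0 std; have [K K0 HK] := control_rhs_bound rho.
have TE : 0 <= 2 * ((T - 0) + E) by rewrite mulr_ge0// subr0 addr_ge0// ltW.
have V0 : 0 <= K ^+ 2 * (2 * ((T - 0) + E)) by apply: mulr_ge0 => //; exact: sqr_ge0.
exists (K ^+ 2 * (2 * ((T - 0) + E))) => // y u [uL2 ty] yr uE s t sT tT.
have Vt : 0 <= K ^+ 2 * (2 * ((T - 0) + E)) * `|t - s| by exact: mulr_ge0.
rewrite -[leRHS]sqr_sqrtr// lerXn2r ?nnegrE ?sqrtr_ge0//.
apply: cV_norm_le => [|i]; first exact: sqrtr_ge0.
rewrite -sqrtr_sqr ler_wsqrtr// !mxE.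
rewrite (is_primitive_val (ty i) tT) (is_primitive_val (ty i) sT) opprD addrACA subrr add0r.
apply: (le_trans (primitive_hoelder (trajectory_inL2 ty i) sT tT)).
rewrite [leRHS]mulrC ler_wpM2l//.
have i1 := square_integrable_sqr (one_plus_enorm_sqi uL2).
apply: (@le_trans _ _ (Int 0 T (fun s => K ^+ 2 * (1 + enorm (u s)) ^+ 2))).
  apply: Int_le; [exact: square_integrable_sqr (trajectory_inL2 ty i)|exact: integrable_onZ|].
  move=> x xT; have xT' := in_segment xT; rewrite -exprMn -[leLHS]real_normK ?num_real//.
  have H := HK x u (y x) xT' (yr x xT').
  rewrite lerXn2r ?nnegrE ?mulr_ge0 ?addr_ge0 ?enorm_ge0//.
  exact: le_trans (entry_le_mx_norm _ _ _) H.
rewrite IntZ// ler_wpM2l ?sqr_ge0//; apply: (le_trans (Int_one_plus_enorm (ltW T0) uL2)).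
by rewrite ler_wpM2l// lerD2l.
Qed.

Lemma energy_le_cost y u : controlled P 0 T y u ->
  beta P / 2 * Int 0 T (fun s => enorm (u s) ^+ 2) <= cost P 0 y u.
Proof.
move=> [uL2 ty]; rewrite (cost_split std (lexx 0) (trajectory_continuous ty) uL2) lerDr.
rewrite /tracking_cost; apply: addr_ge0; last by rewrite mulr_ge0// sqr_ge0.
by rewrite mulr_ge0//; apply: Int_ge0 => s _; exact: sqr_ge0.
Qed.

(* The half sum of two controls drives the system along a trajectory close to
   the half sum of the two trajectories, so the parallelogram identity bounds
   the distance of two nearly optimal controls. *)
Lemma midpoint_estimate (rho E : R) (yb : R -> 'cV[R]_n) : 0 <= E -> {within `[0, T], continuous yb} ->
  exists C d, [/\ 0 <= C, 0 < d & forall (y0 : 'cV[R]_n) J y1 u1 y2 u2 (delta : R), 0 <= delta -> delta <= d ->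
    controlled P 0 T y1 u1 -> controlled P 0 T y2 u2 -> y1 0 = y0 -> y2 0 = y0 ->
    (forall t, t \in `[0, T] -> `|y1 t| <= rho) -> (forall t, t \in `[0, T] -> `|y2 t| <= rho) ->
    Int 0 T (fun s => enorm (u1 s) ^+ 2) <= E -> Int 0 T (fun s => enorm (u2 s) ^+ 2) <= E ->
    (forall t, t \in `[0, T] -> `|y1 t - yb t| <= delta) ->
    (forall t, t \in `[0, T] -> `|y2 t - yb t| <= delta) ->
    (forall y u, controlled P 0 T y u -> y 0 = y0 -> J <= cost P 0 y u) ->
    beta P / 2 * Int 0 T (fun s => enorm (u1 s - u2 s) ^+ 2) <=
      2 * (cost P 0 y1 u1 - J) + 2 * (cost P 0 y2 u2 - J) + C * delta].
Proof.
move=> E0 cb; have T0 := hor_gt0 std.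
have [L L0 HL] := control_rhs_lip A1 (rho + 1).
have [Ct Ct0 HC] := tracking_lipschitz std cb.
(* Bounds the squared coefficient [l]: each control contributes [2 * (T + E)], and the outer 2 comes
   from squaring their sum. *)
pose K := L ^+ 2 * (2 * (4 * (T + E))).
have K0 : 0 <= K.
  by apply: mulr_ge0; rewrite ?sqr_ge0// mulr_ge0// mulr_ge0// addr_ge0// ltW.
pose S := Num.sqrt (gronwall_factor K T * (T * K)).
have S0 : 0 <= S by exact: sqrtr_ge0.
have S2 : S ^+ 2 = gronwall_factor K T * (T * K).
  by rewrite sqr_sqrtr// mulr_ge0 ?gronwall_factor_ge0// mulr_ge0// ltW.
have S10 : 0 < S + 1 by rewrite ltr_wpDl.
(* The tracking costs are all compared with that of [yb]: the first summand is for the midpoint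
   trajectory, at distance [(S + 1) * delta], the second for [y1] and [y2]. The threshold keeps
   [S * delta <= 1], inside the tube. *)
exists (4 * (Ct * ((S + 1) + (S + 1) ^+ 2)) + 4 * (2 * Ct)), (S + 1)^-1; split.
- apply: addr_ge0; last by rewrite !mulr_ge0.
  by rewrite mulr_ge0// mulr_ge0// addr_ge0 ?sqr_ge0// ltW.
- by rewrite invr_gt0.
move=> y0 J y1 u1 y2 u2 delta d0 dS cyu1 cyu2 y10 y20 y1r y2r u1E u2E y1b y2b Jmin.
have [u1L2 ty1] := cyu1; have [u2L2 ty2] := cyu2.
have dS1 : (S + 1) * delta <= 1.
  by have := ler_wpM2l (ltW S10) dS; rewrite mulfV// gt_eqF.
have Sd : S * delta <= 1 by apply: le_trans dS1; rewrite ler_wpM2r// lerDl.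
have d1 : delta <= 1 by apply: le_trans dS1; rewrite -[leLHS]mul1r ler_wpM2r// lerDr.
pose um s := 2^-1 *: (u1 s + u2 s).
have umL2 : inL2 0 T um by apply: inL2Z; exact: inL2D.
(* The half sum does not solve the equation driven by [um], since the dynamics is nonlinear; it
   serves as the reference of the tube, with defect [l s * delta]. *)
pose yr s := 2^-1 *: y1 s + 2^-1 *: y2 s.
pose vr s := 2^-1 *: control_rhs P u1 s (y1 s) + 2^-1 *: control_rhs P u2 s (y2 s).
have tyr : trajectory 0 T yr vr.
  move=> i; have H := is_primitiveD (is_primitiveZ 2^-1 (ty1 i)) (is_primitiveZ 2^-1 (ty2 i)).
  by apply: (eq_is_primitive (ltW T0) _ _ H) => t _; rewrite !mxE.
have yr1 t : t \in `[0, T] -> `|yr t - y1 t| <= delta.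
  move=> tT; have -> : yr t - y1 t = 2^-1 *: ((y2 t - yb t) - (y1 t - yb t)).
    by apply/matrixP => i j; rewrite !mxE; field.
  rewrite normrZ ger0_norm// ler_pdivrMl// mulr_natl mulr2n.
  by apply: (le_trans (ler_normB _ _)); apply: lerD; [exact: y2b|exact: y1b].
have yr2 t : t \in `[0, T] -> `|yr t - y2 t| <= delta.
  move=> tT; have -> : yr t - y2 t = 2^-1 *: ((y1 t - yb t) - (y2 t - yb t)).
    by apply/matrixP => i j; rewrite !mxE; field.
  rewrite normrZ ger0_norm// ler_pdivrMl// mulr_natl mulr2n.
  by apply: (le_trans (ler_normB _ _)); apply: lerD; [exact: y1b|exact: y2b].
have yrb t : t \in `[0, T] -> `|yr t - yb t| <= delta.
  move=> tT; have -> : yr t - yb t = 2^-1 *: ((y1 t - yb t) + (y2 t - yb t)).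
    by apply/matrixP => i j; rewrite !mxE; field.
  rewrite normrZ ger0_norm// ler_pdivrMl// mulr_natl mulr2n.
  by apply: (le_trans (ler_normD _ _)); apply: lerD; [exact: y1b|exact: y2b].
have yrr t : t \in `[0, T] -> `|yr t| <= rho.
  move=> tT; rewrite /yr -scalerDr normrZ ger0_norm// ler_pdivrMl// mulr_natl mulr2n.
  by apply: (le_trans (ler_normD _ _)); apply: lerD; [exact: y1r|exact: y2r].
have wid (x : R) : x <= rho -> x <= rho + 1 by move/le_trans; apply; rewrite lerDl.
have xr t x : t \in `[0, T] -> `|x - yr t| <= 1 -> `|x| <= rho + 1.
  move=> tT xy; rewrite -[x](subrK (yr t)) addrC; apply: (le_trans (ler_normD _ _)).
  by apply: lerD => //; exact: yrr.
pose l s := L * ((1 + enorm (u1 s)) + (1 + enorm (u2 s))).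
have s1 := one_plus_enorm_sqi u1L2; have s2 := one_plus_enorm_sqi u2L2.
have sl : square_integrable 0 T l by apply: square_integrableZ; exact: square_integrableD.
have e1 s : 0 <= 1 + enorm (u1 s) by rewrite addr_ge0// enorm_ge0.
have e2 s : 0 <= 1 + enorm (u2 s) by rewrite addr_ge0// enorm_ge0.
have l0 s : 0 <= l s by rewrite mulr_ge0// addr_ge0.
have lK : Int 0 T (fun s => l s ^+ 2) <= K.
  have i1 := square_integrable_sqr s1; have i2 := square_integrable_sqr s2.
  apply: (@le_trans _ _ (Int 0 T (fun s => L ^+ 2 * (2 * ((1 + enorm (u1 s)) ^+ 2 + (1 + enorm (u2 s)) ^+ 2))))).
    apply: Int_le; first exact: square_integrable_sqr.
      by do 2 apply: integrable_onZ; exact: integrable_onD.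
    move=> s _; rewrite /l exprMn ler_wpM2l ?sqr_ge0//.
    by have := sqr_ge0 ((1 + enorm (u1 s)) - (1 + enorm (u2 s))); move: (1 + _) (1 + _) => a b; nra.
  rewrite IntZ; last by apply: integrable_onZ; exact: integrable_onD.
  rewrite IntZ; last exact: integrable_onD.
  rewrite IntD// /K ler_wpM2l ?sqr_ge0// ler_wpM2l//.
  have := Int_one_plus_enorm (ltW T0) u1L2; have := Int_one_plus_enorm (ltW T0) u2L2.
  rewrite subr0; move: u1E u2E; clear; lra.
have lK0 : 0 <= Int 0 T (fun s => l s ^+ 2) by apply: Int_ge0 => s _; exact: sqr_ge0.
have GF : gronwall_factor (Int 0 T (fun s => l s ^+ 2)) (T - 0) *
    (`|y0 - yr 0| ^+ 2 + (T - 0) * Int 0 T (fun s => (l s * delta) ^+ 2)) <= (S * delta) ^+ 2.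
  have -> : yr 0 = y0 by rewrite /yr y10 y20 -scalerDl -[RHS]scale1r; congr (_ *: _); field.
  rewrite subrr normr0 expr0n add0r subr0.
  have -> : Int 0 T (fun s => (l s * delta) ^+ 2) = delta ^+ 2 * Int 0 T (fun s => l s ^+ 2).
    rewrite -IntZ; last exact: square_integrable_sqr.
    by apply: eq_Int => s _; rewrite exprMn mulrC.
  rewrite exprMn S2 -[leRHS]mulrA; apply: ler_pM.
  - exact: gronwall_factor_ge0.
  - by rewrite mulr_ge0 ?(ltW T0)// mulr_ge0 ?sqr_ge0.
  - exact: gronwall_factor_le (ltW T0) lK.
  - by rewrite -[leRHS]mulrA ler_wpM2l ?(ltW T0)// mulrC ler_wpM2r ?sqr_ge0.
have [||||||||z [tz z0 zy]] := tube_solution (ltW T0) (lF := fun s => L * (1 + enorm (um s))) (l := l)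
    (d := fun s => l s * delta) (F := fun s x => control_rhs P um s x) (y0 := y0) ler01 tyr.
- by move=> w cw _; exact: (control_rhs_inL2 A1 (lexx 0) (lexx T) cw umL2).
- by apply: square_integrableZ; exact: one_plus_enorm_sqi.
- move=> s /in_segment sT x x' xy xy'.
  have := HL s x' x um um sT (xr s x' sT xy') (xr s x sT xy).
  by rewrite subrr enorm0 mulr0 addr0.
- exact: sl.
- by apply: (eq_square_integrable _ (square_integrableZ delta sl)) => s _; rewrite mulrC.
- by move=> s _.
- move=> s /in_segment sT x xy.
  have H1 := HL s (y1 s) x u1 u1 sT (wid _ (y1r s sT)) (xr s x sT xy).
  have H2 := HL s (y2 s) x u2 u2 sT (wid _ (y2r s sT)) (xr s x sT xy).
  rewrite !subrr !enorm0 !mulr0 !addr0 in H1 H2.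
  (* Since the dynamics is affine in the control, evaluating at [um] splits into the half sum of the
     evaluations at [u1] and [u2]. *)
  have -> : control_rhs P um s x - vr s = 2^-1 *: (control_rhs P u1 s x - control_rhs P u1 s (y1 s))
     + 2^-1 *: (control_rhs P u2 s x - control_rhs P u2 s (y2 s)).
    rewrite /vr; move: (control_rhs P u1 s (y1 s)) (control_rhs P u2 s (y2 s)) => a b.
    rewrite /control_rhs /um -scalemxAr mulmxDr.
    by apply/matrixP => i j; rewrite !mxE; field.
  apply: (le_trans (ler_normD _ _)); rewrite !normrZ ger0_norm// -mulrDr.
  have X1 : `|x - y1 s| <= `|x - yr s| + delta.
    rewrite -[x - y1 s](subrKA (yr s)); apply: (le_trans (ler_normD _ _)).
    by rewrite lerD2l yr1.
  have X2 : `|x - y2 s| <= `|x - yr s| + delta.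
    rewrite -[x - y2 s](subrKA (yr s)); apply: (le_trans (ler_normD _ _)).
    by rewrite lerD2l yr2.
  have Y1 := le_trans H1 (ler_wpM2l (mulr_ge0 L0 (e1 s)) X1).
  have Y2 := le_trans H2 (ler_wpM2l (mulr_ge0 L0 (e2 s)) X2).
  have q0 : 0 <= l s * (`|x - yr s| + delta) by rewrite mulr_ge0// addr_ge0.
  rewrite -mulrDr ler_pdivrMl//; apply: (le_trans (lerD Y1 Y2)).
  rewrite -mulrDl -mulrDr -/(l s); lra.
- by apply: (le_trans GF); rewrite expr1n expr_le1// mulr_ge0.
have zd t : t \in `[0, T] -> `|z t - yr t| <= S * delta.
  move=> tT; rewrite -(@ler_pXn2r _ 2) ?nnegrE ?(mulr_ge0 S0 d0)//.
  exact: le_trans (zy t tT) GF.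
have zb t : t \in `[0, T] -> `|z t - yb t| <= (S + 1) * delta.
  move=> tT; rewrite -[z t - yb t](subrKA (yr t)); apply: (le_trans (ler_normD _ _)).
  by rewrite mulrDl mul1r; apply: lerD; [exact: zd|exact: yrb].
have cz := trajectory_continuous tz.
have cy1 := trajectory_continuous ty1; have cy2 := trajectory_continuous ty2.
(* The only use of optimality: the midpoint control cannot do better than [J]. *)
have Jz := Jmin z um (conj umL2 tz) z0.
have tr (w : R -> 'cV[R]_n) (q : R) : 0 <= q -> {within `[0, T], continuous w} ->
    (forall t, t \in `[0, T] -> `|w t - yb t| <= q * delta) ->
    `|tracking_cost P 0 w - tracking_cost P 0 yb| <= Ct * (q + q ^+ 2) * delta.
  move=> q0 cw wq; have qd : 0 <= q * delta by rewrite mulr_ge0.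
  apply: (le_trans (HC 0 w (q * delta) (lexx 0) (ltW T0) qd cw wq)).
  rewrite -mulrA ler_wpM2l// exprMn mulrDl lerD2l ler_wpM2l ?sqr_ge0//.
  by rewrite expr2 -[leRHS]mulr1 ler_wpM2l.
have tz' := tr z (S + 1) (ltW S10) cz zb.
have t1' : `|tracking_cost P 0 y1 - tracking_cost P 0 yb| <= 2 * Ct * delta.
  have := tr y1 1 ler01 cy1; rewrite expr1n -[1 + 1]/(2 : R) [Ct * _]mulrC; apply=> t tT.
  by rewrite mul1r y1b.
have t2' : `|tracking_cost P 0 y2 - tracking_cost P 0 yb| <= 2 * Ct * delta.
  have := tr y2 1 ler01 cy2; rewrite expr1n -[1 + 1]/(2 : R) [Ct * _]mulrC; apply=> t tT.
  by rewrite mul1r y2b.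
rewrite (parallelogram u1L2 u2L2).
rewrite (cost_split std (lexx 0) cz umL2) in Jz.
rewrite (cost_split std (lexx 0) cy1 u1L2) (cost_split std (lexx 0) cy2 u2L2).
move: tz' t1' t2' Jz; rewrite !ler_norml => /andP[_ tz'] /andP[t1' _] /andP[t2' _].
rewrite /um; set em := Int _ _ _; set en1 := Int _ _ _; set en2 := Int _ _ _.
clearbody em en1 en2; move: tz' t1' t2'; set b := beta P; set t1 := tracking_cost P 0 y1; set t2 := tracking_cost P 0 y2.
set tz0 := tracking_cost P 0 z; set tb := tracking_cost P 0 yb; set q := (S + 1) + _.
have -> : b / 2 * (2 * en1 + 2 * en2 - 4 * em) =
  2 * (b / 2 * en1) + 2 * (b / 2 * en2) - 4 * (b / 2 * em) by ring.
have -> : (4 * (Ct * q) + 4 * (2 * Ct)) * delta = 4 * (Ct * q * delta) + 4 * (2 * Ct * delta) by ring.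
clearbody t1 t2 tz0 tb q b; clear.
move: (b / 2 * en1) (b / 2 * en2) (b / 2 * em) (Ct * q * delta) (2 * Ct * delta) => *; lra.
Qed.

End Compactness.

(** * Limits along ultrafilters *)

Section UltraLimits.
Context {R : realType}.

Lemma cvg_null_sub (a : nat -> R) (l : R) : a @ \oo --> l -> (fun k => a k - l) @ \oo --> 0.
Proof.
move=> /cvgrPdist_le H; apply/cvgrPdist_le => e e0; apply: filterS (H e e0) => k.
by rewrite sub0r opprB.
Qed.

(** A cluster point of an ultrafilter is a limit of it. *)
Lemma ultra_compact_cvg (X : topologicalType) (K : set X) (U : set_system nat) (f : nat -> X) :
  UltraFilter U -> compact K -> (forall k, K (f k)) -> exists2 p, K p & f @ U --> p.
Proof.
move=> UU cK fK; have FK : U (f @^-1` K) by apply: (@filterS _ _ _ setT); [move=> k _; exact: fK|exact: filterT].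
have [p [Kp pc]] := cK (f @ U) _ FK; exists p => // B nB.
have [//|nU] := in_ultra_setVsetC (f @^-1` B) UU.
by have [x [nBx Bx]] := pc (~` B) B nU nB; case: nBx.
Qed.

Lemma ultra_limit_le n (U : set_system nat) (f : nat -> 'cV[R]_n) (l : 'cV[R]_n) (c : R) :
  ProperFilter U -> f @ U --> l -> (forall k, `|f k| <= c) -> `|l| <= c.
Proof.
move=> UU /cvgrPdist_le fl fc; apply/ler_addgt0Pr => e e0.
have [k Hk] := filter_ex (fl e e0).
by rewrite -[l](subrK (f k)) addrC; apply: (le_trans (ler_normD _ _)); exact: lerD.
Qed.

Lemma hoelder_continuous n (a b V : R) (y : R -> 'cV[R]_n) : 0 <= V ->
  (forall s t, s \in `[a, b] -> t \in `[a, b] -> `|y t - y s| ^+ 2 <= V * `|t - s|) ->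
  {within `[a, b], continuous y}.
Proof.
move=> V0 yV; apply/subspace_continuousP => x xab; apply/cvgrPdist_le => e e0.
have V1 : 0 < V + 1 by rewrite ltr_wpDl.
have d0 : 0 < e ^+ 2 / (V + 1) by rewrite divr_gt0// exprn_gt0.
change (\forall t \near nbhs x, `[a, b]%classic t -> `|y x - y t| <= e).
apply/nbhs_ballP; exists (e ^+ 2 / (V + 1)) => // t; rewrite -ball_normE /ball_/= => xt tab.
rewrite -(@ler_pXn2r _ 2) ?nnegrE ?(ltW e0)//; apply: (le_trans (yV t x tab xab)).
apply: (@le_trans _ _ ((V + 1) * (e ^+ 2 / (V + 1)))).
  by apply: ler_pM => //; [rewrite lerDl|exact: ltW].
by rewrite mulrC divfK// gt_eqF.
Qed.

(** The argument of Arzela-Ascoli without diagonal sequences. The limit is taken pointwise along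
    [U]; if convergence were not uniform, the bad times would themselves converge along [U],
    contradicting equicontinuity. *)
Lemma ultra_uniform_limit n (T rho V : R) (U : set_system nat) (y : nat -> R -> 'cV[R]_n) :
  0 <= T -> 0 <= V -> UltraFilter U ->
  (forall k t, t \in `[0, T] -> `|y k t| <= rho) ->
  (forall k s t, s \in `[0, T] -> t \in `[0, T] -> `|y k t - y k s| ^+ 2 <= V * `|t - s|) ->
  exists yb, (forall s t, s \in `[0, T] -> t \in `[0, T] -> `|yb t - yb s| ^+ 2 <= V * `|t - s|) /\
    forall e : R, 0 < e -> \forall k \near U, forall t, t \in `[0, T] -> `|y k t - yb t| <= e.
Proof.
move=> T0 V0 UU yr yV.
have /choice[yb Hyb] (t : R) : exists l : 'cV[R]_n, t \in `[0, T] -> (fun k => y k t) @ U --> l.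
  have [tT|tT] := boolP (t \in `[0, T]); last by exists 0.
  have [l _ Hl] := ultra_compact_cvg UU (box_compact (rho := rho)) (fun k => yr k t tT).
  by exists l.
have ybV s t : s \in `[0, T] -> t \in `[0, T] -> `|yb t - yb s| ^+ 2 <= V * `|t - s|.
  move=> sT tT; have VV : 0 <= V * `|t - s| by rewrite mulr_ge0.
  rewrite -[leRHS]sqr_sqrtr// lerXn2r ?nnegrE ?sqrtr_ge0//.
  apply: (@ultra_limit_le n U (fun k => y k t - y k s) (yb t - yb s) _ (@ultra_proper _ U UU)).
    by apply: cvgB; exact: Hyb.
  by move=> k; rewrite -(@ler_pXn2r _ 2) ?nnegrE ?sqrtr_ge0// sqr_sqrtr// yV.
exists yb; split=> // e e0.
have [//|nA] := in_ultra_setVsetC [set k | forall t, t \in `[0, T] -> `|y k t - yb t| <= e] UU.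
(* A time at which the bound fails, whenever there is one; the default time 0 belongs to the
   interval as well. *)
have /choice[tau Htau] k : exists t, t \in `[0, T] /\
    (~ (forall t, t \in `[0, T] -> `|y k t - yb t| <= e) -> e < `|y k t - yb t|).
  have [H|/existsNP[t /not_implyP[tT /negP]]] := pselect (forall t, t \in `[0, T] -> `|y k t - yb t| <= e).
    by exists 0; split=> //; rewrite in_itv/= lexx.
  by rewrite -ltNge => H; exists t.
have [p pT taup] := ultra_compact_cvg UU (@segment_compact _ 0 T) (fun k => (Htau k).1).
have e4 : 0 < e / 4 by rewrite divr_gt0.
have V1 : 0 < V + 1 by rewrite ltr_wpDl.
have d0 : 0 < (e / 4) ^+ 2 / (V + 1) by rewrite divr_gt0// exprn_gt0.
move/cvgrPdist_le : taup => /(_ _ d0) E1.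
move/cvgrPdist_le : (Hyb p pT) => /(_ _ e4) E2.
have [k [[nAk E1k] E2k]] := filter_ex (filterI (filterI nA E1) E2).
have [tkT /(_ nAk) big] := Htau k.
have small (x : 'cV[R]_n) : `|x| ^+ 2 <= V * `|tau k - p| -> `|x| <= e / 4.
  move=> H; rewrite -(@ler_pXn2r _ 2) ?nnegrE ?(ltW e4)//; apply: (le_trans H).
  apply: (@le_trans _ _ ((V + 1) * ((e / 4) ^+ 2 / (V + 1)))).
    by apply: ler_pM => //; [rewrite lerDl|rewrite distrC].
  by rewrite mulrC divfK// gt_eqF.
have S1 := small _ (yV k p (tau k) pT tkT).
have S2 := small _ (ybV p (tau k) pT tkT).
(* Three errors of [e / 4]: the move from [tau k] to [p] for [y k] and for [yb], and pointwise
   convergence at [p]. *)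
suff : `|y k (tau k) - yb (tau k)| <= e / 4 + e / 4 + e / 4 by lra.
rewrite (_ : _ - _ = (y k (tau k) - y k p) - (yb p - y k p) - (yb (tau k) - yb p)); last first.
  by apply/matrixP => i j; rewrite !mxE; ring.
apply: (le_trans (ler_normB _ _)); apply: lerD => //.
by apply: (le_trans (ler_normB _ _)); exact: lerD.
Qed.

(** The sets of [U] meet every tail, so an index satisfying [Q j] can be found beyond any given
    one. *)
Lemma ultra_subsequence (U : set_system nat) (Q : nat -> nat -> Prop) : ProperFilter U ->
  (\oo `<=` U) -> (forall j, U (Q j)) ->
  exists s : nat -> nat, {homo s : j k / (j < k)%N} /\ forall j, Q j (s j).
Proof.
move=> UU ooU UQ.
have /choice[phi Hphi] (Nj : nat * nat) : exists k, (Nj.1 < k)%N /\ Q Nj.2 k.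
  have B : U [set k | (Nj.1 < k)%N] by apply: ooU; exact: nbhs_infty_gt.
  by have [k [Qk Nk]] := filter_ex (filterI (UQ Nj.2) B); exists k.
pose s := fix s j := phi (if j is j'.+1 then s j' else 0%N, j).
exists s; split; last by case=> [|j]; [have [] := Hphi (0%N, 0%N)|have [] := Hphi (s j, j.+1)].
apply: homo_ltn => [x y z|j]; first exact: ltn_trans.
by have [] := Hphi (s j, j.+1).
Qed.

End UltraLimits.

Section MinimizingSequences.
Context {R : realType} {n m : nat} (P : ocp R n m).
Local Notation T := (hor P).
Context (A1 : regA1 P) (std : standing P).

(** The positive weight [beta] lets the cost control the energy, and convergent costs are
    bounded. *)
Lemma energy_bounded (y : nat -> R -> 'cV[R]_n) (u : nat -> R -> 'cV[R]_m) (J : R) :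
  (forall k, controlled P 0 T (y k) (u k)) ->
  (fun k => cost P 0 (y k) (u k)) @ \oo --> J ->
  exists2 E, 0 <= E & forall k, Int 0 T (fun s => enorm (u k s) ^+ 2) <= E.
Proof.
move=> cyu cJ; have b0 : 0 < beta P by case: std.
have cJ0 : (fun k => cost P 0 (y k) (u k) - J) @ \oo --> 0.
  exact: cvg_null_sub.
have [K K0 HK] := null_bounded cJ0.
exists (2 / beta P * (`|J| + K)); first by rewrite mulr_ge0 ?addr_ge0// divr_ge0// ltW.
move=> k; have H := energy_le_cost std (cyu k).
have C : cost P 0 (y k) (u k) <= `|J| + K.
  have := le_trans (ler_norm _) (HK k); have := ler_norm J; lra.
have := le_trans H C; rewrite -[2 / _]invf_div ler_pdivlMl//; last by rewrite divr_gt0.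
Qed.

Lemma minimizing_compactness (I : finType) (y0 : I -> 'cV[R]_n) (J : I -> R) (rho : R)
    (y : nat -> I -> R -> 'cV[R]_n) (u : nat -> I -> R -> 'cV[R]_m) :
  (forall k i, controlled P 0 T (y k i) (u k i)) -> (forall k i, y k i 0 = y0 i) ->
  (forall k i (t : R), t \in `[0, T] -> `|y k i t| <= rho) ->
  (forall i, (fun k => cost P 0 (y k i) (u k i)) @ \oo --> J i) ->
  (forall i z w, controlled P 0 T z w -> z 0 = y0 i -> J i <= cost P 0 z w) ->
  exists s : nat -> nat, {homo s : j k / (j < k)%N} /\ exists (yb : I -> R -> 'cV[R]_n) (ub : I -> R -> 'cV[R]_m) (D : nat -> R),
  [/\ D @ \oo --> 0, forall i, {within `[0, T], continuous (yb i)}, forall i, inL2 0 T (ub i),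
    forall j i (t : R), t \in `[0, T] -> `|y (s j) i t - yb i t| <= D j &
    forall i, (fun j => Int 0 T (fun t => enorm (u (s j) i t - ub i t) ^+ 2)) @ \oo --> 0].
Proof.
move=> cyu yy0 yr cJ Jmin; have T0 := hor_gt0 std; have b0 : 0 < beta P by case: std.
have /choice[E0 HE0] i : exists E, 0 <= E /\ forall k, Int 0 T (fun s => enorm (u k i s) ^+ 2) <= E.
  by have [E E0 H] := energy_bounded (fun k => cyu k i) (cJ i); exists E.
pose E := \sum_i E0 i.
have E_ge0 : 0 <= E by apply: sumr_ge0 => i _; have [] := HE0 i.
have uE k i : Int 0 T (fun s => enorm (u k i s) ^+ 2) <= E.
  apply: le_trans ((HE0 i).2 k) _; rewrite /E (bigD1 i)//= lerDl.
  by apply: sumr_ge0 => j _; have [] := HE0 j.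
have [V V0 HV] := controlled_hoelder A1 std rho E_ge0.
have [U [UU ooU]] := ultraFilterLemma (eventually_filter : ProperFilter \oo).
have PU : ProperFilter U := @ultra_proper _ U UU.
have /choice[yb Hyb] i := ultra_uniform_limit (ltW T0) V0 UU (fun k => yr k i)
  (fun k => HV _ _ (cyu k i) (yr k i) (uE k i)).
have cyb i : {within `[0, T], continuous (yb i)} by apply: hoelder_continuous V0 _; exact: (Hyb i).1.
(* Distance to the limit and excess cost are kept below the same rate, which then serves as [delta]
   in the midpoint estimate. *)
pose Q j k := (forall i, (forall t, t \in `[0, T] -> `|y k i t - yb i t| <= harmonic j) /\
  cost P 0 (y k i) (u k i) - J i <= harmonic j).
have UQ j : U (Q j).
  have h0 : 0 < harmonic j :> R by rewrite invr_gt0.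
  apply: filter_forall => i; apply: filterI; first exact: (Hyb i).2.
  apply: ooU; move/cvgrPdist_le : (cJ i) => /(_ _ h0); apply: filterS => k.
  by rewrite distrC; apply: le_trans; exact: ler_norm.
have [s [s_homo sQ]] := ultra_subsequence PU ooU UQ.
have sQ2 j k : (j <= k)%N -> Q j (s k).
  move=> jk i; have hh : harmonic k <= harmonic j :> R.
    by rewrite lef_pV2 ?posrE// ler_nat ltnS.
  have [H1 H2] := sQ k i; split; last exact: le_trans hh.
  by move=> t tT; exact: le_trans (H1 t tT) hh.
exists s; split=> //.
have cau i c : forall e, 0 < e -> exists K, forall k l, (K <= k)%N -> (K <= l)%N ->
    Int 0 T (fun t => (u (s k) i t c 0 - u (s l) i t c 0) ^+ 2) <= e.
  move=> e e0; have [C [d [C0 d0 HC]]] := midpoint_estimate A1 std rho E_ge0 (cyb i).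
  (* The two excess costs, each with factor 2, and the term [C * delta] add up to
     [(4 + C) * harmonic K]. *)
  have q0 : 0 < Num.min d (beta P / 2 * e / (4 + C)).
    by rewrite lt_min d0/= divr_gt0 ?mulr_gt0// ltr_wpDr.
  have [K _ HK] : \forall k \near \oo, harmonic k <= Num.min d (beta P / 2 * e / (4 + C)).
    move/cvgrPdist_le : (@cvg_harmonic R) => /(_ _ q0); apply: filterS => k.
    by rewrite sub0r normrN; apply: le_trans; exact: ler_norm.
  exists K => k l Kk Kl; have := HK K (leqnn K); rewrite le_min => /andP[hd he].
  have [yk ck] := sQ2 K k Kk i; have [yl cl] := sQ2 K l Kl i.
  have h0 : 0 <= harmonic K :> R by rewrite invr_ge0.
  have := HC (y0 i) (J i) _ _ _ _ _ h0 hd (cyu (s k) i) (cyu (s l) i) (yy0 _ i) (yy0 _ i)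
    (yr _ i) (yr _ i) (uE _ i) (uE _ i) yk yl (Jmin i).
  have dL2 := inL2B (cyu (s k) i).1 (cyu (s l) i).1.
  have comp : Int 0 T (fun t => (u (s k) i t c 0 - u (s l) i t c 0) ^+ 2) <=
     Int 0 T (fun t => enorm (u (s k) i t - u (s l) i t) ^+ 2).
    apply: Int_le; last 2 first.
    - exact: sum_inL2.
    - move=> t _; have := entry_le_enorm (u (s k) i t - u (s l) i t) c 0; rewrite !mxE => H.
      by rewrite -[leLHS]real_normK ?num_real// lerXn2r ?nnegrE ?enorm_ge0.
    exact: square_integrable_sqr (square_integrableB ((cyu (s k) i).1 c) ((cyu (s l) i).1 c)).
  move=> H; apply: (le_trans comp); rewrite -(@ler_pM2l _ (beta P / 2)) ?divr_gt0//.
  apply: (le_trans H); move: he; rewrite ler_pdivlMr ?ltr_wpDr// => he.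
  by move: ck cl he; move: (harmonic K) (beta P / 2 * e) => h x *; lra.
have /choice[ub0 Hub0] (ic : I * 'I_m) := L2_complete (ltW T0)
  (fun k => (cyu (s k) ic.1).1 ic.2) (cau ic.1 ic.2).
pose ub i t : 'cV[R]_m := \col_c ub0 (i, c) t.
have ubL2 i : inL2 0 T (ub i).
  by move=> c; apply: (eq_square_integrable _ (Hub0 (i, c)).1) => t _; rewrite mxE.
exists yb, ub, harmonic; split=> //.
- exact: cvg_harmonic.
- by move=> j i t tT; have [H _] := sQ j i; exact: H.
move=> i; rewrite (_ : (fun j => _) = fun j => \sum_c Int 0 T (fun t => (u (s j) i t c 0 - ub0 (i, c) t) ^+ 2)).
  have : (fun j => \sum_c Int 0 T (fun t => (u (s j) i t c 0 - ub0 (i, c) t) ^+ 2)) @ \oo -->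
    \sum_(c < m) (0 : R) by apply: cvg_sum_seq => c; exact: (Hub0 (i, c)).2.
  by rewrite big1_eq.
apply/funext => j; rewrite Int_enorm_sqr; last exact: inL2B (cyu (s j) i).1 (ubL2 i).
by apply: eq_bigr => c _; apply: eq_Int => t _; rewrite !mxE.
Qed.

End MinimizingSequences.

(** * Convergence of the learned closed loops *)

Section EssentialBound.
Context {R : realType}.
Local Notation mu := (@lebesgue_measure R).

(** Otherwise an interval of positive length would be contained in a null set. *)
Lemma ae_dense (c d : R) (Q : R -> Prop) : c < d -> {ae mu, forall t, Q t} -> exists2 t, t \in `]c, d[ & Q t.
Proof.
move=> cd [N [mN N0 QN]]; apply: contrapT => H.
have cdN : `]c, d[%classic `<=` N.
  move=> t tcd; apply: QN => Qt; apply: H; by exists t.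
have := le_measure mu (mem_set (measurable_itv `]c, d[)) (mem_set mN) cdN.
rewrite [leRHS](_ : _ = 0%E)//= lebesgue_measure_itv/= lte_fin cd -EFinD lee_fin subr_le0.
by rewrite leNgt cd.
Qed.

Lemma Linfnorm_bound n (T B : R) (y : R -> 'cV[R]_n) : 0 < T -> {within `[0, T], continuous y} ->
  (Linfnorm 0 T y <= B%:E)%E -> forall t, t \in `[0, T] -> `|y t| <= B.
Proof.
move=> T0 cy; rewrite /Linfnorm Lnorm.unlock.
(* The norm with exponent infinity is the essential supremum on a space of positive measure. *)
have -> : (0 < mu [set: R])%E.
  have -> : [set: R] = [set` `]-oo, +oo[%R] by rewrite set_itvNyy.
  by rewrite lebesgue_measure_itv/= addye// ltry.
move=> /ess_sup_inf.ess_supP ae_le.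
have dense c d : 0 <= c -> c < d -> d <= T -> exists2 s, s \in `]c, d[ & `|y s| <= B.
  move=> c0 cd dT; have [s scd H] := ae_dense cd ae_le; exists s => //.
  have sT : s \in (`]0, T[%classic : set R).
    rewrite inE/= in_itv/=; move: scd; rewrite in_itv/= => /andP[cs sd].
    by rewrite (le_lt_trans c0 cs) (lt_le_trans sd dT).
  move: H; rewrite /= patchE sT.
  rewrite lee_fin ger0_norm ?enorm_ge0//; apply: le_trans; exact: mx_norm_le_enorm.
move=> t tT; apply/ler_addgt0Pr => e e0.
move/subspace_continuousP : cy => /(_ t tT)/cvgrPdist_le/(_ e e0) ct.
have ct' : \forall s \near nbhs t, `[0, T]%classic s -> `|y t - y s| <= e := ct.
have /nbhs_ballP[r /= r0 Hr] := ct'.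
have := tT; rewrite in_itv/= => /andP[t0 tT'].
(* A one-sided interval next to [t], to the right unless [t] is the final time, so that endpoints
   are covered. *)
have [c [d [c0 cd dT cdr]]] : exists c d, [/\ 0 <= c, c < d, d <= T & forall s, s \in `]c, d[ -> `|t - s| < r].
  have [tlT|Tt] := ltP t T.
    exists t, (Num.min T (t + r)); split=> //.
    - by rewrite lt_min tlT ltrDl.
    - by rewrite ge_min lexx.
    move=> s; rewrite in_itv/= lt_min => /andP[ts /andP[_ sr]].
    by rewrite distrC gtr0_norm ?subr_gt0// ltrBlDl.
  exists (Num.max 0 (t - r)), t; split=> //.
  - by rewrite le_max lexx.
  - by rewrite gt_max ltrBlDr ltrDl r0 (lt_le_trans T0 Tt).
  move=> s; rewrite in_itv/= gt_max => /andP[/andP[_ rs] st].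
  by rewrite gtr0_norm ?subr_gt0// ltrBlDr -ltrBlDl.
have [s scd sB] := dense c d c0 cd dT.
have sT : s \in `[0, T].
  move: scd; rewrite !in_itv/= => /andP[cs sd].
  by rewrite (le_trans c0 (ltW cs)) (le_trans (ltW sd) dT).
have := Hr s; rewrite -ball_normE /ball_/= => /(_ (cdr s scd) sT) ys.
rewrite -[y t](subrK (y s)) addrC; apply: (le_trans (ler_normD _ _)).
exact: lerD.
Qed.

End EssentialBound.

Section Optimality.
Context {R : realType} {n m : nat} (P : ocp R n m) (M : R).
Local Notation T := (hor P).
Context (A1 : regA1 P) (std : standing P) (A2 : regA2 P M).
Context (A : ansatz R n) (e0 : R) (thapp : forall e, 'cV[R]_(pdim A e)).
Context (AP : approx_assumption P M e0 thapp).

Lemma state_eq_controlled (y0 : 'cV[R]_n) e (th : 'cV[R]_(pdim A e)) (y : R -> 'cV[R]_n) :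
  0 < e <= e0 -> inH1 0 T y -> state_eq P 0 y0 y (Fth P th y) ->
  controlled P 0 T y (Fth P th y) /\ y 0 = y0.
Proof.
move=> ee [cy _ _] [wy yy0]; have T0 := hor_gt0 std; split=> //; split.
  apply: continuous_inL2.
  have lG : loc_lip 0 T (fun t => grad (Vth th t)).
    case: AP => _ /(_ e ee)[_ HC _] _; exact: C2_field_loc_lip (Vth_field 0 T th HC).
  exact: loc_lip_along (feedback_loc_lip A1 lG) cy.
exact: weak_deriv_trajectory T0 cy wy.
Qed.

Lemma adjoint_eq_trajectory (y p : R -> 'cV[R]_n) (u : R -> 'cV[R]_m) : inH1 0 T p -> adjoint_eq P y u p ->
  trajectory 0 T p (fun s => adjoint_rhs P y u s (p s)) /\
  p T = (Q2 P)^T *m Q2 P *m (y T - ydT P).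
Proof.
move=> [cp _ _] [wp pT]; split=> //.
exact: weak_deriv_trajectory (hor_gt0 std) cp wp.
Qed.

Lemma cost_le_Jeps g1 g2 e (th : 'cV[R]_(pdim A e)) (y p : R -> 'cV[R]_n) : 0 <= g1 -> 0 <= g2 ->
  cost P 0 y (Fth P th y) <= Jeps P g1 g2 y p th.
Proof.
move=> g10 g20; rewrite /Jeps lerDl; apply: Int_ge0 => t _.
apply: addr_ge0; (apply: mulr_ge0; [exact: divr_ge0|]); last exact: sqr_ge0.
exact: sqr_ge0.
Qed.

(** One parameter [thapp e] must serve all initial values at once, whence common constants over the
    finite index set. *)
Lemma closed_loop_competitors (N : nat) (y0 : 'I_N -> 'cV[R]_n) (ys : 'I_N -> R -> 'cV[R]_n) g1 g2 :
  0 <= g1 -> 0 <= g2 ->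
  (forall i, closed_loop P M (y0 i) (ys i)) -> (forall i, minimizer P (y0 i) (ys i) (Fstar P M (ys i))) ->
  exists C e1, [/\ 0 <= C, 0 < e1 & forall e, 0 < e <= e0 -> e <= e1 -> exists y' p',
    learning_feasible P y0 y' p' (thapp e) /\
    forall i, Jeps P g1 g2 (y' i) (p' i) (thapp e) <= cost P 0 (ys i) (Fstar P M (ys i)) + C * e].
Proof.
move=> g10 g20 ycl ymin; have T0 := hor_gt0 std; have M0 : 0 < M by case: A2.
have [r r0 Hr] := @bigball_tube R n m P M T0 M0.
(* Half of the tube radius, so that every point of the smaller tube has a whole neighbourhood in the
   ball. *)
have r2 : 0 < r / 2 by rewrite divr_gt0.
have tube i t x : t \in `[0, T] -> `|x - ys i t| <= r / 2 -> nbhs x (bigball P M).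
  move=> tT xy; apply: (nbhs_tube r2) => z zx; have [yH _ yW] := ycl i.
  apply: (Hr (ys i) t yH yW tT).
  rewrite -[z - _](subrKA x); apply: (le_trans (ler_normD _ _)).
  by rewrite [leRHS]splitr lerD.
have /choice[Ce HCe] i : exists Ce : R * R, [/\ 0 <= Ce.1, 0 < Ce.2 &
    forall e, 0 < e <= e0 -> e <= Ce.2 -> exists y' p',
    [/\ inH1 0 T y', inH1 0 T p', state_eq P 0 (y0 i) y' (Fth P (thapp e) y'),
      adjoint_eq P y' (Fth P (thapp e) y') p' &
      Jeps P g1 g2 y' p' (thapp e) <= cost P 0 (ys i) (Fstar P M (ys i)) + Ce.1 * e]].
  have [cyu _] := admissible_controlled T0 (ymin i).1.
  have [p [tp pT]] := adjoint_exists A1 std (trajectory_continuous cyu.2) cyu.1.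
  have [C [e1 [C0 e10 H]]] := competitor A1 std A2 AP g10 g20 (ymin i) tp pT r2 (tube i).
  by exists (C, e1).
pose C := \sum_i (Ce i).1.
have C0 : 0 <= C by apply: sumr_ge0 => i _; have [] := HCe i.
have [e1 [e10 He1]] : exists e1 : R, 0 < e1 /\ forall i, e1 <= (Ce i).2.
  (* The default value 1 keeps the threshold positive when there are no initial values. *)
  exists (\big[Num.min/1]_i (Ce i).2); split; last by move=> i; exact: bigmin_le_cond.
  by apply/bigmin_gtP => //; split=> // i _; have [] := HCe i.
exists C, e1; split=> // e ee ee1; have /andP[e_gt0 _] := ee.
have /choice[yp Hyp] i : exists yp : (R -> 'cV[R]_n) * (R -> 'cV[R]_n),
    [/\ inH1 0 T yp.1, inH1 0 T yp.2, state_eq P 0 (y0 i) yp.1 (Fth P (thapp e) yp.1),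
      adjoint_eq P yp.1 (Fth P (thapp e) yp.1) yp.2 &
      Jeps P g1 g2 yp.1 yp.2 (thapp e) <= cost P 0 (ys i) (Fstar P M (ys i)) + (Ce i).1 * e].
  have [_ _ H] := HCe i; have [y' [p' H']] := H e ee (le_trans ee1 (He1 i)).
  by exists (y', p').
exists (fun i => (yp i).1), (fun i => (yp i).2); split=> i.
  by have [] := Hyp i.
have [_ _ _ _ H] := Hyp i; apply: (le_trans H); rewrite lerD2l ler_wpM2r ?(ltW e_gt0)//.
by rewrite /C (bigD1 i)//= lerDl; apply: sumr_ge0 => j _; have [] := HCe j.
Qed.

(** Each learned closed loop is admissible, so no excess cost is negative; minimality against the
    competitor bounds the weighted total. A single excess is then at most the total divided by its
    weight. *)
Lemma costs_converge (N : nat) (y0 : 'I_N -> 'cV[R]_n) (ys : 'I_N -> R -> 'cV[R]_n)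
    (w : 'I_N -> R) g1 g2 (ge : R -> R) (eps : nat -> R) (y p : nat -> 'I_N -> R -> 'cV[R]_n)
    (th : forall k, 'cV[R]_(pdim A (eps k))) :
  (forall i, closed_loop P M (y0 i) (ys i)) -> (forall i, minimizer P (y0 i) (ys i) (Fstar P M (ys i))) ->
  (forall i, 0 < w i) -> 0 <= g1 -> 0 <= g2 -> (forall e, 0 < e <= e0 -> 0 < ge e) ->
  (exists C : R, \forall e \near 0^'+, ge e * pnorm (thapp e) ^+ 2 <= C * e) ->
  (forall k, 0 < eps k <= e0) -> eps @ \oo --> 0 ->
  (forall k, learning_solution P y0 w g1 g2 ge (y k) (p k) (th k)) ->
  forall i, (fun k => cost P 0 (y k i) (Fth P (th k) (y k i))) @ \oo --> cost P 0 (ys i) (Fstar P M (ys i)).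
Proof.
move=> ycl ymin w0 g10 g20 ge0 [Cg HCg] epsP eps0 sol i; have T0 := hor_gt0 std.
have [C [e1 [C0 e10 HC]]] := closed_loop_competitors g10 g20 ycl ymin.
pose J j := cost P 0 (ys j) (Fstar P M (ys j)).
pose c k j := cost P 0 (y k j) (Fth P (th k) (y k j)).
have cJ k j : J j <= c k j.
  have [feas _] := sol k; have [yH pH ys1 _] := feas j.
  have [cyu yy0] := state_eq_controlled (epsP k) yH ys1.
  apply: (ymin j).2; rewrite -yy0; exact: controlled_admissible (ltW T0) cyu.
pose K := (\sum_j w j) * C + `|Cg|.
have W0 : 0 <= \sum_j w j by apply: sumr_ge0 => j _; exact: ltW.
have K0 : 0 <= K by apply: addr_ge0 => //; exact: mulr_ge0.
have bound : \forall k \near \oo, c k i - J i <= K / w i * eps k.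
  move/cvgrPdist_lt : (eps0) => eps_small.
  have E1 := eps_small _ e10.
  have /nbhs_ballP[r /= r0 Hr] : \forall e \near nbhs (0 : R), 0 < e -> ge e * pnorm (thapp e) ^+ 2 <= Cg * e := HCg.
  have E2 := eps_small _ r0.
  apply: filterS2 E1 E2 => k; rewrite sub0r normrN => k1 k2.
  have ek := epsP k; have /andP[ek0 _] := ek.
  rewrite (gtr0_norm ek0) in k1.
  have [y' [p' [feas' Jle]]] := HC (eps k) ek (ltW k1).
  have [_ opt] := sol k.
  have := opt y' p' (thapp (eps k)) feas'.
  have G := Hr (eps k) _ ek0.
  have {}G : ge (eps k) * pnorm (thapp (eps k)) ^+ 2 <= Cg * eps k.
    by apply: G; rewrite -ball_normE /ball_/= sub0r normrN.
  have gk := ge0 _ ek.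
  rewrite /learning_obj => O.
  have L1 : \sum_j w j * c k j <= \sum_j w j * Jeps P g1 g2 (y k j) (p k j) (th k) + ge (eps k) / 2 * pnorm (th k) ^+ 2.
    apply: (@le_trans _ _ (\sum_j w j * Jeps P g1 g2 (y k j) (p k j) (th k))).
      by apply: ler_sum => j _; rewrite ler_wpM2l ?(ltW (w0 j))//; exact: cost_le_Jeps.
    by rewrite lerDl; apply: mulr_ge0; [rewrite divr_ge0// ltW|exact: sqr_ge0].
  have L2 : \sum_j w j * Jeps P g1 g2 (y' j) (p' j) (thapp (eps k)) <= \sum_j w j * J j + (\sum_j w j) * C * eps k.
    rewrite -mulrA mulr_suml -big_split/=; apply: ler_sum => j _; rewrite -mulrDr.
    by rewrite ler_wpM2l ?(ltW (w0 j))// Jle.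
  have L3 : ge (eps k) / 2 * pnorm (thapp (eps k)) ^+ 2 <= `|Cg| * eps k.
    rewrite mulrAC; apply: (@le_trans _ _ (Cg * eps k / 2)).
      by rewrite ler_wpM2r.
    rewrite ler_pdivrMr// (le_trans (ler_wpM2r (ltW ek0) (ler_norm Cg)))//.
    by rewrite ler_peMr ?(mulr_ge0 (normr_ge0 Cg) (ltW ek0))// ler1n.
  (* The competitor pays its excess cost and its regularisation term, the latter of order [eps k] by
     the assumption on [ge]. *)
  have L4 : \sum_j w j * (c k j - J j) <= K * eps k.
    rewrite (eq_bigr (fun j => w j * c k j - w j * J j)) => [|j _]; last by rewrite mulrBr.
    rewrite big_split/= sumrN /K mulrDl lerBlDl addrA.
    exact: le_trans L1 (le_trans O (lerD L2 L3)).
  rewrite mulrAC ler_pdivlMr// mulrC; apply: le_trans L4.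
  rewrite (bigD1 i)//= lerDl; apply: sumr_ge0 => j _.
  by rewrite mulr_ge0 ?(ltW (w0 j))// subr_ge0.
apply: null_sub_cvg; apply/cvgrPdist_le => e e_gt0.
have /cvgrPdist_le/(_ e e_gt0) := nullZ (K / w i) eps0.
apply: filterS2 bound => k bk; rewrite !sub0r !normrN => H.
rewrite -/(c k i) -/(J i) ger0_norm ?subr_ge0//; apply: (le_trans bk).
exact: le_trans (ler_norm _) H.
Qed.

End Optimality.

(** * Identification of strong accumulation points *)

Section AccumulationPoints.
Context {R : realType} {n m : nat} (P : ocp R n m).
Local Notation T := (hor P).
Context (A1 : regA1 P) (std : standing P).
Implicit Types (y p : R -> 'cV[R]_n) (u : R -> 'cV[R]_m).

(** The squared norm is the velocity distance plus at most [n * T] times the squared uniform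
    distance. *)
Lemma Wnorm_null (yk vk : nat -> R -> 'cV[R]_n) y v (D : nat -> R) :
  (forall k, trajectory 0 T (yk k) (vk k)) -> trajectory 0 T y v -> D @ \oo --> 0 ->
  (forall k t, t \in `[0, T] -> `|yk k t - y t| <= D k) ->
  (fun k => Int 0 T (fun s => enorm (vk k s - v s) ^+ 2)) @ \oo --> 0 ->
  (fun k => Wnorm T (fun t => yk k t - y t)) @ \oo --> 0.
Proof.
move=> tk ty D0 yD vD; have T0 := hor_gt0 std.
apply: null_sqr.
apply: (null_le (b := fun k => Int 0 T (fun s => enorm (vk k s - v s) ^+ 2) + n%:R * T * D k ^+ 2)); last first.
  by apply: nullD => //; apply: nullZ; exact: null_square.
move=> k; rewrite sqr_ge0/=; have td := trajectoryB (ltW T0) (tk k) ty.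
have dL2 := continuous_inL2 (trajectory_continuous td); have wL2 := trajectory_inL2 td.
rewrite (Wnorm_sqr T0 td) !L2norm_sqr// -!Int_enorm_sqr// lerD2l.
have := Int_le_cst (c := n%:R * D k ^+ 2) (ltW T0) (sum_inL2 dL2).
rewrite subr0 [leRHS]mulrAC; apply => s sT; apply: (le_trans (enorm_sqr_le _)); rewrite ler_wpM2l//.
have H := yD k s (in_segment sT); rewrite lerXn2r ?nnegrE//.
exact: le_trans H.
Qed.

Lemma L2norm_null (uk : nat -> R -> 'cV[R]_m) u : (forall k, inL2 0 T (uk k)) -> inL2 0 T u ->
  (fun k => L2norm 0 T (fun t => uk k t - u t)) @ \oo --> 0 <->
  (fun k => Int 0 T (fun t => enorm (uk k t - u t) ^+ 2)) @ \oo --> 0.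
Proof.
move=> ukL2 uL2; have E k : L2norm 0 T (fun t => uk k t - u t) ^+ 2 = Int 0 T (fun t => enorm (uk k t - u t) ^+ 2).
  have dL2 := inL2B (ukL2 k) uL2; by rewrite L2norm_sqr// Int_enorm_sqr.
have EE : (fun k => Int 0 T (fun t => enorm (uk k t - u t) ^+ 2)) =
    (fun k => L2norm 0 T (fun t => uk k t - u t) ^+ 2) by apply/funext => k; rewrite E.
by rewrite EE; split; [exact: null_square|exact: null_sqr].
Qed.

Lemma Wnorm_null_uniform (yk : nat -> R -> 'cV[R]_n) y : (forall k, inH1 0 T (yk k)) -> inH1 0 T y ->
  (fun k => Wnorm T (fun t => yk k t - y t)) @ \oo --> 0 ->
  exists2 D : nat -> R, D @ \oo --> 0 & forall k t, t \in `[0, T] -> `|yk k t - y t| <= D k.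
Proof.
move=> ykH yH Wy; have T0 := hor_gt0 std.
have c0 : 0 <= 2 / T + 2 * T by apply: addr_ge0; [apply: divr_ge0 => //; exact: ltW|apply: mulr_ge0 => //; exact: ltW].
exists (fun k => Num.sqrt (2 / T + 2 * T) * Wnorm T (fun t => yk k t - y t)); first exact: nullZ.
move=> k t tT; have [v ty] := inH1_trajectory T0 yH; have [w tk] := inH1_trajectory T0 (ykH k).
have := embedding_bound T0 (trajectory_inH1 (ltW T0) (trajectoryB (ltW T0) tk ty)) tT.
apply: contraTle => H; rewrite -ltNge.
have W0 : 0 <= Num.sqrt (2 / T + 2 * T) * Wnorm T (fun t => yk k t - y t).
  by rewrite mulr_ge0 ?sqrtr_ge0 ?Wnorm_ge0.
have := lt_le_trans H (mx_norm_le_enorm _).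
rewrite -(@ltr_pXn2r _ 2) ?nnegrE ?enorm_ge0//.
by rewrite exprMn sqr_sqrtr.
Qed.

Lemma null_integrals_bounded (uk : nat -> R -> 'cV[R]_m) u : (forall k, inL2 0 T (uk k)) -> inL2 0 T u ->
  (fun k => Int 0 T (fun t => enorm (uk k t - u t) ^+ 2)) @ \oo --> 0 ->
  exists2 E, 0 <= E & forall k, Int 0 T (fun s => enorm (uk k s) ^+ 2) <= E.
Proof.
move=> ukL2 uL2 /null_bounded[K K0 HK].
have I0 : 0 <= Int 0 T (fun s => enorm (u s) ^+ 2) by apply: Int_ge0 => s _; exact: sqr_ge0.
exists (2 * Int 0 T (fun s => enorm (u s) ^+ 2) + 2 * K); first by rewrite addr_ge0// mulr_ge0.
move=> k; have dL2 := inL2B (ukL2 k) uL2.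
apply: (@le_trans _ _ (Int 0 T (fun s => 2 * enorm (u s) ^+ 2 + 2 * enorm (uk k s - u s) ^+ 2))).
  apply: Int_le.
  - exact: sum_inL2.
  - by apply: integrable_onD; apply: integrable_onZ; exact: sum_inL2.
  - by move=> s _; rewrite -{1}[uk k s](subrK (u s)) addrC; exact: enormD_sqr_le.
rewrite IntD; [|by apply: integrable_onZ; exact: sum_inL2..].
rewrite !IntZ; [|exact: sum_inL2..].
by rewrite lerD2l ler_wpM2l// (le_trans (ler_norm _) (HK k)).
Qed.

Lemma energy_limit (uk : nat -> R -> 'cV[R]_m) u : (forall k, inL2 0 T (uk k)) -> inL2 0 T u ->
  (fun k => Int 0 T (fun t => enorm (uk k t - u t) ^+ 2)) @ \oo --> 0 ->
  (fun k => Int 0 T (fun t => enorm (uk k t) ^+ 2) - Int 0 T (fun t => enorm (u t) ^+ 2)) @ \oo --> 0.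
Proof.
move=> ukL2 uL2 I0; apply/cvgrPdist_le => e e0.
pose E := Int 0 T (fun s => enorm (u s) ^+ 2).
have E0 : 0 <= E by apply: Int_ge0 => s _; exact: sqr_ge0.
have E1 : 0 < E + 1 by rewrite ltr_wpDl.
(* This choice leaves [e / 2] for the term with the energy of [u]; the other half is left for the
   squared distance of the controls. *)
pose eta := e / (2 * (E + 1)); have eta0 : 0 < eta by rewrite divr_gt0// mulr_gt0.
have c0 : 0 < 1 + eta^-1 by rewrite addr_gt0// invr_gt0.
have q0 : 0 < e / 2 / (1 + eta^-1) by rewrite !divr_gt0.
move/cvgrPdist_le : I0 => /(_ _ q0); apply: filterS => k; rewrite !sub0r !normrN => H.
apply: (le_trans (energy_diff eta0 uL2 (ukL2 k))).
have {}H := le_trans (ler_norm _) H.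
rewrite ler_pdivlMr// mulrC in H.
have : eta * E <= e / 2.
  rewrite /eta invfM mulrA mulrAC -[leRHS]mulr1 -mulrA ler_wpM2l ?divr_ge0 ?(ltW e0)//.
  by rewrite (ler_pdivrMr _ _ E1) mul1r lerDl.
by move=> HE; rewrite [leRHS]splitr; exact: lerD.
Qed.

Lemma bounded_of_uniform (yk : nat -> R -> 'cV[R]_n) y (D : nat -> R) : {within `[0, T], continuous y} ->
  D @ \oo --> 0 -> (forall k t, t \in `[0, T] -> `|yk k t - y t| <= D k) ->
  exists2 rho, forall t, t \in `[0, T] -> `|y t| <= rho &
    forall k t, t \in `[0, T] -> `|yk k t| <= rho.
Proof.
move=> cy /null_bounded[K K0 HK] yD; have [rho rho0 yr] := continuous_bounded_norm cy.
exists (rho + K) => [t tT|k t tT]; first by rewrite (le_trans (yr t tT))// lerDl.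
rewrite -[yk k t](subrK (y t)) addrC; apply: (le_trans (ler_normD _ _)).
apply: lerD; first exact: yr.
exact: le_trans (yD k t tT) (le_trans (ler_norm _) (HK k)).
Qed.

(** * Limits along a fixed sequence with uniformly convergent states and L^2 convergent controls *)

Section Sequence.
Context (yk : nat -> R -> 'cV[R]_n) (uk : nat -> R -> 'cV[R]_m) (y : R -> 'cV[R]_n) (u : R -> 'cV[R]_m) (D : nat -> R).
Context (ck : forall k, controlled P 0 T (yk k) (uk k)) (cy : {within `[0, T], continuous y}) (uL2 : inL2 0 T u).
Context (D0 : D @ \oo --> 0) (yD : forall k t, t \in `[0, T] -> `|yk k t - y t| <= D k).
Context (uI : (fun k => Int 0 T (fun t => enorm (uk k t - u t) ^+ 2)) @ \oo --> 0).

Lemma D_ge0 k : 0 <= D k.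
Proof.
have T0 := hor_gt0 std.
have T00 : 0 \in `[0, T] by rewrite in_itv/= lexx ltW.
exact: le_trans (normr_ge0 _) (yD k T00).
Qed.

Lemma velocity_limit : (fun k => Int 0 T (fun s =>
  enorm (control_rhs P (uk k) s (yk k s) - control_rhs P u s (y s)) ^+ 2)) @ \oo --> 0.
Proof.
have [rho yr ykr] := bounded_of_uniform cy D0 yD.
have E0 : 0 <= Int 0 T (fun s => enorm (u s) ^+ 2) by apply: Int_ge0 => s _; exact: sqr_ge0.
have [C C0 HC] := control_rhs_stability A1 std rho E0.
apply: (null_le (b := fun k => C * (D k ^+ 2 + Int 0 T (fun s => enorm (uk k s - u s) ^+ 2)))); last first.
  by apply: nullZ; apply: nullD => //; exact: null_square.
move=> k; apply/andP; split; first by apply: Int_ge0 => s _; exact: sqr_ge0.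
have [ukL2 tk] := ck k.
exact: (HC y (yk k) u (uk k) (D k) (D_ge0 k) cy (trajectory_continuous tk) uL2 ukL2 yr (ykr k) (yD k) (lexx _)).
Qed.

Lemma state_limit : controlled P 0 T y u.
Proof.
split=> //; have T0 := hor_gt0 std.
apply: (trajectory_limit (ltW T0) (fun k => (ck k).2) _ D0 yD velocity_limit).
exact: (control_rhs_inL2 A1 (lexx 0) (lexx T) cy uL2).
Qed.

Lemma initial_limit (y0 : 'cV[R]_n) : (forall k, yk k 0 = y0) -> y 0 = y0.
Proof.
move=> yk0; have T0 := hor_gt0 std.
have T00 : 0 \in `[0, T] by rewrite in_itv/= lexx ltW.
apply/matrixP => i j; rewrite ord1.
have H : (fun k : nat => y0 i 0 - y 0 i 0) @ \oo --> 0.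
  apply: null_of_norm_le D0 => k; apply: le_trans (yD k T00).
  by have := entry_le_mx_norm (yk k 0 - y 0) i 0; rewrite !mxE yk0.
have /null_sub_cvg := H => /(cvg_unique _ (cvg_cst (y0 i 0))) -> //.
Qed.

Lemma terminal_limit (pk : nat -> R -> 'cV[R]_n) p (D' : nat -> R) : D' @ \oo --> 0 ->
  (forall k t, t \in `[0, T] -> `|pk k t - p t| <= D' k) ->
  (forall k, pk k T = (Q2 P)^T *m Q2 P *m (yk k T - ydT P)) ->
  p T = (Q2 P)^T *m Q2 P *m (y T - ydT P).
Proof.
move=> D'0 pD pkT; have T0 := hor_gt0 std.
have TT : T \in `[0, T] by rewrite in_itv/= lexx ltW.
set Q := (Q2 P)^T *m Q2 P in pkT *.
apply/matrixP => i j; rewrite ord1.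
have H : (fun k : nat => (Q *m (y T - ydT P)) i 0 - p T i 0) @ \oo --> 0.
  apply: (null_of_norm_le (b := fun k => D' k + n%:R * `|Q| * D k)) => [k|].
    rewrite (_ : _ - _ = (pk k T - p T) i 0 - (Q *m (yk k T - y T)) i 0); last first.
      rewrite pkT (_ : yk k T - y T = (yk k T - ydT P) - (y T - ydT P)); last first.
        by rewrite opprB addrA subrK.
      by rewrite [Q *m (_ - (_ - _))]mulmxBr !mxE; ring.
    apply: (le_trans (ler_normB _ _)); apply: lerD.
      exact: le_trans (entry_le_mx_norm _ _ _) (pD k T TT).
    apply: (le_trans (entry_le_mx_norm _ _ _)); apply: (le_trans (mulmx_norm_le _ _)).
    by rewrite ler_wpM2l ?mulr_ge0// yD.
  by apply: nullD => //; exact: nullZ.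
have /null_sub_cvg := H => /(cvg_unique _ (cvg_cst ((Q *m (y T - ydT P)) i 0))) -> //.
Qed.

Lemma cost_limit : (fun k => cost P 0 (yk k) (uk k)) @ \oo --> cost P 0 y u.
Proof.
apply: null_sub_cvg; have T0 := hor_gt0 std.
have [C C0 HC] := tracking_lipschitz std cy.
apply: (null_of_norm_le (b := fun k => C * (D k + D k ^+ 2) + beta P / 2 *
   `|Int 0 T (fun t => enorm (uk k t) ^+ 2) - Int 0 T (fun t => enorm (u t) ^+ 2)|)); last first.
  apply: nullD; apply: nullZ; first by apply: nullD => //; exact: null_square.
  have /cvg_norm := energy_limit (fun k => (ck k).1) uL2 uI; by rewrite normr0.
move=> k; have [ukL2 tk] := ck k; have cyk := trajectory_continuous tk.
have b0 : 0 <= beta P by case: std => _ _ _ /ltW.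
rewrite !cost_split// opprD addrACA -mulrBr; apply: (le_trans (ler_normD _ _)).
rewrite normrM ger0_norm ?divr_ge0// lerD2r.
exact: (HC 0 (yk k) (D k) (lexx 0) (ltW T0) (D_ge0 k) cyk (yD k)).
Qed.

Lemma adjoint_velocity_limit (pk : nat -> R -> 'cV[R]_n) p (D' : nat -> R) :
  (forall k, {within `[0, T], continuous (pk k)}) -> {within `[0, T], continuous p} ->
  D' @ \oo --> 0 -> (forall k t, t \in `[0, T] -> `|pk k t - p t| <= D' k) ->
  (fun k => Int 0 T (fun s => enorm (adjoint_rhs P (yk k) (uk k) s (pk k s) - adjoint_rhs P y u s (p s)) ^+ 2)) @ \oo --> 0.
Proof.
move=> cpk cp D'0 pD; have T0 := hor_gt0 std.
have T00 : 0 \in `[0, T] by rewrite in_itv/= lexx ltW.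
have [rho yr ykr] := bounded_of_uniform cy D0 yD.
have [B B0 pB] := continuous_bounded_norm cp.
have [E E0 ukE] := null_integrals_bounded (fun k => (ck k).1) uL2 uI.
have [C C0 HC] := adjoint_rhs_stability A1 std rho E0 B0.
have D'_ge0 k : 0 <= D' k by exact: le_trans (normr_ge0 _) (pD k 0 T00).
apply: (null_le (b := fun k => C * ((D k + D' k) ^+ 2 + Int 0 T (fun s => enorm (uk k s - u s) ^+ 2)))); last first.
  by apply: nullZ; apply: nullD => //; apply: null_square; exact: nullD.
move=> k; apply/andP; split; first by apply: Int_ge0 => s _; exact: sqr_ge0.
have [ukL2 tk] := ck k.
apply: (HC y (yk k) u (uk k) p (pk k) (D k + D' k)) => //.
- by rewrite addr_ge0// D_ge0.
- exact: trajectory_continuous tk.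
- exact: ykr.
- by move=> t tT; rewrite (le_trans (yD k tT))// lerDl.
- by move=> t tT; rewrite (le_trans (pD k t tT))// lerDr D_ge0.
Qed.

Lemma adjoint_limit (pk : nat -> R -> 'cV[R]_n) p (D' : nat -> R) :
  (forall k, trajectory 0 T (pk k) (fun s => adjoint_rhs P (yk k) (uk k) s (pk k s))) ->
  {within `[0, T], continuous p} ->
  D' @ \oo --> 0 -> (forall k t, t \in `[0, T] -> `|pk k t - p t| <= D' k) ->
  trajectory 0 T p (fun s => adjoint_rhs P y u s (p s)).
Proof.
move=> tpk cp D'0 pD; have T0 := hor_gt0 std.
apply: (trajectory_limit (ltW T0) tpk _ D'0 pD).
  exact: adjoint_rhs_inL2.
by apply: adjoint_velocity_limit pD => // k; exact: trajectory_continuous (tpk k).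
Qed.

(** No compactness is invoked for the adjoints: stability of the backward equation makes them
    converge to the solution along the limit pair. *)
Lemma adjoint_uniform_limit (pk : nat -> R -> 'cV[R]_n) p :
  (forall k, trajectory 0 T (pk k) (fun s => adjoint_rhs P (yk k) (uk k) s (pk k s))) ->
  (forall k, pk k T = (Q2 P)^T *m Q2 P *m (yk k T - ydT P)) ->
  trajectory 0 T p (fun s => adjoint_rhs P y u s (p s)) ->
  p T = (Q2 P)^T *m Q2 P *m (y T - ydT P) ->
  exists2 D' : nat -> R, D' @ \oo --> 0 & forall k t, t \in `[0, T] -> `|pk k t - p t| <= D' k.
Proof.
move=> tpk pkT tp pT; have T0 := hor_gt0 std.
have [rho yr ykr] := bounded_of_uniform cy D0 yD.
have [B B0 pB] := continuous_bounded_norm (trajectory_continuous tp).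
have [E E0 ukE] := null_integrals_bounded (fun k => (ck k).1) uL2 uI.
have [C C0 HC] := adjoint_stability A1 std rho E0 B0.
pose W k := C * (D k ^+ 2 + Int 0 T (fun s => enorm (uk k s - u s) ^+ 2)).
have W0 k : 0 <= W k.
  apply: mulr_ge0 => //; apply: addr_ge0; first exact: sqr_ge0.
  by apply: Int_ge0 => s _; exact: sqr_ge0.
exists (fun k => Num.sqrt (W k)).
  apply: null_sqr; rewrite (_ : (fun k => _) = W); last by apply/funext => k; rewrite sqr_sqrtr.
  by apply: nullZ; apply: nullD => //; exact: null_square.
move=> k t tT; have [ukL2 tk] := ck k.
rewrite -(@ler_pXn2r _ 2) ?nnegrE ?sqrtr_ge0// sqr_sqrtr//.
exact: (HC (yk k) y (uk k) u (pk k) p (D k) (D_ge0 k) (trajectory_continuous tk) cy ukL2 uL2 (ykr k) yr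
  (yD k) (ukE k) (tpk k) tp (pkT k) pT pB t tT).
Qed.

End Sequence.

Lemma controlled_minimizer (y0 : 'cV[R]_n) y u : controlled P 0 T y u -> y 0 = y0 ->
  (forall z w, controlled P 0 T z w -> z 0 = y0 -> cost P 0 y u <= cost P 0 z w) -> minimizer P y0 y u.
Proof.
move=> cyu yy0 H; have T0 := hor_gt0 std; split.
  by rewrite -yy0; exact: controlled_admissible (ltW T0) cyu.
by move=> z w /(admissible_controlled T0)[czw z0]; exact: H.
Qed.

End AccumulationPoints.

Lemma null_subsequence {R : realType} (a : nat -> R) (l : R) (s : nat -> nat) :
  {homo s : j k / (j < k)%N} -> a @ \oo --> l -> (fun k => a (s k)) @ \oo --> l.
Proof.
move=> sh /cvgrPdist_le al; apply/cvgrPdist_le => e e0.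
have [K _ HK] := al e e0.
have sk k : (k <= s k)%N by elim: k => // k IH; apply: leq_ltn_trans IH (sh _ _ _).
by exists K => // k /= Kk; apply: HK => /=; exact: leq_trans Kk (sk k).
Qed.

Theorem proposition19 (R : realType) (n m N : nat) (P : ocp R n m)
    (Y0 : set 'cV[R]_n) (M : R)
    (A : ansatz R n) (e0 : R) (thapp : forall e, 'cV[R]_(pdim A e))
    (y0 : 'I_N -> 'cV[R]_n) (w : 'I_N -> R) (g1 g2 : R) (ge : R -> R)
    (eps : nat -> R) (y p : nat -> 'I_N -> R -> 'cV[R]_n)
    (th : forall k, 'cV[R]_(pdim A (eps k))) :
  standing P ->
  compact Y0 ->
  regA1 P -> regA2 P M -> regA3 P Y0 M ->
  approx_assumption P M e0 thapp ->
  (forall i, Y0 (y0 i)) ->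
  (forall i, 0 < w i) ->
  0 <= g1 -> 0 <= g2 ->
  (forall e, 0 < e <= e0 -> 0 < ge e) ->
  (exists C : R, \forall e \near 0^'+, ge e * pnorm (thapp e) ^+ 2 <= C * e) ->
  (forall k, 0 < eps k <= e0) ->
  eps @ \oo --> 0 ->
  (forall k, learning_solution P y0 w g1 g2 ge (y k) (p k) (th k)) ->
  (exists Minf : R, 0 < Minf /\
    forall k i, (Linfnorm 0 (hor P) (y k i) <= Minf%:E)%E) ->
  let u := fun k i => Fth P (th k) (y k i) in
  (exists yb pb ub, strong_accumulation (hor P) y p u yb pb ub) /\
  (forall yb pb ub, strong_accumulation (hor P) y p u yb pb ub ->
    forall i,
    [/\ minimizer P (y0 i) (yb i) (ub i),
        state_eq P 0 (y0 i) (yb i) (ub i) &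
        adjoint_eq P (yb i) (ub i) (pb i)]).
Proof.
move=> std _ A1 A2 A3 AP Y0y0 w0 g10 g20 ge0 gepn epsP eps0 sol [Minf [_ yMinf]] u.
have T0 := hor_gt0 std.
have /choice[ys Hys] i : exists ys, closed_loop P M (y0 i) ys /\ minimizer P (y0 i) ys (Fstar P M ys).
  by have [ys [H1 _ H2]] := A3 _ (Y0y0 i); exists ys.
pose J i := cost P 0 (ys i) (Fstar P M (ys i)).
have cJ i : (fun k => cost P 0 (y k i) (u k i)) @ \oo --> J i.
  exact: (costs_converge A1 std A2 AP (fun i => (Hys i).1) (fun i => (Hys i).2) w0 g10 g20 ge0 gepn epsP eps0 sol).
have yH k i : inH1 0 (hor P) (y k i) by have [/(_ i)[]] := sol k.
have pH k i : inH1 0 (hor P) (p k i) by have [/(_ i)[]] := sol k.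
have cyu k i : controlled P 0 (hor P) (y k i) (u k i) /\ y k i 0 = y0 i.
  by have [/(_ i)[H1 _ H2 _] _] := sol k; exact: (state_eq_controlled A1 std AP (epsP k) H1 H2).
have adj k i : trajectory 0 (hor P) (p k i) (fun s => adjoint_rhs P (y k i) (u k i) s (p k i s)) /\
    p k i (hor P) = (Q2 P)^T *m Q2 P *m (y k i (hor P) - ydT P).
  by have [/(_ i)[_ H1 _ H2] _] := sol k; exact: adjoint_eq_trajectory.
have Jmin i z v : controlled P 0 (hor P) z v -> z 0 = y0 i -> J i <= cost P 0 z v.
  by move=> czv z0; apply: (Hys i).2.2; rewrite -z0; exact: controlled_admissible (ltW T0) czv.
split.
  (* The uniform bound on the states enters here, as the input of the compactness argument. *)
  have yr k i (t : R) : t \in `[0, hor P] -> `|y k i t| <= Minf.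
    by have [cy _ _] := yH k i; exact: Linfnorm_bound (yMinf k i) t.
  have [s [sh [yb [ub [D [D0 cyb ubL2 yD uI]]]]]] := minimizing_compactness A1 std
    (fun k i => (cyu k i).1) (fun k i => (cyu k i).2) yr cJ Jmin.
  have ck i k := (cyu (s k) i).1.
  have lim i := state_limit A1 std (ck i) (cyb i) (ubL2 i) D0 (fun k => yD k i) (uI i).
  have vlim i := velocity_limit A1 std (ck i) (cyb i) (ubL2 i) D0 (fun k => yD k i) (uI i).
  (* The candidate adjoints solve the adjoint equation along the limit pair; convergence to them is
     shown afterwards. *)
  have /choice[pb Hpb] i := adjoint_exists A1 std (cyb i) (ubL2 i).
  have pD i := adjoint_uniform_limit A1 std (ck i) (cyb i) (ubL2 i) D0 (fun k => yD k i) (uI i)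
    (fun k => (adj (s k) i).1) (fun k => (adj (s k) i).2) (Hpb i).1 (Hpb i).2.
  exists yb, pb, ub; split.
    move=> i; split=> //.
    - exact: trajectory_inH1 (ltW T0) (lim i).2.
    - exact: trajectory_inH1 (ltW T0) (Hpb i).1.
  exists s; split=> // i; have [D' D'0 pD'] := pD i; split.
  - exact: (Wnorm_null std (fun k => (ck i k).2) (lim i).2 D0 (fun k => yD k i) (vlim i)).
  - apply: (Wnorm_null std (fun k => (adj (s k) i).1) (Hpb i).1 D'0 pD').
    apply: (adjoint_velocity_limit A1 std (ck i) (cyb i) (ubL2 i) D0 (fun k => yD k i) (uI i) _ _ D'0 pD').
      by move=> k; exact: trajectory_continuous (adj (s k) i).1.
    exact: trajectory_continuous (Hpb i).1.
  - by apply/(L2norm_null (fun k => (ck i k).1) (ubL2 i)); exact: uI.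
move=> yb pb ub [HH [s [sh Hs]]] i.
have [ybH pbH ubL2] := HH i; have [Wy Wp Lu] := Hs i.
have ck k := (cyu (s k) i).1.
have [cyb _ _] := ybH; have [cpb _ _] := pbH.
(* Convergence in W_T gives uniform convergence through the embedding, so an arbitrary accumulation
   point meets the assumptions of the limit lemmas. *)
have [D D0 yD] := Wnorm_null_uniform std (fun k => yH (s k) i) ybH Wy.
have [D' D'0 pD] := Wnorm_null_uniform std (fun k => pH (s k) i) pbH Wp.
have uI : (fun k => Int 0 (hor P) (fun t => enorm (u (s k) i t - ub i t) ^+ 2)) @ \oo --> 0.
  by apply/(L2norm_null (fun k => (ck k).1) ubL2).
have cyub := state_limit A1 std ck cyb ubL2 D0 yD uI.
have yb0 := initial_limit std D0 yD (fun k => (cyu (s k) i).2).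
have min : minimizer P (y0 i) (yb i) (ub i).
  apply: controlled_minimizer => // z v czv z0.
  have C1 := cost_limit std ck cyb ubL2 D0 yD uI.
  have C2 := null_subsequence sh (cJ i).
  (* Along the subsequence the costs tend both to the cost of the limit pair and to the optimal
     value [J i]. *)
  rewrite (cvg_unique _ C1 C2)//; exact: Jmin.
split=> //; first by case: min => -[].
split; last exact: (terminal_limit std D0 yD D'0 pD (fun k => (adj (s k) i).2)).
have tpb := adjoint_limit A1 std ck cyb ubL2 D0 yD uI (fun k => (adj (s k) i).1) cpb D'0 pD.
exact: trajectory_weak_deriv (ltW T0) tpb.
Qed.
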